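(* Let $P(z)=pz+p_2z^2+p_3z^3+\dots$ be a probability generating function with $0<p<1$ that is analytic in a neighborhood of $z=1$, let $E=P'(1)$, and let $w(x)$, $x>0$, be the density of the martingale limit $W$ of the associated Galton--Watson process. Let $\phi_n$, $\kappa_m^{*n}$ and the critical angle $\vartheta$ be as defined in the context. Then for all $x>0$ $$w(x)=x^{-1}\sum_{n=1}^{+\infty}\sum_{m=-\infty}^{+\infty}\frac{\phi_n\,\kappa_m^{*n}\,x^{-\frac{n\ln p+2\pi \mathbf{i}m}{\ln E}}}{\Gamma\left(-\frac{2\pi\mathbf{i}m+n\ln p}{\ln E}\right)},$$ and for every $\varepsilon>0$ and $x>0$ there is a constant $A=A(\varepsilon,x)>0$ such that for all integers $n\ge1$ and all $m\in\mathbb{Z}$ $$\left|\frac{\phi_n\,\kappa_m^{*n}\,x^{-\frac{n\ln p+2\pi\mathbf{i}m}{\ln E}}}{\Gamma\left(-\frac{n\ln p+2\pi\mathbf{i}m}{\ln E}\right)}\right|\le A\,\exp\left((\log_E p+\varepsilon)\,n\ln n+\frac{2\pi\left(\frac{\pi}{2}-\vartheta+\varepsilon\right)}{\ln E}|m|\right),$$ where, for each fixed $\varepsilon>0$, $A(\varepsilon,x)$ is uniformly bounded when $x$ ranges over any compact subset of $(0,+\infty)$.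
   Context: **Setting.** $P(z)=\mathbb{E}z^{\xi}=pz+p_2z^2+p_3z^3+\dots$ with all coefficients $\ge0$, $P(1)=1$, $0<p<1$, and $P$ is analytic in some neighborhood of $z=1$ (hence in a neighborhood of the closed unit disc). $E=P'(1)$, so $1<E<+\infty$. $P^{\circ t}$ denotes the $t$-fold composition of $P$ with itself. The Galton--Watson process is $X_0=1$, $X_{t+1}=\sum_{j=1}^{X_t}\xi_{j,t}$ with $\xi_{j,t}$ i.i.d. copies of $\xi$, and $W=\lim_{t\to+\infty}E^{-t}X_t$. **Density.** For $x>0$, $$w(x)=\frac1{2\pi}\int_{-\infty}^{+\infty}\Pi(\mathbf{i}y)e^{\mathbf{i}yx}\,dy\quad\text{(as an improper integral)},\qquad \Pi(z)=\lim_{t\to+\infty}P^{\circ t}\left(1-\frac{z}{E^t}\right).$$ $\Pi$ satisfies $\Pi(Ez)=P(\Pi(z))$, $\Pi(0)=1$, $\Pi'(0)=-1$. **The set $\mathscr{J}_P(0)$.** $P$ is regarded as a holomorphic function on a fixed domain (connected open set) $D\subset\mathbb{C}$ containing the closed unit disc to which it extends holomorphically ($D=\mathbb{C}$ if $P$ is a polynomial or entire). $\mathscr{J}_P(0)$ is the open connected component of the filled Julia set of $P$ that contains the open unit disc and has $0$ as its attracting point, i.e. the connected component containing $0$ of the open set of $z\in D$ all of whose iterates $P^{\circ t}(z)$ are defined (stay in $D$) and satisfy $P^{\circ t}(z)\to0$. **Critical angle.** $\vartheta$ is half of the maximal opening angle of sectors with vertex at $1$ and arbitrarily small radius lying entirely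 in $\mathscr{J}_P(0)$: $\vartheta$ is the supremum of all $\varphi_0\in(0,\pi]$ such that for some $r_0>0$ one has $\{1-re^{\mathbf{i}\varphi}:\ \varphi\in(-\varphi_0,\varphi_0),\ r\in(0,r_0)\}\subset\mathscr{J}_P(0)$. **Coefficients.** $\Phi(z)=\lim_{t\to\infty}p^{-t}P^{\circ t}(z)$ for $z\in\mathscr{J}_P(0)$; it satisfies $\Phi(P(z))=p\Phi(z)$, $\Phi(0)=0$, $\Phi'(0)=1$. The numbers $\phi_n$ are the Taylor coefficients at $0$ of the local inverse: $\Phi^{-1}(z)=\phi_1z+\phi_2z^2+\phi_3z^3+\dots$. The one-periodic Karlin--McGregor function is $K(x)=\Phi(\Pi(E^x))p^{-x}$, and $\kappa_m^{*n}=\int_0^1K(x)^ne^{-2\pi\mathbf{i}mx}\,dx$ for $n\ge1$, $m\in\mathbb{Z}$. *)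

(* Defs.v *)
From Stdlib Require Import Reals ZArith.
From Coquelicot Require Import Coquelicot.
Open Scope R_scope.

Definition Cexp (z : C) : C := (exp (Re z) * cos (Im z), exp (Re z) * sin (Im z)).

(* Meaningful for x > 0 only. *)
Definition Rcpow (x : R) (s : C) : C := Cexp (s * RtoC (ln x))%C.

(* Euler's integral, so the usual Gamma function for Re s > 0 only. It is
   applied to - (n ln p + 2 pi i m) / ln E, whose real part is positive since
   n >= 1 and p < 1 < E. *)
Definition CGamma (s : C) : C :=
  RInt_gen (V := C_R_CompleteNormedModule)
    (fun t : R => (Rcpow t (s - 1) * RtoC (exp (- t)))%C)
    (at_right 0) (Rbar_locally p_infty).

(* The limit of u when u converges; unspecified otherwise. *)
Definition CLim_seq (u : nat -> C) : C :=
  (real (Lim_seq (fun n => Re (u n))), real (Lim_seq (fun n => Im (u n)))).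

Definition is_Cseries (u : nat -> C) (s : C) : Prop :=
  is_series (K := C_AbsRing) (V := C_NormedModule) u s.

(* Both one-sided sums are required to converge. *)
Definition is_bilateral_series (u : Z -> C) (s : C) : Prop :=
  exists s1 s2 : C,
    is_Cseries (fun k : nat => u (Z.of_nat k)) s1 /\
    is_Cseries (fun k : nat => u (- Z.of_nat (S k))%Z) s2 /\
    s = (s1 + s2)%C.

Definition is_Cpseries (a : nat -> C) (z l : C) : Prop :=
  is_pseries (K := C_AbsRing) (V := C_NormedModule) a z l.

Definition holomorphic_on (D : C -> Prop) (f : C -> C) : Prop :=
  forall z : C, D z -> ex_derive (K := C_AbsRing) (V := C_NormedModule) f z.

Definition Copen (U : C -> Prop) : Prop := open (T := C_UniformSpace) U.

Definition Cconnected (S : C -> Prop) : Prop :=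
  forall U V : C -> Prop, Copen U -> Copen V ->
    (forall z, S z -> U z \/ V z) ->
    (exists z, S z /\ U z) -> (exists z, S z /\ V z) ->
    exists z, S z /\ U z /\ V z.

Definition Ccomponent (B : C -> Prop) (z0 z : C) : Prop :=
  exists S : C -> Prop,
    Cconnected S /\ (forall u, S u -> B u) /\ S z0 /\ S z.

Definition is_local_inverse (f g : C -> C) (z0 : C) : Prop :=
  locally (T := C_UniformSpace) z0 (fun z => g (f z) = z) /\
  locally (T := C_UniformSpace) (f z0) (fun z => f (g z) = z).

Definition is_taylor0 (g : C -> C) (a : nat -> C) : Prop :=
  locally (T := C_UniformSpace) (RtoC 0) (fun z => is_Cpseries a z (g z)).

Definition is_pgf (a : nat -> R) : Prop :=
  a 0%nat = 0 /\ (forall n, 0 <= a n) /\ is_series a 1.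

(* D is open and contains 1, so this includes analyticity of the generating
   function near 1. P is a total function; only its values on the domain D matter. *)
Definition extends_pgf (a : nat -> R) (D : C -> Prop) (P : C -> C) : Prop :=
  Copen D /\ Cconnected D /\
  (forall z : C, Cmod z <= 1 -> D z) /\
  holomorphic_on D P /\
  (forall z : C, Cmod z <= 1 -> is_Cpseries (fun n => RtoC (a n)) z (P z)).

Definition iterate (P : C -> C) (t : nat) (z : C) : C := Nat.iter t P z.

Definition basin0 (D : C -> Prop) (P : C -> C) (z : C) : Prop :=
  (forall t : nat, D (iterate P t z)) /\
  filterlim (fun t => iterate P t z) eventually
    (locally (T := C_UniformSpace) (RtoC 0)).

Definition julia0 (D : C -> Prop) (P : C -> C) : C -> Prop :=
  Ccomponent (basin0 D P) (RtoC 0).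

Definition sector_angle (D : C -> Prop) (P : C -> C) (phi0 : R) : Prop :=
  0 < phi0 <= PI /\
  exists r0 : R, 0 < r0 /\
    forall phi r : R, - phi0 < phi < phi0 -> 0 < r < r0 ->
      julia0 D P (1 - RtoC r * Cexp (Ci * RtoC phi))%C.

Definition is_critical_angle (D : C -> Prop) (P : C -> C) (theta : R) : Prop :=
  is_lub (sector_angle D P) theta.

Definition PiFun (P : C -> C) (E : R) (z : C) : C :=
  CLim_seq (fun t => iterate P t (1 - z / RtoC (E ^ t))%C).

Definition PhiFun (P : C -> C) (p : R) (z : C) : C :=
  CLim_seq (fun t => (RtoC (/ p ^ t) * iterate P t z)%C).

(* phi 0 = 0 follows from Phi(0) = 0. *)
Definition is_inverse_coeffs (P : C -> C) (p : R) (phi : nat -> C) : Prop :=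
  exists g : C -> C, is_local_inverse (PhiFun P p) g (RtoC 0) /\ is_taylor0 g phi.

Definition KarlinMcGregor (P : C -> C) (p E x : R) : C :=
  (PhiFun P p (PiFun P E (RtoC (Rpower E x))) * RtoC (Rpower p (- x)))%C.

Definition kappa (P : C -> C) (p E : R) (n : nat) (m : Z) : C :=
  RInt (V := C_R_CompleteNormedModule)
    (fun x : R =>
       (KarlinMcGregor P p E x ^ n * Cexp (- (2 * PI * IZR m * x) * Ci))%C)
    0 1.

Definition density_integrand (P : C -> C) (E x y : R) : C :=
  (PiFun P E (Ci * RtoC y) * Cexp (Ci * RtoC (y * x)))%C.

Definition density (P : C -> C) (E x : R) : C :=
  (RtoC (/ (2 * PI)) *
   RInt_gen (V := C_R_CompleteNormedModule) (density_integrand P E x)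
     (Rbar_locally m_infty) (Rbar_locally p_infty))%C.

Definition exponent (p E : R) (n : nat) (m : Z) : C :=
  ((RtoC (INR n * ln p) + RtoC (2 * PI * IZR m) * Ci) / RtoC (ln E))%C.

Definition expansion_term (P : C -> C) (p E : R) (phi : nat -> C)
    (x : R) (n : nat) (m : Z) : C :=
  (phi n * kappa P p E n m * Rcpow x (- exponent p E n m)
     / CGamma (- exponent p E n m))%C.

(* Main.v *)
(* Write z = e^v. Koenigs linearisation at the repelling fixed point 1 produces Pi, and at
   the attracting fixed point 0 it produces Phi. If the basin contains a sector of half-angle
   b0 at 1, then Pi(e^v) is holomorphic in the strip |Im v| < b0, it takes values in the
   basin, and it tends to 0 as Re v goes to infinity in any smaller closed strip. Comparing Pi on
   the closed right half-disc with the unit circle shows that some b0 > pi/2 is always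
   admissible, so the Fourier integral of Pi (a Bromwich integral along |Im v| = pi/2) can be
   bent to a Hankel contour |Im v| = b with pi/2 < b < b0, where exp(x e^v) decays. On a far
   enough part of this contour Pi = sum_n phi_n Phi(Pi)^n converges geometrically, and
   Phi(Pi(e^v))^n = e^(n v ln p / ln E) times a (ln E)-periodic function whose Fourier
   coefficients are kappa P p E n m. Each mode integrates to a reciprocal Gamma value by
   Hankel's formula, and the errors vanish with the tails.
   For the bound, shifting the Fourier contour gives exp(- 2 pi b' |m| / ln E) M^n for any
   b' < theta, Cauchy's estimate gives C r^(-n) for phi_n, and the Hankel integral with its
   vertical side at Re v = ln n bounds 1/Gamma. *)
Require Import Defs.
From Stdlib Require Import Reals ZArith Lra Lia Psatz ClassicalEpsilon.
From Coquelicot Require Import Coquelicot.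
Open Scope R_scope.

(** * Complex differentiability and integrals *)

(** The variable v = ln z turns multiplication by E into translation by ln E, so the functional
    equations of Pi and Phi become periodicity, and every contour becomes a union of horizontal and
    vertical segments, for which Cauchy's theorem on rectangles suffices. Limits and improper
    integrals are unspecified when they diverge, and P is meaningful only on D, so convergence and
    confinement of orbits to D are carried along with every value. The Fourier integral need not
    converge absolutely and no decay rate of Pi is extracted; past the right angle the weight alone
    makes all integrals converge absolutely, and a sup bound on a half strip controls them. That
    extra angle rests on a strictness argument: |P(z)| = 1 in the closed disc forces z to be a root
    of unity of fixed order, and Pi avoids such points near 1 except at 1 itself. Two angles are
    kept above pi/2: the contour uses the smaller one and the Fourier coefficients the larger one,
    so that the modes decay geometrically on the contour. In the estimate every factor geometric in
    n, including the power of x, is absorbed by eps * n ln n. *)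

Definition Ccont (f : C -> C) (z : C) : Prop :=
  forall eps, 0 < eps -> exists d, 0 < d /\
    forall w, Cmod (w - z) < d -> Cmod (f w - f z) < eps.

(** The non-strict inequality includes w = z, so neither a quotient nor a punctured neighbourhood
    occurs. *)
Definition is_Cder (f : C -> C) (z l : C) : Prop :=
  forall eps, 0 < eps -> exists d, 0 < d /\
    forall w, Cmod (w - z) < d ->
      Cmod (f w - f z - l * (w - z)) <= eps * Cmod (w - z).

Definition Cdiff (f : C -> C) (z : C) : Prop := exists l, is_Cder f z l.

Lemma Cmod_minus_sym (a b : C) : Cmod (a - b) = Cmod (b - a).
Proof. rewrite <- (Cmod_opp (a - b)%C); f_equal; ring. Qed.

Lemma Cmod_triangle_rev (a b : C) : Cmod a - Cmod b <= Cmod (a - b).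
Proof.
  pose proof (Cmod_triangle (a - b) b) as H.
  replace (a - b + b)%C with a in H by ring. lra.
Qed.

Lemma Cmod_minus_triangle (a b : C) : Cmod (a - b) <= Cmod a + Cmod b.
Proof. unfold Cminus. rewrite <- (Cmod_opp b). apply Cmod_triangle. Qed.

Lemma Cmod_minus_trans (a b c : C) : Cmod (a - c) <= Cmod (a - b) + Cmod (b - c).
Proof. replace (a - c)%C with ((a - b) + (b - c))%C by ring. apply Cmod_triangle. Qed.

Lemma Cmod_eq_minus0 (a b : C) : Cmod (a - b) = 0 -> a = b.
Proof.
  intros H. apply Cmod_eq_0 in H.
  replace a with ((a - b) + b)%C by ring. rewrite H. ring.
Qed.

Lemma Cminus_eq_0 (a b : C) : (a - b = 0)%C -> a = b.
Proof. intros H. apply Cmod_eq_minus0. rewrite H. apply Cmod_0. Qed.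

Lemma exp_monotone (x y : R) : x <= y -> exp x <= exp y.
Proof. intros [H| ->]; [left; apply exp_increasing; auto|lra]. Qed.

Lemma RtoC_neq_0 (x : R) : x <> 0 -> RtoC x <> 0%C.
Proof. intros H E. apply H. apply (f_equal fst) in E. exact E. Qed.

Lemma Ci_neq_0 : Ci <> 0%C.
Proof. intros E. apply (f_equal snd) in E. simpl in E. lra. Qed.

Lemma Cmod_RtoC_pos (x : R) : 0 <= x -> Cmod (RtoC x) = x.
Proof. intros. rewrite Cmod_R. apply Rabs_pos_eq; auto. Qed.

Lemma Cminus_diag_mod (z : C) : Cmod (z - z) = 0.
Proof. replace (z - z)%C with (RtoC 0) by ring. apply Cmod_0. Qed.

Lemma Rabs_Re_le (z : C) : Rabs (Re z) <= Cmod z.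
Proof. pose proof (Rmax_Cmod z). unfold Re. pose proof (Rmax_l (Rabs (fst z)) (Rabs (snd z))). lra. Qed.

Lemma Rabs_Im_le (z : C) : Rabs (Im z) <= Cmod z.
Proof. pose proof (Rmax_Cmod z). unfold Im. pose proof (Rmax_r (Rabs (fst z)) (Rabs (snd z))). lra. Qed.

Lemma Cmod_Re_Im (z : C) : Cmod z <= Rabs (Re z) + Rabs (Im z).
Proof.
  destruct z as [x y].
  replace (x, y) with (RtoC x + RtoC y * Ci)%C
    by (apply injective_projections; simpl; ring).
  eapply Rle_trans; [apply Cmod_triangle|].
  rewrite Cmod_mult, Cmod_Ci, !Cmod_R. simpl. apply Req_le.
  f_equal; [|rewrite Rmult_1_r]; f_equal; ring.
Qed.

Lemma Ccont_const (c z : C) : Ccont (fun _ => c) z.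
Proof.
  intros e He. exists 1. split; [lra|]. intros w _.
  rewrite Cminus_diag_mod. lra.
Qed.

Lemma Ccont_id (z : C) : Ccont (fun w => w) z.
Proof. intros e He. exists e. split; [lra|]. auto. Qed.

Lemma Ccont_plus (f g : C -> C) (z : C) :
  Ccont f z -> Ccont g z -> Ccont (fun w => f w + g w)%C z.
Proof.
  intros Hf Hg e He.
  destruct (Hf (e / 2) ltac:(lra)) as (d1 & Hd1 & H1).
  destruct (Hg (e / 2) ltac:(lra)) as (d2 & Hd2 & H2).
  exists (Rmin d1 d2). split; [apply Rmin_pos; lra|]. intros w Hw.
  specialize (H1 w ltac:(pose proof (Rmin_l d1 d2); lra)).
  specialize (H2 w ltac:(pose proof (Rmin_r d1 d2); lra)).
  replace (f w + g w - (f z + g z))%C with ((f w - f z) + (g w - g z))%C by ring.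
  pose proof (Cmod_triangle (f w - f z) (g w - g z)). lra.
Qed.

Lemma Ccont_mult (f g : C -> C) (z : C) :
  Ccont f z -> Ccont g z -> Ccont (fun w => f w * g w)%C z.
Proof.
  intros Hf Hg e He.
  set (A := Cmod (f z)). set (B := Cmod (g z)).
  assert (HA : 0 <= A) by apply Cmod_ge_0.
  assert (HB : 0 <= B) by apply Cmod_ge_0.
  destruct (Hf (e / (2 * (B + 1)))) as (d1 & Hd1 & H1);
    [apply Rdiv_lt_0_compat; lra|].
  destruct (Hg (Rmin 1 (e / (2 * (A + 1))))) as (d2 & Hd2 & H2);
    [apply Rmin_pos; [lra|apply Rdiv_lt_0_compat; lra]|].
  exists (Rmin d1 d2). split; [apply Rmin_pos; lra|]. intros w Hw.
  specialize (H1 w ltac:(pose proof (Rmin_l d1 d2); lra)).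
  specialize (H2 w ltac:(pose proof (Rmin_r d1 d2); lra)).
  pose proof (Rmin_l 1 (e / (2 * (A + 1)))).
  pose proof (Rmin_r 1 (e / (2 * (A + 1)))).
  replace (f w * g w - f z * g z)%C
    with ((f w - f z) * g w + f z * (g w - g z))%C by ring.
  eapply Rle_lt_trans; [apply Cmod_triangle|]. rewrite !Cmod_mult.
  fold A.
  assert (Hg1 : Cmod (g w) <= B + 1).
  { pose proof (Cmod_triangle_rev (g w) (g z)). fold B in H3. lra. }
  assert (Cmod (f w - f z) * Cmod (g w) <= Cmod (f w - f z) * (B + 1)).
  { apply Rmult_le_compat_l; [apply Cmod_ge_0|lra]. }
  assert (Cmod (f w - f z) * (B + 1) < e / 2).
  { apply Rlt_le_trans with (e / (2 * (B + 1)) * (B + 1)).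
    - apply Rmult_lt_compat_r; lra.
    - apply Req_le. field. lra. }
  assert (A * Cmod (g w - g z) <= A * (e / (2 * (A + 1)))).
  { apply Rmult_le_compat_l; lra. }
  assert (A * (e / (2 * (A + 1))) <= e / 2).
  { apply Rle_trans with ((A + 1) * (e / (2 * (A + 1)))).
    - apply Rmult_le_compat_r; [|lra].
      apply Rlt_le, Rdiv_lt_0_compat; lra.
    - apply Req_le. field. lra. }
  lra.
Qed.

Lemma Ccont_comp (f g : C -> C) (z : C) :
  Ccont f z -> Ccont g (f z) -> Ccont (fun w => g (f w)) z.
Proof.
  intros Hf Hg e He.
  destruct (Hg e He) as (d & Hd & H).
  destruct (Hf d Hd) as (d' & Hd' & H').
  exists d'. split; auto.
Qed.

Lemma Ccont_inv_id (z : C) : z <> 0%C -> Ccont Cinv z.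
Proof.
  intros Hz e He.
  assert (Hm : 0 < Cmod z) by (apply Cmod_gt_0; auto).
  exists (Rmin (Cmod z / 2) (e * (Cmod z * Cmod z) / 2)).
  split.
  { apply Rmin_pos; [lra|].
    apply Rdiv_lt_0_compat; [|lra]. repeat apply Rmult_lt_0_compat; auto. }
  intros w Hw.
  pose proof (Rmin_l (Cmod z / 2) (e * (Cmod z * Cmod z) / 2)).
  pose proof (Rmin_r (Cmod z / 2) (e * (Cmod z * Cmod z) / 2)).
  assert (Hw2 : Cmod z / 2 < Cmod w).
  { pose proof (Cmod_triangle_rev z w). rewrite (Cmod_minus_sym z w) in H1. lra. }
  assert (Hw0 : w <> 0%C) by (apply Cmod_gt_0; lra).
  replace (/ w - / z)%C with ((z - w) / (w * z))%C by (field; auto).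
  rewrite Cmod_div by (apply Cmult_neq_0; auto).
  rewrite Cmod_mult, Cmod_minus_sym.
  apply Rlt_div_l; [apply Rmult_lt_0_compat; lra|].
  apply Rlt_le_trans with (e * (Cmod z * Cmod z) / 2); [lra|].
  replace (e * (Cmod z * Cmod z) / 2) with (e * ((Cmod z / 2) * Cmod z)) by field.
  apply Rmult_le_compat_l; [lra|]. apply Rmult_le_compat_r; lra.
Qed.

Lemma Ccont_inv (f : C -> C) (z : C) :
  Ccont f z -> f z <> 0%C -> Ccont (fun w => / f w)%C z.
Proof. intros Hf Hz. apply (Ccont_comp f Cinv); auto. apply Ccont_inv_id; auto. Qed.

(** Carathéodory's form of the derivative: the slope extends continuously to z. The sum, product and
    chain rules then reduce to algebra with continuous slopes. *)
Lemma is_Cder_slope (f : C -> C) (z l : C) :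
  is_Cder f z l <->
  exists q : C -> C, q z = l /\ Ccont q z /\ forall w, f w = (f z + q w * (w - z))%C.
Proof.
  split.
  - intros H.
    exists (fun w => if excluded_middle_informative (w = z) then l
                     else ((f w - f z) / (w - z))%C).
    split; [destruct (excluded_middle_informative (z = z)); tauto|].
    split.
    + intros e He. destruct (H (e / 2) ltac:(lra)) as (d & Hd & H1).
      exists d. split; auto. intros w Hw.
      destruct (excluded_middle_informative (z = z)) as [_|n]; [|tauto].
      destruct (excluded_middle_informative (w = z)) as [->|n].
      * rewrite Cminus_diag_mod; lra.
      * assert (Hn : (w - z)%C <> 0%C).
        { intros E; apply n. apply Cmod_eq_minus0. rewrite E; apply Cmod_0. }
        replace ((f w - f z) / (w - z) - l)%C
          with ((f w - f z - l * (w - z)) / (w - z))%C by (field; auto).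
        rewrite Cmod_div by auto.
        apply Cmod_gt_0 in Hn.
        apply Rle_lt_trans with (e / 2); [|lra].
        apply Rle_div_l; auto.
    + intros w. destruct (excluded_middle_informative (w = z)) as [->|n]; [ring|].
      field. intros E; apply n. apply Cmod_eq_minus0. rewrite E; apply Cmod_0.
  - intros (q & Hq & Hc & Hf) e He.
    destruct (Hc e He) as (d & Hd & H1). exists d; split; auto.
    intros w Hw. rewrite (Hf w), <- Hq.
    replace (f z + q w * (w - z) - f z - q z * (w - z))%C
      with ((q w - q z) * (w - z))%C by ring.
    rewrite Cmod_mult. apply Rmult_le_compat_r; [apply Cmod_ge_0|].
    left; auto.
Qed.

Lemma is_Cder_cont (f : C -> C) (z l : C) : is_Cder f z l -> Ccont f z.
Proof.
  intros H. apply is_Cder_slope in H. destruct H as (q & Hq & Hc & Hf).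
  assert (H : Ccont (fun w => f z + q w * (w + - z))%C z).
  { apply Ccont_plus; [apply Ccont_const|]. apply Ccont_mult; auto.
    apply Ccont_plus; [apply Ccont_id|apply Ccont_const]. }
  intros e He. destruct (H e He) as (d & Hd & H1). exists d; split; auto.
  intros w Hw. rewrite (Hf w). specialize (H1 w Hw).
  replace (f z + q w * (w - z) - f z)%C
    with (f z + q w * (w + - z) - (f z + q z * (z + - z)))%C by ring. auto.
Qed.

Lemma Cdiff_cont (f : C -> C) (z : C) : Cdiff f z -> Ccont f z.
Proof. intros [l H]. eapply is_Cder_cont; eauto. Qed.

Lemma is_Cder_const (c z : C) : is_Cder (fun _ => c) z 0.
Proof.
  apply is_Cder_slope. exists (fun _ => RtoC 0).
  split; [auto|split; [apply Ccont_const|]]. intros; ring.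
Qed.

Lemma is_Cder_id (z : C) : is_Cder (fun w => w) z 1.
Proof.
  apply is_Cder_slope. exists (fun _ => RtoC 1).
  split; [auto|split; [apply Ccont_const|]]. intros; ring.
Qed.

Lemma is_Cder_plus (f g : C -> C) (z l m : C) :
  is_Cder f z l -> is_Cder g z m -> is_Cder (fun w => f w + g w)%C z (l + m).
Proof.
  rewrite !is_Cder_slope. intros (q & Hq & Hc & Hf) (r & Hr & Hc' & Hg).
  exists (fun w => q w + r w)%C. rewrite Hq, Hr.
  split; [auto|split; [apply Ccont_plus; auto|]].
  intros w. rewrite (Hf w), (Hg w). ring.
Qed.

Lemma is_Cder_mult (f g : C -> C) (z l m : C) :
  is_Cder f z l -> is_Cder g z m ->
  is_Cder (fun w => f w * g w)%C z (l * g z + f z * m).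
Proof.
  intros H1 H2. pose proof (is_Cder_cont _ _ _ H2) as Hgc. revert H1 H2.
  rewrite !is_Cder_slope. intros (q & Hq & Hc & Hf) (r & Hr & Hc' & Hg).
  exists (fun w => q w * g w + f z * r w)%C. rewrite Hq, Hr.
  split; [auto|split].
  - apply Ccont_plus; apply Ccont_mult; auto. apply Ccont_const.
  - intros w. rewrite (Hf w), (Hg w). ring.
Qed.

Lemma is_Cder_comp (f g : C -> C) (z l m : C) :
  is_Cder f z l -> is_Cder g (f z) m -> is_Cder (fun w => g (f w)) z (m * l).
Proof.
  intros H1 H2. pose proof (is_Cder_cont _ _ _ H1) as Hfc. revert H1 H2.
  rewrite !is_Cder_slope. intros (q & Hq & Hc & Hf) (r & Hr & Hc' & Hg).
  exists (fun w => r (f w) * q w)%C. rewrite Hq, Hr.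
  split; [auto|split].
  - apply Ccont_mult; auto. apply (Ccont_comp f r); auto.
  - intros w. rewrite (Hg (f w)).
    replace (f w - f z)%C with (q w * (w - z))%C by (rewrite (Hf w); ring). ring.
Qed.

Lemma is_Cder_inv_id (u : C) : u <> 0%C -> is_Cder Cinv u (- (/ u * / u)).
Proof.
  intros Hu e He.
  assert (Hm : 0 < Cmod u) by (apply Cmod_gt_0; auto).
  assert (Hm3 : 0 < Cmod u * Cmod u * Cmod u) by (repeat apply Rmult_lt_0_compat; auto).
  exists (Rmin (Cmod u / 2) (e * (Cmod u * Cmod u * Cmod u) / 2)).
  split; [apply Rmin_pos; [lra|apply Rdiv_lt_0_compat; nra]|].
  intros w Hw.
  pose proof (Rmin_l (Cmod u / 2) (e * (Cmod u * Cmod u * Cmod u) / 2)).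
  pose proof (Rmin_r (Cmod u / 2) (e * (Cmod u * Cmod u * Cmod u) / 2)).
  assert (Hw2 : Cmod u / 2 < Cmod w).
  { pose proof (Cmod_triangle_rev u w). rewrite (Cmod_minus_sym u w) in H1. lra. }
  assert (Hw0 : w <> 0%C) by (apply Cmod_gt_0; lra).
  replace (/ w - / u - - (/ u * / u) * (w - u))%C
    with ((w - u) * ((w - u) / (w * (u * u))))%C by (field; auto).
  rewrite Cmod_mult, Rmult_comm.
  apply Rmult_le_compat_r; [apply Cmod_ge_0|].
  rewrite Cmod_div, !Cmod_mult by (repeat apply Cmult_neq_0; auto).
  apply Rle_div_l; [repeat apply Rmult_lt_0_compat; lra|].
  apply Rle_trans with (e * (Cmod u / 2 * (Cmod u * Cmod u))); [lra|].
  apply Rmult_le_compat_l; [lra|]. apply Rmult_le_compat_r; [nra|lra].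
Qed.

Lemma Cdiff_const (c z : C) : Cdiff (fun _ => c) z.
Proof. eexists; apply is_Cder_const. Qed.

Lemma Cdiff_id (z : C) : Cdiff (fun w => w) z.
Proof. eexists; apply is_Cder_id. Qed.

Lemma Cdiff_plus (f g : C -> C) (z : C) :
  Cdiff f z -> Cdiff g z -> Cdiff (fun w => f w + g w)%C z.
Proof. intros [l H] [m H']. eexists; apply is_Cder_plus; eauto. Qed.

Lemma Cdiff_mult (f g : C -> C) (z : C) :
  Cdiff f z -> Cdiff g z -> Cdiff (fun w => f w * g w)%C z.
Proof. intros [l H] [m H']. eexists; apply is_Cder_mult; eauto. Qed.

Lemma Cdiff_comp (f g : C -> C) (z : C) :
  Cdiff f z -> Cdiff g (f z) -> Cdiff (fun w => g (f w)) z.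
Proof. intros [l H] [m H']. eexists; apply (is_Cder_comp f g); eauto. Qed.

Lemma Cdiff_inv (f : C -> C) (z : C) :
  Cdiff f z -> f z <> 0%C -> Cdiff (fun w => / f w)%C z.
Proof.
  intros H Hz. apply (Cdiff_comp f Cinv); auto.
  eexists; apply is_Cder_inv_id; auto.
Qed.

Lemma Cdiff_ext_loc (f g : C -> C) (z : C) :
  (exists d, 0 < d /\ forall w, Cmod (w - z) < d -> f w = g w) ->
  Cdiff f z -> Cdiff g z.
Proof.
  intros (d & Hd & Hfg) (l & H). exists l. intros e He.
  destruct (H e He) as (d' & Hd' & H1).
  exists (Rmin d d'). split; [apply Rmin_pos; auto|]. intros w Hw.
  pose proof (Rmin_l d d'). pose proof (Rmin_r d d').
  rewrite <- (Hfg w), <- (Hfg z); [apply H1; lra| |lra].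
  rewrite Cminus_diag_mod; auto.
Qed.

Lemma Cdiff_ext (f g : C -> C) (z : C) :
  (forall w, f w = g w) -> Cdiff f z -> Cdiff g z.
Proof. intros H. apply Cdiff_ext_loc. exists 1. split; [lra|auto]. Qed.

Lemma Cdiff_opp (f : C -> C) (z : C) : Cdiff f z -> Cdiff (fun w => - f w)%C z.
Proof.
  intros H. apply Cdiff_ext with (fun w => - (1) * f w)%C; [intros; ring|].
  apply Cdiff_mult; auto. apply Cdiff_const.
Qed.

Lemma Cdiff_minus (f g : C -> C) (z : C) :
  Cdiff f z -> Cdiff g z -> Cdiff (fun w => f w - g w)%C z.
Proof. intros. apply Cdiff_plus; auto. apply Cdiff_opp; auto. Qed.

Lemma Cdiff_div (f g : C -> C) (z : C) :
  Cdiff f z -> Cdiff g z -> g z <> 0%C -> Cdiff (fun w => f w / g w)%C z.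
Proof. intros. apply Cdiff_mult; auto. apply Cdiff_inv; auto. Qed.

Lemma Cdiff_pow (f : C -> C) (n : nat) (z : C) :
  Cdiff f z -> Cdiff (fun w => f w ^ n)%C z.
Proof.
  intros H. induction n; simpl; [apply Cdiff_const|]. apply Cdiff_mult; auto.
Qed.

(** * The complex exponential *)

Lemma Cexp_plus (a b : C) : Cexp (a + b) = (Cexp a * Cexp b)%C.
Proof.
  unfold Cexp. destruct a as [a1 a2], b as [b1 b2]. simpl.
  rewrite exp_plus, cos_plus, sin_plus.
  apply injective_projections; simpl; ring.
Qed.

Lemma Cexp_0 : Cexp 0 = 1%C.
Proof. unfold Cexp; simpl. rewrite exp_0, cos_0, sin_0. apply injective_projections; simpl; ring. Qed.

Lemma Cexp_neq_0 (a : C) : Cexp a <> 0%C.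
Proof.
  intros H. assert (H1 : (Cexp a * Cexp (- a) = 0)%C) by (rewrite H; ring).
  rewrite <- Cexp_plus in H1. replace (a + - a)%C with (RtoC 0) in H1 by ring.
  rewrite Cexp_0 in H1. apply (f_equal fst) in H1. simpl in H1. lra.
Qed.

Lemma Cexp_opp (a : C) : Cexp (- a) = (/ Cexp a)%C.
Proof.
  replace (Cexp (- a)) with (Cexp (- a) * Cexp a / Cexp a)%C
    by (field; apply Cexp_neq_0).
  rewrite <- Cexp_plus. replace (- a + a)%C with (RtoC 0) by ring.
  rewrite Cexp_0. field. apply Cexp_neq_0.
Qed.

Lemma Cmod_Cexp (a : C) : Cmod (Cexp a) = exp (Re a).
Proof.
  unfold Cexp, Cmod; simpl.
  replace (exp (Re a) * cos (Im a) * (exp (Re a) * cos (Im a) * 1) +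
    exp (Re a) * sin (Im a) * (exp (Re a) * sin (Im a) * 1))
    with ((exp (Re a))² * ((sin (Im a))² + (cos (Im a))²)) by (unfold Rsqr; ring).
  rewrite sin2_cos2, Rmult_1_r. apply sqrt_Rsqr. left; apply exp_pos.
Qed.

Lemma Cexp_RtoC (x : R) : Cexp (RtoC x) = RtoC (exp x).
Proof. unfold Cexp; simpl. rewrite cos_0, sin_0. apply injective_projections; simpl; ring. Qed.

(** For the upper side, exp (- x) >= 1 - x gives exp x * (1 - x) <= 1, while (1 + x + 2 x^2) (1 - x)
    = 1 + x^2 (1 - 2 x) >= 1 when x <= 1/2. *)
Lemma exp_remainder (x : R) : Rabs x <= 1/2 -> Rabs (exp x - 1 - x) <= 2 * (x * x).
Proof.
  intros Hx. apply Rabs_le_between in Hx.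
  assert (H0 : 1 + x <= exp x) by apply exp_ineq1_le.
  rewrite Rabs_pos_eq by lra.
  assert (H1 : exp x * (1 - x) <= 1).
  { pose proof (exp_ineq1_le (- x)). rewrite exp_Ropp in H.
    pose proof (exp_pos x). replace 1 with (exp x * / exp x) at 2 by (field; lra).
    apply Rmult_le_compat_l; lra. }
  assert (H2 : 1 <= (1 + x + 2 * (x * x)) * (1 - x)) by nra.
  assert (exp x <= 1 + x + 2 * (x * x)) by (apply Rmult_le_reg_r with (1 - x); lra).
  lra.
Qed.

Lemma Rabs_sin_le (y : R) : Rabs (sin y) <= Rabs y.
Proof.
  destruct (MVT_gen sin 0 y cos) as (c & _ & Hc).
  - intros; apply is_derive_Reals, derivable_pt_lim_sin.
  - intros; apply continuity_sin.
  - rewrite sin_0 in Hc. replace (sin y) with (cos c * (y - 0)) by lra.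
    rewrite Rabs_mult, Rminus_0_r.
    rewrite <- (Rmult_1_l (Rabs y)) at 2.
    apply Rmult_le_compat_r; [apply Rabs_pos|].
    apply Rabs_le_between, COS_bound.
Qed.

Lemma cos_remainder (y : R) : Rabs (cos y - 1) <= y * y.
Proof.
  replace y with (2 * (y / 2)) at 1 by field. rewrite cos_2a_sin.
  pose proof (Rabs_sin_le (y / 2)) as H.
  replace (1 - 2 * sin (y / 2) * sin (y / 2) - 1) with (- (2 * (sin (y/2))²)) by (unfold Rsqr; ring).
  rewrite Rabs_Ropp, Rabs_pos_eq by (pose proof (Rle_0_sqr (sin (y/2))); lra).
  apply Rsqr_le_abs_1 in H. unfold Rsqr in *. nra.
Qed.

Lemma sin_remainder (y : R) : Rabs y <= 1 -> Rabs (sin y - y) <= y * y.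
Proof.
  intros Hy.
  destruct (MVT_gen (fun t => sin t - t) 0 y (fun t => cos t - 1)) as (c & Hc1 & Hc).
  - intros x _. auto_derive; auto. ring.
  - intros x _. apply continuity_pt_minus; [apply continuity_sin|apply derivable_continuous_pt, derivable_pt_id].
  - rewrite sin_0 in Hc. replace (sin y - y) with ((cos c - 1) * (y - 0)) by lra.
    rewrite Rabs_mult, Rminus_0_r.
    pose proof (cos_remainder c).
    assert (Rabs c <= Rabs y).
    { apply Rabs_le_between. unfold Rmin, Rmax in Hc1.
      destruct (Rle_dec 0 y); [rewrite (Rabs_pos_eq y)|rewrite (Rabs_left1 y)]; lra. }
    pose proof (Rabs_pos c). pose proof (Rabs_pos y).
    assert (c * c = Rabs c * Rabs c) by (rewrite <- Rabs_mult; symmetry; apply Rabs_pos_eq; nra).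
    assert (y * y = Rabs y * Rabs y) by (rewrite <- Rabs_mult; symmetry; apply Rabs_pos_eq; nra).
    nra.
Qed.

Lemma Cexp_remainder_small (h : C) : Cmod h <= 1/2 -> Cmod (Cexp h - 1 - h) <= 8 * Cmod h ^ 2.
Proof.
  intros Hh. pose proof (Rabs_Re_le h) as Hx. pose proof (Rabs_Im_le h) as Hy.
  pose proof (Cmod_ge_0 h) as H0. rewrite <- Rsqr_pow2. unfold Rsqr.
  set (m := Cmod h) in *. destruct h as [x y]. simpl in Hx, Hy.
  pose proof (Rabs_pos x). pose proof (Rabs_pos y).
  assert (Hxx : x * x <= m * m).
  { replace (x * x) with (Rabs x * Rabs x) by (rewrite <- Rabs_mult; apply Rabs_pos_eq; nra). nra. }
  assert (Hyy : y * y <= m * m).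
  { replace (y * y) with (Rabs y * Rabs y) by (rewrite <- Rabs_mult; apply Rabs_pos_eq; nra). nra. }
  pose proof (exp_remainder x ltac:(lra)) as R1. pose proof (cos_remainder y).
  pose proof (sin_remainder y ltac:(lra)).
  pose proof (COS_bound y). pose proof (SIN_bound y).
  assert (Hex : exp x <= 2).
  { assert (Hr : Rabs x <= 1/2) by lra. apply Rabs_le_between in R1.
    apply Rabs_le_between in Hr. nra. }
  pose proof (exp_pos x).
  eapply Rle_trans; [apply Cmod_Re_Im|]. unfold Cexp; simpl.
  set (E := exp x) in *. set (c := cos y) in *. set (s := sin y) in *.
  replace (E * c + - (1) + - x) with ((E - 1 - x) + E * (c - 1)) by ring.
  replace (E * s + - 0 + - y) with (E * (s - y) + (E - 1 - x) * y + x * y) by ring.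
  assert (Hxy : Rabs (x * y) <= m * m) by (rewrite Rabs_mult; nra).
  assert (B1 : Rabs (E - 1 - x + E * (c - 1)) <= 4 * (m * m)).
  { eapply Rle_trans; [apply Rabs_triang|]. rewrite Rabs_mult, (Rabs_pos_eq E) by lra.
    assert (E * Rabs (c - 1) <= 2 * (y * y)) by
      (pose proof (Rabs_pos (c-1)); nra). lra. }
  assert (B2 : Rabs (E * (s - y) + (E - 1 - x) * y + x * y) <= 4 * (m * m)).
  { eapply Rle_trans; [apply Rabs_triang|].
    pose proof (Rabs_triang (E * (s - y)) ((E - 1 - x) * y)) as HT.
    rewrite !Rabs_mult, (Rabs_pos_eq E) in HT by lra.
    assert (E * Rabs (s - y) <= 2 * (y * y)) by (pose proof (Rabs_pos (s-y)); nra).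
    assert (Rabs (E - 1 - x) * Rabs y <= 2 * (x * x) * (1/2))
      by (pose proof (Rabs_pos (E - 1 - x)); nra).
    lra. }
  lra.
Qed.

(** Beyond |h| = 1/2 the square is bounded below, so the triangle inequality is enough. The factor 1
    + exp (Re h) is kept because the remainder is later multiplied by a decaying exponential and
    integrated. *)
Lemma Cexp_remainder (h : C) :
  Cmod (Cexp h - 1 - h) <= 12 * (Cmod h ^ 2 * (1 + exp (Re h))).
Proof.
  pose proof (exp_pos (Re h)) as He. pose proof (Cmod_ge_0 h) as H0.
  assert (H2 : 0 <= Cmod h ^ 2) by (apply pow_le; auto).
  destruct (Rle_dec (Cmod h) (1/2)) as [Hs|Hs].
  - pose proof (Cexp_remainder_small h Hs).
    assert (0 <= Cmod h ^ 2 * exp (Re h)) by (apply Rmult_le_pos; lra). lra.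
  - eapply Rle_trans; [apply Cmod_minus_triangle|].
    pose proof (Cmod_minus_triangle (Cexp h) 1) as H1.
    rewrite Cmod_Cexp, Cmod_1 in H1.
    assert (Hq : 1 <= 4 * Cmod h ^ 2) by nra.
    assert (exp (Re h) * 1 <= exp (Re h) * (4 * Cmod h ^ 2)) by (apply Rmult_le_compat_l; lra).
    nra.
Qed.

Lemma is_Cder_Cexp (z : C) : is_Cder Cexp z (Cexp z).
Proof.
  intros e He. set (M := Cmod (Cexp z)).
  assert (HM : 0 < M) by (apply Cmod_gt_0, Cexp_neq_0).
  exists (Rmin (1/2) (e / (8 * M))).
  split; [apply Rmin_pos; [lra|apply Rdiv_lt_0_compat; lra]|].
  intros w Hw. pose proof (Rmin_l (1/2) (e / (8 * M))). pose proof (Rmin_r (1/2) (e / (8 * M))).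
  replace (Cexp w) with (Cexp z * Cexp (w - z))%C by (rewrite <- Cexp_plus; f_equal; ring).
  replace (Cexp z * Cexp (w - z) - Cexp z - Cexp z * (w - z))%C
    with (Cexp z * (Cexp (w - z) - 1 - (w - z)))%C by ring.
  rewrite Cmod_mult. fold M.
  pose proof (Cexp_remainder_small (w - z) ltac:(lra)).
  pose proof (Cmod_ge_0 (w - z)).
  apply Rle_trans with (M * (8 * Cmod (w - z) ^ 2)).
  { apply Rmult_le_compat_l; lra. }
  replace (M * (8 * Cmod (w - z) ^ 2)) with ((8 * M * Cmod (w - z)) * Cmod (w - z)) by ring.
  apply Rmult_le_compat_r; auto.
  apply Rle_trans with (8 * M * (e / (8 * M))).
  - apply Rmult_le_compat_l; lra.
  - apply Req_le; field; lra.
Qed.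

Lemma Cdiff_Cexp (f : C -> C) (z : C) : Cdiff f z -> Cdiff (fun w => Cexp (f w)) z.
Proof. intros H. apply (Cdiff_comp f Cexp); auto. eexists; apply is_Cder_Cexp. Qed.

Lemma is_derive_is_Cder (f : C -> C) (z l : C) :
  is_derive (K := C_AbsRing) (V := C_NormedModule) f z l -> is_Cder f z l.
Proof.
  intros [_ H] e He.
  specialize (H z (fun P HP => HP) (mkposreal e He)).
  apply locally_C in H. destruct H as [d Hd].
  exists d. split; [apply cond_pos|]. intros w Hw.
  assert (Hb : ball (M := C_UniformSpace) z d w) by (apply C_NormedModule_mixin_compat1; exact Hw).
  specialize (Hd w Hb). rewrite (Cmult_comm l). exact Hd.
Qed.

(** Balls of the product uniform structure are squares, contained in the disc of radius sqrt 2 * d;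
    the factor 2 is a round upper bound. *)
Lemma ball_Cmod (z w : C) (d : posreal) :
  ball (M := C_UniformSpace) z d w -> Cmod (w - z) < 2 * d.
Proof.
  intros H. apply C_NormedModule_mixin_compat2 in H.
  pose proof (cond_pos d). change (Cmod (w - z) < sqrt 2 * d) in H.
  assert (sqrt 2 <= 2) by (rewrite <- (sqrt_Rsqr 2) at 2 by lra; apply sqrt_le_1; unfold Rsqr; lra).
  nra.
Qed.

Lemma Cmod_ball (z w : C) (d : R) : Cmod (w - z) < d -> ball (M := C_UniformSpace) z d w.
Proof. intros H. apply C_NormedModule_mixin_compat1. exact H. Qed.

Lemma locally_C_Cmod (z : C) (Q : C -> Prop) :
  locally (T := C_UniformSpace) z Q <->
  exists d, 0 < d /\ forall w, Cmod (w - z) < d -> Q w.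
Proof.
  split.
  - intros [d Hd]. exists d. split; [apply cond_pos|].
    intros w Hw. apply Hd, Cmod_ball; auto.
  - intros (d & Hd & H). exists (mkposreal (d / 2) ltac:(lra)).
    intros w Hw. apply ball_Cmod in Hw. simpl in Hw. apply H. lra.
Qed.

Lemma filterlim_C_iff {T : Type} (F : (T -> Prop) -> Prop) {FF : Filter F} (f : T -> C) (l : C) :
  filterlim f F (locally (T := C_UniformSpace) l) <->
  forall eps, 0 < eps -> F (fun t => Cmod (f t - l) < eps).
Proof.
  split.
  - intros H eps He.
    apply (H (fun w => Cmod (w - l) < eps)). apply locally_C_Cmod.
    exists eps; auto.
  - intros H Q HQ. apply locally_C_Cmod in HQ. destruct HQ as (d & Hd & HQ).
    unfold filtermap. generalize (H d Hd). apply filter_imp. auto.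
Qed.

(** * Integrals of complex functions of a real variable *)

Definition CI (f : R -> C) (a b : R) : C := RInt (V := C_R_CompleteNormedModule) f a b.

Definition Rcont (f : R -> C) (t : R) : Prop :=
  forall eps, 0 < eps -> exists d, 0 < d /\
    forall s, Rabs (s - t) < d -> Cmod (f s - f t) < eps.

Definition Rder (f : R -> C) (t : R) (l : C) : Prop :=
  forall eps, 0 < eps -> exists d, 0 < d /\
    forall s, Rabs (s - t) < d -> Cmod (f s - f t - l * RtoC (s - t)) <= eps * Rabs (s - t).

Definition Rcont_on (f : R -> C) (a b : R) : Prop :=
  forall t, Rmin a b <= t <= Rmax a b -> Rcont f t.

Lemma norm_C_R (z : C) : norm (K := R_AbsRing) (V := C_R_NormedModule) z = Cmod z.
Proof.
  destruct z as [x y]. unfold norm; simpl. unfold prod_norm, norm; simpl. unfold abs; simpl.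
  unfold Cmod; simpl. f_equal. rewrite !Rmult_1_r, <- !Rabs_mult.
  rewrite !Rabs_pos_eq by nra. reflexivity.
Qed.

Lemma Rcont_continuous (f : R -> C) (t : R) :
  Rcont f t <-> continuous (T := R_UniformSpace) (U := C_UniformSpace) f t.
Proof.
  unfold continuous. rewrite filterlim_C_iff by apply _. split.
  - intros H e He. destruct (H e He) as (d & Hd & H1).
    exists (mkposreal d Hd). intros s Hs. apply H1. exact Hs.
  - intros H e He. destruct (H e He) as [d Hd].
    exists d. split; [apply cond_pos|]. intros s Hs. apply Hd. exact Hs.
Qed.

Lemma ex_CI (f : R -> C) (a b : R) :
  Rcont_on f a b -> ex_RInt (V := C_R_NormedModule) f a b.
Proof.
  intros H. apply (ex_RInt_continuous (V := C_R_CompleteNormedModule)).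
  intros z Hz. apply Rcont_continuous. auto.
Qed.

Lemma is_CI (f : R -> C) (a b : R) :
  Rcont_on f a b -> is_RInt (V := C_R_NormedModule) f a b (CI f a b).
Proof.
  intros H. apply (RInt_correct (V := C_R_CompleteNormedModule)). apply ex_CI; auto.
Qed.

Lemma CI_unique (f : R -> C) (a b : R) (l : C) :
  is_RInt (V := C_R_NormedModule) f a b l -> CI f a b = l.
Proof. apply (is_RInt_unique (V := C_R_CompleteNormedModule)). Qed.

Lemma CI_ext (f g : R -> C) (a b : R) :
  (forall t, Rmin a b < t < Rmax a b -> f t = g t) -> CI f a b = CI g a b.
Proof. apply (RInt_ext (V := C_R_CompleteNormedModule)). Qed.

Lemma CI_plus (f g : R -> C) (a b : R) :
  Rcont_on f a b -> Rcont_on g a b ->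
  CI (fun t => f t + g t)%C a b = (CI f a b + CI g a b)%C.
Proof. intros. apply (RInt_plus (V := C_R_CompleteNormedModule)); apply ex_CI; auto. Qed.

(** The integral lives in a real normed module, so a complex factor is handled through real and
    imaginary parts. *)
Lemma is_RInt_C_scal (c : C) (f : R -> C) (a b : R) (l : C) :
  is_RInt (V := C_R_NormedModule) f a b l ->
  is_RInt (V := C_R_NormedModule) (fun t => c * f t)%C a b (c * l)%C.
Proof.
  intros H.
  pose proof (is_RInt_fct_extend_fst (U := R_NormedModule) (V := R_NormedModule) f a b l H) as H1.
  pose proof (is_RInt_fct_extend_snd (U := R_NormedModule) (V := R_NormedModule) f a b l H) as H2.
  destruct c as [c1 c2], l as [l1 l2]. simpl in H1, H2.
  apply (is_RInt_fct_extend_pair (U := R_NormedModule) (V := R_NormedModule)); simpl.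
  - apply (is_RInt_minus (V := R_NormedModule)); apply (is_RInt_scal (V := R_NormedModule)); auto.
  - apply (is_RInt_plus (V := R_NormedModule)); apply (is_RInt_scal (V := R_NormedModule)); auto.
Qed.

Lemma CI_scal (c : C) (f : R -> C) (a b : R) :
  Rcont_on f a b -> CI (fun t => c * f t)%C a b = (c * CI f a b)%C.
Proof. intros H. apply CI_unique, is_RInt_C_scal, is_CI; auto. Qed.

Lemma scal_C_R (r : R) (z : C) : scal (V := C_R_NormedModule) r z = (RtoC r * z)%C.
Proof.
  unfold scal; simpl. unfold prod_scal, scal; simpl. unfold mult; simpl.
  destruct z; apply injective_projections; simpl; ring.
Qed.

Lemma CI_const (c : C) (a b : R) : CI (fun _ => c) a b = (RtoC (b - a) * c)%C.
Proof.
  apply CI_unique.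
  rewrite <- scal_C_R. apply (is_RInt_const (V := C_R_NormedModule)).
Qed.

Lemma CI_point (f : R -> C) (a : R) : CI f a a = 0%C.
Proof. apply (RInt_point (V := C_R_CompleteNormedModule)). Qed.

Lemma CI_Chasles (f : R -> C) (a b c : R) :
  Rcont_on f a b -> Rcont_on f b c -> (CI f a b + CI f b c)%C = CI f a c.
Proof. intros. apply (RInt_Chasles (V := C_R_CompleteNormedModule)); apply ex_CI; auto. Qed.

Lemma CI_norm_le (f : R -> C) (g : R -> R) (a b lg : R) :
  a <= b -> Rcont_on f a b -> (forall t, a <= t <= b -> Cmod (f t) <= g t) ->
  is_RInt g a b lg -> Cmod (CI f a b) <= lg.
Proof.
  intros Hab Hf Hg Hlg. rewrite <- norm_C_R.
  apply (norm_RInt_le (V := C_R_NormedModule) f g a b); auto.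
  - intros; rewrite norm_C_R; auto.
  - apply is_CI; auto.
Qed.

Lemma CI_norm (f : R -> C) (a b M : R) :
  a <= b -> Rcont_on f a b -> (forall t, a <= t <= b -> Cmod (f t) <= M) ->
  Cmod (CI f a b) <= (b - a) * M.
Proof.
  intros Hab Hf Hg. apply (CI_norm_le f (fun _ => M) a b); auto.
  apply (is_RInt_const (V := R_NormedModule)).
Qed.

Lemma CI_shift (f : R -> C) (a b v : R) :
  Rcont_on f (a + v) (b + v) -> CI (fun t => f (t + v)) a b = CI f (a + v) (b + v).
Proof.
  intros H.
  pose proof (RInt_comp_lin (V := C_R_CompleteNormedModule) f 1 v a b) as H1.
  rewrite !Rmult_1_l in H1. unfold CI. rewrite <- H1 by (apply ex_CI; auto).
  apply (RInt_ext (V := C_R_CompleteNormedModule)). intros t _.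
  rewrite Rmult_1_l. symmetry. apply (scal_one (V := C_R_NormedModule)).
Qed.

Lemma Rder_is_derive (f : R -> C) (t : R) (l : C) :
  Rder f t l -> is_derive (K := R_AbsRing) (V := C_R_NormedModule) f t l.
Proof.
  intros H. split; [apply is_linear_scal_l|].
  intros x Hx. apply (is_filter_lim_locally_unique (V := R_NormedModule)) in Hx. subst x.
  intros [e He]. destruct (H e He) as (d & Hd & H1).
  exists (mkposreal d Hd). intros s Hs. specialize (H1 s Hs).
  rewrite norm_C_R, scal_C_R, Cmult_comm. exact H1.
Qed.

Lemma CI_FTC (f df : R -> C) (a b : R) :
  (forall t, Rmin a b <= t <= Rmax a b -> Rder f t (df t)) -> Rcont_on df a b ->
  CI df a b = (f b - f a)%C.
Proof.
  intros H1 H2. apply CI_unique.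
  apply (is_RInt_derive (V := C_R_CompleteNormedModule) f df a b).
  - intros; apply Rder_is_derive; auto.
  - intros; apply Rcont_continuous; auto.
Qed.

Lemma Rcont_path (f : C -> C) (g : R -> C) (t : R) :
  Rcont g t -> Ccont f (g t) -> Rcont (fun s => f (g s)) t.
Proof.
  intros Hg Hf e He. destruct (Hf e He) as (d & Hd & H1).
  destruct (Hg d Hd) as (d' & Hd' & H2). exists d'. split; auto.
Qed.

Lemma Rcont_h (y t : R) : Rcont (fun s => (s, y)) t.
Proof.
  intros e He. exists e. split; auto. intros s Hs.
  replace ((s, y) - (t, y))%C with (RtoC (s - t)) by (apply injective_projections; simpl; ring).
  rewrite Cmod_R; auto.
Qed.

Lemma Rcont_v (x t : R) : Rcont (fun s => (x, s)) t.
Proof.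
  intros e He. exists e. split; auto. intros s Hs.
  replace ((x, s) - (x, t))%C with (Ci * RtoC (s - t))%C by (apply injective_projections; simpl; ring).
  rewrite Cmod_mult, Cmod_Ci, Cmod_R; lra.
Qed.

(** * Cauchy theory on rectangles *)

Definition hint (f : C -> C) (y a b : R) : C := CI (fun t => f (t, y)) a b.
Definition vint (f : C -> C) (x c d : R) : C := (Ci * CI (fun t => f (x, t)) c d)%C.

Definition rect_int (f : C -> C) (a b c d : R) : C :=
  (hint f c a b + vint f b c d - hint f d a b - vint f a c d)%C.

Definition in_rect (a b c d : R) (z : C) : Prop := a <= Re z <= b /\ c <= Im z <= d.

Definition on_bd (a b c d : R) (z : C) : Prop :=
  in_rect a b c d z /\ (Re z = a \/ Re z = b \/ Im z = c \/ Im z = d).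

Lemma nested_intervals (a b : nat -> R) :
  (forall n, a n <= a (S n)) -> (forall n, b (S n) <= b n) -> (forall n, a n <= b n) ->
  exists x, forall n, a n <= x <= b n.
Proof.
  intros Ha Hb Hab.
  assert (Ha' : forall n k, a n <= a (n + k)%nat).
  { intros n k; induction k; [rewrite Nat.add_0_r; lra|].
    rewrite Nat.add_succ_r. eapply Rle_trans; eauto. }
  assert (Hb' : forall n k, b (n + k)%nat <= b n).
  { intros n k; induction k; [rewrite Nat.add_0_r; lra|].
    rewrite Nat.add_succ_r. eapply Rle_trans; [apply Hb|auto]. }
  assert (Hm : forall n m, a n <= b m).
  { intros n m. apply Rle_trans with (a (n + m)%nat); auto.
    apply Rle_trans with (b (n + m)%nat); auto. rewrite Nat.add_comm; auto. }
  destruct (completeness (fun y => exists n, y = a n)) as [x [Hx1 Hx2]].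
  - exists (b 0%nat). intros y [n ->]; auto.
  - exists (a 0%nat); eauto.
  - exists x. intros n. split; [apply Hx1; eauto|]. apply Hx2. intros y [m ->]; auto.
Qed.

(* Bisection: a property of rectangles inherited from the four quarters and true of all
   small rectangles around each point is true. *)
Lemma rect_bisection (Q : R -> R -> R -> R -> Prop) (a0 b0 c0 d0 : R) :
  a0 <= b0 -> c0 <= d0 ->
  (forall a b c d, a0 <= a -> a <= b -> b <= b0 -> c0 <= c -> c <= d -> d <= d0 ->
     Q a ((a + b) / 2) c ((c + d) / 2) -> Q ((a + b) / 2) b c ((c + d) / 2) ->
     Q a ((a + b) / 2) ((c + d) / 2) d -> Q ((a + b) / 2) b ((c + d) / 2) d ->
     Q a b c d) ->
  (forall z, in_rect a0 b0 c0 d0 z -> exists e, 0 < e /\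
     forall a b c d, a0 <= a -> b <= b0 -> c0 <= c -> d <= d0 -> in_rect a b c d z ->
       b - a < e -> d - c < e -> Q a b c d) ->
  Q a0 b0 c0 d0.
Proof.
  intros Hab Hcd Hsplit Hloc. apply NNPP. intros Hbad.
  set (V := fun r : (R * R) * (R * R) =>
    let '((a, b), (c, d)) := r in
    (a0 <= a /\ a <= b /\ b <= b0 /\ c0 <= c /\ c <= d /\ d <= d0) /\ ~ Q a b c d).
  set (N := fun r r' : (R * R) * (R * R) =>
    let '((a, b), (c, d)) := r in let '((a', b'), (c', d')) := r' in
    a <= a' /\ b' <= b /\ c <= c' /\ d' <= d /\ b' - a' = (b - a) / 2 /\ d' - c' = (d - c) / 2).
  assert (Hstep : forall r, exists r', V r -> V r' /\ N r r').
  { intros [[a b] [c d]].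
    destruct (excluded_middle_informative (V ((a, b), (c, d)))) as [[H1 H2]|H];
      [|exists ((a, b), (c, d)); tauto].
    destruct (classic (Q a ((a + b) / 2) c ((c + d) / 2))) as [q1|q1].
    2:{ exists ((a, ((a + b) / 2)), (c, ((c + d) / 2))). intros _.
        unfold V, N. repeat split; try lra; auto. }
    destruct (classic (Q ((a + b) / 2) b c ((c + d) / 2))) as [q2|q2].
    2:{ exists ((((a + b) / 2), b), (c, ((c + d) / 2))). intros _.
        unfold V, N. repeat split; try lra; auto. }
    destruct (classic (Q a ((a + b) / 2) ((c + d) / 2) d)) as [q3|q3].
    2:{ exists ((a, ((a + b) / 2)), (((c + d) / 2), d)). intros _.
        unfold V, N. repeat split; try lra; auto. }
    destruct (classic (Q ((a + b) / 2) b ((c + d) / 2) d)) as [q4|q4].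
    2:{ exists ((((a + b) / 2), b), (((c + d) / 2), d)). intros _.
        unfold V, N. repeat split; try lra; auto. }
    exfalso. apply H2, Hsplit; tauto. }
  set (step := fun r => proj1_sig (constructive_indefinite_description _ (Hstep r))).
  assert (Hs : forall r, V r -> V (step r) /\ N r (step r)).
  { intros r. unfold step. destruct (constructive_indefinite_description _ (Hstep r)); auto. }
  set (s := fun n => Nat.iter n step ((a0, b0), (c0, d0))).
  assert (HV : forall n, V (s n)).
  { induction n; [unfold s; simpl; repeat split; try lra; auto|]. apply Hs; auto. }
  assert (HN : forall n, N (s n) (s (S n))) by (intros n; apply Hs; auto).
  destruct (nested_intervals (fun n => fst (fst (s n))) (fun n => snd (fst (s n)))) as [x Hx].
  1,2,3: intros n; specialize (HN n); specialize (HV n);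
    destruct (s n) as [[a b] [c d]], (s (S n)) as [[a' b'] [c' d']]; simpl in *; tauto.
  destruct (nested_intervals (fun n => fst (snd (s n))) (fun n => snd (snd (s n)))) as [y Hy].
  1,2,3: intros n; specialize (HN n); specialize (HV n);
    destruct (s n) as [[a b] [c d]], (s (S n)) as [[a' b'] [c' d']]; simpl in *; tauto.
  assert (Hw : forall n, snd (fst (s n)) - fst (fst (s n)) = (b0 - a0) * (/ 2) ^ n /\
                         snd (snd (s n)) - fst (snd (s n)) = (d0 - c0) * (/ 2) ^ n).
  { induction n; [simpl; lra|]. specialize (HN n).
    destruct (s n) as [[a b] [c d]], (s (S n)) as [[a' b'] [c' d']]; simpl in *; lra. }
  destruct (Hloc (x, y)) as (e & He & HQ).
  { specialize (Hx 0%nat). specialize (Hy 0%nat). simpl in *. split; simpl; lra. }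
  set (w := Rmax (b0 - a0) (d0 - c0) + 1).
  assert (Hwm : b0 - a0 <= w /\ d0 - c0 <= w /\ 0 < w).
  { unfold w. pose proof (Rmax_l (b0 - a0) (d0 - c0)). pose proof (Rmax_r (b0 - a0) (d0 - c0)). lra. }
  destruct (pow_lt_1_zero (/ 2) ltac:(rewrite Rabs_pos_eq; lra) (e / w)
    ltac:(apply Rdiv_lt_0_compat; lra)) as [n Hn].
  specialize (Hn n ltac:(lia)).
  assert (Hp : 0 < (/ 2) ^ n) by (apply pow_lt; lra). rewrite Rabs_pos_eq in Hn by lra.
  assert (Hwn : w * (/ 2) ^ n < e).
  { replace e with (w * (e / w)) by (field; lra). apply Rmult_lt_compat_l; lra. }
  specialize (HV n). specialize (Hw n). specialize (Hx n). specialize (Hy n).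
  destruct (s n) as [[a b] [c d]]; simpl in *. apply HV. apply HQ; try tauto.
  - split; simpl; lra.
  - destruct Hw as [-> _]. nra.
  - destruct Hw as [_ ->]. nra.
Qed.

Lemma Rcont_on_h (f : C -> C) (y a b : R) :
  (forall t, Rmin a b <= t <= Rmax a b -> Ccont f (t, y)) -> Rcont_on (fun t => f (t, y)) a b.
Proof. intros H t Ht. apply (Rcont_path f (fun s => (s, y))); [apply Rcont_h|auto]. Qed.

Lemma Rcont_on_v (f : C -> C) (x c d : R) :
  (forall t, Rmin c d <= t <= Rmax c d -> Ccont f (x, t)) -> Rcont_on (fun t => f (x, t)) c d.
Proof. intros H t Ht. apply (Rcont_path f (fun s => (x, s))); [apply Rcont_v|auto]. Qed.

Lemma rect_h (f : C -> C) (a b c d y a' b' : R) :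
  (forall z, on_bd a b c d z -> Ccont f z) -> c <= d -> y = c \/ y = d -> a <= a' -> a' <= b' -> b' <= b ->
  Rcont_on (fun t => f (t, y)) a' b'.
Proof.
  intros H Hcd Hy H1 H2 H3. apply Rcont_on_h. intros t Ht. apply H.
  rewrite Rmin_left, Rmax_right in Ht by lra. split; [split|]; simpl; lra.
Qed.

Lemma rect_v (f : C -> C) (a b c d x c' d' : R) :
  (forall z, on_bd a b c d z -> Ccont f z) -> a <= b -> x = a \/ x = b -> c <= c' -> c' <= d' -> d' <= d ->
  Rcont_on (fun t => f (x, t)) c' d'.
Proof.
  intros H Hab Hy H1 H2 H3. apply Rcont_on_v. intros t Ht. apply H.
  rewrite Rmin_left, Rmax_right in Ht by lra. split; [split|]; simpl; lra.
Qed.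

Lemma rect_split_h (f : C -> C) (a m b c d : R) :
  (forall z, on_bd a b c d z -> Ccont f z) -> a <= m <= b -> c <= d ->
  rect_int f a b c d = (rect_int f a m c d + rect_int f m b c d)%C.
Proof.
  intros H Hm Hcd. unfold rect_int, hint.
  rewrite <- (CI_Chasles (fun t => f (t, c)) a m b), <- (CI_Chasles (fun t => f (t, d)) a m b);
    try (eapply rect_h; [exact H|..]; lra).
  ring.
Qed.

Lemma rect_split_v (f : C -> C) (a b c m d : R) :
  (forall z, on_bd a b c d z -> Ccont f z) -> a <= b -> c <= m <= d ->
  rect_int f a b c d = (rect_int f a b c m + rect_int f a b m d)%C.
Proof.
  intros H Hm Hcd. unfold rect_int, vint.
  rewrite <- (CI_Chasles (fun t => f (a, t)) c m d), <- (CI_Chasles (fun t => f (b, t)) c m d);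
    try (eapply rect_v; [exact H|..]; lra).
  ring.
Qed.

Lemma rect_int_plus (f g : C -> C) (a b c d : R) :
  (forall z, on_bd a b c d z -> Ccont f z) -> (forall z, on_bd a b c d z -> Ccont g z) ->
  a <= b -> c <= d ->
  rect_int (fun z => f z + g z)%C a b c d = (rect_int f a b c d + rect_int g a b c d)%C.
Proof.
  intros Hf Hg Hab Hcd. unfold rect_int, hint, vint.
  rewrite !CI_plus; [ring|..];
   first [eapply rect_h; [exact Hf|..]; lra | eapply rect_h; [exact Hg|..]; lra
         |eapply rect_v; [exact Hf|..]; lra | eapply rect_v; [exact Hg|..]; lra].
Qed.

Lemma rect_int_scal (k : C) (f : C -> C) (a b c d : R) :
  (forall z, on_bd a b c d z -> Ccont f z) -> a <= b -> c <= d ->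
  rect_int (fun z => k * f z)%C a b c d = (k * rect_int f a b c d)%C.
Proof.
  intros Hf Hab Hcd. unfold rect_int, hint, vint.
  rewrite !CI_scal; [ring|..];
   first [eapply rect_h; [exact Hf|..]; lra |eapply rect_v; [exact Hf|..]; lra].
Qed.

Lemma rect_int_bound (f : C -> C) (a b c d M : R) :
  (forall z, on_bd a b c d z -> Ccont f z) -> a <= b -> c <= d ->
  (forall z, on_bd a b c d z -> Cmod (f z) <= M) ->
  Cmod (rect_int f a b c d) <= 2 * ((b - a) + (d - c)) * M.
Proof.
  intros Hf Hab Hcd HM. unfold rect_int, vint.
  assert (H1 : forall y, y = c \/ y = d -> Cmod (hint f y a b) <= (b - a) * M).
  { intros y Hy. apply CI_norm; auto; [eapply rect_h; [exact Hf|..]; lra|].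
    intros t Ht; apply HM; split; [split|]; simpl; lra. }
  assert (H2 : forall x, x = a \/ x = b -> Cmod (Ci * CI (fun t => f (x, t)) c d) <= (d - c) * M).
  { intros x Hx. rewrite Cmod_mult, Cmod_Ci, Rmult_1_l.
    apply CI_norm; auto; [eapply rect_v; [exact Hf|..]; lra|].
    intros t Ht; apply HM; split; [split|]; simpl; lra. }
  pose proof (H1 c ltac:(lra)). pose proof (H1 d ltac:(lra)).
  pose proof (H2 a ltac:(lra)). pose proof (H2 b ltac:(lra)).
  set (A := hint f c a b) in *. set (B := hint f d a b) in *.
  set (U := (Ci * CI (fun t => f (a, t)) c d)%C) in *. set (V := (Ci * CI (fun t => f (b, t)) c d)%C) in *.
  pose proof (Cmod_minus_triangle (A + V - B) U). pose proof (Cmod_minus_triangle (A + V) B).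
  pose proof (Cmod_triangle A V). lra.
Qed.

(** Derivative of a quadratic primitive along a side of a rectangle: [dx] is 1 on horizontal sides
    and [Ci] on vertical ones. *)
Lemma Rder_poly2 (p q : C) (x0 : R -> C) (dx : C) (t : R) :
  (forall s t, x0 s - x0 t = dx * RtoC (s - t))%C ->
  Rder (fun s => p * x0 s + q * (x0 s * x0 s))%C t ((p + 2 * q * x0 t) * dx)%C.
Proof.
  intros Hx e He.
  set (K := Cmod (q * dx * dx)). assert (0 <= K) by apply Cmod_ge_0.
  exists (e / (K + 1)). split; [apply Rdiv_lt_0_compat; lra|]. intros s Hs.
  replace (p * x0 s + q * (x0 s * x0 s) - (p * x0 t + q * (x0 t * x0 t)) - (p + 2 * q * x0 t) * dx * (s - t)%R)%C
    with (q * dx * dx * RtoC (s - t) * RtoC (s - t))%C.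
  2:{ assert (E : x0 s = (x0 t + dx * RtoC (s - t))%C) by (rewrite <- Hx; ring). rewrite E. ring. }
  rewrite !Cmod_mult, Cmod_R, <- !Cmod_mult. fold K.
  apply Rmult_le_compat_r; [apply Rabs_pos|].
  apply Rle_trans with ((K + 1) * (e / (K + 1))).
  - apply Rmult_le_compat; try lra; apply Rabs_pos.
  - apply Req_le; field; lra.
Qed.

Lemma Ccont_affine (p q z : C) : Ccont (fun w => p + q * w)%C z.
Proof. apply Ccont_plus; [apply Ccont_const|apply Ccont_mult; [apply Ccont_const|apply Ccont_id]]. Qed.

(** An affine function has a quadratic primitive, whose corner values cancel. This is the part of f
    that Goursat's argument may subtract for free. *)
Lemma rect_int_affine (p q : C) (a b c d : R) :
  rect_int (fun w => p + q * w)%C a b c d = 0%C.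
Proof.
  set (F := fun w : C => (p * w + q / 2 * (w * w))%C).
  assert (Hh : forall y, hint (fun w => p + q * w)%C y a b = (F (b, y) - F (a, y))%C).
  { intros y. unfold hint. apply (CI_FTC (fun t => F (t, y))).
    - intros t _. unfold F.
      replace (p + q * (t, y))%C with ((p + 2 * (q / 2) * (t, y)) * 1)%C by (field; auto).
      apply (Rder_poly2 p (q / 2) (fun t => (t, y)) 1).
      intros; apply injective_projections; simpl; ring.
    - apply (Rcont_on_h (fun w => p + q * w)%C). intros; apply Ccont_affine. }
  assert (Hv : forall x, vint (fun w => p + q * w)%C x c d = (F (x, d) - F (x, c))%C).
  { intros x. unfold vint. rewrite <- CI_scal by (apply (Rcont_on_v (fun w => p + q * w)%C); intros; apply Ccont_affine).
    apply (CI_FTC (fun t => F (x, t))).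
    - intros t _. unfold F.
      replace (Ci * (p + q * (x, t)))%C with ((p + 2 * (q / 2) * (x, t)) * Ci)%C by (field; auto).
      apply (Rder_poly2 p (q / 2) (fun t => (x, t)) Ci).
      intros; apply injective_projections; simpl; ring.
    - intros t _. apply (Rcont_path (fun w => Ci * (p + q * w))%C (fun t => (x, t))); [apply Rcont_v|].
      apply Ccont_mult; [apply Ccont_const|apply Ccont_affine]. }
  unfold rect_int. rewrite !Hh, !Hv. ring.
Qed.

(** The property carried through the bisection is |integral| <= e * (half-perimeter)^2. It survives
    reassembly because each quarter has half the half-perimeter and there are four of them; on small
    rectangles it follows from differentiability once the affine part of f has been subtracted. *)
Theorem goursat (f : C -> C) (a b c d : R) :
  a <= b -> c <= d -> (forall z, in_rect a b c d z -> Cdiff f z) -> rect_int f a b c d = 0%C.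
Proof.
  intros Hab Hcd Hf.
  assert (Hfc : forall z, in_rect a b c d z -> Ccont f z) by (intros; apply Cdiff_cont; auto).
  apply Cmod_eq_0, Rle_antisym; [|apply Cmod_ge_0].
  apply le_epsilon. intros eps Heps. rewrite Rplus_0_l.
  set (w := (b - a) + (d - c) + 1). assert (Hw : 0 < w) by (unfold w; lra).
  set (e := eps / (w * w)). assert (He : 0 < e) by (apply Rdiv_lt_0_compat; nra).
  assert (HQ : Cmod (rect_int f a b c d) <= e * (((b - a) + (d - c)) * ((b - a) + (d - c)))).
  2:{ eapply Rle_trans; [exact HQ|]. replace eps with (e * (w * w)) by (unfold e; field; lra).
      apply Rmult_le_compat_l; [lra|]. unfold w. nra. }
  apply (rect_bisection (fun a b c d =>
    Cmod (rect_int f a b c d) <= e * (((b - a) + (d - c)) * ((b - a) + (d - c))))); auto.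
  - intros a' b' c' d' H1 H2 H3 H4 H5 H6 Q1 Q2 Q3 Q4.
    assert (Hs : forall z, in_rect a' b' c' d' z -> Ccont f z).
    { intros z [? ?]; apply Hfc; split; lra. }
    assert (Hs0 : forall z, on_bd a' b' c' d' z -> Ccont f z) by (intros z [? _]; auto).
    rewrite (rect_split_h f a' ((a' + b') / 2) b' c' d' Hs0) by lra.
    rewrite (rect_split_v f a' ((a' + b') / 2) c' ((c' + d') / 2) d'),
            (rect_split_v f ((a' + b') / 2) b' c' ((c' + d') / 2) d'); try lra.
    2,3: intros z [[? ?] _]; apply Hs; split; lra.
    set (I1 := rect_int f a' ((a' + b') / 2) c' ((c' + d') / 2)) in *.
    set (I2 := rect_int f ((a' + b') / 2) b' c' ((c' + d') / 2)) in *.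
    set (I3 := rect_int f a' ((a' + b') / 2) ((c' + d') / 2) d') in *.
    set (I4 := rect_int f ((a' + b') / 2) b' ((c' + d') / 2) d') in *.
    pose proof (Cmod_triangle (I1 + I3) (I2 + I4)). pose proof (Cmod_triangle I1 I3).
    pose proof (Cmod_triangle I2 I4).
    replace (b' - (a' + b') / 2) with ((b' - a') / 2) in * by field.
    replace ((a' + b') / 2 - a') with ((b' - a') / 2) in * by field.
    replace (d' - (c' + d') / 2) with ((d' - c') / 2) in * by field.
    replace ((c' + d') / 2 - c') with ((d' - c') / 2) in * by field.
    nra.
  - intros z Hz. destruct (Hf z Hz) as [l Hl].
    destruct (Hl (e / 2) ltac:(lra)) as (dl & Hdl & H1).
    exists (dl / 2). split; [lra|]. intros a' b' c' d' h1 h2 h3 h4 Hz' h5 h6.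
    assert (Hs : forall z, in_rect a' b' c' d' z -> Ccont f z).
    { intros z' [? ?]; apply Hfc; split; lra. }
    assert (Hs0 : forall z, on_bd a' b' c' d' z -> Ccont f z) by (intros ? [? _]; auto).
    destruct Hz' as [Hz1 Hz2].
    set (g := fun w => ((f w + (- (f z - l * z) + - l * w)))%C).
    assert (Eg : rect_int f a' b' c' d' = rect_int g a' b' c' d').
    { unfold g. rewrite rect_int_plus; auto; try lra.
      - rewrite rect_int_affine. ring.
      - intros; apply Ccont_affine. }
    rewrite Eg.
    assert (Hsm : forall w, in_rect a' b' c' d' w -> Cmod (w - z) <= (b' - a') + (d' - c')).
    { intros w' [Hw1 Hw2]. eapply Rle_trans; [apply Cmod_Re_Im|].
      apply Rplus_le_compat; apply Rabs_le_between; unfold Re, Im in *; simpl; lra. }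
    eapply Rle_trans; [apply rect_int_bound with (M := e / 2 * ((b' - a') + (d' - c'))); try lra|].
    + intros w' [Hw' _]. unfold g. apply Ccont_plus; [auto|apply Ccont_affine].
    + intros w' [Hw' _]. specialize (Hsm w' Hw'). unfold g.
      replace (f w' + (- (f z - l * z) + - l * w'))%C with (f w' - f z - l * (w' - z))%C by ring.
      eapply Rle_trans; [apply H1; lra|]. apply Rmult_le_compat_l; lra.
    + apply Req_le. field.
Qed.

(** The frame between the two rectangles is cut into four rectangles on which f is holomorphic. *)
Lemma rect_int_shrink (f : C -> C) (a b c d a' b' c' d' : R) :
  a <= a' -> a' <= b' -> b' <= b -> c <= c' -> c' <= d' -> d' <= d ->
  (forall z, in_rect a b c d z -> (Re z <= a' \/ b' <= Re z \/ Im z <= c' \/ d' <= Im z) -> Cdiff f z) ->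
  rect_int f a b c d = rect_int f a' b' c' d'.
Proof.
  intros H1 H2 H3 H4 H5 H6 H.
  assert (Hc : forall z, in_rect a b c d z ->
    (Re z <= a' \/ b' <= Re z \/ Im z <= c' \/ d' <= Im z) -> Ccont f z).
  { intros; apply Cdiff_cont; auto. }
  rewrite (rect_split_h f a a' b), (rect_split_h f a' b' b), (rect_split_v f a' b' c c' d),
    (rect_split_v f a' b' c' d' d); try lra.
  2-5: intros z [[? ?] ?]; apply Hc; [split; lra|lra].
  rewrite (goursat f a a'), (goursat f b' b), (goursat f a' b' c c'), (goursat f a' b' d' d); try lra.
  2-5: intros z [? ?]; apply H; [split; lra|lra].
  ring.
Qed.

Lemma on_bd_square_dist (x0 y0 r : R) (z : C) :
  0 < r -> on_bd (x0 - r) (x0 + r) (y0 - r) (y0 + r) z ->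
  r <= Cmod (z - (x0, y0)) <= 2 * r.
Proof.
  intros Hr [[H1 H2] H3].
  pose proof (Rabs_Re_le (z - (x0, y0))) as HR. pose proof (Rabs_Im_le (z - (x0, y0))) as HI.
  unfold Re, Im in *. simpl in *. split.
  - revert HR HI. unfold Rabs. destruct (Rcase_abs _), (Rcase_abs _); intros; lra.
  - eapply Rle_trans; [apply Cmod_Re_Im|]. unfold Re, Im; simpl.
    unfold Rabs. destruct (Rcase_abs _), (Rcase_abs _); lra.
Qed.

Lemma RInt_arctan_square (r : R) : 0 < r ->
  is_RInt (fun t => r / (r * r + t * t)) (- r) r (PI / 2).
Proof.
  intros Hr.
  replace (PI / 2) with (minus (atan (r / r)) (atan (- r / r))).
  2:{ replace (r / r) with 1 by (field; lra). replace (- r / r) with (Ropp 1) by (field; lra).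
      rewrite atan_opp, atan_1. unfold minus, plus, opp; simpl. field. }
  apply (is_RInt_derive (fun t => atan (t / r)) (fun t => r / (r * r + t * t))).
  - intros x _. auto_derive; [auto|]. unfold Rsqr. field. split; nra.
  - intros x _. apply (ex_derive_continuous (V := R_NormedModule)). auto_derive. nra.
Qed.

Lemma RInt_odd_square (r : R) : 0 < r ->
  is_RInt (fun t => t / (r * r + t * t)) (- r) r 0.
Proof.
  intros Hr.
  replace 0 with (minus (ln (r * r + r * r) / 2) (ln (r * r + (- r) * (- r)) / 2)).
  2:{ replace (- r * - r) with (r * r) by ring. unfold minus, plus, opp; simpl. field. }
  apply (is_RInt_derive (fun t => ln (r * r + t * t) / 2) (fun t => t / (r * r + t * t))).
  - intros x _. auto_derive; [nra|]. field. nra.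
  - intros x _. apply (ex_derive_continuous (V := R_NormedModule)). auto_derive. nra.
Qed.

(** On a square centred at the pole each side contributes i * pi/2 through an arctangent, and the
    logarithmic parts are odd, hence vanish. *)
Lemma rect_int_inv (x0 y0 r : R) : 0 < r ->
  rect_int (fun z => / (z - (x0, y0)))%C (x0 - r) (x0 + r) (y0 - r) (y0 + r)
  = (RtoC (2 * PI) * Ci)%C.
Proof.
  intros Hr.
  assert (Hshift : forall g : R -> C, forall m l, Rcont_on g (m - r) (m + r) ->
     is_RInt (V := C_R_NormedModule) (fun t => g (t + m)) (- r) r l -> CI g (m - r) (m + r) = l).
  { intros g m l Hg Hl. apply CI_unique in Hl. rewrite CI_shift in Hl.
    - replace (m - r) with (- r + m) by ring. replace (m + r) with (r + m) by ring. exact Hl.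
    - replace (- r + m) with (m - r) by ring. replace (r + m) with (m + r) by ring. exact Hg. }
  assert (Hcont : forall z, on_bd (x0 - r) (x0 + r) (y0 - r) (y0 + r) z ->
     Ccont (fun z => / (z - (x0, y0)))%C z).
  { intros z Hz. apply on_bd_square_dist in Hz; auto.
    apply Ccont_inv.
    - apply Ccont_plus; [apply Ccont_id|apply Ccont_const].
    - apply Cmod_gt_0. lra. }
  pose proof (RInt_arctan_square r Hr) as HA. pose proof (RInt_odd_square r Hr) as HB.
  assert (HB' : is_RInt (fun t => - (t / (r * r + t * t))) (- r) r (- 0)) by
    apply (is_RInt_opp (V := R_NormedModule)), HB.
  assert (HA' : is_RInt (fun t => - (r / (r * r + t * t))) (- r) r (- (PI / 2))) by
    apply (is_RInt_opp (V := R_NormedModule)), HA.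
  rewrite Ropp_0 in HB'.
  assert (Bot : hint (fun z => / (z - (x0, y0)))%C (y0 - r) (x0 - r) (x0 + r) = (0, PI / 2)).
  { unfold hint. apply Hshift; [eapply (rect_h (fun z => / (z - (x0, y0)))%C); [exact Hcont|..]; lra|].
    eapply is_RInt_ext;
     [|apply (is_RInt_fct_extend_pair (U := R_NormedModule) (V := R_NormedModule)
        (fun t => (t / (r * r + t * t), r / (r * r + t * t)))); [exact HB|exact HA]].
    intros t _. simpl. apply injective_projections; simpl; field; nra. }
  assert (Top : hint (fun z => / (z - (x0, y0)))%C (y0 + r) (x0 - r) (x0 + r) = (0, - (PI / 2))).
  { unfold hint. apply Hshift; [eapply (rect_h (fun z => / (z - (x0, y0)))%C); [exact Hcont|..]; lra|].
    eapply is_RInt_ext;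
     [|apply (is_RInt_fct_extend_pair (U := R_NormedModule) (V := R_NormedModule)
        (fun t => (t / (r * r + t * t), - (r / (r * r + t * t))))); [exact HB|exact HA']].
    intros t _. simpl. apply injective_projections; simpl; field; nra. }
  assert (Rig : vint (fun z => / (z - (x0, y0)))%C (x0 + r) (y0 - r) (y0 + r) = (Ci * RtoC (PI / 2))%C).
  { unfold vint. f_equal. unfold RtoC. apply Hshift; [eapply (rect_v (fun z => / (z - (x0, y0)))%C); [exact Hcont|..]; lra|].
    eapply is_RInt_ext;
     [|apply (is_RInt_fct_extend_pair (U := R_NormedModule) (V := R_NormedModule)
        (fun t => (r / (r * r + t * t), - (t / (r * r + t * t))))); [exact HA|exact HB']].
    intros t _. simpl. apply injective_projections; simpl; field; nra. }
  assert (Lef : vint (fun z => / (z - (x0, y0)))%C (x0 - r) (y0 - r) (y0 + r) = (Ci * RtoC (- (PI / 2)))%C).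
  { unfold vint. f_equal. unfold RtoC. apply Hshift; [eapply (rect_v (fun z => / (z - (x0, y0)))%C); [exact Hcont|..]; lra|].
    eapply is_RInt_ext;
     [|apply (is_RInt_fct_extend_pair (U := R_NormedModule) (V := R_NormedModule)
        (fun t => (- (r / (r * r + t * t)), - (t / (r * r + t * t))))); [exact HA'|exact HB']].
    intros t _. simpl. apply injective_projections; simpl; field; nra. }
  unfold rect_int. rewrite Bot, Top, Rig, Lef.
  apply injective_projections; simpl; field.
Qed.

Theorem residue_rect (f : C -> C) (k : C) (a b c d x0 y0 : R) :
  a < x0 < b -> c < y0 < d ->
  (forall z, in_rect a b c d z -> z <> (x0, y0) -> Cdiff f z) ->
  (forall eps, 0 < eps -> exists dl, 0 < dl /\ forall z, z <> (x0, y0) ->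
     Cmod (z - (x0, y0)) < dl -> Cmod ((z - (x0, y0)) * f z - k) <= eps) ->
  rect_int f a b c d = (RtoC (2 * PI) * Ci * k)%C.
Proof.
  intros Hx Hy Hf Hk. apply Cmod_eq_minus0, Rle_antisym; [|apply Cmod_ge_0].
  apply le_epsilon. intros eps Heps. rewrite Rplus_0_l.
  (* The small square of half-side r has perimeter 8 r, while the error in f - k / (z - z0) is at
     most (eps / 8) / r on it. *)
  destruct (Hk (eps / 8) ltac:(lra)) as (dl & Hdl & H).
  set (r := Rmin (dl / 4) (Rmin (Rmin (x0 - a) (b - x0)) (Rmin (y0 - c) (d - y0)))).
  assert (Hr : 0 < r).
  { unfold r. repeat apply Rmin_pos; lra. }
  assert (Hr2 : r <= dl / 4 /\ r <= x0 - a /\ r <= b - x0 /\ r <= y0 - c /\ r <= d - y0).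
  { unfold r. set (A := Rmin (x0 - a) (b - x0)). set (B := Rmin (y0 - c) (d - y0)).
    pose proof (Rmin_l (dl / 4) (Rmin A B)). pose proof (Rmin_r (dl / 4) (Rmin A B)).
    pose proof (Rmin_l A B). pose proof (Rmin_r A B).
    pose proof (Rmin_l (x0 - a) (b - x0)). pose proof (Rmin_r (x0 - a) (b - x0)).
    pose proof (Rmin_l (y0 - c) (d - y0)). pose proof (Rmin_r (y0 - c) (d - y0)).
    fold A in H4, H5. fold B in H6, H7. lra. }
  rewrite (rect_int_shrink f a b c d (x0 - r) (x0 + r) (y0 - r) (y0 + r)); try lra.
  2:{ intros z Hz Hz2. apply Hf; auto. intros ->. simpl in Hz2. lra. }
  set (B := on_bd (x0 - r) (x0 + r) (y0 - r) (y0 + r)).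
  assert (Hb : forall z, B z -> z <> (x0, y0)).
  { intros z Hz ->. apply on_bd_square_dist in Hz; auto. rewrite Cminus_diag_mod in Hz. lra. }
  assert (Hinv : forall z, B z -> Ccont (fun z => / (z - (x0, y0)))%C z).
  { intros z Hz. apply on_bd_square_dist in Hz; auto.
    apply Ccont_inv; [apply Ccont_plus; [apply Ccont_id|apply Ccont_const]|apply Cmod_gt_0; lra]. }
  assert (Hfc : forall z, B z -> Ccont f z).
  { intros z Hz. apply Cdiff_cont, Hf; [|apply Hb, Hz].
    destruct Hz as [[? ?] _]; split; lra. }
  rewrite <- (rect_int_inv x0 y0 r Hr).
  set (I := rect_int (fun z => / (z - (x0, y0)))%C (x0 - r) (x0 + r) (y0 - r) (y0 + r)).
  replace (rect_int f (x0 - r) (x0 + r) (y0 - r) (y0 + r) - I * k)%C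
   with (rect_int (fun z => f z + - k * / (z - (x0, y0)))%C (x0 - r) (x0 + r) (y0 - r) (y0 + r)).
  2:{ rewrite rect_int_plus; try lra; auto.
      - rewrite rect_int_scal; try lra; auto. fold I. ring.
      - intros z Hz. apply Ccont_mult; [apply Ccont_const|auto]. }
  eapply Rle_trans; [apply rect_int_bound with (M := eps / 8 / r); try lra|].
  - intros z Hz. apply Ccont_plus; [auto|apply Ccont_mult; [apply Ccont_const|auto]].
  - intros z Hz. pose proof (Hb z Hz) as Hn. pose proof (on_bd_square_dist _ _ _ _ Hr Hz) as Hd.
    specialize (H z Hn ltac:(lra)).
    assert (Hz0 : (z - (x0, y0))%C <> 0%C) by (apply Cmod_gt_0; lra).
    replace (f z + - k * / (z - (x0, y0)))%C
      with (((z - (x0, y0)) * f z - k) / (z - (x0, y0)))%C by (field; auto).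
    rewrite Cmod_div by auto.
    apply Rle_div_l; [lra|]. eapply Rle_trans; [exact H|].
    replace (eps / 8 / r * Cmod (z - (x0, y0))) with (eps / 8 * (Cmod (z - (x0, y0)) / r)) by (field; lra).
    rewrite <- (Rmult_1_r (eps / 8)) at 1. apply Rmult_le_compat_l; [lra|].
    apply Rle_div_r; lra.
  - apply Req_le. field. lra.
Qed.

(** Compactness through bisection: local bounds come from continuity and four bounds are glued by
    their sum. *)
Lemma bounded_on_rect (f : C -> C) (a b c d : R) :
  a <= b -> c <= d -> (forall z, in_rect a b c d z -> Ccont f z) ->
  exists M, 0 < M /\ forall z, in_rect a b c d z -> Cmod (f z) <= M.
Proof.
  intros Hab Hcd H.
  apply (rect_bisection (fun a b c d =>
    exists M, 0 < M /\ forall z, in_rect a b c d z -> Cmod (f z) <= M)); auto.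
  - intros a' b' c' d' _ _ _ _ _ _ (M1 & P1 & H1) (M2 & P2 & H2) (M3 & P3 & H3) (M4 & P4 & H4).
    exists (M1 + M2 + M3 + M4). split; [lra|]. intros z [Hz1 Hz2].
    destruct (Rle_dec (Re z) ((a' + b') / 2)), (Rle_dec (Im z) ((c' + d') / 2)).
    + specialize (H1 z ltac:(split; lra)). lra.
    + specialize (H3 z ltac:(split; lra)). lra.
    + specialize (H2 z ltac:(split; lra)). lra.
    + specialize (H4 z ltac:(split; lra)). lra.
  - intros z Hz. destruct (H z Hz 1 ltac:(lra)) as (e & He & H1).
    exists (e / 2). split; [lra|]. intros a' b' c' d' _ _ _ _ [Hz1 Hz2] h1 h2.
    exists (Cmod (f z) + 1). split; [pose proof (Cmod_ge_0 (f z)); lra|].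
    intros w [Hw1 Hw2].
    assert (Hwz : Cmod (w - z) < e).
    { eapply Rle_lt_trans; [apply Cmod_Re_Im|].
      assert (Rabs (Re (w - z)) <= b' - a') by (apply Rabs_le_between; unfold Re in *; simpl; lra).
      assert (Rabs (Im (w - z)) <= d' - c') by (apply Rabs_le_between; unfold Im in *; simpl; lra).
      lra. }
    specialize (H1 w Hwz). pose proof (Cmod_triangle_rev (f w) (f z)). lra.
Qed.

(** * Cauchy's formula and locally uniform limits of holomorphic functions *)

Definition in_square (z0 : C) (r : R) : C -> Prop :=
  in_rect (Re z0 - r) (Re z0 + r) (Im z0 - r) (Im z0 + r).

Definition square_int (f : C -> C) (z0 : C) (r : R) : C :=
  rect_int f (Re z0 - r) (Re z0 + r) (Im z0 - r) (Im z0 + r).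

(** The consequence of holomorphy that visibly passes to uniform limits and still implies
    differentiability, by [cauchy_strong]. The formula is asked on the inscribed disc, the integral
    is over the square. *)
Definition cauchy_repr (f : C -> C) (z0 : C) (r : R) : Prop :=
  (forall z, in_square z0 r z -> Ccont f z) /\
  forall u, Cmod (u - z0) < r ->
    square_int (fun w => f w / (w - u))%C z0 r = (RtoC (2 * PI) * Ci * f u)%C.

Lemma twoPiI_neq_0 : (RtoC (2 * PI) * Ci)%C <> 0%C.
Proof.
  intros H. apply (f_equal snd) in H. simpl in H. pose proof PI_RGT_0. lra.
Qed.

Lemma Cmod_twoPiI : Cmod (RtoC (2 * PI) * Ci) = 2 * PI.
Proof. pose proof PI_RGT_0. rewrite Cmod_mult, Cmod_Ci, Cmod_RtoC_pos; lra. Qed.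

Lemma cauchy_formula (f : C -> C) (z0 : C) (r : R) :
  0 < r -> (forall z, in_square z0 r z -> Cdiff f z) -> cauchy_repr f z0 r.
Proof.
  intros Hr Hf. split; [intros; apply Cdiff_cont; auto|].
  intros u Hu. destruct u as [x0 y0].
  pose proof (Rabs_Re_le ((x0, y0) - z0)) as HR. pose proof (Rabs_Im_le ((x0, y0) - z0)) as HI.
  assert (HR' : Rabs (Re ((x0, y0) - z0)%C) < r) by lra.
  assert (HI' : Rabs (Im ((x0, y0) - z0)%C) < r) by lra.
  apply Rabs_lt_between in HR'. apply Rabs_lt_between in HI'.
  unfold square_int. unfold Re, Im in *. simpl in HR', HI'.
  assert (Hin : in_square z0 r (x0, y0)) by (split; unfold Re, Im; simpl; lra).
  apply residue_rect with x0 y0; try lra.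
  - intros z Hz Hn. apply Cdiff_div; [apply Hf; auto| |].
    + apply Cdiff_minus; [apply Cdiff_id|apply Cdiff_const].
    + intros E. apply Hn, Cmod_eq_minus0. rewrite E; apply Cmod_0.
  - intros eps He. destruct (Cdiff_cont _ _ (Hf _ Hin) eps He) as (d & Hd & H).
    exists d. split; auto. intros z Hz Hdz. left.
    replace ((z - (x0, y0)) * (f z / (z - (x0, y0))) - f (x0, y0))%C with (f z - f (x0, y0))%C; [auto|].
    field. intros E. apply Hz, Cmod_eq_minus0. rewrite E; apply Cmod_0.
Qed.

Lemma on_bd_square (z0 : C) (r : R) (w : C) :
  0 < r -> on_bd (Re z0 - r) (Re z0 + r) (Im z0 - r) (Im z0 + r) w ->
  r <= Cmod (w - z0) <= 2 * r.
Proof. destruct z0 as [x y]. apply on_bd_square_dist. Qed.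

Lemma Ccont_div_sub (f : C -> C) (u w : C) :
  Ccont f w -> (w - u)%C <> 0%C -> Ccont (fun w => f w / (w - u))%C w.
Proof.
  intros. apply Ccont_mult; auto. apply Ccont_inv; auto.
  apply Ccont_plus; [apply Ccont_id|apply Ccont_const].
Qed.

(** A two-point derivative with quadratic error, which is what the linearisation at the repelling
    fixed point consumes. Combining the three Cauchy kernels leaves the numerator (h - k) ((w - z0)
    (h + k) - h k) over (w - z0 - h) (w - z0 - k) (w - z0)^2. The constant is this integrand bound,
    12 M / r^3, times the perimeter 8 r, divided by 2 pi. *)
Lemma cauchy_strong (f : C -> C) (z0 : C) (r : R) :
  0 < r -> cauchy_repr f z0 r ->
  exists (l : C) (K : R), 0 < K /\ forall h k, Cmod h <= r / 2 -> Cmod k <= r / 2 ->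
    Cmod (f (z0 + h) - f (z0 + k) - l * (h - k))%C <= K * Cmod (h - k) * (Cmod h + Cmod k).
Proof.
  intros Hr [Hc HF].
  destruct (bounded_on_rect f (Re z0 - r) (Re z0 + r) (Im z0 - r) (Im z0 + r)) as (M & HM & HMf);
    [lra|lra|exact Hc|].
  set (T := (RtoC (2 * PI) * Ci)%C).
  assert (HT : T <> 0%C) by apply twoPiI_neq_0.
  set (l := (square_int (fun w => f w / (w - z0) / (w - z0))%C z0 r / T)%C).
  exists l, (12 * M / (r * r * r) * (8 * r) / (2 * PI)).
  pose proof PI_RGT_0 as HPI.
  assert (Hr3 : 0 < r * r * r) by (repeat apply Rmult_lt_0_compat; auto).
  split.
  { apply Rdiv_lt_0_compat; [|lra]. apply Rmult_lt_0_compat; [|lra]. apply Rdiv_lt_0_compat; lra. }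
  intros h k Hh Hk.
  set (B := on_bd (Re z0 - r) (Re z0 + r) (Im z0 - r) (Im z0 + r)).
  assert (HB : forall w, B w -> Ccont f w) by (intros w [Hw _]; apply Hc; auto).
  assert (Hd : forall w u, B w -> Cmod u <= r / 2 -> r / 2 <= Cmod (w - (z0 + u))).
  { intros w u Hw Hu. pose proof (on_bd_square _ _ _ Hr Hw).
    pose proof (Cmod_triangle_rev (w - z0) u).
    replace (w - (z0 + u))%C with (w - z0 - u)%C by ring. lra. }
  assert (Hn : forall w u, B w -> Cmod u <= r / 2 -> (w - (z0 + u))%C <> 0%C).
  { intros w u Hw Hu. apply Cmod_gt_0. specialize (Hd w u Hw Hu). lra. }
  assert (Hn0 : forall w, B w -> (w - z0)%C <> 0%C).
  { intros w Hw. apply Cmod_gt_0. pose proof (on_bd_square _ _ _ Hr Hw). lra. }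
  assert (HFu : forall u, Cmod u <= r / 2 -> f (z0 + u)%C = (square_int (fun w => f w / (w - (z0 + u)))%C z0 r / T)%C).
  { intros u Hu. rewrite HF; [fold T; field; exact HT|].
    replace (z0 + u - z0)%C with u by ring. lra. }
  rewrite (HFu h Hh), (HFu k Hk). unfold l.
  set (G := fun w => (f w / (w - (z0 + h)) + (- (1) * (f w / (w - (z0 + k))) + - (h - k) * (f w / (w - z0) / (w - z0))))%C).
  assert (EG : (square_int (fun w => f w / (w - (z0 + h))) z0 r / T - square_int (fun w => f w / (w - (z0 + k))) z0 r / T -
     square_int (fun w => f w / (w - z0) / (w - z0)) z0 r / T * (h - k))%C = (square_int G z0 r / T)%C).
  { unfold G, square_int.
    rewrite !rect_int_plus, !rect_int_scal; try lra; try (field; exact HT).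
    all: intros w Hw.
    all: repeat (first [apply Ccont_plus | apply (Ccont_mult (fun _ => _)); [apply Ccont_const|]]).
    all: repeat (apply Ccont_div_sub; auto). }
  rewrite EG. rewrite Cmod_div by exact HT. unfold T. rewrite Cmod_twoPiI.
  apply Rle_div_l; [lra|].
  assert (HGc : forall w, B w -> Ccont G w).
  { intros w Hw. unfold G.
    repeat (first [apply Ccont_plus | apply (Ccont_mult (fun _ => _)); [apply Ccont_const|]]);
    repeat (apply Ccont_div_sub; auto). }
  eapply Rle_trans.
  { apply (rect_int_bound G) with (M := 12 * M / (r * r * r) * (Cmod (h - k) * (Cmod h + Cmod k))); [exact HGc|lra|lra|].
    intros w Hw. fold B in Hw.
    pose proof (on_bd_square _ _ _ Hr Hw) as Hw0.
    pose proof (Hd w h Hw Hh) as Hwh. pose proof (Hd w k Hw Hk) as Hwk.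
    assert (HMw : Cmod (f w) <= M) by (apply HMf; destruct Hw; auto).
    unfold G.
    replace (f w / (w - (z0 + h)) + (- (1) * (f w / (w - (z0 + k))) + - (h - k) * (f w / (w - z0) / (w - z0))))%C
      with (f w * ((h - k) * ((w - z0) * (h + k) - h * k)) /
        ((w - (z0 + h)) * (w - (z0 + k)) * ((w - z0) * (w - z0))))%C by (field; auto).
    rewrite Cmod_div by (repeat apply Cmult_neq_0; auto).
    rewrite !Cmod_mult.
    set (hk := Cmod (h - k)). set (X := Cmod (w - z0)) in *.
    assert (Hnum : Cmod ((w - z0) * (h + k) - h * k) <= 3 * r * (Cmod h + Cmod k)).
    { eapply Rle_trans; [apply Cmod_minus_triangle|]. rewrite !Cmod_mult. fold X.
      pose proof (Cmod_triangle h k). pose proof (Cmod_ge_0 h). pose proof (Cmod_ge_0 k).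
      pose proof (Cmod_ge_0 (h + k)).
      assert (X * Cmod (h + k) <= 2 * r * (Cmod h + Cmod k)) by (apply Rmult_le_compat; lra).
      assert (Cmod h * Cmod k <= r * Cmod k) by (apply Rmult_le_compat_r; lra). nra. }
    assert (Hden : r * r * r * r / 4 <= Cmod (w - (z0 + h)) * Cmod (w - (z0 + k)) * (X * X)).
    { replace (r * r * r * r / 4) with (r / 2 * (r / 2) * (r * r)) by field.
      apply Rmult_le_compat; try nra. }
    apply Rle_div_l; [nra|].
    assert (Hhk : 0 <= hk) by apply Cmod_ge_0.
    pose proof (Cmod_ge_0 h). pose proof (Cmod_ge_0 k).
    set (S := Cmod h + Cmod k) in *. assert (HS : 0 <= S) by (unfold S; lra).
    pose proof (Cmod_ge_0 (f w)). pose proof (Cmod_ge_0 ((w - z0) * (h + k) - h * k)).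
    apply Rle_trans with (M * (hk * (3 * r * S))).
    { apply Rmult_le_compat; [auto|apply Rmult_le_pos; auto|auto|apply Rmult_le_compat_l; auto]. }
    apply Rle_trans with (12 * M / (r * r * r) * (hk * S) * (r * r * r * r / 4)).
    { apply Req_le. field. lra. }
    apply Rmult_le_compat_l; auto.
    apply Rmult_le_pos; [|apply Rmult_le_pos; auto]. apply Rlt_le, Rdiv_lt_0_compat; lra. }
  apply Req_le. field. split; lra.
Qed.

Lemma strong_is_Cder (f : C -> C) (z0 l : C) (r K : R) :
  0 < r -> 0 < K -> (forall h k, Cmod h <= r -> Cmod k <= r ->
    Cmod (f (z0 + h) - f (z0 + k) - l * (h - k))%C <= K * Cmod (h - k) * (Cmod h + Cmod k)) ->
  is_Cder f z0 l.
Proof.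
  intros Hr HK H e He.
  exists (Rmin r (e / K)). split; [apply Rmin_pos; auto; apply Rdiv_lt_0_compat; auto|].
  intros w Hw. pose proof (Rmin_l r (e / K)). pose proof (Rmin_r r (e / K)).
  specialize (H (w - z0)%C 0%C ltac:(lra) ltac:(rewrite Cmod_0; lra)).
  replace (z0 + (w - z0))%C with w in H by ring. rewrite Cplus_0_r, Cmod_0 in H.
  replace (w - z0 - 0)%C with (w - z0)%C in H by ring.
  eapply Rle_trans; [exact H|].
  rewrite Rplus_0_r. rewrite (Rmult_comm K), Rmult_assoc, Rmult_comm.
  apply Rmult_le_compat_r; [apply Cmod_ge_0|].
  apply Rle_trans with (K * (e / K)); [apply Rmult_le_compat_l; lra|].
  apply Req_le; field; lra.
Qed.

Lemma uniform_limit_cont (fn : nat -> C -> C) (f : C -> C) (z0 : C) (R0 : R) :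
  (forall n z, Cmod (z - z0) < R0 -> Ccont (fn n) z) ->
  (forall eps, 0 < eps -> exists n, forall z, Cmod (z - z0) < R0 -> Cmod (fn n z - f z) <= eps) ->
  forall z, Cmod (z - z0) < R0 -> Ccont f z.
Proof.
  intros H1 H2 z Hz e He.
  destruct (H2 (e / 4) ltac:(lra)) as [n Hn].
  destruct (H1 n z Hz (e / 4) ltac:(lra)) as (d & Hd & Hdn).
  exists (Rmin d (R0 - Cmod (z - z0))). split; [apply Rmin_pos; lra|].
  intros w Hw. pose proof (Rmin_l d (R0 - Cmod (z - z0))). pose proof (Rmin_r d (R0 - Cmod (z - z0))).
  assert (Hw0 : Cmod (w - z0) < R0) by (pose proof (Cmod_minus_trans w z z0); lra).
  pose proof (Hn w Hw0). pose proof (Hn z Hz). specialize (Hdn w ltac:(lra)).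
  replace (f w - f z)%C with (- (fn n w - f w) + ((fn n w - fn n z) + (fn n z - f z)))%C by ring.
  pose proof (Cmod_triangle (- (fn n w - f w)) ((fn n w - fn n z) + (fn n z - f z))) as T1.
  pose proof (Cmod_triangle (fn n w - fn n z) (fn n z - f z)) as T2.
  rewrite Cmod_opp in T1. lra.
Qed.

Lemma in_square_Cmod (z0 : C) (r : R) (w : C) : in_square z0 r w -> Cmod (w - z0) <= 2 * r.
Proof.
  intros [H1 H2]. eapply Rle_trans; [apply Cmod_Re_Im|].
  assert (Rabs (Re (w - z0)) <= r) by (apply Rabs_le_between; unfold Re in *; simpl; lra).
  assert (Rabs (Im (w - z0)) <= r) by (apply Rabs_le_between; unfold Im in *; simpl; lra).
  lra.
Qed.

(** Cauchy's formula for [fn n] passes to the limit because 1 / (w - u) is bounded on the boundary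
    of the square; differentiability at the centre then comes from the formula. One good index per
    eps is all that is asked. *)
Theorem weierstrass (fn : nat -> C -> C) (f : C -> C) (z0 : C) (R0 : R) :
  0 < R0 ->
  (forall n z, Cmod (z - z0) < R0 -> Cdiff (fn n) z) ->
  (forall eps, 0 < eps -> exists n, forall z, Cmod (z - z0) < R0 -> Cmod (fn n z - f z) <= eps) ->
  Cdiff f z0.
Proof.
  intros HR H1 H2.
  assert (Hc : forall z, Cmod (z - z0) < R0 -> Ccont f z).
  { apply (uniform_limit_cont fn); auto. intros; apply Cdiff_cont; auto. }
  set (r := R0 / 4). assert (Hr : 0 < r) by (unfold r; lra).
  assert (Hsq : forall w, in_square z0 r w -> Cmod (w - z0) < R0).
  { intros w Hw. apply in_square_Cmod in Hw. unfold r in Hw. lra. }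
  assert (HC : cauchy_repr f z0 r).
  { split; [intros; apply Hc; auto|]. intros u Hu.
    apply Cmod_eq_minus0, Rle_antisym; [|apply Cmod_ge_0].
    apply le_epsilon. intros eps Heps. rewrite Rplus_0_l.
    set (dd := r - Cmod (u - z0)). assert (Hdd : 0 < dd) by (unfold dd; lra).
    pose proof PI_RGT_0.
    (* Total weight of the two errors: perimeter over distance to the boundary for the integral, and
       2 pi for the value at u. *)
    set (q := 8 * r / dd + 2 * PI + 1). assert (Hq : 0 < q).
    { unfold q. assert (0 < 8 * r / dd) by (apply Rdiv_lt_0_compat; lra). lra. }
    destruct (H2 (eps / q)) as [n Hn]; [apply Rdiv_lt_0_compat; lra|].
    assert (Heq : 0 < eps / q) by (apply Rdiv_lt_0_compat; lra).
    destruct (cauchy_formula (fn n) z0 r Hr) as [_ HFn]; [intros; apply H1; auto|].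
    specialize (HFn u Hu).
    set (B := on_bd (Re z0 - r) (Re z0 + r) (Im z0 - r) (Im z0 + r)).
    assert (Hd : forall w, B w -> dd <= Cmod (w - u)).
    { intros w Hw. pose proof (on_bd_square _ _ _ Hr Hw).
      pose proof (Cmod_minus_trans w u z0). unfold dd. lra. }
    assert (HB : forall w, B w -> Ccont f w /\ Ccont (fn n) w /\ (w - u)%C <> 0%C).
    { intros w Hw. assert (in_square z0 r w) by (destruct Hw; auto).
      repeat split; [apply Hc; auto|apply Cdiff_cont, H1; auto|].
      apply Cmod_gt_0. specialize (Hd w Hw). lra. }
    replace (square_int (fun w => f w / (w - u)) z0 r - RtoC (2 * PI) * Ci * f u)%C
      with (square_int (fun w => f w / (w - u) + - (1) * (fn n w / (w - u)))%C z0 r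
            + RtoC (2 * PI) * Ci * (fn n u - f u))%C.
    2:{ unfold square_int in *. rewrite rect_int_plus, rect_int_scal; try lra.
        - rewrite HFn. ring.
        - intros w Hw. destruct (HB w Hw) as (h1 & h2 & h3). apply Ccont_div_sub; auto.
        - intros w Hw. destruct (HB w Hw) as (h1 & h2 & h3). apply Ccont_div_sub; auto.
        - intros w Hw. destruct (HB w Hw) as (h1 & h2 & h3).
          apply Ccont_mult; [apply Ccont_const|apply Ccont_div_sub; auto]. }
    eapply Rle_trans; [apply Cmod_triangle|].
    rewrite (Cmod_mult (RtoC (2 * PI) * Ci)), Cmod_twoPiI.
    assert (HI : Cmod (square_int (fun w => f w / (w - u) + - (1) * (fn n w / (w - u)))%C z0 r)
        <= 8 * r / dd * (eps / q)).
    { unfold square_int. eapply Rle_trans.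
      - apply rect_int_bound with (M := eps / q / dd); try lra.
        + intros w Hw. destruct (HB w Hw) as (h1 & h2 & h3).
          apply Ccont_plus; [|apply Ccont_mult; [apply Ccont_const|]]; apply Ccont_div_sub; auto.
        + intros w Hw. destruct (HB w Hw) as (h1 & h2 & h3).
          replace (f w / (w - u) + - (1) * (fn n w / (w - u)))%C with ((f w - fn n w) / (w - u))%C by (field; auto).
          rewrite Cmod_div, Cmod_minus_sym by auto. specialize (Hd w Hw).
          specialize (Hn w (Hsq w (proj1 Hw))).
          apply Rle_div_l; [lra|]. eapply Rle_trans; [exact Hn|].
          replace (eps / q / dd * Cmod (w - u)) with (eps / q * (Cmod (w - u) / dd)) by (field; lra).
          rewrite <- (Rmult_1_r (eps / q)) at 1. apply Rmult_le_compat_l; [lra|]. apply Rle_div_r; lra.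
      - apply Req_le. field. lra. }
    assert (HI2 : 2 * PI * Cmod (fn n u - f u) <= 2 * PI * (eps / q)).
    { apply Rmult_le_compat_l; [lra|]. apply Hn. unfold r in *. lra. }
    apply Rle_trans with (q * (eps / q)); [unfold q at 1; nra|]. apply Req_le; field; lra. }
  destruct (cauchy_strong f z0 r Hr HC) as (l & K & HK & H).
  exists l. apply (strong_is_Cder f z0 l (r / 2) K); auto. lra.
Qed.

(** * Fourier expansion of periodic functions in a strip *)

Lemma Cexp_eq_1 (z : C) : Cexp z = 1%C -> Rabs (Im z) < 2 * PI -> z = 0%C.
Proof.
  intros H Hz. pose proof PI_RGT_0.
  assert (HR : Re z = 0).
  { pose proof (Cmod_Cexp z) as H1. rewrite H, Cmod_1 in H1. apply exp_inv. rewrite exp_0. auto. }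
  assert (HI : Im z = 0).
  { unfold Cexp in H. rewrite HR, exp_0 in H. apply (f_equal fst) in H. simpl in H.
    assert (Hs : sin (Im z / 2) = 0).
    { replace (Im z) with (2 * (Im z / 2)) in H by field. rewrite cos_2a_sin in H.
      apply Rsqr_0_uniq. unfold Rsqr. lra. }
    apply Rabs_lt_between in Hz.
    destruct (Rtotal_order (Im z) 0) as [h|[h|h]]; auto.
    - pose proof (sin_gt_0 (- (Im z / 2)) ltac:(lra) ltac:(lra)) as H2. rewrite sin_neg in H2. lra.
    - pose proof (sin_gt_0 (Im z / 2) ltac:(lra) ltac:(lra)). lra. }
  destruct z; unfold Re, Im in *; simpl in *; subst; auto.
Qed.

(** At a simple zero, g equals (z - z0) times its continuous slope, so (z - z0) f / g is f over the
    slope, with limit f (z0) / k. *)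
Lemma residue_quotient (f g : C -> C) (k : C) (a b c d x0 y0 : R) :
  a < x0 < b -> c < y0 < d -> k <> 0%C ->
  (forall z, in_rect a b c d z -> Cdiff f z) ->
  (forall z, in_rect a b c d z -> Cdiff g z) ->
  (forall z, in_rect a b c d z -> z <> (x0, y0) -> g z <> 0%C) ->
  g (x0, y0) = 0%C -> is_Cder g (x0, y0) k ->
  rect_int (fun z => f z / g z)%C a b c d = (RtoC (2 * PI) * Ci * (f (x0, y0) / k))%C.
Proof.
  intros Hx Hy Hk Hf Hg Hn Hg0 Hgk.
  assert (Hin : in_rect a b c d (x0, y0)) by (split; simpl; lra).
  apply residue_rect with x0 y0; auto.
  - intros z Hz Hz0. apply Cdiff_div; auto.
  - intros eps He. apply is_Cder_slope in Hgk. destruct Hgk as (q & Hq & Hqc & Hgq).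
    assert (Hc : Ccont (fun w => f w * / q w)%C (x0, y0)).
    { apply Ccont_mult; [apply Cdiff_cont; auto|]. apply Ccont_inv; auto. congruence. }
    destruct (Hc eps He) as (d1 & Hd1 & H1).
    destruct (Hqc (Cmod k)) as (d2 & Hd2 & H2); [apply Cmod_gt_0; auto|].
    exists (Rmin d1 d2). split; [apply Rmin_pos; auto|]. intros z Hz Hd.
    pose proof (Rmin_l d1 d2). pose proof (Rmin_r d1 d2).
    specialize (H1 z ltac:(lra)). specialize (H2 z ltac:(lra)).
    assert (Hqz : q z <> 0%C).
    { intros E. rewrite E, Hq in H2. replace (0 - k)%C with (- k)%C in H2 by ring.
      rewrite Cmod_opp in H2. lra. }
    assert (Hz' : (z - (x0, y0))%C <> 0%C).
    { intros E. apply Hz, Cmod_eq_minus0. rewrite E; apply Cmod_0. }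
    left. rewrite Hgq, Hg0, <- Hq.
    replace ((z - (x0, y0)) * (f z / (0 + q z * (z - (x0, y0)))) - f (x0, y0) / q (x0, y0))%C
      with (f z * / q z - f (x0, y0) * / q (x0, y0))%C; auto.
    unfold Cdiv. rewrite Cplus_0_l. field. repeat split; auto. congruence.
Qed.

Fixpoint csum (u : nat -> C) (n : nat) : C :=
  match n with O => RtoC 0 | S n => (csum u n + u n)%C end.

Definition emode (L : R) (m : Z) (u : C) : C := Cexp (RtoC (2 * PI * IZR m / L) * Ci * u).

Definition fourier_coeff (f : C -> C) (L : R) (m : Z) : C :=
  (RtoC (/ L) * hint (fun w => f w * emode L (- m) w)%C 0 0 L)%C.

Lemma emode_plus (L : R) (m n : Z) (u : C) : (emode L (m + n) u = emode L m u * emode L n u)%C.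
Proof.
  unfold emode. rewrite <- Cexp_plus. f_equal. rewrite plus_IZR.
  unfold Rdiv. rewrite Rmult_plus_distr_l, Rmult_plus_distr_r, RtoC_plus. ring.
Qed.

Lemma emode_add (L : R) (m : Z) (u v : C) : (emode L m (u + v) = emode L m u * emode L m v)%C.
Proof. unfold emode. rewrite <- Cexp_plus. f_equal. ring. Qed.

Lemma emode_opp (L : R) (m : Z) (u : C) : emode L (- m) u = emode L m (- u)%C.
Proof.
  unfold emode. f_equal. rewrite opp_IZR.
  replace (2 * PI * - IZR m / L) with (- (2 * PI * IZR m / L)) by (unfold Rdiv; ring).
  rewrite RtoC_opp. ring.
Qed.

Lemma Cmod_emode (L : R) (m : Z) (u : C) : Cmod (emode L m u) = exp (- (2 * PI * IZR m / L * Im u)).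
Proof. unfold emode. rewrite Cmod_Cexp. f_equal. unfold Re, Im; simpl. ring. Qed.

Lemma emode_period (L : R) (m : Z) : 0 < L -> emode L m (RtoC L) = 1%C.
Proof.
  intros HL. unfold emode.
  assert (HN : forall n : nat, Cexp (RtoC (2 * PI * INR n) * Ci) = 1%C).
  { intros n. induction n.
    - simpl INR. rewrite Rmult_0_r. replace (RtoC 0 * Ci)%C with (RtoC 0) by ring. apply Cexp_0.
    - rewrite S_INR. replace (RtoC (2 * PI * (INR n + 1)) * Ci)%C
        with (RtoC (2 * PI * INR n) * Ci + RtoC (2 * PI) * Ci)%C
        by (rewrite Rmult_plus_distr_l, Rmult_1_r, RtoC_plus; ring).
      rewrite Cexp_plus, IHn. unfold Cexp; simpl.
      replace (2 * PI * 0 - 0 * 1) with 0 by ring. replace (2 * PI * 1 + 0 * 0) with (2 * PI) by ring.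
      rewrite exp_0, cos_2PI, sin_2PI. apply injective_projections; simpl; ring. }
  replace (RtoC (2 * PI * IZR m / L) * Ci * RtoC L)%C with (RtoC (2 * PI * IZR m) * Ci)%C.
  2:{ replace (2 * PI * IZR m) with (2 * PI * IZR m / L * L) at 1 by (field; lra).
      rewrite RtoC_mult. ring. }
  destruct (Z_le_gt_dec 0 m) as [h|h].
  - rewrite <- (Z2Nat.id m) by lia. rewrite <- INR_IZR_INZ. apply HN.
  - replace m with (- Z.of_nat (Z.to_nat (- m)))%Z by (rewrite Z2Nat.id; lia).
    rewrite opp_IZR, <- INR_IZR_INZ.
    replace (RtoC (2 * PI * - INR (Z.to_nat (- m))) * Ci)%C
      with (- (RtoC (2 * PI * INR (Z.to_nat (- m))) * Ci))%C
      by (rewrite Ropp_mult_distr_r_reverse, RtoC_opp; ring).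
    rewrite Cexp_opp, HN. field.
Qed.

Lemma Cdiff_emode (f : C -> C) (L : R) (m : Z) (z : C) :
  Cdiff f z -> Cdiff (fun w => emode L m (f w)) z.
Proof.
  intros H. unfold emode. apply Cdiff_Cexp. apply Cdiff_mult; auto. apply Cdiff_const.
Qed.

Lemma RtoC_pair (x y L : R) : ((x + L)%R, y) = ((x, y) + RtoC L)%C.
Proof. apply injective_projections; simpl; ring. Qed.

Section Periodic.
Variables (g : C -> C) (L B : R).
Hypothesis HL : 0 < L.
Hypothesis Hd : forall z, Rabs (Im z) < B -> Cdiff g z.
Hypothesis Hper : forall z, g (z + RtoC L)%C = g z.

Lemma periodic_vint (x c d : R) : vint g (x + L) c d = vint g x c d.
Proof.
  unfold vint. f_equal. apply CI_ext. intros t _. rewrite RtoC_pair. apply Hper.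
Qed.

Lemma periodic_cont_h (y a b : R) : Rabs y < B -> Rcont_on (fun t => g (t, y)) a b.
Proof. intros Hy. apply Rcont_on_h. intros t _. apply Cdiff_cont, Hd. auto. Qed.

(** Cauchy's theorem on one period: the vertical sides cancel by periodicity. *)
Lemma periodic_hint_level (y x : R) : Rabs y < B -> hint g y x (x + L) = hint g 0 x (x + L).
Proof.
  intros Hy. apply Rabs_lt_between in Hy.
  destruct (Rle_dec 0 y).
  - assert (H : rect_int g x (x + L) 0 y = 0%C).
    { apply goursat; try lra. intros z [_ Hz]. apply Hd. apply Rabs_lt_between. lra. }
    unfold rect_int in H. rewrite periodic_vint in H.
    symmetry. apply Cminus_eq_0. rewrite <- H. ring.
  - assert (H : rect_int g x (x + L) y 0 = 0%C).
    { apply goursat; try lra. intros z [_ Hz]. apply Hd. apply Rabs_lt_between. lra. }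
    unfold rect_int in H. rewrite periodic_vint in H.
    apply Cminus_eq_0. rewrite <- H. ring.
Qed.

Lemma periodic_hint_shift (y x : R) : Rabs y < B -> hint g y x (x + L) = hint g y 0 L.
Proof.
  intros Hy. unfold hint.
  rewrite <- (CI_Chasles (fun t => g (t, y)) x 0 (x + L)) by (apply periodic_cont_h; auto).
  rewrite <- (CI_Chasles (fun t => g (t, y)) 0 L (x + L)) by (apply periodic_cont_h; auto).
  replace (CI (fun t => g (t, y)) L (x + L)) with (CI (fun t => g (t, y)) 0 x).
  2:{ rewrite <- (Rplus_0_l L) at 1. rewrite <- CI_shift by (apply periodic_cont_h; auto).
      apply CI_ext. intros t _. rewrite RtoC_pair. auto. }
  replace (CI (fun t => g (t, y)) x 0) with (- CI (fun t => g (t, y)) 0 x)%C; [ring|].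
  pose proof (CI_Chasles (fun t => g (t, y)) x 0 x) as H.
  rewrite CI_point in H.
  symmetry. apply Cminus_eq_0. rewrite <- H by (apply periodic_cont_h; auto). ring.
Qed.

Lemma periodic_bounded (b : R) : 0 < b < B ->
  exists M, 0 < M /\ forall z, Rabs (Im z) <= b -> Cmod (g z) <= M.
Proof.
  intros Hb.
  destruct (bounded_on_rect g 0 L (- b) b) as (M & HM & H); try lra.
  { intros z [_ Hz]. apply Cdiff_cont, Hd. apply Rabs_lt_between; lra. }
  exists M. split; auto.
  assert (Hn : forall (n : nat) z, g (z + RtoC (INR n * L))%C = g z).
  { induction n; intros z.
    - simpl. rewrite Rmult_0_l, Cplus_0_r; auto.
    - rewrite S_INR, Rmult_plus_distr_r, Rmult_1_l, RtoC_plus, Cplus_assoc, Hper. auto. }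
  intros z Hz. apply Rabs_le_between in Hz.
  set (k := Int_part (Re z / L)).
  assert (Hk : IZR k <= Re z / L < IZR k + 1).
  { unfold k. pose proof (base_Int_part (Re z / L)). lra. }
  assert (Hk2 : IZR k * L <= Re z < (IZR k + 1) * L).
  { split; [apply Rle_div_r|apply Rlt_div_l]; lra. }
  destruct (Z_le_gt_dec 0 k) as [h|h].
  - replace z with ((z - RtoC (INR (Z.to_nat k) * L)) + RtoC (INR (Z.to_nat k) * L))%C by ring.
    rewrite Hn. apply H. rewrite INR_IZR_INZ, Z2Nat.id by lia.
    split; unfold Re, Im in *; simpl; lra.
  - rewrite <- (Hn (Z.to_nat (- k))). apply H. rewrite INR_IZR_INZ, Z2Nat.id, opp_IZR by lia.
    split; unfold Re, Im in *; simpl; lra.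
Qed.
End Periodic.

Section Fourier.
Variables (f : C -> C) (L B b M : R).
Hypothesis HL : 0 < L.
Hypothesis Hb : 0 < b < B.
Hypothesis HM : 0 <= M.
Hypothesis Hd : forall z, Rabs (Im z) < B -> Cdiff f z.
Hypothesis Hper : forall z, f (z + RtoC L)%C = f z.
Hypothesis Hbd : forall z, Rabs (Im z) <= b -> Cmod (f z) <= M.

Lemma mode_Cdiff (m : Z) (z : C) : Rabs (Im z) < B -> Cdiff (fun w => f w * emode L m w)%C z.
Proof. intros Hz. apply Cdiff_mult; auto. apply Cdiff_emode, Cdiff_id. Qed.

Lemma mode_per (m : Z) (z : C) : (f (z + RtoC L) * emode L m (z + RtoC L) = f z * emode L m z)%C.
Proof. rewrite Hper, emode_add, emode_period; auto. ring. Qed.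

Lemma fourier_coeff_level (m : Z) (x y : R) : Rabs y < B ->
  hint (fun w => f w * emode L (- m) w)%C y x (x + L) = (RtoC L * fourier_coeff f L m)%C.
Proof.
  intros Hy. unfold fourier_coeff.
  rewrite (periodic_hint_level (fun w => f w * emode L (- m) w)%C L B); auto.
  - rewrite (periodic_hint_shift (fun w => f w * emode L (- m) w)%C L B); auto.
    + rewrite Cmult_assoc, <- RtoC_mult. replace (L * / L) with 1 by (field; lra). ring.
    + intros; apply mode_Cdiff; auto.
    + apply mode_per.
    + rewrite Rabs_R0; lra.
  - intros; apply mode_Cdiff; auto.
  - apply mode_per.
Qed.

Lemma fourier_coeff_bound (m : Z) :
  Cmod (fourier_coeff f L m) <= M * exp (- (2 * PI * Rabs (IZR m) / L * b)).
Proof.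
  (* The line is moved to the side on which [emode L (- m)] is small: down for m >= 0, up for m <
     0. *)
  set (y := if Rle_dec 0 (IZR m) then - b else b).
  assert (Hy : Rabs y = b).
  { unfold y. destruct (Rle_dec 0 (IZR m)); [rewrite Rabs_Ropp|]; apply Rabs_pos_eq; lra. }
  assert (Hmy : IZR m * y = - (Rabs (IZR m) * b)).
  { unfold y. destruct (Rle_dec 0 (IZR m)); [rewrite Rabs_pos_eq|rewrite Rabs_left]; lra. }
  pose proof (fourier_coeff_level m 0 y ltac:(lra)) as H.
  apply (f_equal Cmod) in H. rewrite Cmod_mult, Cmod_RtoC_pos in H by lra.
  apply Rmult_le_reg_l with L; auto. rewrite <- H, Rplus_0_l.
  eapply Rle_trans.
  - apply CI_norm with (M := M * exp (- (2 * PI * Rabs (IZR m) / L * b))); [lra| |].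
    + apply (Rcont_on_h (fun w => f w * emode L (- m) w)%C). intros; apply Cdiff_cont, mode_Cdiff. simpl; lra.
    + intros t _. rewrite Cmod_mult, Cmod_emode. apply Rmult_le_compat; try apply Cmod_ge_0.
      * left; apply exp_pos.
      * apply Hbd. simpl. lra.
      * apply Req_le. f_equal. rewrite opp_IZR. simpl.
        replace (2 * PI * - IZR m / L * y) with (- (2 * PI / L * (IZR m * y))) by (field; lra).
        rewrite Hmy. field. lra.
  - apply Req_le. ring.
Qed.

(** Its inverse is the sum of the powers of [emode L s (v - w)], convergent for s = 1 when w lies
    below v and for s = -1 when w lies above v. The two signs produce the two halves of the Fourier
    series. *)
Let kernel (s : Z) (v w : C) : C := (1 - emode L s (v - w))%C.

Lemma kernel_Cdiff (s : Z) (v z : C) : Cdiff (kernel s v) z.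
Proof.
  unfold kernel. apply Cdiff_minus; [apply Cdiff_const|].
  apply Cdiff_emode, Cdiff_minus; [apply Cdiff_const|apply Cdiff_id].
Qed.

Lemma kernel_lower (s : Z) (v w : C) (dl : R) :
  IZR s * Im (v - w) >= dl -> 0 < dl ->
  1 - exp (- (2 * PI / L * dl)) <= Cmod (kernel s v w) /\
  Cmod (emode L s (v - w)) <= exp (- (2 * PI / L * dl)).
Proof.
  intros H Hdl. pose proof PI_RGT_0.
  assert (H2 : Cmod (emode L s (v - w)) <= exp (- (2 * PI / L * dl))).
  { rewrite Cmod_emode. apply exp_monotone.
    replace (2 * PI * IZR s / L * Im (v - w)) with (2 * PI / L * (IZR s * Im (v - w))) by (field; lra).
    apply Ropp_le_contravar, Rmult_le_compat_l; [|lra].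
    apply Rlt_le, Rdiv_lt_0_compat; lra. }
  split; auto. unfold kernel.
  pose proof (Cmod_triangle_rev 1 (emode L s (v - w))). rewrite Cmod_1 in H1. lra.
Qed.

(* The geometric expansion of 1 / (1 - q) is peeled off one term at a time, which avoids
   exchanging an infinite sum with an integral. *)
Lemma fourier_half (s : Z) (y : R) (x : R) (v : C) (dl : R) (j : nat) (N : nat) :
  Rabs y <= b -> IZR s * (Im v - y) >= dl -> 0 < dl ->
  exists rem : C,
    hint (fun w => f w * (emode L (s * Z.of_nat j) (v - w)) / kernel s v w)%C y x (x + L)
    = (RtoC L * csum (fun k => fourier_coeff f L (s * Z.of_nat (j + k)) *
          emode L (s * Z.of_nat (j + k)) v) N + RtoC L * rem)%C /\
    Cmod rem <= M * exp (- (2 * PI / L * dl)) ^ (j + N) / (1 - exp (- (2 * PI / L * dl))).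
Proof.
  intros Hy Hs Hdl. pose proof PI_RGT_0.
  set (q := exp (- (2 * PI / L * dl))).
  assert (Hq : 0 < q < 1).
  { split; [apply exp_pos|]. unfold q. rewrite <- exp_0. apply exp_increasing.
    assert (0 < 2 * PI / L * dl) by (apply Rmult_lt_0_compat; [apply Rdiv_lt_0_compat|]; lra). lra. }
  assert (Hker : forall t, 1 - q <= Cmod (kernel s v (t, y)) /\ Cmod (emode L s (v - (t, y))) <= q).
  { intros t. apply kernel_lower; auto. }
  assert (Hk0 : forall t, kernel s v (t, y) <> 0%C).
  { intros t. apply Cmod_gt_0. specialize (Hker t). lra. }
  set (G := fun j w => (f w * (emode L (s * Z.of_nat j) (v - w)) / kernel s v w)%C).
  set (F := fun j w => (f w * (emode L (s * Z.of_nat j) (v - w)))%C).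
  assert (HGc : forall j t, Ccont (G j) (t, y)).
  { intros j' t. apply Cdiff_cont. unfold G. apply Cdiff_div; auto; [|apply kernel_Cdiff].
    apply Cdiff_mult; [apply Hd; simpl; lra|].
    apply Cdiff_emode, Cdiff_minus; [apply Cdiff_const|apply Cdiff_id]. }
  assert (HFc : forall j t, Ccont (F j) (t, y)).
  { intros j' t. apply Cdiff_cont. unfold F.
    apply Cdiff_mult; [apply Hd; simpl; lra|].
    apply Cdiff_emode, Cdiff_minus; [apply Cdiff_const|apply Cdiff_id]. }
  assert (Hstep : forall j, hint (G j) y x (x + L) =
     (RtoC L * (fourier_coeff f L (s * Z.of_nat j) * emode L (s * Z.of_nat j) v) + hint (G (S j)) y x (x + L))%C).
  { intros j'.
    replace (RtoC L * (fourier_coeff f L (s * Z.of_nat j') * emode L (s * Z.of_nat j') v))%C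
      with (hint (F j') y x (x + L)).
    - unfold hint. rewrite <- CI_plus by (apply Rcont_on_h; auto).
      apply CI_ext. intros t _. unfold F, G.
      replace (s * Z.of_nat (S j'))%Z with (s * Z.of_nat j' + s)%Z by lia.
      rewrite emode_plus. pose proof (Hk0 t) as Hkt. unfold kernel in *. field. exact Hkt.
    - transitivity (hint (fun w => f w * emode L (- (s * Z.of_nat j')) w)%C y x (x + L) * emode L (s * Z.of_nat j') v)%C.
      + unfold hint. rewrite Cmult_comm, <- CI_scal.
        * apply CI_ext. intros t _. unfold F. rewrite emode_opp.
          unfold Cminus. rewrite emode_add. ring.
        * apply (Rcont_on_h (fun w => f w * emode L (- (s * Z.of_nat j')) w)%C).
          intros; apply Cdiff_cont, mode_Cdiff. simpl; lra.
      + rewrite fourier_coeff_level by lra. ring. }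
  assert (Hexp : forall N, hint (G j) y x (x + L) = (RtoC L * csum (fun k => fourier_coeff f L (s * Z.of_nat (j + k)) *
          emode L (s * Z.of_nat (j + k)) v) N + hint (G (j + N)%nat) y x (x + L))%C).
  { intros n. induction n.
    - simpl. rewrite Nat.add_0_r. ring.
    - rewrite IHn, (Hstep (j + n)%nat), Nat.add_succ_r. simpl csum. ring. }
  exists (hint (G (j + N)%nat) y x (x + L) / RtoC L)%C.
  assert (HLC : RtoC L <> 0%C) by (apply RtoC_neq_0; lra).
  split.
  - change (fun w => f w * emode L (s * Z.of_nat j) (v - w) / kernel s v w)%C with (G j).
    rewrite (Hexp N). f_equal. field. exact HLC.
  - rewrite Cmod_div, Cmod_RtoC_pos by (auto; lra).
    apply Rle_div_l; auto.
    eapply Rle_trans.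
    + apply CI_norm with (M := M * q ^ (j + N) / (1 - q)); [lra|apply Rcont_on_h; auto|].
      intros t _. unfold G. rewrite Cmod_div, Cmod_mult by auto.
      destruct (Hker t) as [K1 K2]. apply Rle_div_l; [lra|].
      apply Rle_trans with (M * q ^ (j + N)).
      * apply Rmult_le_compat; try apply Cmod_ge_0; [apply Hbd; simpl; lra|].
        assert (E : forall n, emode L (s * Z.of_nat n) (v - (t, y)) = (emode L s (v - (t, y)) ^ n)%C).
        { induction n; [rewrite Z.mul_0_r; unfold emode; rewrite Rmult_0_r; unfold Rdiv; rewrite Rmult_0_l;
            replace (0 * Ci * (v - (t, y)))%C with (RtoC 0) by ring; apply Cexp_0|].
          replace (s * Z.of_nat (S n))%Z with (s + s * Z.of_nat n)%Z by lia.
          rewrite emode_plus, IHn. simpl. reflexivity. }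
        rewrite E, Cmod_pow. apply pow_incr. split; [apply Cmod_ge_0|auto].
      * assert (0 <= M * q ^ (j + N)) by (apply Rmult_le_pos; auto; apply pow_le; lra).
        replace (M * q ^ (j + N) / (1 - q) * Cmod (kernel s v (t, y)))
          with (M * q ^ (j + N) * (Cmod (kernel s v (t, y)) / (1 - q))) by (field; lra).
        rewrite <- (Rmult_1_r (M * q ^ (j + N))) at 1. apply Rmult_le_compat_l; auto.
        apply Rle_div_r; lra.
    + apply Req_le. ring.
Qed.

(** The residue of f / [kernel 1 v] at v, over a window of one period centred at Re v so that no
    other zero of the kernel is inside. The vertical sides cancel. On the top side -1 / (1 - q) is
    rewritten as q^(-1) / (1 - q^(-1)), which is why the negative half starts with exponent 1 and
    the other with exponent 0. *)
Lemma fourier_residue (v : C) : Rabs (Im v) < b ->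
  (RtoC L * f v = hint (fun w => f w * emode L (1 * Z.of_nat 0) (v - w) / kernel 1 v w)%C (- b) (Re v - L / 2) (Re v - L / 2 + L)
     + hint (fun w => f w * emode L (-1 * Z.of_nat 1) (v - w) / kernel (-1) v w)%C b (Re v - L / 2) (Re v - L / 2 + L))%C.
Proof.
  intros Hv. pose proof PI_RGT_0. pose proof Hv as Hv'. apply Rabs_lt_between in Hv'.
  assert (HLC : RtoC L <> 0%C) by (apply RtoC_neq_0; lra).
  set (T := (RtoC (2 * PI) * Ci)%C). assert (HT : T <> 0%C) by apply twoPiI_neq_0.
  set (x := Re v - L / 2). set (h := fun w => (f w / kernel 1 v w)%C).
  assert (Hk0 : kernel 1 v v = 0%C).
  { unfold kernel. replace (v - v)%C with (RtoC 0) by ring. unfold emode.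
    rewrite Cmult_0_r, Cexp_0. ring. }
  assert (Hkn : forall z, in_rect x (x + L) (- b) b z -> z <> (Re v, Im v) -> kernel 1 v z <> 0%C).
  { intros z [Hz _] Hn E. apply Hn. unfold kernel in E.
    assert (E1 : emode L 1 (v - z) = 1%C).
    { apply Cmod_eq_minus0. rewrite Cmod_minus_sym, E. apply Cmod_0. }
    unfold emode in E1. apply Cexp_eq_1 in E1.
    - assert (E2 : (v - z = 0)%C).
      { replace (v - z)%C with (RtoC (2 * PI * 1 / L) * Ci * (v - z) / (T / RtoC L))%C.
        - rewrite E1. field. split; auto.
        - unfold T. unfold Rdiv. rewrite Rmult_1_r, RtoC_mult, RtoC_inv by lra. field.
          split; [|split]; auto. 1: apply Ci_neq_0. apply RtoC_neq_0; lra. }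
      symmetry. rewrite <- surjective_pairing. apply Cmod_eq_minus0. rewrite E2. apply Cmod_0.
    - replace (Im (RtoC (2 * PI * 1 / L) * Ci * (v - z))%C) with (2 * PI / L * (Re v - Re z))
        by (unfold Re, Im; simpl; field; lra).
      rewrite Rabs_mult, Rabs_pos_eq by (apply Rlt_le, Rdiv_lt_0_compat; lra).
      assert (Rabs (Re v - Re z) <= L / 2) by (apply Rabs_le_between; unfold x in Hz; lra).
      apply Rle_lt_trans with (2 * PI / L * (L / 2)).
      + apply Rmult_le_compat_l; [apply Rlt_le, Rdiv_lt_0_compat|]; lra.
      + replace (2 * PI / L * (L / 2)) with PI by (field; lra). lra. }
  assert (Hkd : is_Cder (kernel 1 v) (Re v, Im v) (T / RtoC L)).
  { rewrite <- surjective_pairing. unfold kernel.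
    replace (T / RtoC L)%C with (0 + (- (1) * (Cexp (RtoC (2 * PI * 1 / L) * Ci * (v - v)) * (RtoC (2 * PI * 1 / L) * Ci * - (1)))))%C.
    - apply is_Cder_slope.
      assert (Hd0 : is_Cder (fun w => 1 + (- (1)) * emode L 1 (v - w))%C v (0 + (- (1) * (Cexp (RtoC (2 * PI * 1 / L) * Ci * (v - v)) * (RtoC (2 * PI * 1 / L) * Ci * - (1)))))%C).
      { apply is_Cder_plus; [apply is_Cder_const|].
        replace (- (1) * (Cexp (RtoC (2 * PI * 1 / L) * Ci * (v - v)) * (RtoC (2 * PI * 1 / L) * Ci * - (1))))%C
          with (0 * emode L 1 (v - v) + (- (1) * (Cexp (RtoC (2 * PI * 1 / L) * Ci * (v - v)) * (RtoC (2 * PI * 1 / L) * Ci * - (1)))))%C by ring.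
        apply (is_Cder_mult (fun _ => (- (1))%C) (fun w => emode L 1 (v - w))); [apply is_Cder_const|].
        unfold emode. apply (is_Cder_comp (fun w => RtoC (2 * PI * 1 / L) * Ci * (v - w))%C Cexp); [|apply is_Cder_Cexp].
        replace (RtoC (2 * PI * 1 / L) * Ci * - (1))%C
          with (0 * (v - v) + RtoC (2 * PI * 1 / L) * Ci * - (1))%C by ring.
        apply (is_Cder_mult (fun _ => (RtoC (2 * PI * 1 / L) * Ci)%C) (fun w => v - w)%C); [apply is_Cder_const|].
        apply is_Cder_slope. exists (fun _ => (- (1))%C). split; [auto|split; [apply Ccont_const|]]. intros; ring. }
      apply is_Cder_slope in Hd0. destruct Hd0 as (q & Hq1 & Hq2 & Hq3).
      exists q. split; [auto|split; auto]. intros w. specialize (Hq3 w).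
      replace (1 - emode L 1 (v - w))%C with (1 + - (1) * emode L 1 (v - w))%C by ring. rewrite Hq3. ring.
    - replace (RtoC (2 * PI * 1 / L) * Ci * (v - v))%C with (RtoC 0) by ring. rewrite Cexp_0.
      unfold T, Rdiv. rewrite Rmult_1_r, RtoC_mult, RtoC_inv by lra. unfold Cdiv. ring. }
  assert (HTL : (T / RtoC L)%C <> 0%C).
  { intros E. apply HT. replace T with (T / RtoC L * RtoC L)%C by (field; auto). rewrite E; ring. }
  assert (Hres : rect_int h x (x + L) (- b) b = (RtoC L * f v)%C).
  { unfold h. rewrite (residue_quotient f (kernel 1 v) (T / RtoC L) x (x + L) (- b) b (Re v) (Im v)); auto.
    - rewrite <- surjective_pairing. fold T. field. auto.
    - unfold x; lra.
    - intros z [_ Hz]. apply Hd. apply Rabs_lt_between; lra.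
    - intros; apply kernel_Cdiff. }
  rewrite <- Hres. unfold rect_int.
  rewrite (periodic_vint h L).
  2:{ intros z. unfold h, kernel. rewrite Hper.
      replace (emode L 1 (v - z)) with (emode L 1 (v - (z + RtoC L))); [reflexivity|].
      replace (v - z)%C with ((v - (z + RtoC L)) + RtoC L)%C by ring.
      rewrite (emode_add _ _ (v - (z + RtoC L))), emode_period by auto. ring. }
  replace (hint h (- b) x (x + L) + vint h x (- b) b - hint h b x (x + L) - vint h x (- b) b)%C
    with (hint h (- b) x (x + L) + (- (1)) * hint h b x (x + L))%C by ring.
  f_equal.
  - unfold hint. apply CI_ext. intros t _. unfold h. unfold emode at 1. simpl (1 * Z.of_nat 0)%Z.
    replace (RtoC (2 * PI * 0 / L) * Ci * (v - (t, (- b)%R)))%C with (RtoC 0).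
    + rewrite Cexp_0, Cmult_1_r. auto.
    + unfold Rdiv. rewrite Rmult_0_r, Rmult_0_l. ring.
  - unfold hint.
    assert (Hkt : forall t, kernel 1 v (t, b) <> 0%C /\ kernel (-1) v (t, b) <> 0%C).
    { intros t.
      destruct (kernel_lower (-1) v (t, b) (b - Im v)) as [K1 K2]; [unfold Im; simpl; lra|lra|].
      assert (Q : exp (- (2 * PI / L * (b - Im v))) < 1).
      { rewrite <- exp_0. apply exp_increasing.
        assert (0 < 2 * PI / L * (b - Im v)) by (apply Rmult_lt_0_compat; [apply Rdiv_lt_0_compat|]; lra). lra. }
      assert (K3 : kernel (-1) v (t, b) <> 0%C) by (apply Cmod_gt_0; lra).
      split; auto. intros E. apply K3. unfold kernel in *.
      assert (E1 : emode L 1 (v - (t, b)) = 1%C) by (apply Cmod_eq_minus0; rewrite Cmod_minus_sym, E; apply Cmod_0).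
      assert (E2 : (emode L (-1) (v - (t, b)) * emode L 1 (v - (t, b)) = 1)%C).
      { rewrite <- emode_plus. simpl. unfold emode. rewrite Rmult_0_r. unfold Rdiv. rewrite Rmult_0_l.
        replace (0 * Ci * (v - (t, b)))%C with (RtoC 0) by ring. apply Cexp_0. }
      rewrite E1, Cmult_1_r in E2. rewrite E2. ring. }
    rewrite <- CI_scal.
    + apply CI_ext. intros t _. unfold h. destruct (Hkt t) as [K1 K2]. simpl (-1 * Z.of_nat 1)%Z.
      assert (E2 : (emode L (-1) (v - (t, b)) * emode L 1 (v - (t, b)) = 1)%C).
      { rewrite <- emode_plus. simpl. unfold emode. rewrite Rmult_0_r. unfold Rdiv. rewrite Rmult_0_l.
        replace (0 * Ci * (v - (t, b)))%C with (RtoC 0) by ring. apply Cexp_0. }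
      unfold kernel in *. set (p := emode L 1 (v - (t, b))) in *. set (m := emode L (-1) (v - (t, b))) in *.
      assert (Hm : m <> 0%C) by (apply Cexp_neq_0).
      replace p with (/ m)%C in * by (replace p with (m * p * / m)%C by (field; auto); rewrite E2; ring).
      field. repeat split; auto.
      intros E. apply K2. replace (1 - m)%C with (- (m - 1))%C by ring. rewrite E. ring.
    + apply Rcont_on_h. intros t _. apply Cdiff_cont. unfold h. apply Cdiff_div; [apply Hd|apply kernel_Cdiff|apply Hkt].
      simpl. rewrite Rabs_pos_eq; lra.
Qed.

(** The explicit geometric remainder matters: it is uniform on every narrower strip, which later
    allows the series to be integrated along an unbounded contour. *)
Theorem fourier_expansion (v : C) (N : nat) : Rabs (Im v) < b ->
  Cmod (f v - (csum (fun k => fourier_coeff f L (Z.of_nat k) * emode L (Z.of_nat k) v) N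
             + csum (fun k => fourier_coeff f L (- Z.of_nat (S k)) * emode L (- Z.of_nat (S k)) v) N))%C
  <= 2 * M * exp (- (2 * PI / L * (b - Rabs (Im v)))) ^ N / (1 - exp (- (2 * PI / L * (b - Rabs (Im v))))).
Proof.
  intros Hv. pose proof Hv as Hv'. apply Rabs_lt_between in Hv'. pose proof PI_RGT_0.
  assert (HLC : RtoC L <> 0%C) by (apply RtoC_neq_0; lra).
  set (dl := b - Rabs (Im v)). assert (Hdl : 0 < dl) by (unfold dl; lra).
  assert (Hdl2 : dl <= b - Im v /\ dl <= Im v + b).
  { unfold dl. pose proof (Rle_abs (Im v)). pose proof (Rle_abs (- Im v)). rewrite Rabs_Ropp in H1. lra. }
  set (q := exp (- (2 * PI / L * dl))).
  assert (Hq : 0 < q < 1).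
  { split; [apply exp_pos|]. unfold q. rewrite <- exp_0. apply exp_increasing.
    assert (0 < 2 * PI / L * dl) by (apply Rmult_lt_0_compat; [apply Rdiv_lt_0_compat|]; lra). lra. }
  pose proof (fourier_residue v Hv) as HR.
  destruct (fourier_half 1 (- b) (Re v - L / 2) v dl 0 N) as (r1 & E1 & B1); auto; try (simpl; lra).
  { rewrite Rabs_Ropp, Rabs_pos_eq; lra. }
  destruct (fourier_half (-1) b (Re v - L / 2) v dl 1 N) as (r2 & E2 & B2); auto; try (simpl; lra).
  { rewrite Rabs_pos_eq; lra. }
  rewrite E1, E2 in HR. fold q in B1, B2.
  assert (X : forall u w, (forall k, u k = w k) -> forall n, csum u n = csum w n).
  { intros u w Huw n. induction n; simpl; [auto|rewrite IHn, Huw; auto]. }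
  rewrite (X _ (fun k => fourier_coeff f L (Z.of_nat k) * emode L (Z.of_nat k) v)%C) in HR
    by (intros k; rewrite Nat.add_0_l, Z.mul_1_l; auto).
  rewrite (X (fun k => fourier_coeff f L (-1 * Z.of_nat (1 + k)) * emode L (-1 * Z.of_nat (1 + k)) v)%C
     (fun k => fourier_coeff f L (- Z.of_nat (S k)) * emode L (- Z.of_nat (S k)) v)%C) in HR
    by (intros k; replace (-1 * Z.of_nat (1 + k))%Z with (- Z.of_nat (S k))%Z by lia; auto).
  set (S1 := csum _ N) in *. set (S2 := csum (fun k => fourier_coeff f L (- Z.of_nat (S k)) * _)%C N) in *.
  replace (f v - (S1 + S2))%C with (r1 + r2)%C.
  2:{ replace (f v) with (RtoC L * f v / RtoC L)%C by (field; auto). rewrite HR. field. auto. }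
  eapply Rle_trans; [apply Cmod_triangle|].
  assert (Hp : q ^ (1 + N) <= q ^ N) by (simpl; pose proof (pow_le q N ltac:(lra)); nra).
  assert (B3 : Cmod r2 <= M * q ^ N / (1 - q)).
  { eapply Rle_trans; [exact B2|]. unfold Rdiv. apply Rmult_le_compat_r; [left; apply Rinv_0_lt_compat; lra|].
    apply Rmult_le_compat_l; auto. }
  rewrite Nat.add_0_l in B1. lra.
Qed.
End Fourier.

(** * Hankel contours and the reciprocal Gamma function *)

Definition climit (F : R -> C) (l : C) : Prop :=
  forall eps, 0 < eps -> exists M0, forall M, M0 <= M -> Cmod (F M - l) <= eps.

Lemma climit_unique (F : R -> C) (l l' : C) : climit F l -> climit F l' -> l = l'.
Proof.
  intros H H'. apply Cmod_eq_minus0, Rle_antisym; [|apply Cmod_ge_0].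
  apply le_epsilon. intros e He. rewrite Rplus_0_l.
  destruct (H (e / 2) ltac:(lra)) as [M HM]. destruct (H' (e / 2) ltac:(lra)) as [M' HM'].
  specialize (HM (Rmax M M') (Rmax_l _ _)). specialize (HM' (Rmax M M') (Rmax_r _ _)).
  rewrite Cmod_minus_sym in HM. pose proof (Cmod_minus_trans l (F (Rmax M M')) l'). lra.
Qed.

Lemma climit_ext (F G : R -> C) (l : C) (m : R) :
  (forall M, m <= M -> F M = G M) -> climit F l -> climit G l.
Proof.
  intros E H e He. destruct (H e He) as [M0 HM]. exists (Rmax m M0). intros M h.
  pose proof (Rmax_l m M0). pose proof (Rmax_r m M0). rewrite <- E by lra. apply HM; lra.
Qed.

Lemma climit_plus (F G : R -> C) (l m : C) :
  climit F l -> climit G m -> climit (fun M => F M + G M)%C (l + m)%C.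
Proof.
  intros H H' e He.
  destruct (H (e / 2) ltac:(lra)) as [M HM]. destruct (H' (e / 2) ltac:(lra)) as [M' HM'].
  exists (Rmax M M'). intros N h. pose proof (Rmax_l M M'). pose proof (Rmax_r M M').
  specialize (HM N ltac:(lra)). specialize (HM' N ltac:(lra)).
  replace (F N + G N - (l + m))%C with ((F N - l) + (G N - m))%C by ring.
  pose proof (Cmod_triangle (F N - l) (G N - m)). lra.
Qed.

Lemma climit_scal (F : R -> C) (k l : C) : climit F l -> climit (fun M => k * F M)%C (k * l)%C.
Proof.
  intros H e He. set (K := Cmod k + 1). assert (HK : 0 < K) by (unfold K; pose proof (Cmod_ge_0 k); lra).
  destruct (H (e / K)) as [M HM]; [apply Rdiv_lt_0_compat; auto|].
  exists M. intros N h. specialize (HM N h).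
  replace (k * F N - k * l)%C with (k * (F N - l))%C by ring. rewrite Cmod_mult.
  apply Rle_trans with (K * (e / K)); [|apply Req_le; field; lra].
  apply Rmult_le_compat; try apply Cmod_ge_0; [unfold K; lra|auto].
Qed.

Lemma climit_shift (F : R -> C) (l : C) (m : R) : climit F l -> climit (fun M => F (M + m)) l.
Proof.
  intros H e He. destruct (H e He) as [M0 HM]. exists (M0 - m). intros M h. apply HM. lra.
Qed.

Lemma climit_filterlim (F : R -> C) (l : C) :
  climit F l <-> filterlim F (Rbar_locally p_infty) (locally (T := C_UniformSpace) l).
Proof.
  rewrite filterlim_C_iff by apply _. split.
  - intros H e He. destruct (H (e / 2) ltac:(lra)) as [M HM].
    exists M. intros x Hx. specialize (HM x ltac:(lra)). lra.
  - intros H e He. destruct (H e He) as [M HM]. exists (M + 1). intros x Hx. left. apply HM. lra.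
Qed.

Lemma climit_bound (F : R -> C) (l : C) (m B : R) :
  climit F l -> (forall M, m <= M -> Cmod (F M) <= B) -> Cmod l <= B.
Proof.
  intros H HB. apply le_epsilon. intros e He. destruct (H e He) as [M0 HM].
  specialize (HM (Rmax m M0) (Rmax_r _ _)). specialize (HB (Rmax m M0) (Rmax_l _ _)).
  pose proof (Cmod_triangle_rev l (F (Rmax m M0))). rewrite Cmod_minus_sym in HM. lra.
Qed.

Lemma climit_cauchy (F : R -> C) :
  (forall eps, 0 < eps -> exists M0, forall M N, M0 <= M -> M <= N -> Cmod (F N - F M) <= eps) ->
  exists l, climit F l.
Proof.
  intros H.
  destruct (proj1 (filterlim_locally_cauchy (U := C_R_CompleteNormedModule)
    (F := Rbar_locally p_infty) F)) as [l Hl].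
  - intros eps. destruct (H (eps / 2)) as [M0 HM]; [pose proof (cond_pos eps); lra|].
    exists (fun M => M0 < M). split; [exists M0; auto|].
    intros u v Hu Hv. apply Cmod_ball. pose proof (cond_pos eps).
    destruct (Rle_dec u v).
    + specialize (HM u v ltac:(lra) r). lra.
    + specialize (HM v u ltac:(lra) ltac:(lra)). rewrite Cmod_minus_sym. lra.
  - exists l. apply climit_filterlim. exact Hl.
Qed.

Lemma is_RInt_exp_decay (S sg a b : R) : sg <> 0 ->
  is_RInt (fun t => S * exp (- (sg * t))) a b (S * exp (- (sg * a)) / sg - S * exp (- (sg * b)) / sg).
Proof.
  intros Hs.
  replace (S * exp (- (sg * a)) / sg - S * exp (- (sg * b)) / sg)
    with (minus (- (S * exp (- (sg * b)) / sg)) (- (S * exp (- (sg * a)) / sg)))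
    by (unfold minus, plus, opp; simpl; ring).
  apply (is_RInt_derive (fun t => - (S * exp (- (sg * t)) / sg)) (fun t => S * exp (- (sg * t)))).
  - intros x _. auto_derive; auto. field. auto.
  - intros x _. apply (ex_derive_continuous (V := R_NormedModule)). auto_derive. auto.
Qed.

Lemma ray_limit (f : R -> C) (r S sg : R) :
  0 < sg -> 0 <= S -> (forall t, r <= t -> Rcont f t) ->
  (forall t, r <= t -> Cmod (f t) <= S * exp (- (sg * t))) ->
  exists l, climit (fun M => CI f r M) l /\ Cmod l <= S * exp (- (sg * r)) / sg.
Proof.
  intros Hsg HS Hc Hb.
  assert (Hcont : forall a b, r <= a -> a <= b -> Rcont_on f a b).
  { intros a b h1 h2 t Ht. rewrite Rmin_left in Ht by lra. apply Hc; lra. }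
  assert (HI : forall a b, r <= a -> a <= b -> Cmod (CI f a b) <= S * exp (- (sg * a)) / sg).
  { intros a b h1 h2.
    eapply Rle_trans; [apply (CI_norm_le f (fun t => S * exp (- (sg * t)))); auto; [|apply is_RInt_exp_decay; lra]|].
    - intros; apply Hb; lra.
    - assert (0 <= S * exp (- (sg * b)) / sg); [|lra].
      apply Rmult_le_pos; [apply Rmult_le_pos; auto; left; apply exp_pos|left; apply Rinv_0_lt_compat; auto]. }
  destruct (climit_cauchy (fun M => CI f r M)) as [l Hl].
  - intros eps He.
    set (q := S / (sg * eps) + 1). assert (Hq : 1 <= q).
    { assert (0 <= S / (sg * eps)); [|unfold q; lra].
      apply Rmult_le_pos; auto. left; apply Rinv_0_lt_compat, Rmult_lt_0_compat; auto. }
    exists (Rmax r (ln q / sg)). intros M N h1 h2.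
    pose proof (Rmax_l r (ln q / sg)). pose proof (Rmax_r r (ln q / sg)).
    replace (CI f r N - CI f r M)%C with (CI f M N).
    2:{ rewrite <- (CI_Chasles f r M N) by (apply Hcont; lra). ring. }
    eapply Rle_trans; [apply HI; lra|].
    assert (E : exp (- (sg * M)) <= / q).
    { rewrite <- (exp_ln q) at 1 by lra. rewrite <- exp_Ropp. apply exp_monotone.
      apply Ropp_le_contravar. replace (ln q) with (sg * (ln q / sg)) by (field; lra).
      apply Rmult_le_compat_l; lra. }
    apply Rle_div_l; auto.
    apply Rle_trans with (S * / q); [apply Rmult_le_compat_l; auto|].
    apply Rle_div_l; [lra|].
    apply Rle_trans with (eps * sg * (S / (sg * eps))); [apply Req_le; field; lra|].
    apply Rmult_le_compat_l; [|unfold q; lra]. apply Rlt_le, Rmult_lt_0_compat; auto.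
  - exists l. split; auto. apply (climit_bound (fun M => CI f r M) l r); auto. intros M HM. apply HI; lra.
Qed.

(* In the variable v = ln z, z running over a Hankel loop around the negative axis, the
   contour is the ray from infinity - i b, the segment over Re v = r, and the ray to
   infinity + i b, here truncated at Re v = M. *)
Definition hankel (f : C -> C) (b r M : R) : C :=
  (hint f b r M - hint f (- b) r M + vint f r (- b) b)%C.

Lemma hankel_rect (f : C -> C) (b r M : R) :
  hankel f b r M = (vint f M (- b) b - rect_int f r M (- b) b)%C.
Proof. unfold hankel, rect_int. ring. Qed.

(** The truncated contour may be replaced by the segment that closes it. Limits can thus be stated
    on Re v = M alone, independently of r, while estimates are made on the contour for whichever r
    is convenient. *)
Lemma hankel_entire (f : C -> C) (b r M : R) : 0 <= b -> r <= M ->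
  (forall z, in_rect r M (- b) b z -> Cdiff f z) -> hankel f b r M = vint f M (- b) b.
Proof. intros Hb HrM Hf. rewrite hankel_rect, goursat; auto; [ring|lra]. Qed.

Lemma hankel_limit (f : C -> C) (b r S S' sg : R) :
  0 < b -> 0 < sg -> 0 <= S ->
  (forall t, r <= t -> Ccont f (t, b) /\ Ccont f (t, - b)) ->
  (forall th, - b <= th <= b -> Ccont f (r, th)) ->
  (forall t, r <= t -> Cmod (f (t, b)) <= S * exp (- (sg * t)) /\ Cmod (f (t, - b)) <= S * exp (- (sg * t))) ->
  (forall th, - b <= th <= b -> Cmod (f (r, th)) <= S') ->
  exists l, climit (hankel f b r) l /\ Cmod l <= 2 * (S * exp (- (sg * r)) / sg) + 2 * b * S'.
Proof.
  intros Hb Hsg HS Hc Hcv Hbd Hbv.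
  destruct (ray_limit (fun t => f (t, b)) r S sg) as (l1 & L1 & B1); auto.
  { intros t Ht. apply (Rcont_path f (fun s => (s, b))); [apply Rcont_h|apply Hc; auto]. }
  { intros t Ht. apply Hbd; auto. }
  destruct (ray_limit (fun t => f (t, - b)) r S sg) as (l2 & L2 & B2); auto.
  { intros t Ht. apply (Rcont_path f (fun s => (s, - b))); [apply Rcont_h|apply Hc; auto]. }
  { intros t Ht. apply Hbd; auto. }
  exists (l1 + (- (1) * l2) + vint f r (- b) b)%C. split.
  - apply climit_ext with (m := r) (F := fun M => (hint f b r M + - (1) * hint f (- b) r M + vint f r (- b) b)%C).
    + intros M _. unfold hankel. ring.
    + apply climit_plus; [apply climit_plus; [auto|apply climit_scal; auto]|].
      intros e He. exists 0. intros. rewrite Cminus_diag_mod. lra.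
  - eapply Rle_trans; [apply Cmod_triangle|].
    assert (Cmod (l1 + - (1) * l2) <= Cmod l1 + Cmod l2).
    { replace (l1 + - (1) * l2)%C with (l1 - l2)%C by ring. apply Cmod_minus_triangle. }
    assert (Cmod (vint f r (- b) b) <= 2 * b * S').
    { unfold vint. rewrite Cmod_mult, Cmod_Ci, Rmult_1_l. replace (2 * b) with (b - - b) by ring.
      apply CI_norm; auto; [lra|]. apply Rcont_on_v. intros t Ht.
      rewrite Rmin_left, Rmax_right in Ht by lra. auto. }
    lra.
Qed.

Lemma vint_scal (k : C) (f : C -> C) (x c d : R) : c <= d ->
  (forall t, c <= t <= d -> Ccont f (x, t)) -> vint (fun z => k * f z)%C x c d = (k * vint f x c d)%C.
Proof.
  intros Hcd H. unfold vint. rewrite CI_scal; [ring|]. apply Rcont_on_v. intros t Ht.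
  rewrite Rmin_left, Rmax_right in Ht by lra. auto.
Qed.

Lemma hankel_ext (f g : C -> C) (b r M : R) :
  0 <= b -> r <= M ->
  (forall t, r <= t -> f (t, b) = g (t, b) /\ f (t, - b) = g (t, - b)) ->
  (forall th, - b <= th <= b -> f (r, th) = g (r, th)) ->
  hankel f b r M = hankel g b r M.
Proof.
  intros Hb HrM H1 H2. unfold hankel, hint, vint.
  rewrite (CI_ext (fun t => f (t, b)) (fun t => g (t, b))), (CI_ext (fun t => f (t, - b)) (fun t => g (t, - b))),
    (CI_ext (fun t => f (r, t)) (fun t => g (r, t))); auto.
  all: intros t; rewrite Rmin_left by lra; intros Ht; try apply H1; try apply H2; try lra.
  rewrite Rmax_right in Ht by lra. lra.
Qed.

Section HankelLin.
Variables (b r : R).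
Hypothesis Hb : 0 <= b.
Definition cont_on_contour (f : C -> C) : Prop :=
  (forall t, r <= t -> Ccont f (t, b) /\ Ccont f (t, - b)) /\
  (forall th, - b <= th <= b -> Ccont f (r, th)).

Lemma contour_h (f : C -> C) (M : R) : cont_on_contour f -> r <= M ->
  Rcont_on (fun t => f (t, b)) r M /\ Rcont_on (fun t => f (t, - b)) r M /\
  Rcont_on (fun t => f (r, t)) (- b) b.
Proof.
  intros [H1 H2] HM. split; [|split].
  - apply Rcont_on_h. intros t Ht. rewrite Rmin_left in Ht by lra. apply H1; lra.
  - apply Rcont_on_h. intros t Ht. rewrite Rmin_left in Ht by lra. apply H1; lra.
  - apply Rcont_on_v. intros t Ht. rewrite Rmin_left, Rmax_right in Ht by lra. apply H2; lra.
Qed.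

Lemma hankel_plus (f g : C -> C) (M : R) : cont_on_contour f -> cont_on_contour g -> r <= M ->
  hankel (fun z => f z + g z)%C b r M = (hankel f b r M + hankel g b r M)%C.
Proof.
  intros Hf Hg HM. destruct (contour_h f M Hf HM) as (h1 & h2 & h3).
  destruct (contour_h g M Hg HM) as (k1 & k2 & k3).
  unfold hankel, hint, vint. rewrite !CI_plus by auto. ring.
Qed.

Lemma hankel_scal (k : C) (f : C -> C) (M : R) : cont_on_contour f -> r <= M ->
  hankel (fun z => k * f z)%C b r M = (k * hankel f b r M)%C.
Proof.
  intros Hf HM. destruct (contour_h f M Hf HM) as (h1 & h2 & h3).
  unfold hankel, hint, vint. rewrite !CI_scal by auto. ring.
Qed.

Lemma cont_on_contour_Cdiff (f : C -> C) :
  (forall t, r <= t -> Cdiff f (t, b) /\ Cdiff f (t, - b)) ->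
  (forall th, - b <= th <= b -> Cdiff f (r, th)) -> cont_on_contour f.
Proof.
  intros H1 H2. split.
  - intros t Ht. destruct (H1 t Ht). split; apply Cdiff_cont; auto.
  - intros t Ht. apply Cdiff_cont; auto.
Qed.
End HankelLin.

(** * The exponential weight and its decay on the contour *)

Definition weight (x : R) (v : C) : C := (Cexp (RtoC x * Cexp v) * Cexp v)%C.

(** With z = exp v, [weight] is exp (x z) dz, its last factor being the Jacobian, and this is z^(-s)
    exp (x z) dz. *)
Definition hankel_kernel (s : C) (x : R) (v : C) : C := (Cexp (- (s * v)) * weight x v)%C.

Lemma Re_Cexp (v : C) : Re (Cexp v) = exp (Re v) * cos (Im v).
Proof. reflexivity. Qed.

Lemma Cmod_Cexp_lin (s v : C) :
  Cmod (Cexp (- (s * v))) = exp (- (Re s * Re v) + Im s * Im v).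
Proof. rewrite Cmod_Cexp. f_equal. unfold Re, Im; simpl. ring. Qed.

Lemma Cdiff_weight (x : R) (v : C) : Cdiff (weight x) v.
Proof.
  unfold weight. apply Cdiff_mult; [|apply Cdiff_Cexp, Cdiff_id].
  apply Cdiff_Cexp, Cdiff_mult; [apply Cdiff_const|apply Cdiff_Cexp, Cdiff_id].
Qed.

Lemma Cdiff_exp_lin (s v : C) : Cdiff (fun v => Cexp (- (s * v)))%C v.
Proof.
  apply Cdiff_Cexp, Cdiff_opp, Cdiff_mult; [apply Cdiff_const|apply Cdiff_id].
Qed.

Lemma Cdiff_hankel_kernel (s : C) (x : R) (v : C) : Cdiff (hankel_kernel s x) v.
Proof. apply Cdiff_mult; [apply Cdiff_exp_lin|apply Cdiff_weight]. Qed.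

(** From exp y >= (1 + y/2)^2. Quadratic decay in y = const * exp t suffices: one power of exp t
    pays for the Jacobian and the other leaves exp (- t). *)
Lemma exp_neg_sqr (y : R) : 0 < y -> exp (- y) <= 4 / (y * y).
Proof.
  intros Hy. rewrite exp_Ropp. pose proof (exp_ineq1_le (y / 2)) as H.
  assert (H2 : y * y / 4 <= exp y).
  { replace (exp y) with (exp (y / 2) * exp (y / 2)) by (rewrite <- exp_plus; f_equal; field). nra. }
  assert (0 < y * y) by nra.
  replace (4 / (y * y)) with (/ (y * y / 4)) by (field; lra).
  apply Rinv_le_contravar; lra.
Qed.

Lemma cos_obtuse (b : R) : PI / 2 < b < PI -> 0 < - cos b.
Proof. intros Hb. pose proof (cos_lt_0 b ltac:(lra) ltac:(lra)). lra. Qed.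

Lemma weight_mod (x : R) (v : C) :
  Cmod (weight x v) = exp (x * (exp (Re v) * cos (Im v))) * exp (Re v).
Proof.
  unfold weight. rewrite Cmod_mult, !Cmod_Cexp. f_equal. f_equal.
  unfold Cexp, Re, Im; simpl. ring.
Qed.

(** On both rays the cosine is cos b < 0, so the decay is doubly exponential in t; only exp (- t) is
    retained, to allow comparison with an exponential. *)
Lemma weight_ray (x b t y : R) : 0 < x -> PI / 2 < b < PI -> y = b \/ y = - b ->
  Cmod (weight x (t, y)) <= 4 / ((x * - cos b) * (x * - cos b)) * exp (- (1 * t)).
Proof.
  intros Hx Hb Hy. rewrite weight_mod. unfold Re, Im; simpl.
  assert (E : cos y = cos b) by (destruct Hy as [-> | ->]; [|rewrite cos_neg]; auto).
  rewrite E. pose proof (cos_obtuse b Hb) as Hk. set (k := - cos b) in *.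
  replace (cos b) with (- k) by (unfold k; ring). rewrite Rmult_1_l.
  pose proof (exp_pos t).
  replace (x * (exp t * - k)) with (- (x * k * exp t)) by ring.
  assert (Hxk : 0 < x * k) by (apply Rmult_lt_0_compat; auto).
  pose proof (exp_neg_sqr (x * k * exp t) ltac:(apply Rmult_lt_0_compat; auto)) as H1.
  eapply Rle_trans; [apply Rmult_le_compat_r; [lra|exact H1]|].
  rewrite exp_Ropp. apply Req_le. field. split; [|split]; lra.
Qed.

Lemma weight_le (x : R) (v : C) : 0 < x -> Cmod (weight x v) <= exp (x * exp (Re v)) * exp (Re v).
Proof.
  intros Hx. rewrite weight_mod. apply Rmult_le_compat_r; [left; apply exp_pos|].
  apply exp_monotone. apply Rmult_le_compat_l; [lra|].
  rewrite <- (Rmult_1_r (exp (Re v))) at 2. apply Rmult_le_compat_l; [left; apply exp_pos|].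
  apply COS_bound.
Qed.

Lemma hankel_limit_Cdiff (f : C -> C) (b r S S' sg : R) :
  0 < b -> 0 < sg -> 0 <= S ->
  (forall t y, r <= t -> y = b \/ y = - b -> Cdiff f (t, y) /\ Cmod (f (t, y)) <= S * exp (- (sg * t))) ->
  (forall th, - b <= th <= b -> Cdiff f (r, th) /\ Cmod (f (r, th)) <= S') ->
  exists l, climit (hankel f b r) l /\ Cmod l <= 2 * (S * exp (- (sg * r)) / sg) + 2 * b * S'.
Proof.
  intros Hb Hsg HS H1 H2. apply hankel_limit; auto.
  - intros t Ht. split; apply Cdiff_cont, H1; auto.
  - intros t Ht. apply Cdiff_cont, H2; auto.
  - intros t Ht. split; apply H1; auto.
  - intros t Ht. apply H2; auto.
Qed.

Lemma hankel_weight_limit (f : C -> C) (b r x S : R) :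
  PI / 2 < b < PI -> 0 < x -> 0 <= S ->
  (forall v, Rabs (Im v) <= b -> r <= Re v -> Cdiff f v /\ Cmod (f v) <= S) ->
  exists l, climit (hankel (fun v => f v * weight x v)%C b r) l /\
    Cmod l <= S * (2 * (4 / ((x * - cos b) * (x * - cos b)) * exp (- r)) + 2 * b * (exp (x * exp r) * exp r)).
Proof.
  intros Hb Hx HS Hf. pose proof PI_RGT_0. pose proof (cos_obtuse b Hb).
  set (W := 4 / ((x * - cos b) * (x * - cos b))).
  assert (HW : 0 <= W).
  { apply Rlt_le, Rdiv_lt_0_compat; [lra|]. repeat apply Rmult_lt_0_compat; auto. }
  destruct (hankel_limit_Cdiff (fun v => f v * weight x v)%C b r (S * W) (S * (exp (x * exp r) * exp r)) 1)
    as (l & Hl & Hl2); try lra.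
  - apply Rmult_le_pos; auto.
  - intros t y Ht Hy.
    destruct (Hf (t, y)) as [F1 F2]; [|simpl; lra|].
    { simpl. destruct Hy as [-> | ->]; [|rewrite Rabs_Ropp]; rewrite Rabs_pos_eq; lra. }
    split; [apply Cdiff_mult; auto; apply Cdiff_weight|].
    rewrite Cmod_mult, Rmult_assoc. apply Rmult_le_compat; try apply Cmod_ge_0; auto.
    apply weight_ray; auto.
  - intros th Hth. destruct (Hf (r, th)) as [F1 F2]; [|simpl; lra|].
    { simpl. apply Rabs_le_between; lra. }
    split; [apply Cdiff_mult; auto; apply Cdiff_weight|].
    rewrite Cmod_mult. apply Rmult_le_compat; try apply Cmod_ge_0; auto.
    apply (weight_le x (r, th)); auto.
  - exists l. split; auto. eapply Rle_trans; [exact Hl2|]. apply Req_le. rewrite Rmult_1_l. field.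
Qed.

(** Lets one quantity inherit smallness in X from one bound and decay in t from another, each to a
    fractional power. *)
Lemma Rpower_interpolation (m a c k : R) : 0 < m -> m <= a -> m <= c -> 0 < k < 1 ->
  m <= Rpower a k * Rpower c (1 - k).
Proof.
  intros Hm Ha Hc Hk. unfold Rpower. rewrite <- exp_plus.
  rewrite <- (exp_ln m) at 1 by auto. apply exp_monotone.
  pose proof (Rcomplements.ln_le m a Hm Ha). pose proof (Rcomplements.ln_le m c Hm Hc). nra.
Qed.

(** * Hankel's formula derived from Euler's integral *)

Section HankelGamma.
Variables (s : C) (b : R).
Hypothesis Hs : 0 < Re s.
Hypothesis Hb : PI / 2 < b < PI.
(** With z = exp v, [ze] is 1 - z and [g0] dv is z^(-s) dz. The number k makes Re [ze] = 1 + k exp t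
    on the rays, T bounds the effect of Im s in the strip, and c0 bounds Re [ze] below on Re v = -1.
    That segment passes to the left of v = 0, so the only zero of [ze] in the strip is enclosed
    while [ze] has positive real part on the contour. *)
Let k := - cos b.
Let T := exp (Rabs (Im s) * b).
Let ze (v : C) : C := (1 - Cexp v)%C.
Let g0 (v : C) : C := (Cexp (- (s * v)) * Cexp v)%C.
Let c0 := 1 - exp (- (1)).

Lemma k_pos : 0 < k <= 1.
Proof. pose proof (cos_obtuse b Hb). pose proof (COS_bound b). unfold k. lra. Qed.

Lemma c0_pos : 0 < c0 < 1.
Proof.
  unfold c0. pose proof (exp_pos (- (1))).
  pose proof (exp_increasing (- (1)) 0 ltac:(lra)) as H1. rewrite exp_0 in H1. lra.
Qed.

Lemma cos_ray (y : R) : y = b \/ y = - b -> cos y = - k.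
Proof. unfold k. intros [-> | ->]; [|rewrite cos_neg]; ring. Qed.

Lemma g0_mod (v : C) : Rabs (Im v) <= b ->
  Cmod (g0 v) <= T * exp (- (Re s * Re v)) * exp (Re v).
Proof.
  intros Hv. unfold g0. rewrite Cmod_mult, Cmod_Cexp_lin, Cmod_Cexp.
  apply Rmult_le_compat_r; [left; apply exp_pos|]. unfold T. rewrite <- exp_plus.
  apply exp_monotone. pose proof (Rle_abs (Im s * Im v)) as H. rewrite Rabs_mult in H.
  pose proof (Rabs_pos (Im s)). nra.
Qed.

Lemma ze_ray (t y : R) : - (1) <= t -> y = b \/ y = - b ->
  Re (ze (t, y)) = 1 + k * exp t /\ k * exp t <= Cmod (ze (t, y)) <= 4 * exp t.
Proof.
  intros Ht Hy. pose proof k_pos as Hk. pose proof (exp_pos t).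
  assert (HR : Re (ze (t, y)) = 1 + k * exp t).
  { unfold ze, Re; simpl. rewrite cos_ray by auto. ring. }
  split; auto. split.
  - pose proof (Rabs_Re_le (ze (t, y))) as H1. rewrite HR, Rabs_pos_eq in H1 by nra. lra.
  - unfold ze. eapply Rle_trans; [apply Cmod_minus_triangle|]. rewrite Cmod_1, Cmod_Cexp.
    (* As t >= -1 and exp 1 <= 3, the constant 1 is at most 3 exp t, which gives the factor 4. *)
    simpl. assert (/ 3 <= exp t); [|lra].
    apply Rle_trans with (exp (- (1))); [|apply exp_monotone; lra].
    rewrite exp_Ropp. apply Rinv_le_contravar; [apply exp_pos|apply exp_le_3].
Qed.

Lemma ze_seg (th : R) : c0 <= Re (ze (- (1), th)) /\ c0 <= Cmod (ze (- (1), th)) <= 2.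
Proof.
  assert (H1 : c0 <= Re (ze (- (1), th))).
  { unfold ze, c0, Re; simpl. pose proof (COS_bound th). pose proof (exp_pos (- (1))). nra. }
  split; auto. split.
  - pose proof (Rabs_Re_le (ze (- (1), th))). pose proof (Rle_abs (Re (ze (- (1), th)))). lra.
  - unfold ze. eapply Rle_trans; [apply Cmod_minus_triangle|]. rewrite Cmod_1, Cmod_Cexp.
    pose proof c0_pos. unfold c0 in *. simpl. lra.
Qed.

Lemma ze_neq_0_re (v : C) : 0 < Re (ze v) -> ze v <> 0%C.
Proof. intros H E. rewrite E in H. simpl in H. lra. Qed.

Lemma Cdiff_ze (v : C) : Cdiff ze v.
Proof. apply Cdiff_minus; [apply Cdiff_const|apply Cdiff_Cexp, Cdiff_id]. Qed.

Lemma Cdiff_g0 (v : C) : Cdiff g0 v.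
Proof. apply Cdiff_mult; [apply Cdiff_exp_lin|apply Cdiff_Cexp, Cdiff_id]. Qed.

Lemma Cdiff_exp_ze (X : R) (v : C) : Cdiff (fun v => Cexp (- (RtoC X * ze v)))%C v.
Proof. apply Cdiff_Cexp, Cdiff_opp, Cdiff_mult; [apply Cdiff_const|apply Cdiff_ze]. Qed.

Lemma one_minus_exp (w : C) : 0 <= Re w ->
  Cmod (1 - Cexp (- w)) <= 2 /\ Cmod (1 - Cexp (- w)) <= 5 * Cmod w.
Proof.
  intros Hw.
  assert (H2 : Cmod (1 - Cexp (- w)) <= 2).
  { eapply Rle_trans; [apply Cmod_minus_triangle|]. rewrite Cmod_1, Cmod_Cexp.
    assert (exp (Re (- w)%C) <= exp 0) by (apply exp_monotone; unfold Re in *; simpl; lra).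
    rewrite exp_0 in H. lra. }
  split; auto. pose proof (Cmod_ge_0 w).
  destruct (Rle_dec (Cmod w) (1/2)) as [h|h]; [|lra].
  pose proof (Cexp_remainder_small (- w) ltac:(rewrite Cmod_opp; lra)) as H3.
  rewrite Cmod_opp in H3.
  replace (1 - Cexp (- w))%C with (w - (Cexp (- w) - 1 - - w))%C by ring.
  eapply Rle_trans; [apply Cmod_minus_triangle|]. nra.
Qed.

(* With A(X) the contour integral of aX X, A'(X) is X^(s-1) exp(-X) times the Hankel
   integral, while A(0) = 0 and A(infinity) = 2 pi i by the residue at v = 0. This gives
   Gamma(s) times the Hankel integral as 2 pi i, with neither analytic continuation nor the
   reflection formula. *)
Let aX (X : R) (v : C) : C := (g0 v * (1 - Cexp (- (RtoC X * ze v))) / ze v)%C.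

Lemma Re_scal (X : R) (w : C) : Re (RtoC X * w)%C = X * Re w.
Proof. unfold Re; simpl. ring. Qed.

Lemma Cdiff_aX (X : R) (v : C) : 0 < Re (ze v) -> Cdiff (aX X) v.
Proof.
  intros H. apply Cdiff_div; [|apply Cdiff_ze|apply ze_neq_0_re; auto].
  apply Cdiff_mult; [apply Cdiff_g0|]. apply Cdiff_minus; [apply Cdiff_const|apply Cdiff_exp_ze].
Qed.

Lemma ray_Re_pos (t y : R) : - (1) <= t -> y = b \/ y = - b -> 0 < Re (ze (t, y)).
Proof.
  intros Ht Hy. destruct (ze_ray t y Ht Hy) as [-> _]. pose proof k_pos. pose proof (exp_pos t). nra.
Qed.

Lemma seg_Re_pos (th : R) : 0 < Re (ze (- (1), th)).
Proof. pose proof (ze_seg th). pose proof c0_pos. lra. Qed.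

Lemma T_pos : 0 < T. Proof. apply exp_pos. Qed.

Lemma ray_im (t y : R) : y = b \/ y = - b -> Rabs (Im (t, y)) <= b.
Proof.
  pose proof PI_RGT_0. simpl. intros [-> | ->]; [|rewrite Rabs_Ropp]; rewrite Rabs_pos_eq; lra.
Qed.

Lemma g0_ray (t y : R) : y = b \/ y = - b -> Cmod (g0 (t, y)) <= T * (exp (- (Re s * t)) * exp t).
Proof. intros Hy. rewrite <- Rmult_assoc. apply (g0_mod (t, y)), ray_im; auto. Qed.

Lemma g0_seg (th : R) : - b <= th <= b -> Cmod (g0 (- (1), th)) <= T * exp (Re s).
Proof.
  intros Hth. eapply Rle_trans; [apply g0_mod; simpl; apply Rabs_le_between; lra|].
  simpl. replace (- (Re s * - (1))) with (Re s) by ring.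
  assert (exp (- (1)) <= 1) by (pose proof c0_pos; unfold c0 in *; lra).
  rewrite <- (Rmult_1_r (T * exp (Re s))) at 2. apply Rmult_le_compat_l; auto.
  apply Rmult_le_pos; left; [apply T_pos|apply exp_pos].
Qed.

(** The factor (1 - exp (- X ze)) / ze is at most 5 X and at most (2 / k) exp (- t) on the rays.
    Interpolating with q = min (Re s, 1) / 2 leaves X^q times exp (- (Re s - q) t): integrable since
    q < Re s, and vanishing as X tends to 0 since q > 0. *)
Lemma aX_limit (X : R) : 0 < X -> exists l, climit (hankel (aX X) b (- (1))) l /\
  Cmod l <= 2 * (T * (Rpower (5 * X) (Rmin (Re s) 1 / 2) * Rpower (2 / k) (1 - Rmin (Re s) 1 / 2))
     * exp (- ((Re s - Rmin (Re s) 1 / 2) * - (1))) / (Re s - Rmin (Re s) 1 / 2))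
     + 2 * b * (T * exp (Re s) * (5 * X)).
Proof.
  intros HX. pose proof PI_RGT_0. pose proof k_pos as Hk. pose proof T_pos as HT.
  set (q := Rmin (Re s) 1 / 2).
  assert (Hq : 0 < q /\ q < 1 /\ q < Re s).
  { unfold q. pose proof (Rmin_l (Re s) 1). pose proof (Rmin_r (Re s) 1).
    assert (0 < Rmin (Re s) 1) by (apply Rmin_pos; lra). lra. }
  assert (Hfac : forall v, 0 < Re (ze v) -> Cmod (aX X v) = Cmod (g0 v) * (Cmod (1 - Cexp (- (RtoC X * ze v))) / Cmod (ze v))).
  { intros v Hv. unfold aX. rewrite Cmod_div, Cmod_mult by (apply ze_neq_0_re; auto). unfold Rdiv; ring. }
  apply hankel_limit_Cdiff; try lra.
  - apply Rmult_le_pos; [lra|]. apply Rmult_le_pos; left; apply exp_pos.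
  - intros t y Ht Hy. pose proof (ray_Re_pos t y Ht Hy) as Hre.
    split; [apply Cdiff_aX; auto|]. rewrite Hfac by auto.
    destruct (ze_ray t y Ht Hy) as [_ [HZ _]]. pose proof (exp_pos t) as Het.
    assert (HZ0 : 0 < Cmod (ze (t, y))) by nra.
    destruct (one_minus_exp (RtoC X * ze (t, y))%C) as [E1 E2].
    { rewrite Re_scal. apply Rmult_le_pos; lra. }
    rewrite Cmod_mult, Cmod_RtoC_pos in E2 by lra.
    set (m := Cmod (1 - Cexp (- (RtoC X * ze (t, y)))) / Cmod (ze (t, y))).
    assert (Hm1 : m <= 5 * X) by (apply Rle_div_l; lra).
    assert (Hm2 : m <= 2 / k * exp (- t)).
    { apply Rle_div_l; auto. eapply Rle_trans; [exact E1|].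
      apply Rle_trans with (2 / k * exp (- t) * (k * exp t)).
      - rewrite exp_Ropp. apply Req_le. field. lra.
      - apply Rmult_le_compat_l; auto. apply Rmult_le_pos; [|left; apply exp_pos].
        apply Rlt_le, Rdiv_lt_0_compat; lra. }
    assert (Hm : m <= Rpower (5 * X) q * Rpower (2 / k) (1 - q) * exp (- ((1 - q) * t))).
    { destruct (Rle_dec m 0) as [h|h].
      - eapply Rle_trans; [exact h|]. left. repeat apply Rmult_lt_0_compat; apply exp_pos.
      - eapply Rle_trans; [apply (Rpower_interpolation m (5 * X) (2 / k * exp (- t)) q); lra|].
        rewrite Rmult_assoc. apply Rmult_le_compat_l; [left; apply exp_pos|].
        apply Req_le. unfold Rpower.
        rewrite ln_mult by (try apply exp_pos; apply Rdiv_lt_0_compat; lra).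
        rewrite ln_exp, <- exp_plus. f_equal. ring. }
    apply Rle_trans with (T * (exp (- (Re s * t)) * exp t) * (Rpower (5 * X) q * Rpower (2 / k) (1 - q) * exp (- ((1 - q) * t)))).
    { apply Rmult_le_compat; auto; [apply Cmod_ge_0| |apply g0_ray; auto].
      apply Rmult_le_pos; [apply Cmod_ge_0|left; apply Rinv_0_lt_compat; auto]. }
    apply Req_le. rewrite <- !Rmult_assoc.
    replace (exp (- ((Re s - q) * t))) with (exp (- (Re s * t)) * exp t * exp (- ((1 - q) * t))).
    + ring.
    + rewrite <- !exp_plus. f_equal. ring.
  - intros th Hth. pose proof (seg_Re_pos th) as Hre. split; [apply Cdiff_aX; auto|].
    rewrite Hfac by auto.
    destruct (ze_seg th) as [_ [HZ _]]. pose proof c0_pos.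
    destruct (one_minus_exp (Cmult (RtoC X) (ze (- (1), th)))) as [E1 E2].
    { rewrite Re_scal. apply Rmult_le_pos; lra. }
    rewrite Cmod_mult, Cmod_RtoC_pos in E2 by lra.
    apply Rmult_le_compat; [apply Cmod_ge_0| |apply g0_seg; auto|apply Rle_div_l; lra].
    apply Rmult_le_pos; [apply Cmod_ge_0|left; apply Rinv_0_lt_compat; lra].
Qed.
(** In this strip 1 - exp v vanishes only at v = 0, with derivative -1, whence the sign. *)
Lemma residue_at_0 (M : R) : 0 < M ->
  rect_int (fun v => g0 v / ze v)%C (- (1)) M (- b) b = (- (RtoC (2 * PI) * Ci))%C.
Proof.
  intros HM. pose proof PI_RGT_0.
  assert (E0 : Cexp (0, 0) = 1%C) by exact Cexp_0.
  rewrite (residue_quotient g0 ze (- (1))%C (- (1)) M (- b) b 0 0); try lra.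
  - unfold g0. replace (- (s * (0, 0)))%C with (0, 0) by (apply injective_projections; simpl; ring).
    rewrite E0. field.
  - intros E. apply (f_equal fst) in E. simpl in E. lra.
  - intros; apply Cdiff_g0.
  - intros; apply Cdiff_ze.
  - intros z [_ Hz] Hn E. apply Hn. apply Cexp_eq_1.
    + unfold ze in E. symmetry. apply Cminus_eq_0. exact E.
    + apply Rabs_lt_between. lra.
  - unfold ze. rewrite E0. ring.
  - unfold ze. apply is_Cder_slope.
    assert (Hc : is_Cder (fun v => 1 + - (1) * Cexp v)%C (0, 0) (0 + (0 * Cexp (0, 0) + - (1) * Cexp (0, 0)))%C).
    { apply is_Cder_plus; [apply is_Cder_const|].
      apply (is_Cder_mult (fun _ => (- (1))%C) Cexp); [apply is_Cder_const|apply is_Cder_Cexp]. }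
    apply is_Cder_slope in Hc. destruct Hc as (q & Hq1 & Hq2 & Hq3).
    exists q. split; [rewrite Hq1, E0; ring|split; auto].
    intros w. specialize (Hq3 w).
    replace (1 - Cexp w)%C with (1 + - (1) * Cexp w)%C by ring. rewrite Hq3. ring.
Qed.

Lemma exp_decay_small (sg e : R) : 0 < sg -> 0 < e -> exists M0, forall M, M0 <= M -> exp (- (sg * M)) <= e.
Proof.
  intros Hsg He. exists (- ln e / sg). intros M HM.
  rewrite <- (exp_ln e) by auto. apply exp_monotone.
  assert (sg * (- ln e / sg) <= sg * M) by (apply Rmult_le_compat_l; lra).
  replace (sg * (- ln e / sg)) with (- ln e) in H by (field; lra). lra.
Qed.

(** The contour closed by Re v = M encloses the pole at v = 0, and on the closing segment the
    integrand is O(exp (- Re s * M)). *)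
Lemma aInf_limit : climit (hankel (fun v => g0 v / ze v)%C b (- (1))) (RtoC (2 * PI) * Ci)%C.
Proof.
  intros e He. pose proof PI_RGT_0. pose proof T_pos as HT.
  destruct (exp_decay_small (Re s) (e / (4 * b * T))) as [M0 HM0]; auto.
  { apply Rdiv_lt_0_compat; auto. repeat apply Rmult_lt_0_compat; lra. }
  exists (Rmax 1 M0). intros M HM. pose proof (Rmax_l 1 M0). pose proof (Rmax_r 1 M0).
  rewrite hankel_rect, residue_at_0 by lra.
  replace (vint (fun v => g0 v / ze v)%C M (- b) b - - (RtoC (2 * PI) * Ci) - RtoC (2 * PI) * Ci)%C
    with (vint (fun v => g0 v / ze v)%C M (- b) b) by ring.
  unfold vint. rewrite Cmod_mult, Cmod_Ci, Rmult_1_l.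
  assert (HeM : 2 <= exp M) by (pose proof (exp_ineq1_le M); lra).
  assert (Hze : forall th, exp M / 2 <= Cmod (ze (M, th))).
  { intros th. unfold ze. rewrite Cmod_minus_sym.
    pose proof (Cmod_triangle_rev (Cexp (M, th)) 1) as H2. rewrite Cmod_1, Cmod_Cexp in H2.
    simpl in H2. lra. }
  assert (Hz0 : forall th, ze (M, th) <> 0%C).
  { intros th. apply Cmod_gt_0. specialize (Hze th). lra. }
  eapply Rle_trans; [apply CI_norm with (M := 2 * T * exp (- (Re s * M))); try lra|].
  - apply (Rcont_on_v (fun v => g0 v / ze v)%C). intros t _. apply Cdiff_cont, Cdiff_div; auto;
      [apply Cdiff_g0|apply Cdiff_ze].
  - intros th Hth. rewrite Cmod_div by auto. specialize (Hze th).
    apply Rle_div_l; [lra|].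
    eapply Rle_trans; [apply g0_mod; simpl; apply Rabs_le_between; lra|]. simpl.
    apply Rle_trans with (2 * T * exp (- (Re s * M)) * (exp M / 2)); [apply Req_le; field|].
    apply Rmult_le_compat_l; auto. repeat apply Rmult_le_pos; try lra. left; apply exp_pos.
  - specialize (HM0 M ltac:(lra)).
    apply Rle_trans with ((b - - b) * (2 * T * (e / (4 * b * T)))).
    + apply Rmult_le_compat_l; [lra|]. apply Rmult_le_compat_l; lra.
    + apply Req_le. field. lra.
Qed.

Lemma hankel_kernel_limit_ex : exists h, climit (fun M => vint (hankel_kernel s 1) M (- b) b) h.
Proof.
  pose proof PI_RGT_0. pose proof T_pos as HT.
  destruct (hankel_weight_limit (fun v => Cexp (- (s * v)))%C b (- (1)) 1 (T * exp (Re s))) as (h & Hh & _); try lra.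
  - apply Rmult_le_pos; left; [auto|apply exp_pos].
  - intros v Hv1 Hv2. split; [apply Cdiff_exp_lin|].
    rewrite Cmod_Cexp_lin. unfold T. rewrite <- exp_plus. apply exp_monotone.
    pose proof (Rle_abs (Im s * Im v)) as H1. rewrite Rabs_mult in H1.
    pose proof (Rabs_pos (Im s)). nra.
  - exists h. eapply climit_ext; [|exact Hh]. intros M HM.
    apply (hankel_entire (hankel_kernel s 1) b (- (1)) M); [lra|exact HM|].
    intros; apply Cdiff_hankel_kernel.
Qed.

Lemma RtoC_exp_ln (x : R) : 0 < x -> Cexp (RtoC (ln x)) = RtoC x.
Proof. intros Hx. rewrite Cexp_RtoC, exp_ln; auto. Qed.

(** Scaling z by x is translation of v by ln x. Since only the limit in Re v counts, the dependence
    on x is a mere factor x^(s-1). *)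
Lemma hankel_kernel_scale (x : R) (v : C) : 0 < x ->
  hankel_kernel s x v = (Rcpow x (s - 1) * hankel_kernel s 1 (v + RtoC (ln x)))%C.
Proof.
  intros Hx. unfold hankel_kernel, weight, Rcpow. rewrite !Cexp_plus, RtoC_exp_ln by auto.
  replace (- (s * (v + RtoC (ln x))))%C with (- (s * v) + - (s * RtoC (ln x)))%C by ring.
  replace ((s - 1) * RtoC (ln x))%C with (s * RtoC (ln x) + - RtoC (ln x))%C by ring.
  rewrite !Cexp_plus, !Cexp_opp, RtoC_exp_ln by auto.
  replace (RtoC 1 * (Cexp v * RtoC x))%C with (RtoC x * Cexp v)%C by ring.
  field. repeat split; try apply Cexp_neq_0. apply RtoC_neq_0; lra.
Qed.

Lemma hankel_kernel_limit_scale (x : R) (h : C) : 0 < x ->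
  climit (fun M => vint (hankel_kernel s 1) M (- b) b) h ->
  climit (fun M => vint (hankel_kernel s x) M (- b) b) (Rcpow x (s - 1) * h)%C.
Proof.
  intros Hx Hh. pose proof PI_RGT_0.
  apply climit_ext with (m := 0) (F := fun M => (Rcpow x (s - 1) * vint (hankel_kernel s 1) (M + ln x) (- b) b)%C).
  - intros M _. rewrite <- vint_scal; [|lra|intros; apply Cdiff_cont, Cdiff_hankel_kernel].
    unfold vint. f_equal. apply CI_ext. intros t _.
    rewrite (hankel_kernel_scale x (M, t)) by auto. rewrite RtoC_pair. reflexivity.
  - apply climit_scal. apply (climit_shift (fun M => vint (hankel_kernel s 1) M (- b) b)). auto.
Qed.

Lemma g0_exp_ze (X : R) (v : C) :
  (g0 v * Cexp (- (RtoC X * ze v)) = RtoC (exp (- X)) * hankel_kernel s X v)%C.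
Proof.
  unfold g0, hankel_kernel, weight, ze.
  replace (- (RtoC X * (1 - Cexp v)))%C with (RtoC (- X) + RtoC X * Cexp v)%C by (rewrite RtoC_opp; ring).
  rewrite Cexp_plus, Cexp_RtoC. ring.
Qed.

(** First-order Taylor remainder of [aX] in X. Differentiation under the integral amounts to
    bounding the contour integral of this remainder by K d^2. *)
Let DX (X d : R) (v : C) : C :=
  (aX (X + d) v + (- (1) * aX X v + - RtoC d * (g0 v * Cexp (- (RtoC X * ze v)))))%C.

(** The restriction |d| <= X / 2 keeps half of the decay of exp (- X ze) after multiplication by the
    exponential in the remainder. *)
Lemma DX_bound (X d : R) (v : C) : 0 < X -> Rabs d <= X / 2 -> 0 < Re (ze v) ->
  Cmod (DX X d v) <= Cmod (g0 v) * (24 * (d * d) * Cmod (ze v) * exp (- (X / 2 * Re (ze v)))).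
Proof.
  intros HX Hd Hre. pose proof (ze_neq_0_re v Hre) as Hz. apply Rabs_le_between in Hd.
  assert (E : DX X d v = (g0 v * (Cexp (- (RtoC X * ze v)) *
     - (Cexp (- (RtoC d * ze v)) - 1 - - (RtoC d * ze v)) / ze v))%C).
  { unfold DX, aX. replace (- (RtoC (X + d) * ze v))%C with (- (RtoC X * ze v) + - (RtoC d * ze v))%C
      by (rewrite RtoC_plus; ring).
    rewrite Cexp_plus. field. auto. }
  rewrite E, Cmod_mult. apply Rmult_le_compat_l; [apply Cmod_ge_0|].
  rewrite Cmod_div, Cmod_mult, Cmod_opp, Cmod_Cexp by auto.
  pose proof (Cexp_remainder (- (RtoC d * ze v))) as HR.
  rewrite Cmod_opp, Cmod_mult, Cmod_R in HR.
  assert (Re1 : Re (- (RtoC d * ze v))%C = - (d * Re (ze v))) by (unfold Re; simpl; ring).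
  assert (Re2 : Re (- (RtoC X * ze v))%C = - (X * Re (ze v))) by (unfold Re; simpl; ring).
  rewrite Re1 in HR. rewrite Re2.
  set (m := Cmod (ze v)) in *. set (u := Re (ze v)) in *.
  assert (Hm : 0 < m) by (apply Cmod_gt_0; auto).
  apply Rle_div_l; auto.
  assert (Hdd : (Rabs d * m) ^ 2 = d * d * (m * m)).
  { replace ((Rabs d * m) ^ 2) with ((Rabs d * Rabs d) * (m * m)) by ring.
    rewrite <- Rabs_mult, Rabs_pos_eq by nra. ring. }
  rewrite Hdd in HR.
  eapply Rle_trans; [apply Rmult_le_compat_l; [left; apply exp_pos|exact HR]|].
  assert (K : exp (- (X * u)) * (1 + exp (- (d * u))) <= 2 * exp (- (X / 2 * u))).
  { rewrite Rmult_plus_distr_l, Rmult_1_r, <- exp_plus.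
    assert (exp (- (X * u)) <= exp (- (X / 2 * u))) by (apply exp_monotone; nra).
    assert (exp (- (X * u) + - (d * u)) <= exp (- (X / 2 * u))) by (apply exp_monotone; nra). lra. }
  assert (0 <= d * d * (m * m)) by (apply Rmult_le_pos; nra).
  replace (exp (- (X * u)) * (12 * (d * d * (m * m) * (1 + exp (- (d * u))))))
    with (12 * (d * d * (m * m)) * (exp (- (X * u)) * (1 + exp (- (d * u))))) by ring.
  apply Rle_trans with (12 * (d * d * (m * m)) * (2 * exp (- (X / 2 * u)))).
  - apply Rmult_le_compat_l; lra.
  - apply Req_le. ring.
Qed.

Lemma Cdiff_g0_exp (X : R) (v : C) : Cdiff (fun v => g0 v * Cexp (- (RtoC X * ze v)))%C v.
Proof. apply Cdiff_mult; [apply Cdiff_g0|apply Cdiff_exp_ze]. Qed.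

Lemma DX_limit (X : R) : 0 < X -> exists K, 0 <= K /\ forall d, Rabs d <= X / 2 ->
  exists l, climit (hankel (DX X d) b (- (1))) l /\ Cmod l <= K * (d * d).
Proof.
  intros HX. pose proof PI_RGT_0. pose proof k_pos as Hk. pose proof T_pos as HT.
  set (q := X / 2 * k). assert (Hq : 0 < q) by (unfold q; nra).
  (* 24 comes from [DX_bound], 4 from |ze| <= 4 exp t, and 4 / q^2 from quadratic decay of the
     exponential; on the segment 48 is 24 times |ze| <= 2. *)
  set (S1 := T * (24 * 4 * (4 / (q * q)))). set (S2 := T * exp (Re s) * 48).
  assert (Hqq : 0 < q * q) by nra.
  assert (HS1 : 0 <= S1).
  { unfold S1. apply Rmult_le_pos; [lra|]. apply Rmult_le_pos; [lra|]. apply Rlt_le, Rdiv_lt_0_compat; lra. }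
  assert (HS2 : 0 <= S2).
  { unfold S2. apply Rmult_le_pos; [|lra]. apply Rmult_le_pos; left; [auto|apply exp_pos]. }
  exists (2 * (S1 * exp (- (Re s * - (1))) / Re s) + 2 * b * S2).
  split.
  { apply Rplus_le_le_0_compat; [|apply Rmult_le_pos; lra].
    apply Rmult_le_pos; [lra|]. apply Rmult_le_pos; [|left; apply Rinv_0_lt_compat; auto].
    apply Rmult_le_pos; auto. left; apply exp_pos. }
  intros d Hd.
  assert (Hdd : 0 <= d * d) by nra.
  assert (HDd : forall v, 0 < Re (ze v) -> Cdiff (DX X d) v).
  { intros v Hv. unfold DX. apply Cdiff_plus; [apply Cdiff_aX; auto|].
    apply Cdiff_plus; apply Cdiff_mult; try apply Cdiff_const; [apply Cdiff_aX; auto|apply Cdiff_g0_exp]. }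
  destruct (hankel_limit_Cdiff (DX X d) b (- (1)) (S1 * (d * d)) (S2 * (d * d)) (Re s)) as (l & Hl & Hl2); try lra.
  - apply Rmult_le_pos; auto.
  - intros t y Ht Hy. pose proof (ray_Re_pos t y Ht Hy) as Hre. split; [auto|].
    eapply Rle_trans; [apply DX_bound; auto|].
    destruct (ze_ray t y Ht Hy) as [Hr1 [_ Hr2]]. pose proof (exp_pos t) as Het.
    set (u := exp t) in *.
    assert (HE : exp (- (X / 2 * Re (ze (t, y)))) <= 4 / (q * q) / (u * u)).
    { rewrite Hr1. apply Rle_trans with (exp (- (q * u))).
      - apply exp_monotone. unfold q. nra.
      - eapply Rle_trans; [apply exp_neg_sqr; nra|]. apply Req_le. field. split; lra. }
    apply Rle_trans with (T * (exp (- (Re s * t)) * u) * (24 * (d * d) * (4 * u) * (4 / (q * q) / (u * u)))).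
    + pose proof (Cmod_ge_0 (ze (t, y))). pose proof (exp_pos (- (X / 2 * Re (ze (t, y))))).
      apply Rmult_le_compat; [apply Cmod_ge_0| |apply g0_ray; auto|].
      * apply Rmult_le_pos; [|lra]. apply Rmult_le_pos; lra.
      * apply Rmult_le_compat; try lra; [apply Rmult_le_pos; lra|].
        apply Rmult_le_compat_l; lra.
    + apply Req_le. unfold S1. field. split; lra.
  - intros th Hth. pose proof (seg_Re_pos th) as Hre. split; [auto|].
    eapply Rle_trans; [apply DX_bound; auto|].
    destruct (ze_seg th) as [_ [_ Hr2]].
    pose proof (Cmod_ge_0 (ze (- (1), th))). pose proof (exp_pos (- (X / 2 * Re (ze (- (1), th))))).
    assert (HE : exp (- (X / 2 * Re (ze (- (1), th)))) <= 1).
    { apply Rle_trans with (exp 0); [apply exp_monotone|rewrite exp_0; lra].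
      assert (0 <= X / 2 * Re (ze (- (1), th))) by (apply Rmult_le_pos; lra). lra. }
    apply Rle_trans with (T * exp (Re s) * (24 * (d * d) * 2 * 1)).
    + apply Rmult_le_compat; [apply Cmod_ge_0| |apply g0_seg; auto|].
      * apply Rmult_le_pos; [|lra]. apply Rmult_le_pos; lra.
      * apply Rmult_le_compat; try lra; [apply Rmult_le_pos; lra|].
        apply Rmult_le_compat_l; lra.
    + apply Req_le. unfold S2. ring.
  - exists l. split; auto. eapply Rle_trans; [exact Hl2|]. apply Req_le. field. lra.
Qed.

Lemma contour_aX (X : R) : cont_on_contour b (- (1)) (aX X).
Proof.
  apply cont_on_contour_Cdiff.
  - intros t Ht. split; apply Cdiff_aX, ray_Re_pos; auto.
  - intros th Hth. apply Cdiff_aX, seg_Re_pos.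
Qed.

Lemma contour_g0_exp (X : R) : cont_on_contour b (- (1)) (fun v => g0 v * Cexp (- (RtoC X * ze v)))%C.
Proof.
  apply cont_on_contour_Cdiff; intros; [split|]; apply Cdiff_g0_exp.
Qed.

Lemma contour_scal (c : C) (r : R) (f : C -> C) : cont_on_contour b r f -> cont_on_contour b r (fun v => c * f v)%C.
Proof.
  intros [H1 H2]. split.
  - intros t Ht. destruct (H1 t Ht). split; apply Ccont_mult; auto; apply Ccont_const.
  - intros t Ht. apply Ccont_mult; auto; apply Ccont_const.
Qed.

Lemma contour_plus (r : R) (f g : C -> C) : cont_on_contour b r f -> cont_on_contour b r g ->
  cont_on_contour b r (fun v => f v + g v)%C.
Proof.
  intros [H1 H2] [G1 G2]. split.
  - intros t Ht. destruct (H1 t Ht), (G1 t Ht). split; apply Ccont_plus; auto.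
  - intros t Ht. apply Ccont_plus; auto.
Qed.

Lemma A_derivative (A : R -> C) (h : C) (X : R) :
  (forall X, 0 < X -> climit (hankel (aX X) b (- (1))) (A X)) ->
  climit (fun M => vint (hankel_kernel s 1) M (- b) b) h -> 0 < X ->
  Rder A X (RtoC (exp (- X)) * (Rcpow X (s - 1) * h))%C.
Proof.
  intros HA Hh HX e He. pose proof PI_RGT_0.
  destruct (DX_limit X HX) as (K & HK & HD).
  exists (Rmin (X / 2) (e / (K + 1))). split; [apply Rmin_pos; [lra|apply Rdiv_lt_0_compat; lra]|].
  intros Y HY. pose proof (Rmin_l (X / 2) (e / (K + 1))). pose proof (Rmin_r (X / 2) (e / (K + 1))).
  set (d := Y - X) in *. replace Y with (X + d) by (unfold d; ring).
  assert (Hd2 : Rabs d <= X / 2) by lra. pose proof Hd2 as Hd3. apply Rabs_le_between in Hd3.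
  destruct (HD d Hd2) as (l & Hl & Hl2).
  assert (El : l = (A (X + d)%R - A X - RtoC (exp (- X)) * (Rcpow X (s - 1) * h) * RtoC d)%C).
  { apply (climit_unique _ _ _ Hl).
    replace (A (X + d)%R - A X - RtoC (exp (- X)) * (Rcpow X (s - 1) * h) * RtoC d)%C
      with (A (X + d)%R + (- (1) * A X + - RtoC d * (RtoC (exp (- X)) * (Rcpow X (s - 1) * h))))%C by ring.
    apply climit_ext with (m := - (1)) (F := fun M => (hankel (aX (X + d)) b (- (1)) M +
       (- (1) * hankel (aX X) b (- (1)) M + - RtoC d * hankel (fun v => g0 v * Cexp (- (RtoC X * ze v)))%C b (- (1)) M))%C).
    - intros M HM. unfold DX.
      pose proof (contour_aX (X + d)) as C1. pose proof (contour_aX X) as C2. pose proof (contour_g0_exp X) as C3.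
      rewrite (hankel_plus b (- (1)) ltac:(lra) (aX (X + d))); auto.
      + rewrite (hankel_plus b (- (1)) ltac:(lra) (fun v => - (1) * aX X v)%C); auto.
        * rewrite !(hankel_scal b (- (1)) ltac:(lra)); auto.
        * apply contour_scal; auto.
        * apply (contour_scal (- RtoC d)%C (- (1)) (fun v => g0 v * Cexp (- (RtoC X * ze v)))%C); auto.
      + apply (contour_plus (- (1)) (fun v => - (1) * aX X v)%C); [apply contour_scal; auto|].
        apply (contour_scal (- RtoC d)%C (- (1)) (fun v => g0 v * Cexp (- (RtoC X * ze v)))%C); auto.
    - apply climit_plus; [apply HA; lra|]. apply climit_plus; apply climit_scal; [apply HA; lra|].
      apply climit_ext with (m := - (1)) (F := fun M => (RtoC (exp (- X)) * vint (hankel_kernel s X) M (- b) b)%C).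
      + intros M HM. rewrite (hankel_entire _ b (- (1)) M); [|lra|auto|intros; apply Cdiff_g0_exp].
        rewrite <- vint_scal; [|lra|intros; apply Cdiff_cont, Cdiff_hankel_kernel].
        unfold vint. f_equal. apply CI_ext. intros t _. symmetry. apply g0_exp_ze.
      + apply climit_scal. apply hankel_kernel_limit_scale; auto. }
  rewrite <- El. eapply Rle_trans; [exact Hl2|].
  replace (d * d) with (Rabs d * Rabs d) by (rewrite <- Rabs_mult; apply Rabs_pos_eq; nra).
  rewrite <- Rmult_assoc. apply Rmult_le_compat_r; [apply Rabs_pos|].
  apply Rle_trans with ((K + 1) * (e / (K + 1))); [|apply Req_le; field; lra].
  apply Rmult_le_compat; try lra. apply Rabs_pos.
Qed.

(** Removing the limit value leaves the contour integral of - g0 exp (- X ze) / ze, and Re ze >= c0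
    on the whole contour makes it O(exp (- c0 X)). *)
Lemma A_at_infinity (A : R -> C) :
  (forall X, 0 < X -> climit (hankel (aX X) b (- (1))) (A X)) -> climit A (RtoC (2 * PI) * Ci)%C.
Proof.
  intros HA. pose proof PI_RGT_0. pose proof k_pos as Hk. pose proof T_pos as HT. pose proof c0_pos as Hc0.
  set (S1 := T / k). set (S2 := T * exp (Re s) / c0).
  assert (HS1 : 0 < S1) by (apply Rdiv_lt_0_compat; lra).
  assert (HS2 : 0 < S2) by (apply Rdiv_lt_0_compat; [apply Rmult_lt_0_compat; [auto|apply exp_pos]|lra]).
  set (K := 2 * (S1 * exp (- (Re s * - (1))) / Re s) + 2 * b * S2).
  assert (HK : 0 < K).
  { unfold K. apply Rplus_lt_0_compat; [|apply Rmult_lt_0_compat; lra].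
    apply Rmult_lt_0_compat; [lra|]. apply Rdiv_lt_0_compat; auto.
    apply Rmult_lt_0_compat; auto. apply exp_pos. }
  assert (HB : forall X, 0 < X -> Cmod (A X - RtoC (2 * PI) * Ci) <= K * exp (- (c0 * X))).
  { intros X HX.
    set (f := fun v => (- (g0 v * Cexp (- (RtoC X * ze v)) / ze v))%C).
    assert (Hfd : forall v, 0 < Re (ze v) -> Cdiff f v).
    { intros v Hv. unfold f. apply Cdiff_opp, Cdiff_div; [apply Cdiff_g0_exp|apply Cdiff_ze|apply ze_neq_0_re; auto]. }
    assert (Hid : forall v, 0 < Re (ze v) -> f v = (aX X v + - (1) * (g0 v / ze v))%C).
    { intros v Hv. unfold f, aX. pose proof (ze_neq_0_re v Hv). field. auto. }
    assert (Hfm : forall v, 0 < Re (ze v) -> c0 <= Re (ze v) ->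
      Cmod (f v) <= exp (- (c0 * X)) * (Cmod (g0 v) / Cmod (ze v))).
    { intros v Hv Hv2. unfold f. pose proof (ze_neq_0_re v Hv).
      rewrite Cmod_opp, Cmod_div, Cmod_mult, Cmod_Cexp by auto.
      replace (Cmod (g0 v) * exp (Re (- (RtoC X * ze v))%C) / Cmod (ze v))
        with (exp (Re (- (RtoC X * ze v))%C) * (Cmod (g0 v) / Cmod (ze v))) by (unfold Rdiv; ring).
      apply Rmult_le_compat_r.
      - apply Rmult_le_pos; [apply Cmod_ge_0|]. left; apply Rinv_0_lt_compat, Cmod_gt_0; auto.
      - apply exp_monotone. replace (Re (- (RtoC X * ze v))%C) with (- (X * Re (ze v))) by (unfold Re; simpl; ring). nra. }
    pose proof (exp_pos (- (c0 * X))) as HeX.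
    destruct (hankel_limit_Cdiff f b (- (1)) (S1 * exp (- (c0 * X))) (S2 * exp (- (c0 * X))) (Re s)) as (l & Hl & Hl2); try lra.
    - apply Rmult_le_pos; lra.
    - intros t y Ht Hy. pose proof (ray_Re_pos t y Ht Hy) as Hre. split; [auto|].
      destruct (ze_ray t y Ht Hy) as [Hr1 [Hr2 _]]. pose proof (exp_pos t) as Het.
      eapply Rle_trans; [apply Hfm; auto; rewrite Hr1; nra|].
      rewrite (Rmult_comm S1), Rmult_assoc. apply Rmult_le_compat_l; [lra|].
      apply Rle_div_l; [nra|]. eapply Rle_trans; [apply g0_ray; auto|].
      apply Rle_trans with (S1 * exp (- (Re s * t)) * (k * exp t)).
      + unfold S1. apply Req_le. field. lra.
      + apply Rmult_le_compat_l; auto. apply Rmult_le_pos; [lra|left; apply exp_pos].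
    - intros th Hth. pose proof (seg_Re_pos th) as Hre. split; [auto|].
      destruct (ze_seg th) as [Hr1 [Hr2 _]].
      eapply Rle_trans; [apply Hfm; auto|].
      rewrite (Rmult_comm S2). apply Rmult_le_compat_l; [lra|].
      apply Rle_div_l; [lra|]. eapply Rle_trans; [apply g0_seg; auto|].
      apply Rle_trans with (S2 * c0); [unfold S2; apply Req_le; field; lra|].
      apply Rmult_le_compat_l; lra.
    - replace (A X - RtoC (2 * PI) * Ci)%C with l.
      + eapply Rle_trans; [exact Hl2|]. apply Req_le. unfold K. field. lra.
      + apply (climit_unique _ _ _ Hl).
        replace (A X - RtoC (2 * PI) * Ci)%C with (A X + - (1) * (RtoC (2 * PI) * Ci))%C by ring.
        apply climit_ext with (m := - (1)) (F := fun M => (hankel (aX X) b (- (1)) M +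
          - (1) * hankel (fun v => g0 v / ze v)%C b (- (1)) M)%C).
        * intros M HM.
          assert (Cq : cont_on_contour b (- (1)) (fun v => g0 v / ze v)%C).
          { apply cont_on_contour_Cdiff.
            - intros t Ht. split; apply Cdiff_div; try apply Cdiff_g0; try apply Cdiff_ze;
                apply ze_neq_0_re, ray_Re_pos; auto.
            - intros th Hth. apply Cdiff_div; try apply Cdiff_g0; try apply Cdiff_ze. apply ze_neq_0_re, seg_Re_pos. }
          rewrite <- (hankel_scal b (- (1)) ltac:(lra)) by auto.
          rewrite <- (hankel_plus b (- (1)) ltac:(lra)); auto.
          -- apply hankel_ext; try lra.
             ++ intros t Ht. split; symmetry; apply Hid, ray_Re_pos; auto.
             ++ intros th _. symmetry; apply Hid, seg_Re_pos.
          -- apply contour_aX.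
          -- apply contour_scal; auto.
        * apply climit_plus; [apply HA; auto|apply climit_scal, aInf_limit]. }
  intros e He. destruct (exp_decay_small c0 (e / K)) as [M0 HM0]; [lra|apply Rdiv_lt_0_compat; auto|].
  exists (Rmax 1 M0). intros M HM. pose proof (Rmax_l 1 M0). pose proof (Rmax_r 1 M0).
  eapply Rle_trans; [apply HB; lra|].
  apply Rle_trans with (K * (e / K)); [|apply Req_le; field; lra].
  apply Rmult_le_compat_l; [lra|]. apply HM0; lra.
Qed.

Lemma A_at_zero (A : R -> C) :
  (forall X, 0 < X -> climit (hankel (aX X) b (- (1))) (A X)) ->
  forall e, 0 < e -> exists d, 0 < d /\ forall X, 0 < X < d -> Cmod (A X) <= e.
Proof.
  intros HA e He. pose proof PI_RGT_0.
  set (q := Rmin (Re s) 1 / 2).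
  assert (Hq : 0 < q /\ q < 1 /\ q < Re s).
  { unfold q. pose proof (Rmin_l (Re s) 1). pose proof (Rmin_r (Re s) 1).
    assert (0 < Rmin (Re s) 1) by (apply Rmin_pos; lra). lra. }
  set (K1 := 2 * (T * Rpower (2 / k) (1 - q) * exp (- ((Re s - q) * - (1))) / (Re s - q))).
  assert (HK1 : 0 < K1).
  { unfold K1. apply Rmult_lt_0_compat; [lra|]. apply Rdiv_lt_0_compat; [|lra].
    repeat apply Rmult_lt_0_compat; apply exp_pos. }
  set (K2 := 2 * b * (T * exp (Re s))).
  assert (HK2 : 0 < K2).
  { unfold K2. apply Rmult_lt_0_compat; [lra|]. apply Rmult_lt_0_compat; apply exp_pos. }
  exists (Rmin (Rpower (e / (2 * K1)) (/ q) / 5) (e / (2 * K2) / 5)).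
  split.
  { apply Rmin_pos; [apply Rdiv_lt_0_compat; [apply exp_pos|lra]|].
    apply Rdiv_lt_0_compat; [apply Rdiv_lt_0_compat|]; lra. }
  intros X [HX1 HX2].
  pose proof (Rmin_l (Rpower (e / (2 * K1)) (/ q) / 5) (e / (2 * K2) / 5)).
  pose proof (Rmin_r (Rpower (e / (2 * K1)) (/ q) / 5) (e / (2 * K2) / 5)).
  destruct (aX_limit X HX1) as (l & Hl & Hl2). fold q in Hl2.
  rewrite (climit_unique _ _ _ (HA X HX1) Hl).
  assert (P1 : Rpower (5 * X) q <= e / (2 * K1)).
  { apply Rle_trans with (Rpower (Rpower (e / (2 * K1)) (/ q)) q).
    - apply Rle_Rpower_l; lra.
    - rewrite Rpower_mult. replace (/ q * q) with 1 by (field; lra).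
      rewrite Rpower_1; [lra|apply Rdiv_lt_0_compat; lra]. }
  assert (P2 : 5 * X <= e / (2 * K2)) by lra.
  eapply Rle_trans; [exact Hl2|].
  apply Rle_trans with (K1 * Rpower (5 * X) q + K2 * (5 * X)).
  { apply Req_le. unfold K1, K2. field. lra. }
  apply Rle_trans with (K1 * (e / (2 * K1)) + K2 * (e / (2 * K2))).
  - apply Rplus_le_compat; apply Rmult_le_compat_l; lra.
  - apply Req_le. field. lra.
Qed.

Lemma gamma_integrand_cont (t : R) : 0 < t -> Rcont (fun t => (Rcpow t (s - 1) * RtoC (exp (- t)))%C) t.
Proof.
  intros Ht.
  assert (Hln : Rcont (fun u => RtoC (ln u)) t).
  { apply Rcont_continuous.
    apply (continuous_comp (fun u => ln u) RtoC).
    - apply (ex_derive_continuous (V := R_NormedModule)). auto_derive. auto.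
    - apply Rcont_continuous. intros e He. exists e. split; auto. intros u Hu.
      rewrite <- RtoC_minus, Cmod_R. auto. }
  set (G := fun w => (Cexp ((s - 1) * w) * Cexp (- Cexp w))%C).
  assert (HG : Rcont (fun u => G (RtoC (ln u))) t).
  { apply (Rcont_path G (fun u => RtoC (ln u))); auto. apply Cdiff_cont. unfold G. apply Cdiff_mult.
    - apply Cdiff_Cexp, Cdiff_mult; [apply Cdiff_const|apply Cdiff_id].
    - apply Cdiff_Cexp, Cdiff_opp, Cdiff_Cexp, Cdiff_id. }
  intros e He. destruct (HG e He) as (d & Hd & H1).
  exists (Rmin d t). split; [apply Rmin_pos; auto|]. intros u Hu.
  pose proof (Rmin_l d t). pose proof (Rmin_r d t). specialize (H1 u ltac:(lra)).
  assert (Hu0 : 0 < u) by (assert (Rabs (u - t) < t) as Hx by lra; apply Rabs_lt_between in Hx; lra).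
  unfold G in H1. rewrite !RtoC_exp_ln in H1 by auto.
  rewrite <- !RtoC_opp, !Cexp_RtoC in H1. exact H1.
Qed.

(** Integrating A' gives h times the truncated Euler integral as A(Y) - A(X), which tends to 2 pi i.
    The limit is nonzero, so h is nonzero; hence Euler's integral converges to 2 pi i / h, which is
    in turn nonzero. *)
Theorem hankel_gamma (x : R) : 0 < x ->
  CGamma s <> 0%C /\
  climit (fun M => vint (hankel_kernel s x) M (- b) b)
    (RtoC (2 * PI) * Ci * Rcpow x (s - 1) / CGamma s)%C.
Proof.
  intros Hx. pose proof PI_RGT_0.
  destruct hankel_kernel_limit_ex as [h Hh].
  assert (HAex : forall X, exists l, 0 < X -> climit (hankel (aX X) b (- (1))) l).
  { intros X. destruct (Rlt_dec 0 X) as [h0|h0]; [|exists 0%C; intros; lra].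
    destruct (aX_limit X h0) as (l & Hl & _). eauto. }
  set (A := fun X => proj1_sig (constructive_indefinite_description _ (HAex X))).
  assert (HA : forall X, 0 < X -> climit (hankel (aX X) b (- (1))) (A X)).
  { intros X. unfold A. destruct (constructive_indefinite_description _ (HAex X)); auto. }
  set (gi := fun t => (Rcpow t (s - 1) * RtoC (exp (- t)))%C).
  assert (Hgi : forall X Y, 0 < X -> 0 < Y -> Rcont_on gi X Y).
  { intros X Y h1 h2 t Ht. apply gamma_integrand_cont.
    pose proof (Rmin_pos X Y h1 h2). lra. }
  assert (HFTC : forall X Y, 0 < X -> 0 < Y -> (h * CI gi X Y = A Y - A X)%C).
  { intros X Y h1 h2. rewrite <- CI_scal by auto.
    apply (CI_FTC A).
    - intros t Ht. pose proof (Rmin_pos X Y h1 h2).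
      replace (h * gi t)%C with (RtoC (exp (- t)) * (Rcpow t (s - 1) * h))%C by (unfold gi; ring).
      apply A_derivative; auto. lra.
    - intros t Ht. apply (Rcont_path (fun w => h * w)%C gi); [apply Hgi with X Y; auto|].
      apply Ccont_mult; [apply Ccont_const|apply Ccont_id]. }
  set (J := (RtoC (2 * PI) * Ci)%C). assert (HJ : J <> 0%C) by apply twoPiI_neq_0.
  assert (Hlim : forall e, 0 < e -> exists d N, 0 < d /\ 0 < N /\ forall X Y, 0 < X < d -> N < Y ->
     Cmod (h * CI gi X Y - J) <= e).
  { intros e He. destruct (A_at_zero A HA (e / 2) ltac:(lra)) as (d & Hd & H1).
    destruct (A_at_infinity A HA (e / 2) ltac:(lra)) as (N & H2).
    exists d, (Rmax 1 N). pose proof (Rmax_l 1 N). pose proof (Rmax_r 1 N).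
    split; [auto|split; [lra|]]. intros X Y hX hY.
    rewrite HFTC by lra. specialize (H1 X hX). specialize (H2 Y ltac:(lra)).
    replace (A Y - A X - J)%C with ((A Y - J) - A X)%C by ring.
    pose proof (Cmod_minus_triangle (A Y - J) (A X)). unfold J in *. lra. }
  assert (Hh0 : h <> 0%C).
  { intros ->. destruct (Hlim (Cmod J / 2)) as (d & N & Hd & HN & H1).
    { apply Cmod_gt_0 in HJ. lra. }
    specialize (H1 (d / 2) (N + 1) ltac:(lra) ltac:(lra)).
    rewrite Cmult_0_l in H1. replace (0 - J)%C with (- J)%C in H1 by ring. rewrite Cmod_opp in H1.
    apply Cmod_gt_0 in HJ. lra. }
  assert (HG : is_RInt_gen (V := C_R_NormedModule) gi (at_right 0) (Rbar_locally p_infty) (J / h)%C).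
  { intros Q HQ. apply locally_C_Cmod in HQ. destruct HQ as (e & He & HQ).
    set (e' := e * Cmod h / 2). assert (Hhm : 0 < Cmod h) by (apply Cmod_gt_0; auto).
    assert (He' : 0 < e') by (unfold e'; apply Rdiv_lt_0_compat; [apply Rmult_lt_0_compat; auto|lra]).
    destruct (Hlim e' He') as (d & N & Hd & HN & H1).
    apply (Filter_prod _ _ _ (fun X => 0 < X < d) (fun Y => N < Y)).
    - exists (mkposreal d Hd). intros y Hy1 Hy2. change (Rabs (y - 0) < d) in Hy1.
      rewrite Rminus_0_r, Rabs_pos_eq in Hy1; lra.
    - exists N. auto.
    - intros X Y hX hY. simpl. exists (CI gi X Y). split; [apply is_CI, Hgi; lra|].
      apply HQ. specialize (H1 X Y hX hY).
      replace (CI gi X Y - J / h)%C with ((h * CI gi X Y - J) / h)%C by (field; auto).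
      rewrite Cmod_div by auto. apply Rlt_div_l; auto. unfold e' in H1.
      assert (0 < e * Cmod h) by (apply Rmult_lt_0_compat; auto). lra. }
  assert (EG : CGamma s = (J / h)%C).
  { unfold CGamma. apply (is_RInt_gen_unique (V := C_R_CompleteNormedModule)). exact HG. }
  assert (HJh : (J / h)%C <> 0%C).
  { intros E. apply HJ. replace J with (J / h * h)%C by (field; auto). rewrite E; ring. }
  split; [rewrite EG; auto|].
  rewrite EG. replace (J * Rcpow x (s - 1) / (J / h))%C with (Rcpow x (s - 1) * h)%C by (field; auto).
  apply hankel_kernel_limit_scale; auto.
Qed.
End HankelGamma.

(** * Linearisation at a repelling fixed point *)

Definition cseq_lim (u : nat -> C) (l : C) : Prop :=
  forall eps, 0 < eps -> exists N, forall n, (N <= n)%nat -> Cmod (u n - l) <= eps.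

Lemma cseq_lim_filterlim (u : nat -> C) (l : C) :
  cseq_lim u l <-> filterlim u eventually (locally (T := C_UniformSpace) l).
Proof.
  rewrite filterlim_C_iff by apply _. split.
  - intros H e He. destruct (H (e / 2) ltac:(lra)) as [N HN].
    exists N. intros n Hn. specialize (HN n Hn). lra.
  - intros H e He. destruct (H e He) as [N HN]. exists N. intros n Hn. left; auto.
Qed.

Lemma cseq_lim_unique (u : nat -> C) (l l' : C) : cseq_lim u l -> cseq_lim u l' -> l = l'.
Proof.
  intros H H'. apply Cmod_eq_minus0, Rle_antisym; [|apply Cmod_ge_0].
  apply le_epsilon. intros e He. rewrite Rplus_0_l.
  destruct (H (e / 2) ltac:(lra)) as [N HN]. destruct (H' (e / 2) ltac:(lra)) as [N' HN'].
  specialize (HN (N + N')%nat ltac:(lia)). specialize (HN' (N + N')%nat ltac:(lia)).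
  rewrite Cmod_minus_sym in HN. pose proof (Cmod_minus_trans l (u (N + N')%nat) l'). lra.
Qed.

Lemma CLim_seq_unique (u : nat -> C) (l : C) : cseq_lim u l -> CLim_seq u = l.
Proof.
  intros H. unfold CLim_seq. destruct l as [x y].
  assert (HR : is_lim_seq (fun n => Re (u n)) x).
  { apply is_lim_seq_spec. intros [e He]. destruct (H (e / 2) ltac:(lra)) as [N HN].
    exists N. intros n Hn. specialize (HN n Hn). pose proof (Rabs_Re_le (u n - (x, y))) as H1.
    unfold Re in *; simpl in *. unfold Rminus. lra. }
  assert (HI : is_lim_seq (fun n => Im (u n)) y).
  { apply is_lim_seq_spec. intros [e He]. destruct (H (e / 2) ltac:(lra)) as [N HN].
    exists N. intros n Hn. specialize (HN n Hn). pose proof (Rabs_Im_le (u n - (x, y))) as H1.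
    unfold Im in *; simpl in *. unfold Rminus. lra. }
  rewrite (is_lim_seq_unique _ _ HR), (is_lim_seq_unique _ _ HI). reflexivity.
Qed.

Lemma cseq_lim_ext (u v : nat -> C) (l : C) (m : nat) :
  (forall n, (m <= n)%nat -> u n = v n) -> cseq_lim u l -> cseq_lim v l.
Proof.
  intros E H e He. destruct (H e He) as [N HN]. exists (m + N)%nat. intros n Hn.
  rewrite <- E by lia. apply HN. lia.
Qed.

Lemma cseq_lim_shift (u : nat -> C) (l : C) (m : nat) :
  cseq_lim (fun n => u (m + n)%nat) l -> cseq_lim u l.
Proof.
  intros H e He. destruct (H e He) as [N HN]. exists (m + N)%nat. intros n Hn.
  replace n with (m + (n - m))%nat by lia. apply HN. lia.
Qed.

Lemma cseq_lim_cont (u : nat -> C) (f : C -> C) (l : C) :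
  cseq_lim u l -> Ccont f l -> cseq_lim (fun n => f (u n)) (f l).
Proof.
  intros H Hf e He. destruct (Hf e He) as (d & Hd & H1).
  destruct (H (d / 2) ltac:(lra)) as [N HN]. exists N. intros n Hn.
  specialize (HN n Hn). left. apply H1. lra.
Qed.

Lemma cseq_lim_bound (u : nat -> C) (l c : C) (B : R) (m : nat) :
  cseq_lim u l -> (forall n, (m <= n)%nat -> Cmod (u n - c) <= B) -> Cmod (l - c) <= B.
Proof.
  intros H HB. apply le_epsilon. intros e He. destruct (H e He) as [N HN].
  specialize (HN (m + N)%nat ltac:(lia)). specialize (HB (m + N)%nat ltac:(lia)).
  rewrite Cmod_minus_sym in HN. pose proof (Cmod_minus_trans l (u (m + N)%nat) c). lra.
Qed.

Lemma cseq_lim_cauchy (u : nat -> C) :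
  (forall eps, 0 < eps -> exists N, forall n m, (N <= n)%nat -> (n <= m)%nat -> Cmod (u m - u n) <= eps) ->
  exists l, cseq_lim u l.
Proof.
  intros H.
  destruct (proj1 (filterlim_locally_cauchy (U := C_R_CompleteNormedModule) (F := eventually) u)) as [l Hl].
  - intros eps. pose proof (cond_pos eps). destruct (H (eps / 2)) as [N HN]; [lra|].
    exists (fun n => (N <= n)%nat). split; [exists N; auto|].
    intros n m Hn Hm. apply Cmod_ball.
    destruct (Nat.le_ge_cases n m).
    + specialize (HN n m Hn H1). lra.
    + specialize (HN m n Hm H1). rewrite Cmod_minus_sym. lra.
  - exists l. apply cseq_lim_filterlim. exact Hl.
Qed.

Lemma geometric_cauchy (u : nat -> C) (c q : R) : 0 <= c -> 0 < q < 1 ->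
  (forall n, Cmod (u (S n) - u n) <= c * q ^ n) ->
  exists l, cseq_lim u l /\ forall n, Cmod (u n - l) <= c * q ^ n / (1 - q).
Proof.
  intros Hc Hq H.
  assert (Hk : forall n j, Cmod (u (n + j)%nat - u n) <= c * q ^ n / (1 - q)).
  { intros n j.
    assert (H1 : Cmod (u (n + j)%nat - u n) <= c * q ^ n * (1 - q ^ j) / (1 - q)).
    { induction j.
      - rewrite Nat.add_0_r, Cminus_diag_mod. simpl. unfold Rdiv. lra.
      - rewrite Nat.add_succ_r.
        pose proof (Cmod_minus_trans (u (S (n + j))) (u (n + j)%nat) (u n)).
        specialize (H (n + j)%nat). rewrite pow_add in H.
        replace (c * q ^ n * (1 - q ^ S j) / (1 - q)) with (c * (q ^ n * q ^ j) + c * q ^ n * (1 - q ^ j) / (1 - q))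
          by (simpl; field; lra). lra. }
    eapply Rle_trans; [exact H1|]. unfold Rdiv. apply Rmult_le_compat_r; [left; apply Rinv_0_lt_compat; lra|].
    assert (0 <= c * q ^ n) by (apply Rmult_le_pos; auto; apply pow_le; lra).
    pose proof (pow_le q j ltac:(lra)). nra. }
  assert (Hsm : forall eps, 0 < eps -> exists N, forall n, (N <= n)%nat -> c * q ^ n / (1 - q) <= eps).
  { intros eps He.
    destruct (pow_lt_1_zero q ltac:(rewrite Rabs_pos_eq; lra) (eps * (1 - q) / (c + 1))) as [N HN].
    { apply Rdiv_lt_0_compat; [apply Rmult_lt_0_compat|]; lra. }
    exists N. intros n Hn. specialize (HN n Hn). rewrite Rabs_pos_eq in HN by (apply pow_le; lra).
    apply Rle_div_l; [lra|]. pose proof (pow_le q n ltac:(lra)).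
    apply Rle_trans with ((c + 1) * (eps * (1 - q) / (c + 1))); [apply Rmult_le_compat; lra|].
    apply Req_le. field. lra. }
  destruct (cseq_lim_cauchy u) as [l Hl].
  - intros eps He. destruct (Hsm eps He) as [N HN]. exists N. intros n m Hn Hm.
    replace m with (n + (m - n))%nat by lia. eapply Rle_trans; [apply Hk|auto].
  - exists l. split; auto. intros n. rewrite Cmod_minus_sym.
    apply (cseq_lim_bound u l (u n) _ n); auto.
    intros m Hm. replace m with (n + (m - n))%nat by lia. apply Hk.
Qed.

Lemma is_Cder_unique (f : C -> C) (z l l' : C) : is_Cder f z l -> is_Cder f z l' -> l = l'.
Proof.
  intros H H'. apply Cmod_eq_minus0, Rle_antisym; [|apply Cmod_ge_0].
  apply le_epsilon. intros e He. rewrite Rplus_0_l.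
  destruct (H (e / 2) ltac:(lra)) as (d & Hd & H1). destruct (H' (e / 2) ltac:(lra)) as (d' & Hd' & H2).
  set (m := Rmin d d' / 2).
  assert (Hm : 0 < m) by (unfold m; pose proof (Rmin_pos d d' Hd Hd'); lra).
  pose proof (Rmin_l d d'). pose proof (Rmin_r d d').
  assert (E : (z + RtoC m - z)%C = RtoC m) by ring.
  specialize (H1 (z + RtoC m)%C). specialize (H2 (z + RtoC m)%C).
  rewrite E, Cmod_RtoC_pos in H1, H2 by lra.
  specialize (H1 ltac:(unfold m; lra)). specialize (H2 ltac:(unfold m; lra)).
  pose proof (Cmod_minus_triangle (f (z + RtoC m) - f z - l' * RtoC m)%C (f (z + RtoC m) - f z - l * RtoC m)%C) as T.
  replace (f (z + RtoC m) - f z - l' * RtoC m - (f (z + RtoC m) - f z - l * RtoC m))%C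
    with ((l - l') * RtoC m)%C in T by ring.
  rewrite Cmod_mult, Cmod_RtoC_pos in T by lra.
  apply Rmult_le_reg_r with m; auto. lra.
Qed.

Lemma iterate_S (P : C -> C) (t : nat) (z : C) : iterate P (S t) z = P (iterate P t z).
Proof. reflexivity. Qed.

Lemma iterate_add (P : C -> C) (t s : nat) (z : C) : iterate P (t + s) z = iterate P t (iterate P s z).
Proof. induction t; [reflexivity|]. exact (f_equal P IHt). Qed.

Lemma iterate_Sr (P : C -> C) (t : nat) (z : C) : iterate P (S t) z = iterate P t (P z).
Proof. replace (S t) with (t + 1)%nat by lia. apply iterate_add. Qed.

Section Repelling.
Variables (P : C -> C) (E r A : R).
Hypothesis HE : 1 < E.
Hypothesis Hr : 0 < r.
Hypothesis HA : 0 < A.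
Hypothesis HP1 : P 1 = 1%C.
Hypothesis Hstrong : forall h k, Cmod h <= r -> Cmod k <= r ->
  Cmod (P (1 + h) - P (1 + k) - RtoC E * (h - k))%C <= A * Cmod (h - k) * (Cmod h + Cmod k).
Hypothesis Hdiff : forall h, Cmod h <= r -> Cdiff P (1 + h)%C.

(** K solves 4 A + E K = E^2 K, which is exactly what closes the induction for the quadratic error
    of the iterates: one step contributes 4 A and propagates the old error with factor E. The number
    delta keeps the iterates within distance r of 1 and makes the error smaller than the main
    term. *)
Let K := 4 * A / (E * (E - 1)).
Let delta := Rmin (r / 2) (/ (4 * (K + A))).

Lemma K_pos : 0 < K.
Proof. unfold K. apply Rdiv_lt_0_compat; nra. Qed.

Lemma delta_bounds : 0 < delta /\ 2 * delta <= r /\ 2 * K * delta <= 1 / 2 /\ A * delta <= 1.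
Proof.
  pose proof K_pos.
  assert (0 < / (4 * (K + A))) by (apply Rinv_0_lt_compat; lra).
  assert (H1 : delta <= r / 2) by apply Rmin_l. assert (H2 : delta <= / (4 * (K + A))) by apply Rmin_r.
  assert (H3 : (K + A) * delta <= 1 / 4).
  { apply Rle_trans with ((K + A) * / (4 * (K + A))); [apply Rmult_le_compat_l; lra|].
    apply Req_le. field. lra. }
  assert (H4 : 0 < delta) by (apply Rmin_pos; lra).
  repeat split; try lra; nra.
Qed.

Lemma repelling_step (x y : C) (X : R) (t s : nat) :
  (s <= t)%nat -> Cmod x <= X -> Cmod y <= X -> E ^ t * X <= delta -> 0 <= X ->
  Cmod (iterate P s (1 + x) - 1) <= 2 * (E ^ s * Cmod x) ->
  Cmod (iterate P s (1 + y) - 1) <= 2 * (E ^ s * Cmod y) ->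
  Cmod (iterate P s (1 + x) - iterate P s (1 + y) - RtoC (E ^ s) * (x - y)) <=
    K * (E ^ s * Cmod (x - y)) * (E ^ s * (Cmod x + Cmod y)) ->
  Cmod (iterate P (S s) (1 + x) - iterate P (S s) (1 + y) - RtoC (E ^ S s) * (x - y)) <=
    K * (E ^ S s * Cmod (x - y)) * (E ^ S s * (Cmod x + Cmod y)).
Proof.
  destruct delta_bounds as (D0 & D1 & D2 & D3). pose proof K_pos as HK.
  intros Hs Hx Hy HX HX0 I1 I2 I3.
  assert (p1 : 0 < E ^ s) by (apply pow_lt; lra).
  assert (p2 : E ^ s <= E ^ t) by (apply Rle_pow; [lra|auto]).
  pose proof (Cmod_ge_0 x). pose proof (Cmod_ge_0 y). pose proof (Cmod_ge_0 (x - y)) as Hxy.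
  set (u := (iterate P s (1 + x) - 1)%C) in *. set (v := (iterate P s (1 + y) - 1)%C) in *.
  assert (HsX : E ^ s * X <= delta).
  { apply Rle_trans with (E ^ t * X); auto. apply Rmult_le_compat_r; auto. }
  assert (Hsx : E ^ s * Cmod x <= E ^ s * X) by (apply Rmult_le_compat_l; lra).
  assert (Hsy : E ^ s * Cmod y <= E ^ s * X) by (apply Rmult_le_compat_l; lra).
  pose proof (Hstrong u v ltac:(lra) ltac:(lra)) as HS.
  rewrite !iterate_S.
  replace (1 + u)%C with (iterate P s (1 + x)) in HS by (unfold u; ring).
  replace (1 + v)%C with (iterate P s (1 + y)) in HS by (unfold v; ring).
  replace (u - v)%C with (iterate P s (1 + x) - iterate P s (1 + y))%C in HS by (unfold u, v; ring).
  set (d := (iterate P s (1 + x) - iterate P s (1 + y))%C) in *.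
  assert (Hd : Cmod d <= 2 * (E ^ s * Cmod (x - y))).
  { replace d with ((d - RtoC (E ^ s) * (x - y)) + RtoC (E ^ s) * (x - y))%C by ring.
    eapply Rle_trans; [apply Cmod_triangle|]. rewrite Cmod_mult, Cmod_RtoC_pos by lra.
    assert (K * (E ^ s * Cmod (x - y)) * (E ^ s * (Cmod x + Cmod y)) <= E ^ s * Cmod (x - y)); [|lra].
    rewrite (Rmult_comm K), Rmult_assoc. rewrite <- (Rmult_1_r (E ^ s * Cmod (x - y))) at 2.
    apply Rmult_le_compat_l; [apply Rmult_le_pos; lra|].
    apply Rle_trans with (K * (2 * delta)); [|lra]. apply Rmult_le_compat_l; lra. }
  replace (P (iterate P s (1 + x)) - P (iterate P s (1 + y)) - RtoC (E ^ S s) * (x - y))%C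
    with ((P (iterate P s (1 + x)) - P (iterate P s (1 + y)) - RtoC E * d)
      + RtoC E * (d - RtoC (E ^ s) * (x - y)))%C.
  2:{ simpl. rewrite RtoC_mult. ring. }
  eapply Rle_trans; [apply Cmod_triangle|]. rewrite (Cmod_mult (RtoC E)), Cmod_RtoC_pos by lra.
  set (q := E ^ s) in *. set (w := Cmod (x - y)) in *. set (S0 := Cmod x + Cmod y) in *.
  assert (B1 : A * Cmod d * (Cmod u + Cmod v) <= A * (2 * (q * w)) * (2 * (q * S0))).
  { pose proof (Cmod_ge_0 d). pose proof (Cmod_ge_0 u). pose proof (Cmod_ge_0 v).
    apply Rmult_le_compat; [apply Rmult_le_pos; lra|lra|apply Rmult_le_compat_l; lra|unfold S0; lra]. }
  assert (B2 : E * Cmod (d - RtoC q * (x - y)) <= E * (K * (q * w) * (q * S0))) by (apply Rmult_le_compat_l; lra).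
  apply Rle_trans with (A * (2 * (q * w)) * (2 * (q * S0)) + E * (K * (q * w) * (q * S0))); [lra|].
  simpl. fold q. apply Req_le. unfold K. field. lra.
Qed.

Lemma one_fixed (n : nat) : iterate P n (1 + 0)%C = 1%C.
Proof. rewrite Cplus_0_r. induction n; [reflexivity|]. rewrite iterate_S, IHn; auto. Qed.

Lemma scaled_le_delta (t n : nat) (X : R) : (n <= t)%nat -> 0 <= X -> E ^ t * X <= delta ->
  0 <= E ^ n * X <= delta.
Proof.
  intros Hn HX H.
  assert (p1 : 0 < E ^ n) by (apply pow_lt; lra).
  assert (p2 : E ^ n <= E ^ t) by (apply Rle_pow; [lra|auto]).
  split; [apply Rmult_le_pos; lra|].
  apply Rle_trans with (E ^ t * X); auto. apply Rmult_le_compat_r; auto.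
Qed.

Lemma repelling_single (t : nat) (x : C) : E ^ t * Cmod x <= delta -> forall n, (n <= t)%nat ->
  Cmod (iterate P n (1 + x) - 1 - RtoC (E ^ n) * x) <= K * (E ^ n * Cmod x) * (E ^ n * Cmod x) /\
  Cmod (iterate P n (1 + x) - 1) <= 2 * (E ^ n * Cmod x).
Proof.
  destruct delta_bounds as (D0 & D1 & D2 & D3). pose proof K_pos as HK.
  intros Hx. pose proof (Cmod_ge_0 x) as Hx0.
  assert (Himp : forall n, (n <= t)%nat ->
     Cmod (iterate P n (1 + x) - 1 - RtoC (E ^ n) * x) <= K * (E ^ n * Cmod x) * (E ^ n * Cmod x) ->
     Cmod (iterate P n (1 + x) - 1) <= 2 * (E ^ n * Cmod x)).
  { intros n Hn HJ. destruct (scaled_le_delta t n (Cmod x) Hn Hx0 Hx) as [q1 q2].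
    replace (iterate P n (1 + x) - 1)%C with ((iterate P n (1 + x) - 1 - RtoC (E ^ n) * x) + RtoC (E ^ n) * x)%C by ring.
    eapply Rle_trans; [apply Cmod_triangle|].
    rewrite Cmod_mult, Cmod_RtoC_pos by (left; apply pow_lt; lra).
    set (X := E ^ n * Cmod x) in *.
    assert (K * X <= K * delta) by (apply Rmult_le_compat_l; lra).
    assert (K * X * X <= 1 * X) by (apply Rmult_le_compat_r; lra). lra. }
  induction n; intros Hn.
  - assert (Z : Cmod (iterate P 0 (1 + x) - 1 - RtoC (E ^ 0) * x) <= K * (E ^ 0 * Cmod x) * (E ^ 0 * Cmod x)).
    { simpl. replace (1 + x - 1 - 1 * x)%C with (RtoC 0) by ring. rewrite Cmod_0.
      apply Rmult_le_pos; [apply Rmult_le_pos|]; lra. }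
    split; auto.
  - destruct (IHn ltac:(lia)) as [J1 J2].
    assert (Z : Cmod (iterate P (S n) (1 + x) - 1 - RtoC (E ^ S n) * x) <= K * (E ^ S n * Cmod x) * (E ^ S n * Cmod x)).
    { pose proof (repelling_step x 0%C (Cmod x) t n ltac:(lia) ltac:(lra) ltac:(rewrite Cmod_0; lra) Hx ltac:(lra) J2) as H1.
      rewrite !one_fixed, !Cmod_0, !Rplus_0_r in H1.
      replace (x - 0)%C with x in H1 by ring.
      apply H1; auto. rewrite Cminus_diag_mod. lra. }
    split; auto.
Qed.

Lemma repelling_iterates (t : nat) (h k : C) :
  E ^ t * Cmod h <= delta -> E ^ t * Cmod k <= delta -> forall s, (s <= t)%nat ->
  Cmod (iterate P s (1 + h) - iterate P s (1 + k) - RtoC (E ^ s) * (h - k)) <=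
    K * (E ^ s * Cmod (h - k)) * (E ^ s * (Cmod h + Cmod k)).
Proof.
  intros Hh Hk. pose proof K_pos as HK.
  pose proof (Cmod_ge_0 h). pose proof (Cmod_ge_0 k). pose proof (Cmod_ge_0 (h - k)).
  induction s; intros Hs.
  - simpl. replace (1 + h - (1 + k) - 1 * (h - k))%C with (RtoC 0) by ring. rewrite Cmod_0.
    apply Rmult_le_pos; [apply Rmult_le_pos|]; lra.
  - destruct (repelling_single t h Hh s ltac:(lia)) as [_ J1].
    destruct (repelling_single t k Hk s ltac:(lia)) as [_ J2].
    apply (repelling_step h k (Rmax (Cmod h) (Cmod k)) t s); auto; try lia;
      try apply Rmax_l; try apply Rmax_r.
    + unfold Rmax. destruct (Rle_dec (Cmod h) (Cmod k)); auto.
    + apply Rle_trans with (Cmod h); auto. apply Rmax_l.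
    + apply IHs. lia.
Qed.

Let ft (t : nat) (z : C) : C := iterate P t (1 - z / RtoC (E ^ t))%C.

Lemma pow_E_neq (t : nat) : RtoC (E ^ t) <> 0%C.
Proof. apply RtoC_neq_0. apply pow_nonzero. lra. Qed.

Lemma scaled_arg (t : nat) (z : C) : E ^ t * Cmod (- (z / RtoC (E ^ t))) = Cmod z.
Proof.
  assert (0 < E ^ t) by (apply pow_lt; lra).
  rewrite Cmod_opp, Cmod_div, Cmod_RtoC_pos by (try apply pow_E_neq; lra). field. lra.
Qed.

(** The bound is uniform in t, so it survives in the limit and gives Pi both its derivative -1 at 0
    and a Lipschitz bound. *)
Lemma ft_strong (t : nat) (z w : C) : Cmod z <= delta -> Cmod w <= delta ->
  Cmod (ft t z - ft t w + (z - w)) <= K * Cmod (z - w) * (Cmod z + Cmod w).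
Proof.
  intros Hz Hw.
  pose proof (repelling_iterates t (- (z / RtoC (E ^ t))) (- (w / RtoC (E ^ t)))
    ltac:(rewrite scaled_arg; auto) ltac:(rewrite scaled_arg; auto) t (Nat.le_refl t)) as H.
  pose proof (pow_E_neq t) as Hn.
  rewrite Rmult_plus_distr_l, !scaled_arg in H.
  replace (- (z / RtoC (E ^ t)) - - (w / RtoC (E ^ t)))%C with (- ((z - w) / RtoC (E ^ t)))%C in H by (field; auto).
  rewrite scaled_arg in H. unfold ft, Cminus in *.
  replace (RtoC (E ^ t) * - ((z + - w) / RtoC (E ^ t)))%C with (- (z + - w))%C in H by (field; auto).
  replace (- - (z + - w))%C with (z + - w)%C in H by ring. exact H.
Qed.

Lemma ft_lipschitz (t : nat) (z w : C) : Cmod z <= delta -> Cmod w <= delta ->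
  Cmod (ft t z - ft t w) <= 2 * Cmod (z - w).
Proof.
  intros Hz Hw. destruct delta_bounds as (D0 & D1 & D2 & D3). pose proof K_pos as HK.
  pose proof (ft_strong t z w Hz Hw) as H. pose proof (Cmod_ge_0 (z - w)).
  replace (ft t z - ft t w)%C with ((ft t z - ft t w + (z - w)) - (z - w))%C by ring.
  eapply Rle_trans; [apply Cmod_minus_triangle|].
  assert (K * Cmod (z - w) * (Cmod z + Cmod w) <= Cmod (z - w)); [|lra].
  assert (K * (Cmod z + Cmod w) <= 1) by nra. nra.
Qed.

(** The extra application of P is moved into the argument: [ft (S t) z] is [ft t z'] with z' = E^t
    (1 - P (1 - z / E^(t+1))), and z' - z is O(E^(-t)) by the second-order error of P at 1. The
    uniform Lipschitz bound finishes. *)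
Lemma ft_succ (t : nat) (z : C) : Cmod z <= delta / 2 ->
  Cmod (ft (S t) z - ft t z) <= (2 * A * delta * delta) * (/ E) ^ t.
Proof.
  intros Hz. destruct delta_bounds as (D0 & D1 & D2 & D3).
  assert (Ht : 0 < E ^ t) by (apply pow_lt; lra). assert (Ht1 : 1 <= E ^ t) by (apply pow_R1_Rle; lra).
  pose proof (pow_E_neq t) as Hn. pose proof (pow_E_neq (S t)) as HnS.
  set (z' := (RtoC (E ^ t) * (1 - P (1 - z / RtoC (E ^ S t))))%C).
  assert (E1 : ft (S t) z = ft t z').
  { unfold ft. rewrite iterate_Sr. f_equal. unfold z'. field. auto. }
  set (x := (- (z / RtoC (E ^ S t)))%C).
  assert (Hx : Cmod x = Cmod z / E ^ S t).
  { unfold x. rewrite Cmod_opp, Cmod_div, Cmod_RtoC_pos; auto. left; apply pow_lt; lra. }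
  assert (HES : E ^ S t = E * E ^ t) by reflexivity.
  assert (HE2 : E ^ t <= E ^ S t) by (rewrite HES; nra).
  pose proof (Cmod_ge_0 z) as Hz0.
  assert (Hx2 : Cmod x <= Cmod z / E ^ t).
  { rewrite Hx. unfold Rdiv. apply Rmult_le_compat_l; auto. apply Rinv_le_contravar; lra. }
  assert (Hx3 : Cmod x <= delta / 2).
  { eapply Rle_trans; [exact Hx2|]. apply Rle_div_l; auto. nra. }
  pose proof (Hstrong x 0%C ltac:(lra) ltac:(rewrite Cmod_0; lra)) as HS.
  rewrite Cplus_0_r, HP1, Cmod_0, Rplus_0_r in HS. replace (x - 0)%C with x in HS by ring.
  assert (Ez : (z' - z)%C = (- (RtoC (E ^ t) * (P (1 + x) - 1 - RtoC E * x)))%C).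
  { unfold z', x. replace (1 + - (z / RtoC (E ^ S t)))%C with (1 - z / RtoC (E ^ S t))%C by ring.
    rewrite HES, RtoC_mult. field. split; auto. apply RtoC_neq_0. lra. }
  assert (Hzz : Cmod (z' - z) <= A * delta * delta * / E ^ t / 4).
  { rewrite Ez, Cmod_opp, Cmod_mult, Cmod_RtoC_pos by lra.
    apply Rle_trans with (E ^ t * (A * (delta / 2 / E ^ t) * (delta / 2 / E ^ t))).
    - apply Rmult_le_compat_l; [lra|]. eapply Rle_trans; [exact HS|].
      assert (Cmod x <= delta / 2 / E ^ t).
      { eapply Rle_trans; [exact Hx2|]. unfold Rdiv. apply Rmult_le_compat_r; [left; apply Rinv_0_lt_compat; auto|lra]. }
      pose proof (Cmod_ge_0 x). rewrite !Rmult_assoc. apply Rmult_le_compat_l; [lra|]. apply Rmult_le_compat; auto.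
    - apply Req_le. field. lra. }
  assert (Hinv : / E ^ t <= 1) by (rewrite <- Rinv_1; apply Rinv_le_contravar; lra).
  assert (Hinv0 : 0 < / E ^ t) by (apply Rinv_0_lt_compat; auto).
  assert (Hadd : 0 <= A * delta * delta) by (apply Rmult_le_pos; [apply Rmult_le_pos|]; lra).
  assert (Hz' : Cmod z' <= delta).
  { replace z' with (z + (z' - z))%C by ring. eapply Rle_trans; [apply Cmod_triangle|].
    assert (A * delta * delta * / E ^ t / 4 <= delta / 2); [|lra].
    assert (A * delta * delta * / E ^ t <= A * delta * delta) by nra. nra. }
  rewrite E1. eapply Rle_trans; [apply ft_lipschitz; auto; lra|].
  rewrite pow_inv.
  assert (0 <= A * delta * delta * / E ^ t) by (apply Rmult_le_pos; lra). lra.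
Qed.

Lemma one_minus_arg_Cdiff (t s : nat) (z : C) : Cmod z <= delta -> (s <= t)%nat ->
  Cdiff (fun w => iterate P s (1 - w / RtoC (E ^ t)))%C z.
Proof.
  intros Hz. destruct delta_bounds as (D0 & D1 & D2 & D3). induction s; intros Hs.
  - simpl. apply Cdiff_minus; [apply Cdiff_const|].
    apply (Cdiff_div (fun w => w) (fun _ => RtoC (E ^ t))); [apply Cdiff_id|apply Cdiff_const|apply pow_E_neq].
  - apply (Cdiff_comp (fun w => iterate P s (1 - w / RtoC (E ^ t)))%C P); [apply IHs; lia|].
    destruct (repelling_single t (- (z / RtoC (E ^ t))) ltac:(rewrite scaled_arg; auto) s ltac:(lia)) as [_ H].
    destruct (scaled_le_delta t s (Cmod (- (z / RtoC (E ^ t)))) ltac:(lia) (Cmod_ge_0 _) ltac:(rewrite scaled_arg; auto)) as [q1 q2].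
    replace (iterate P s (1 - z / RtoC (E ^ t)))%C with (1 + (iterate P s (1 - z / RtoC (E ^ t)) - 1))%C by ring.
    apply Hdiff. unfold Cminus at 2. lra.
Qed.

Theorem repelling_linearisation : exists d0 K0, 0 < d0 /\ 0 < K0 /\
  (forall z, Cmod z <= d0 -> cseq_lim (fun t => iterate P t (1 - z / RtoC (E ^ t)))%C (PiFun P E z)) /\
  (forall z w, Cmod z <= d0 -> Cmod w <= d0 ->
     Cmod (PiFun P E z - PiFun P E w + (z - w)) <= K0 * Cmod (z - w) * (Cmod z + Cmod w)) /\
  (forall z, Cmod z < d0 -> Cdiff (PiFun P E) z).
Proof.
  destruct delta_bounds as (D0 & D1 & D2 & D3). pose proof K_pos as HK.
  assert (Hq : 0 < / E < 1).
  { split; [apply Rinv_0_lt_compat; lra|]. rewrite <- Rinv_1. apply Rinv_lt_contravar; lra. }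
  set (c := 2 * A * delta * delta).
  assert (Hc : 0 <= c) by (unfold c; repeat apply Rmult_le_pos; lra).
  assert (HL : forall z, Cmod z <= delta / 2 -> cseq_lim (fun t => ft t z) (PiFun P E z) /\
     forall t, Cmod (ft t z - PiFun P E z) <= c * (/ E) ^ t / (1 - / E)).
  { intros z Hz. destruct (geometric_cauchy (fun t => ft t z) c (/ E) Hc Hq) as (l & Hl & Hl2).
    - intros t. apply ft_succ; auto.
    - assert (El : PiFun P E z = l) by (apply CLim_seq_unique; exact Hl).
      rewrite El. auto. }
  exists (delta / 2), K. repeat split; try lra.
  - intros z Hz. apply HL; auto.
  - intros z w Hz Hw. destruct (HL z Hz) as [L1 _]. destruct (HL w Hw) as [L2 _].
    apply le_epsilon. intros e He.
    destruct (L1 (e / 2) ltac:(lra)) as [N1 H1]. destruct (L2 (e / 2) ltac:(lra)) as [N2 H2].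
    set (n := (N1 + N2)%nat). specialize (H1 n ltac:(unfold n; lia)). specialize (H2 n ltac:(unfold n; lia)).
    pose proof (ft_strong n z w ltac:(lra) ltac:(lra)) as H3.
    replace (PiFun P E z - PiFun P E w + (z - w))%C with
      ((ft n z - ft n w + (z - w)) + ((ft n w - PiFun P E w) - (ft n z - PiFun P E z)))%C by ring.
    eapply Rle_trans; [apply Cmod_triangle|].
    pose proof (Cmod_minus_triangle (ft n w - PiFun P E w) (ft n z - PiFun P E z)). lra.
  - intros z Hz. apply (weierstrass ft (PiFun P E) z (delta / 2 - Cmod z)); [lra| |].
    + intros n w Hw. apply one_minus_arg_Cdiff; [|lia].
      pose proof (Cmod_triangle_rev w z). lra.
    + intros eps He.
      destruct (pow_lt_1_zero (/ E) ltac:(rewrite Rabs_pos_eq; lra) (eps * (1 - / E) / (c + 1))) as [N HN].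
      { apply Rdiv_lt_0_compat; [apply Rmult_lt_0_compat|]; lra. }
      exists N. intros w Hw. specialize (HN N (Nat.le_refl N)).
      pose proof (Cmod_triangle_rev w z).
      destruct (HL w ltac:(lra)) as [_ H1]. eapply Rle_trans; [apply H1|].
      assert (0 < (/ E) ^ N) by (apply pow_lt; lra). rewrite Rabs_pos_eq in HN by lra.
      apply Rle_div_l; [lra|].
      apply Rle_trans with ((c + 1) * (eps * (1 - / E) / (c + 1))); [apply Rmult_le_compat; lra|].
      apply Req_le. field. lra.
Qed.
End Repelling.

(** * The generating function and its basin at 0 *)

Lemma sum_n_csum (u : nat -> C) (n : nat) : sum_n (G := C_NormedModule) u n = csum u (S n).
Proof.
  induction n; [rewrite sum_O; simpl; ring|].
  rewrite sum_Sn, IHn. reflexivity.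
Qed.

Lemma is_Cseries_csum (u : nat -> C) (l : C) : is_Cseries u l <-> cseq_lim (csum u) l.
Proof.
  unfold is_Cseries, is_series. split.
  - intros H. apply (cseq_lim_shift (csum u) l 1).
    apply cseq_lim_ext with (m := 0%nat) (u := sum_n (G := C_NormedModule) u); [intros; apply sum_n_csum|].
    apply cseq_lim_filterlim. exact H.
  - intros H. apply (cseq_lim_filterlim (sum_n (G := C_NormedModule) u)).
    apply cseq_lim_ext with (m := 0%nat) (u := fun n => csum u (S n)); [intros; symmetry; apply sum_n_csum|].
    intros e He. destruct (H e He) as [N HN]. exists N. intros n Hn. apply HN. lia.
Qed.

Lemma pow_n_Cpow (z : C) (n : nat) : pow_n (K := C_Ring) z n = (z ^ n)%C.
Proof. induction n; [reflexivity|]. simpl. rewrite IHn. reflexivity. Qed.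

Lemma is_Cpseries_csum (a : nat -> C) (z l : C) :
  is_Cpseries a z l -> cseq_lim (csum (fun k => a k * z ^ k)%C) l.
Proof.
  intros H. apply is_Cseries_csum. unfold is_Cpseries, is_pseries in H.
  eapply is_series_ext; [|exact H]. intros n. simpl.
  change (scal (V := C_NormedModule) (pow_n (K := C_Ring) z n) (a n)) with (Cmult (pow_n (K := C_Ring) z n) (a n)).
  rewrite pow_n_Cpow. apply Cmult_comm.
Qed.

Section GeneratingFunction.
Variables (a : nat -> R) (p E : R) (D : C -> Prop) (P : C -> C).
Hypothesis ha : is_pgf a.
Hypothesis hp : a 1%nat = p.
Hypothesis hp01 : 0 < p < 1.
Hypothesis hP : extends_pgf a D P.
Hypothesis hE : is_derive (K := C_AbsRing) (V := C_NormedModule) P (RtoC 1) (RtoC E).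

Lemma pgf_partial_sum_le (n : nat) : sum_n a n <= 1.
Proof.
  destruct ha as (_ & Hn & Hs).
  apply (is_lim_seq_incr_compare (sum_n a) 1); [exact Hs|].
  intros m. rewrite sum_Sn. unfold plus; simpl. specialize (Hn (S m)). lra.
Qed.

Lemma pgf_series (z : C) : Cmod z <= 1 -> cseq_lim (csum (fun k => RtoC (a k) * z ^ k)%C) (P z).
Proof. intros Hz. apply (is_Cpseries_csum (fun n => RtoC (a n))). apply hP; auto. Qed.

(** The remaining terms have degree at least 2 and total mass 1 - p - a_k. The case k = 2 yields the
    quadratic error at 0, and a general k with a_k > 0 yields the equality case |P(z)| = 1. *)
Lemma pgf_two_terms (k : nat) (z : C) : (2 <= k)%nat -> Cmod z <= 1 ->
  Cmod (P z - RtoC p * z - RtoC (a k) * z ^ k) <= Cmod z ^ 2 * (1 - p - a k).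
Proof.
  intros Hk Hz. destruct ha as (H0 & Hn & Hs). pose proof (Cmod_ge_0 z) as Hz0.
  assert (Hpart : forall n, (k <= n)%nat ->
    Cmod (csum (fun k => RtoC (a k) * z ^ k)%C (S n) - RtoC p * z - RtoC (a k) * z ^ k) <=
      Cmod z ^ 2 * (sum_n a n - p - a k)).
  (* The guards subtract each distinguished term only once the partial sum contains it, so that the
     induction can start at 0. *)
  { assert (Hgen : forall n,
      Cmod (csum (fun k => RtoC (a k) * z ^ k)%C (S n) - (if le_dec 1 n then RtoC p * z else 0)
         - (if le_dec k n then RtoC (a k) * z ^ k else 0)) <=
      Cmod z ^ 2 * (sum_n a n - (if le_dec 1 n then p else 0) - (if le_dec k n then a k else 0))).
    { induction n.
      - destruct (le_dec 1 0); [lia|]. destruct (le_dec k 0); [lia|].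
        simpl. rewrite sum_O, H0. replace (0 + 0 * 1 - 0 - 0)%C with (RtoC 0) by ring. rewrite Cmod_0. nra.
      - rewrite sum_Sn. unfold plus; simpl AbelianMonoid.plus.
        change (csum (fun k0 => RtoC (a k0) * z ^ k0)%C (S (S n)))
          with (csum (fun k0 => RtoC (a k0) * z ^ k0)%C (S n) + RtoC (a (S n)) * z ^ S n)%C.
        set (S0 := csum (fun k0 => RtoC (a k0) * z ^ k0)%C (S n)) in *.
        destruct (Nat.eq_dec n 0) as [e1|n1].
        + subst n. destruct (le_dec 1 0); [lia|]. destruct (le_dec k 0); [lia|].
          destruct (le_dec 1 1); [|lia]. destruct (le_dec k 1); [lia|].
          rewrite hp.
          replace (S0 + RtoC p * z ^ 1 - RtoC p * z - 0)%C with (S0 - 0 - 0)%C by (simpl; ring).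
          eapply Rle_trans; [exact IHn|]. apply Req_le. ring.
        + destruct (le_dec 1 n); [|lia]. destruct (le_dec 1 (S n)); [|lia].
          destruct (Nat.eq_dec k (S n)) as [e2|n2].
          * subst k. destruct (le_dec (S n) n); [lia|]. destruct (le_dec (S n) (S n)); [|lia].
            replace (S0 + RtoC (a (S n)) * z ^ S n - RtoC p * z - RtoC (a (S n)) * z ^ S n)%C
              with (S0 - RtoC p * z - 0)%C by ring.
            eapply Rle_trans; [exact IHn|]. apply Req_le. ring.
          * assert (Hb : Cmod (RtoC (a (S n)) * z ^ S n) <= Cmod z ^ 2 * a (S n)).
            { rewrite Cmod_mult, Cmod_RtoC_pos, Cmod_pow, Rmult_comm by auto.
              apply Rmult_le_compat_r; auto. replace (S n) with (2 + (n - 1))%nat by lia.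
              rewrite pow_add. rewrite <- (Rmult_1_r (Cmod z ^ 2)) at 2.
              apply Rmult_le_compat_l; [apply pow_le; auto|].
              rewrite <- (pow1 (n - 1)). apply pow_incr. lra. }
            assert (Hkk : (if le_dec k (S n) then RtoC (a k) * z ^ k else 0)%C = (if le_dec k n then RtoC (a k) * z ^ k else 0)%C /\
               (if le_dec k (S n) then a k else 0) = (if le_dec k n then a k else 0)).
            { destruct (le_dec k (S n)), (le_dec k n); try lia; auto. }
            destruct Hkk as [-> ->].
            set (Z := (if le_dec k n then RtoC (a k) * z ^ k else 0)%C) in *.
            replace (S0 + RtoC (a (S n)) * z ^ S n - RtoC p * z - Z)%C
              with ((S0 - RtoC p * z - Z) + RtoC (a (S n)) * z ^ S n)%C by ring.
            eapply Rle_trans; [apply Cmod_triangle|].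
            change (sum_n a n + a (S n)) with (sum_n a n + a (S n)). nra. }
    intros n Hkn. specialize (Hgen n).
    destruct (le_dec 1 n); [|lia]. destruct (le_dec k n); [|lia]. exact Hgen. }
  pose proof (pgf_series z Hz) as HL.
  replace (P z - RtoC p * z - RtoC (a k) * z ^ k)%C with (P z - (RtoC p * z + RtoC (a k) * z ^ k))%C by ring.
  apply (cseq_lim_bound _ _ _ _ (S k) HL).
  intros n Hn'. destruct n; [lia|].
  replace (csum (fun k => RtoC (a k) * z ^ k)%C (S n) - (RtoC p * z + RtoC (a k) * z ^ k))%C
    with (csum (fun k => RtoC (a k) * z ^ k)%C (S n) - RtoC p * z - RtoC (a k) * z ^ k)%C by ring.
  eapply Rle_trans; [apply Hpart; lia|]. apply Rmult_le_compat_l; [apply pow_le; auto|].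
  pose proof (pgf_partial_sum_le n). lra.
Qed.

Lemma pgf_quadratic (z : C) : Cmod z <= 1 -> Cmod (P z - RtoC p * z) <= (1 - p) * Cmod z ^ 2.
Proof.
  intros Hz. pose proof (pgf_two_terms 2 z (Nat.le_refl 2) Hz) as H.
  destruct ha as (_ & Hn & _). specialize (Hn 2%nat).
  replace (P z - RtoC p * z)%C with ((P z - RtoC p * z - RtoC (a 2%nat) * z ^ 2) + RtoC (a 2%nat) * z ^ 2)%C by ring.
  eapply Rle_trans; [apply Cmod_triangle|]. rewrite Cmod_mult, Cmod_RtoC_pos, Cmod_pow by auto. lra.
Qed.

Lemma pgf_contract (z : C) : Cmod z <= 1 -> Cmod (P z) <= Cmod z * (p + (1 - p) * Cmod z).
Proof.
  intros Hz. pose proof (pgf_quadratic z Hz). pose proof (Cmod_triangle_rev (P z) (RtoC p * z)).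
  rewrite Cmod_mult, Cmod_RtoC_pos in H0 by lra. nra.
Qed.

Lemma pgf_disc (z : C) : Cmod z <= 1 -> Cmod (P z) <= Cmod z.
Proof.
  intros Hz. pose proof (Cmod_ge_0 z). eapply Rle_trans; [apply pgf_contract; auto|].
  rewrite <- (Rmult_1_r (Cmod z)) at 3. apply Rmult_le_compat_l; auto. nra.
Qed.

Lemma pgf_iter_disc (t : nat) (z : C) : Cmod z <= 1 -> Cmod (iterate P t z) <= Cmod z.
Proof.
  intros Hz. induction t; [apply Rle_refl|]. rewrite iterate_S.
  eapply Rle_trans; [apply pgf_disc; lra|auto].
Qed.

Lemma pgf_one : P 1 = 1%C.
Proof.
  assert (H1 : cseq_lim (csum (fun k => RtoC (a k) * 1 ^ k)%C) 1).
  { destruct ha as (_ & _ & Hs).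
    apply (cseq_lim_shift _ _ 1).
    apply cseq_lim_ext with (m := 0%nat) (u := fun n => RtoC (sum_n a n)).
    - intros n _. induction n; [rewrite sum_O; simpl; ring|].
      rewrite sum_Sn. unfold plus; simpl AbelianMonoid.plus. rewrite RtoC_plus, IHn.
      change (csum (fun k => RtoC (a k) * 1 ^ k)%C (1 + S n)) with
        (csum (fun k => RtoC (a k) * 1 ^ k)%C (1 + n) + RtoC (a (S n)) * 1 ^ S n)%C.
      assert (E1 : forall m, (1 ^ m)%C = 1%C) by (induction m; simpl; [auto|rewrite IHm; ring]).
      rewrite E1. ring.
    - intros e He.
      assert (Hs' : is_lim_seq (sum_n a) 1) by exact Hs.
      apply is_lim_seq_spec in Hs'. destruct (Hs' (mkposreal e He)) as [N HN].
      exists N. intros n Hn. specialize (HN n Hn). simpl in HN.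
      rewrite <- RtoC_minus, Cmod_R. lra. }
  eapply cseq_lim_unique; [apply pgf_series; rewrite Cmod_1; lra|exact H1].
Qed.

Lemma pgf_P_Cdiff (z : C) : D z -> Cdiff P z.
Proof.
  intros Hz. destruct hP as (_ & _ & _ & Hh & _). destruct (Hh z Hz) as [l Hl].
  exists l. apply is_derive_is_Cder. exact Hl.
Qed.

Lemma D_disc (z : C) : Cmod z <= 1 -> D z.
Proof. apply hP. Qed.

Lemma D_open (z : C) : D z -> exists d, 0 < d /\ forall w, Cmod (w - z) < d -> D w.
Proof. intros Hz. apply locally_C_Cmod. apply hP; auto. Qed.

(** On [0, 1] the modulus of P(x) is at most x (p + (1 - p) x), with equal value at 1 and slope 2 -
    p there. Hence E >= 2 - p. *)
Lemma mean_gt_1 : 1 < E.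
Proof.
  apply Rlt_le_trans with (2 - p); [lra|]. apply le_epsilon. intros e He.
  pose proof (is_derive_is_Cder _ _ _ hE (e / 2) ltac:(lra)) as (d & Hd & H).
  set (h := Rmin (d / 2) (Rmin (1 / 2) (e / 2))).
  assert (Hh : 0 < h) by (unfold h; repeat apply Rmin_pos; lra).
  assert (Hh2 : h <= d / 2 /\ h <= 1 / 2 /\ h <= e / 2).
  { unfold h. pose proof (Rmin_l (d / 2) (Rmin (1 / 2) (e / 2))). pose proof (Rmin_r (d / 2) (Rmin (1 / 2) (e / 2))).
    pose proof (Rmin_l (1 / 2) (e / 2)). pose proof (Rmin_r (1 / 2) (e / 2)). lra. }
  specialize (H (RtoC (1 - h))).
  replace (RtoC (1 - h) - 1)%C with (RtoC (- h)) in H by (apply injective_projections; simpl; ring).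
  rewrite Cmod_R, Rabs_Ropp, Rabs_pos_eq in H by lra. specialize (H ltac:(lra)).
  rewrite pgf_one in H.
  pose proof (pgf_contract (RtoC (1 - h)) ltac:(rewrite Cmod_RtoC_pos; lra)) as H1.
  rewrite Cmod_RtoC_pos in H1 by lra.
  pose proof (Cmod_triangle_rev 1 (P (RtoC (1 - h)))) as H2. rewrite Cmod_1 in H2.
  pose proof (Rabs_Re_le (P (RtoC (1 - h)) - 1 - RtoC E * RtoC (- h))%C) as H3.
  pose proof (Rle_abs (- (Re (P (RtoC (1 - h)) - 1 - RtoC E * RtoC (- h))%C))) as H4. rewrite Rabs_Ropp in H4.
  assert (H5 : Re (P (RtoC (1 - h))) <= Cmod (P (RtoC (1 - h)))).
  { eapply Rle_trans; [apply Rle_abs|apply Rabs_Re_le]. }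
  assert (H6 : Re (P (RtoC (1 - h)) - 1 - RtoC E * RtoC (- h))%C = Re (P (RtoC (1 - h))) - 1 + E * h)
    by (unfold Re; simpl; ring).
  rewrite H6 in *.
  assert (H7 : h * (2 - p - (1 - p) * h) <= h * (E + e / 2)) by nra.
  apply Rmult_le_reg_l in H7; auto. nra.
Qed.

(** Since p < 1 some a_k with k >= 2 is positive. If |P(z)| = 1, the terms p z and a_k z^k must have
    modulus 1 and the same direction, so z^(k-1) = 1; the witness is k - 1. *)
Lemma pgf_strict : exists k, (1 <= k)%nat /\ forall z, Cmod z <= 1 -> Cmod (P z) = 1 -> (z ^ k)%C = 1%C.
Proof.
  destruct ha as (H0 & Hn & Hs).
  assert (Hex : exists k, (2 <= k)%nat /\ 0 < a k).
  { apply NNPP. intros Hno.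
    assert (Hz : forall k, (2 <= k)%nat -> a k = 0).
    { intros k Hk. apply Rle_antisym; [|auto]. apply Rnot_lt_le. intros h. apply Hno. eauto. }
    assert (Hsum : forall n, sum_n a n <= p).
    { induction n; [rewrite sum_O, H0; lra|]. rewrite sum_Sn. unfold plus; simpl.
      destruct n; [rewrite sum_O, H0, hp; lra|]. rewrite (Hz (S (S n))) by lia. lra. }
    assert (1 <= p); [|lra].
    assert (Hs' : is_lim_seq (sum_n a) 1) by exact Hs.
    pose proof (is_lim_seq_le (sum_n a) (fun _ => p) 1 p Hsum Hs' (is_lim_seq_const p)) as H. exact H. }
  destruct Hex as (k & Hk & Hak). exists (k - 1)%nat. split; [lia|].
  intros z Hz HPz. pose proof (pgf_two_terms k z Hk Hz) as H. pose proof (Cmod_ge_0 z) as Hz0.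
  assert (Hz2 : Cmod z ^ 2 <= 1) by (simpl; nra).
  assert (Hkp : 0 <= 1 - p - a k).
  { pose proof (pgf_partial_sum_le k).
    assert (p + a k <= sum_n a k); [|lra].
    assert (Hmono : forall n, (1 <= n)%nat -> p <= sum_n a n).
    { induction n; [lia|]. intros _. rewrite sum_Sn. unfold plus; simpl.
      destruct n; [rewrite sum_O, H0, hp; lra|]. specialize (IHn ltac:(lia)). specialize (Hn (S (S n))). lra. }
    destruct k; [lia|]. rewrite sum_Sn. unfold plus; simpl. specialize (Hmono k ltac:(lia)). lra. }
  set (u := (z ^ (k - 1))%C).
  assert (Hu : Cmod u <= 1).
  { unfold u. rewrite Cmod_pow. rewrite <- (pow1 (k - 1)). apply pow_incr. lra. }
  assert (Hzk : (RtoC p * z + RtoC (a k) * z ^ k)%C = (z * (RtoC p + RtoC (a k) * u))%C).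
  { unfold u. replace k with (S (k - 1)) at 2 by lia. simpl. ring. }
  assert (Hlow : p + a k <= Cmod (RtoC p + RtoC (a k) * u)).
  { pose proof (Cmod_triangle (P z - RtoC p * z - RtoC (a k) * z ^ k) (RtoC p * z + RtoC (a k) * z ^ k)) as HT.
    replace (P z - RtoC p * z - RtoC (a k) * z ^ k + (RtoC p * z + RtoC (a k) * z ^ k))%C with (P z) in HT by ring.
    rewrite HPz, Hzk, Cmod_mult in HT.
    pose proof (Cmod_ge_0 (RtoC p + RtoC (a k) * u)). nra. }
  pose proof (Cmod2_alt (RtoC p + RtoC (a k) * u)) as H1.
  pose proof (Cmod2_alt u) as H2.
  assert (E1 : Re (RtoC p + RtoC (a k) * u)%C = p + a k * Re u) by (unfold Re; simpl; ring).
  assert (E2 : Im (RtoC p + RtoC (a k) * u)%C = a k * Im u) by (unfold Im; simpl; ring).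
  rewrite E1, E2 in H1. pose proof (Cmod_ge_0 u) as Hu0.
  set (m := Cmod (RtoC p + RtoC (a k) * u)) in *. set (x := Re u) in *. set (y := Im u) in *.
  assert (Hm : (p + a k) ^ 2 <= m ^ 2) by (apply pow_incr; lra).
  assert (Hxy : x ^ 2 + y ^ 2 <= 1) by (rewrite <- H2; simpl; nra).
  assert (Hx : 1 <= x).
  { assert (Hpa : 0 < p * a k) by (apply Rmult_lt_0_compat; lra).
    assert (0 <= p * a k * (x - 1)); [|apply Rmult_le_reg_l with (p * a k); lra].
    assert (a k * a k * (x ^ 2 + y ^ 2) <= a k * a k * 1) by (apply Rmult_le_compat_l; nra). nra. }
  assert (x = 1) by nra. assert (y = 0) by nra.
  fold u. apply injective_projections; simpl; [exact H3|exact H4].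
Qed.

Lemma iter_Cdiff (t : nat) (z : C) : (forall j, (j < t)%nat -> D (iterate P j z)) -> Cdiff (iterate P t) z.
Proof.
  induction t; intros H; [apply Cdiff_id|].
  apply (Cdiff_comp (iterate P t) P); [apply IHt; intros; apply H; lia|].
  apply pgf_P_Cdiff, H. lia.
Qed.

(** On |z| <= rho one step contracts by q, and rho is small enough for q^2 < p: the increments of
    p^(-t) P^t(z) are of size q^(2t) / p^(t+1), so this makes the limit Phi converge
    geometrically. *)
Let rho := p / 2.
Let q := p + (1 - p) * rho.

Lemma rho_q : 0 < rho < 1 /\ 0 < q < 1 /\ q * q / p < 1.
Proof.
  unfold q, rho. split; [lra|split; [split; nra|]].
  apply Rlt_div_l; [lra|].
  (* Here q = p (3 - p) / 2, and 4 - p (3 - p)^2 = (1 - p)^2 (4 - p). *)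
  assert (0 < p * ((1 - p) * (1 - p) * (4 - p) / 4)).
  { apply Rmult_lt_0_compat; [lra|]. apply Rdiv_lt_0_compat; [|lra].
    repeat apply Rmult_lt_0_compat; lra. }
  lra.
Qed.

Lemma iter_geometric (t : nat) (z : C) : Cmod z <= rho -> Cmod (iterate P t z) <= q ^ t * Cmod z.
Proof.
  destruct rho_q as (R1 & R2 & R3). intros Hz. induction t.
  - simpl. rewrite Rmult_1_l. apply Rle_refl.
  - rewrite iterate_S. pose proof (pgf_iter_disc t z ltac:(lra)) as H.
    eapply Rle_trans; [apply pgf_contract; lra|].
    pose proof (Cmod_ge_0 (iterate P t z)).
    apply Rle_trans with (Cmod (iterate P t z) * q).
    + apply Rmult_le_compat_l; auto. unfold q. nra.
    + simpl. nra.
Qed.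

Lemma disc_iter_to_rho (z : C) : Cmod z < 1 -> exists T, Cmod (iterate P T z) < rho.
Proof.
  destruct rho_q as (R1 & R2 & R3). intros Hz. pose proof (Cmod_ge_0 z).
  set (s := p + (1 - p) * Cmod z). assert (Hs : 0 < s < 1) by (unfold s; nra).
  assert (H1 : forall t, Cmod (iterate P t z) <= s ^ t).
  { induction t; [simpl; lra|]. rewrite iterate_S.
    pose proof (pgf_iter_disc t z ltac:(lra)) as H1.
    eapply Rle_trans; [apply pgf_contract; lra|].
    pose proof (Cmod_ge_0 (iterate P t z)). simpl. rewrite Rmult_comm.
    apply Rmult_le_compat; auto; unfold s; nra. }
  destruct (pow_lt_1_zero s ltac:(rewrite Rabs_pos_eq; lra) rho ltac:(lra)) as [N HN].
  specialize (HN N (Nat.le_refl N)). rewrite Rabs_pos_eq in HN by (apply pow_le; lra).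
  exists N. specialize (H1 N). lra.
Qed.

Lemma rho_basin (z : C) : Cmod z <= rho -> basin0 D P z.
Proof.
  destruct rho_q as (R1 & R2 & R3). intros Hz. split.
  - intros t. apply D_disc. pose proof (pgf_iter_disc t z ltac:(lra)). lra.
  - apply cseq_lim_filterlim. intros e He.
    destruct (pow_lt_1_zero q ltac:(rewrite Rabs_pos_eq; lra) e He) as [N HN].
    exists N. intros n Hn. specialize (HN n Hn). rewrite Rabs_pos_eq in HN by (apply pow_le; lra).
    replace (iterate P n z - 0)%C with (iterate P n z) by ring.
    pose proof (iter_geometric n z Hz). pose proof (pow_le q n ltac:(lra)). pose proof (Cmod_ge_0 z). nra.
Qed.

Lemma basin_pullback (T : nat) (z : C) : (forall j, (j < T)%nat -> D (iterate P j z)) ->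
  basin0 D P (iterate P T z) -> basin0 D P z.
Proof.
  intros HD [H1 H2]. split.
  - intros t. destruct (lt_dec t T); auto.
    replace t with ((t - T) + T)%nat by lia. rewrite iterate_add. apply H1.
  - apply cseq_lim_filterlim. apply cseq_lim_filterlim in H2.
    apply (cseq_lim_shift _ _ T).
    apply cseq_lim_ext with (m := 0%nat) (u := fun t => iterate P t (iterate P T z)); auto.
    intros n _. rewrite <- iterate_add. f_equal. lia.
Qed.

Lemma disc_basin (z : C) : Cmod z < 1 -> basin0 D P z.
Proof.
  intros Hz. destruct (disc_iter_to_rho z Hz) as [T HT]. apply (basin_pullback T).
  - intros j _. apply D_disc. pose proof (pgf_iter_disc j z ltac:(lra)). lra.
  - apply rho_basin. lra.
Qed.

Lemma basin_iter (t : nat) (z : C) : basin0 D P z -> basin0 D P (iterate P t z).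
Proof.
  intros [H1 H2]. split.
  - intros j. rewrite <- iterate_add. apply H1.
  - apply cseq_lim_filterlim. apply cseq_lim_filterlim in H2. intros e He.
    destruct (H2 e He) as [N HN]. exists N. intros n Hn. rewrite <- iterate_add. apply HN. lia.
Qed.

(** A single T brings a whole neighbourhood into the disc of radius rho, so identities that hold
    there can be pulled back and differentiated. *)
Lemma basin_open (z : C) : basin0 D P z -> exists T d, 0 < d /\
  forall w, Cmod (w - z) < d -> Cmod (iterate P T w) < rho /\ basin0 D P w.
Proof.
  destruct rho_q as (R1 & R2 & R3). intros [H1 H2].
  apply cseq_lim_filterlim in H2. destruct (H2 (rho / 2) ltac:(lra)) as [T HT].
  specialize (HT T (Nat.le_refl T)). replace (iterate P T z - 0)%C with (iterate P T z) in HT by ring.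
  assert (Hc : forall t, Ccont (iterate P t) z) by (intros; apply Cdiff_cont, iter_Cdiff; auto).
  assert (HD : forall t, exists d, 0 < d /\ forall w, Cmod (w - z) < d -> forall j, (j < t)%nat -> D (iterate P j w)).
  { induction t; [exists 1; split; [lra|]; intros; lia|].
    destruct IHt as (d & Hd & Hdj). destruct (D_open _ (H1 t)) as (e & He & HDe).
    destruct (Hc t e He) as (d' & Hd' & Hct).
    exists (Rmin d d'). split; [apply Rmin_pos; auto|]. intros w Hw j Hj.
    pose proof (Rmin_l d d'). pose proof (Rmin_r d d').
    destruct (Nat.eq_dec j t) as [->|]; [apply HDe, Hct; lra|apply Hdj; [lra|lia]]. }
  destruct (HD T) as (d & Hd & Hdj). destruct (Hc T (rho / 2) ltac:(lra)) as (d' & Hd' & Hct).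
  exists T, (Rmin d d'). split; [apply Rmin_pos; auto|]. intros w Hw.
  pose proof (Rmin_l d d'). pose proof (Rmin_r d d').
  assert (HwT : Cmod (iterate P T w) < rho).
  { specialize (Hct w ltac:(lra)). pose proof (Cmod_triangle_rev (iterate P T w) (iterate P T z)). lra. }
  split; auto. apply (basin_pullback T); [intros; apply Hdj; auto; lra|]. apply rho_basin. lra.
Qed.

(** * The Koenigs function of the attracting fixed point 0 *)

Lemma Phi_rho_limit : exists c s, 0 <= c /\ 0 < s < 1 /\ forall z, Cmod z <= rho ->
  cseq_lim (fun t => RtoC (/ p ^ t) * iterate P t z)%C (PhiFun P p z) /\
  forall t, Cmod (RtoC (/ p ^ t) * iterate P t z - PhiFun P p z) <= c * s ^ t / (1 - s).
Proof.
  destruct rho_q as (R1 & R2 & R3).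
  assert (Hs : 0 < q * q / p < 1) by (split; auto; apply Rdiv_lt_0_compat; nra).
  assert (Hc : 0 <= / p) by (left; apply Rinv_0_lt_compat; lra).
  exists (/ p), (q * q / p). split; [auto|split; [auto|]]. intros z Hz.
  destruct (geometric_cauchy (fun t => RtoC (/ p ^ t) * iterate P t z)%C (/ p) (q * q / p) Hc Hs) as (l & Hl & Hl2).
  { intros t. assert (Hpt : 0 < p ^ t) by (apply pow_lt; lra).
    assert (Hps : 0 < / p ^ S t) by (apply Rinv_0_lt_compat, pow_lt; lra).
    replace (RtoC (/ p ^ S t) * iterate P (S t) z - RtoC (/ p ^ t) * iterate P t z)%C
      with (RtoC (/ p ^ S t) * (P (iterate P t z) - RtoC p * iterate P t z))%C.
    2:{ rewrite iterate_S. replace (RtoC (/ p ^ t)) with (RtoC (/ p ^ S t) * RtoC p)%C; [ring|].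
        rewrite <- RtoC_mult. f_equal. simpl. field. split; lra. }
    rewrite Cmod_mult, Cmod_RtoC_pos by lra.
    pose proof (iter_geometric t z Hz) as G. pose proof (pgf_iter_disc t z ltac:(lra)) as G2.
    pose proof (pgf_quadratic (iterate P t z) ltac:(lra)) as G3.
    pose proof (Cmod_ge_0 (iterate P t z)) as G0. pose proof (pow_le q t ltac:(lra)) as Hqt.
    pose proof (Cmod_ge_0 z) as Hz0.
    assert (G1 : Cmod (iterate P t z) <= q ^ t) by nra.
    assert (G4 : Cmod (iterate P t z) ^ 2 <= q ^ t * q ^ t) by (simpl; rewrite Rmult_1_r; apply Rmult_le_compat; auto).
    replace (/ p * (q * q / p) ^ t) with (/ p ^ S t * (q ^ t * q ^ t)).
    2:{ unfold Rdiv. rewrite !Rpow_mult_distr, pow_inv. simpl. field. split; lra. }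
    apply Rmult_le_compat_l; [lra|].
    pose proof (pow2_ge_0 (Cmod (iterate P t z))). nra. }
  replace (PhiFun P p z) with l; [auto|symmetry; apply CLim_seq_unique; exact Hl].
Qed.

Lemma Phi_rho_Cdiff (z : C) : Cmod z < rho -> Cdiff (PhiFun P p) z.
Proof.
  intros Hz. destruct rho_q as (R1 & R2 & R3). destruct Phi_rho_limit as (c & s & Hc & Hs & H).
  apply (weierstrass (fun t w => RtoC (/ p ^ t) * iterate P t w)%C (PhiFun P p) z (rho - Cmod z)); [lra| |].
  - intros n w Hw. pose proof (Cmod_triangle_rev w z).
    apply Cdiff_mult; [apply Cdiff_const|]. apply iter_Cdiff. intros j _. apply D_disc.
    pose proof (pgf_iter_disc j w ltac:(lra)). lra.
  - intros eps He.
    destruct (pow_lt_1_zero s ltac:(rewrite Rabs_pos_eq; lra) (eps * (1 - s) / (c + 1))) as [N HN].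
    { apply Rdiv_lt_0_compat; [apply Rmult_lt_0_compat|]; lra. }
    exists N. intros w Hw. specialize (HN N (Nat.le_refl N)).
    pose proof (Cmod_triangle_rev w z).
    destruct (H w ltac:(lra)) as [_ H1]. eapply Rle_trans; [apply H1|].
    assert (0 < s ^ N) by (apply pow_lt; lra). rewrite Rabs_pos_eq in HN by lra.
    apply Rle_div_l; [lra|].
    apply Rle_trans with ((c + 1) * (eps * (1 - s) / (c + 1))); [apply Rmult_le_compat; lra|].
    apply Req_le. field. lra.
Qed.

(** Dropping T initial terms of the limit only rescales it. This carries convergence and holomorphy
    from the small disc to the entire basin. *)
Lemma Phi_iter (T : nat) (w : C) : Cmod (iterate P T w) <= rho ->
  PhiFun P p w = (RtoC (/ p ^ T) * PhiFun P p (iterate P T w))%C.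
Proof.
  intros Hw. destruct Phi_rho_limit as (c & s & Hc & Hs & H). destruct (H _ Hw) as [H1 _].
  apply CLim_seq_unique. apply (cseq_lim_shift _ _ T).
  apply cseq_lim_ext with (m := 0%nat)
    (u := fun t => (RtoC (/ p ^ T) * (RtoC (/ p ^ t) * iterate P t (iterate P T w)))%C).
  - intros n _. rewrite <- iterate_add, Cmult_assoc, <- RtoC_mult, (Nat.add_comm n T). f_equal.
    f_equal. rewrite pow_add. field. split; apply pow_nonzero; lra.
  - apply (cseq_lim_cont _ (fun x => RtoC (/ p ^ T) * x)%C); auto.
    apply Ccont_mult; [apply Ccont_const|apply Ccont_id].
Qed.

Lemma Phi_Cdiff (z : C) : basin0 D P z -> Cdiff (PhiFun P p) z.
Proof.
  intros Hz. destruct (basin_open z Hz) as (T & d & Hd & H).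
  apply Cdiff_ext_loc with (f := fun w => (RtoC (/ p ^ T) * PhiFun P p (iterate P T w))%C).
  - exists d. split; auto. intros w Hw. symmetry. apply Phi_iter. left. apply H; auto.
  - apply Cdiff_mult; [apply Cdiff_const|].
    apply (Cdiff_comp (iterate P T) (PhiFun P p)).
    + apply iter_Cdiff. intros; apply Hz.
    + apply Phi_rho_Cdiff. apply H. rewrite Cminus_diag_mod; auto.
Qed.

Lemma Phi_functional (z : C) : basin0 D P z -> PhiFun P p (P z) = (RtoC p * PhiFun P p z)%C.
Proof.
  intros Hz. destruct (basin_open z Hz) as (T & d & Hd & H).
  destruct (H z) as [H1 _]; [rewrite Cminus_diag_mod; auto|].
  destruct rho_q as (R1 & R2 & R3).
  assert (H2 : Cmod (iterate P (S T) z) <= rho).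
  { rewrite iterate_S. pose proof (pgf_disc (iterate P T z) ltac:(lra)). lra. }
  rewrite (Phi_iter (S T) z H2). rewrite (Phi_iter T (P z)) by (rewrite <- iterate_Sr; auto).
  rewrite <- iterate_Sr, Cmult_assoc, <- RtoC_mult. f_equal. f_equal. simpl. field.
  split; [apply pow_nonzero|]; lra.
Qed.

Lemma Phi_0 : PhiFun P p 0 = 0%C.
Proof.
  destruct rho_q as (R1 & R2 & R3).
  apply CLim_seq_unique. apply cseq_lim_ext with (m := 0%nat) (u := fun _ => 0%C).
  - intros n _. assert (H : iterate P n 0 = 0%C); [|rewrite H; ring].
    apply Cmod_eq_0. pose proof (iter_geometric n 0%C ltac:(rewrite Cmod_0; lra)).
    rewrite Cmod_0 in H. pose proof (Cmod_ge_0 (iterate P n 0)). lra.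
  - intros e He. exists 0%nat. intros. rewrite Cminus_diag_mod. lra.
Qed.
End GeneratingFunction.

(** * The function Pi in logarithmic coordinates *)

(** Since Re u >= 1/2, the argument is atan (y / x), and |atan t| <= |t|. The bound on Im w measures
    the loss of angle when 1 - z is replaced by Pi(z). *)
Lemma Cexp_log (u : C) : Cmod (u - 1) <= 1 / 2 ->
  exists w, Cexp w = u /\ Rabs (Im w) <= 2 * Cmod (u - 1).
Proof.
  intros Hu. set (e := Cmod (u - 1)) in *. destruct u as [x y].
  pose proof (Rabs_Re_le ((x, y) - 1)) as HR. pose proof (Rabs_Im_le ((x, y) - 1)) as HI.
  fold e in HR, HI. unfold Re, Im in *; simpl in HR, HI.
  assert (HR2 : Rabs (x + - (1)) <= 1 / 2) by lra. apply Rabs_le_between in HR2.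
  replace (y + - 0) with y in HI by ring.
  assert (Hx : 1 / 2 <= x) by lra.
  set (t := y / x).
  assert (Hs : 0 < sqrt (1 + t²)) by (apply sqrt_lt_R0; unfold Rsqr; nra).
  exists (ln (x * sqrt (1 + t²)), atan t). split.
  - unfold Cexp, Re, Im; simpl. rewrite exp_ln by (apply Rmult_lt_0_compat; lra).
    rewrite cos_atan, sin_atan. apply injective_projections; simpl.
    + field. lra.
    + unfold t. field. split; [lra|]. fold t. lra.
  - simpl. eapply Rle_trans.
    + assert (Hat : Rabs (atan t) <= Rabs t).
      { destruct (MVT_gen atan 0 t (fun c => / (1 + c²))) as (c & _ & Hc).
        - intros; apply is_derive_Reals. replace (/ (1 + x0²)) with (1 / (1 + x0²)) by (unfold Rdiv; ring). apply is_derive_Reals.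
          auto_derive; auto. unfold Rsqr. field. nra.
        - intros. apply derivable_continuous_pt, derivable_pt_atan.
        - rewrite atan_0 in Hc. replace (atan t) with (/ (1 + c²) * (t - 0)) by lra.
          rewrite Rminus_0_r, Rabs_mult. rewrite <- (Rmult_1_l (Rabs t)) at 2.
          apply Rmult_le_compat_r; [apply Rabs_pos|].
          assert (1 <= 1 + c²) by (pose proof (Rle_0_sqr c); lra).
          rewrite Rabs_pos_eq by (left; apply Rinv_0_lt_compat; lra).
          rewrite <- Rinv_1. apply Rinv_le_contravar; lra. }
      exact Hat.
    + unfold t. rewrite Rabs_div by lra. rewrite (Rabs_pos_eq x) by lra.
      apply Rle_div_l; [lra|]. pose proof (Rabs_pos y). nra.
Qed.

(** Separates 1 from the other n-th roots of unity: if u^n = 1 and u is not 1, then n |u - 1| >=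
    1. *)
Lemma Cpow_linear (u : C) (n : nat) : Cmod u <= 1 ->
  Cmod (u ^ n - 1 - RtoC (INR n) * (u - 1)) <= INR n * INR n * Cmod (u - 1) ^ 2.
Proof.
  intros Hu. set (d := Cmod (u - 1)). assert (Hd : 0 <= d) by apply Cmod_ge_0.
  assert (H1 : forall n, Cmod (u ^ n - 1) <= INR n * d).
  { induction n0.
    - simpl. replace (1 - 1)%C with (RtoC 0) by ring. rewrite Cmod_0. lra.
    - rewrite S_INR. change (u ^ S n0)%C with (u * u ^ n0)%C.
      replace (u * u ^ n0 - 1)%C with (u * (u ^ n0 - 1) + (u - 1))%C by ring.
      eapply Rle_trans; [apply Cmod_triangle|]. rewrite Cmod_mult. fold d.
      pose proof (Cmod_ge_0 (u ^ n0 - 1)). nra. }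
  induction n.
  - simpl. replace (1 - 1 - 0 * (u - 1))%C with (RtoC 0) by ring. rewrite Cmod_0. lra.
  - rewrite S_INR, RtoC_plus. change (u ^ S n)%C with (u * u ^ n)%C.
    replace (u * u ^ n - 1 - (RtoC (INR n) + 1) * (u - 1))%C
      with ((u ^ n - 1 - RtoC (INR n) * (u - 1)) + (u - 1) * (u ^ n - 1))%C by ring.
    eapply Rle_trans; [apply Cmod_triangle|]. rewrite Cmod_mult. fold d.
    specialize (H1 n). pose proof (pos_INR n) as Hn.
    assert (d * Cmod (u ^ n - 1) <= d * (INR n * d)) by (apply Rmult_le_compat_l; auto).
    assert (0 <= (INR n + 1) * d ^ 2) by (apply Rmult_le_pos; [lra|apply pow_le; auto]).
    fold d in IHn. replace ((INR n + 1) * (INR n + 1) * d ^ 2)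
      with (INR n * INR n * d ^ 2 + d * (INR n * d) + (INR n + 1) * d ^ 2) by ring. lra.
Qed.

Lemma Ccont_Cmod (f : C -> C) (z : C) : Ccont f z -> Ccont (fun w => RtoC (Cmod (f w))) z.
Proof.
  intros H e He. destruct (H e He) as (d & Hd & H1). exists d. split; auto. intros w Hw.
  rewrite <- RtoC_minus, Cmod_R. specialize (H1 w Hw).
  apply Rabs_lt_between. pose proof (Cmod_triangle_rev (f w) (f z)).
  pose proof (Cmod_triangle_rev (f z) (f w)) as H2. rewrite Cmod_minus_sym in H2. lra.
Qed.

Section Angle.
Variables (a : nat -> R) (p E : R) (D : C -> Prop) (P : C -> C).
Hypothesis ha : is_pgf a.
Hypothesis hp : a 1%nat = p.
Hypothesis hp01 : 0 < p < 1.
Hypothesis hP : extends_pgf a D P.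
Hypothesis hE : is_derive (K := C_AbsRing) (V := C_NormedModule) P (RtoC 1) (RtoC E).
Let HE1 : 1 < E := mean_gt_1 a p E D P ha hp hp01 hP hE.
Let L := ln E.

Lemma lnE_pos : 0 < L.
Proof. unfold L. rewrite <- ln_1. apply ln_increasing; lra. Qed.

Lemma exp_L : exp L = E.
Proof. apply exp_ln. lra. Qed.

(** The radius is shrunk until the quadratic error is at most a quarter of |z| and Pi stays in D.
    The linear coefficient supplied by Cauchy's formula is E by uniqueness of the derivative. *)
Lemma Pi_local : exists d0, 0 < d0 /\
  (forall z, Cmod z <= d0 -> cseq_lim (fun t => iterate P t (1 - z / RtoC (E ^ t)))%C (PiFun P E z)) /\
  (exists K0, 0 < K0 /\ K0 * d0 <= 1 / 4 /\
     forall z, Cmod z <= d0 -> Cmod (PiFun P E z - 1 + z) <= K0 * Cmod z * Cmod z) /\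
  (forall z w, Cmod z <= d0 -> Cmod w <= d0 -> Cmod (PiFun P E z - PiFun P E w) <= 2 * Cmod (z - w)) /\
  (forall z, Cmod z <= d0 -> Cdiff (PiFun P E) z) /\
  (forall z, Cmod z <= d0 -> D (PiFun P E z)).
Proof.
  destruct (D_open a D P hP 1%C) as (e & He & HDe).
  { apply (D_disc a D P hP). rewrite Cmod_1. lra. }
  set (r := e / 4). assert (Hr : 0 < r) by (unfold r; lra).
  assert (Hsq : forall z, in_square 1 r z -> Cdiff P z).
  { intros z Hz. apply (pgf_P_Cdiff a D P hP). apply HDe. apply in_square_Cmod in Hz. unfold r in Hz. lra. }
  destruct (cauchy_strong P 1 r Hr (cauchy_formula P 1 r Hr Hsq)) as (l & A & HA & HS).
  assert (El : l = RtoC E).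
  { apply (is_Cder_unique P 1); [apply (strong_is_Cder P 1 l (r / 2) A); auto; lra|].
    apply is_derive_is_Cder; auto. }
  subst l.
  destruct (repelling_linearisation P E (r / 2) A HE1 ltac:(lra) HA (pgf_one a D P ha hP) HS)
    as (d0 & K0 & Hd0 & HK0 & H1 & H2 & H3).
  { intros h Hh. apply (pgf_P_Cdiff a D P hP), HDe. replace (1 + h - 1)%C with h by ring. unfold r in *. lra. }
  set (d := Rmin (d0 / 2) (Rmin (/ (4 * K0)) (e / 4))).
  assert (Hd : 0 < d).
  { unfold d. repeat apply Rmin_pos; try lra. apply Rinv_0_lt_compat; lra. }
  assert (Hdb : d <= d0 / 2 /\ d <= / (4 * K0) /\ d <= e / 4).
  { unfold d. pose proof (Rmin_l (d0 / 2) (Rmin (/ (4 * K0)) (e / 4))). pose proof (Rmin_r (d0 / 2) (Rmin (/ (4 * K0)) (e / 4))).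
    pose proof (Rmin_l (/ (4 * K0)) (e / 4)). pose proof (Rmin_r (/ (4 * K0)) (e / 4)). lra. }
  assert (HKd : K0 * d <= 1 / 4).
  { apply Rle_trans with (K0 * / (4 * K0)); [apply Rmult_le_compat_l; lra|]. apply Req_le; field; lra. }
  assert (Hpi0 : PiFun P E 0 = 1%C).
  { eapply cseq_lim_unique; [apply H1; rewrite Cmod_0; lra|].
    apply cseq_lim_ext with (m := 0%nat) (u := fun _ => 1%C).
    - intros n _. assert (HEn : RtoC (E ^ n) <> 0%C) by (apply RtoC_neq_0, pow_nonzero; lra).
      replace (1 - 0 / RtoC (E ^ n))%C with (1 + 0)%C by (field; auto).
      symmetry. apply (one_fixed P). apply (pgf_one a D P ha hP).
    - intros eps Heps. exists 0%nat. intros. rewrite Cminus_diag_mod. lra. }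
  assert (HQ : forall z, Cmod z <= d -> Cmod (PiFun P E z - 1 + z) <= K0 * Cmod z * Cmod z).
  { intros z Hz. pose proof (H2 z 0%C ltac:(lra) ltac:(rewrite Cmod_0; lra)) as H.
    rewrite Hpi0, Cmod_0, Rplus_0_r in H. replace (z - 0)%C with z in H by ring. exact H. }
  exists d. split; [auto|]. split; [intros; apply H1; lra|].
  split; [exists K0; repeat split; auto|]. split; [|split].
  - intros z w Hz Hw. pose proof (H2 z w ltac:(lra) ltac:(lra)) as H. pose proof (Cmod_ge_0 (z - w)).
    replace (PiFun P E z - PiFun P E w)%C with ((PiFun P E z - PiFun P E w + (z - w)) - (z - w))%C by ring.
    eapply Rle_trans; [apply Cmod_minus_triangle|].
    pose proof (Cmod_ge_0 z). pose proof (Cmod_ge_0 w).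
    assert (K0 * (Cmod z + Cmod w) <= 1) by nra. nra.
  - intros z Hz. apply H3. lra.
  - intros z Hz. apply HDe. specialize (HQ z Hz).
    replace (PiFun P E z - 1)%C with ((PiFun P E z - 1 + z) - z)%C by ring.
    eapply Rle_lt_trans; [apply Cmod_minus_triangle|]. pose proof (Cmod_ge_0 z).
    assert (K0 * Cmod z * Cmod z <= Cmod z) by nra. lra.
Qed.

Lemma E_pow_neq (t : nat) : RtoC (E ^ t) <> 0%C.
Proof. apply RtoC_neq_0, pow_nonzero. lra. Qed.

(** The functional equation Pi(E^s z) = P^s(Pi(z)), together with convergence of the limit that
    defines the left side. The orbit must remain in D so that the iterates are continuous at w. *)
Lemma Pi_pull (s : nat) (z w : C) :
  cseq_lim (fun t => iterate P t (1 - z / RtoC (E ^ t)))%C w ->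
  (forall j, (j < s)%nat -> D (iterate P j w)) ->
  cseq_lim (fun t => iterate P t (1 - (RtoC (E ^ s) * z) / RtoC (E ^ t)))%C (iterate P s w) /\
  PiFun P E (RtoC (E ^ s) * z) = iterate P s w.
Proof.
  intros Hz HD.
  assert (H : cseq_lim (fun t => iterate P t (1 - (RtoC (E ^ s) * z) / RtoC (E ^ t)))%C (iterate P s w)).
  { apply (cseq_lim_shift _ _ s).
    apply cseq_lim_ext with (m := 0%nat) (u := fun t => iterate P s (iterate P t (1 - z / RtoC (E ^ t)))%C).
    - intros n _. rewrite iterate_add. f_equal. f_equal. rewrite pow_add, RtoC_mult.
      pose proof (E_pow_neq s). pose proof (E_pow_neq n). field. auto.
    - apply cseq_lim_cont; auto. apply Cdiff_cont, (iter_Cdiff a D P hP); auto. }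
  split; auto. apply CLim_seq_unique. exact H.
Qed.

(* The logarithmic form of the sector condition, with the point 1 - z replaced by Pi(z) =
   1 - z + O(z^2); the price is an arbitrarily small loss in the angle. *)
Definition good_angle (phi0 : R) : Prop :=
  exists d, 0 < d /\ forall v, Rabs (Im v) < phi0 -> exp (Re v) < d -> basin0 D P (PiFun P E (Cexp v)).

(** Write 1 - Pi(z) = z u with u near 1 and u = exp w. Then Pi(exp v) = 1 - exp (v + w), a point of
    the sector as soon as |Im w| is below the loss phi0 - phi1. *)
Lemma sector_good (phi0 phi1 : R) : sector_angle D P phi0 -> phi1 < phi0 -> good_angle phi1.
Proof.
  intros [_ (r0 & Hr0 & HS)] Hphi.
  destruct Pi_local as (d0 & Hd0 & _ & (K0 & HK0 & HK0d & HQ) & _ & _ & _).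
  (* The middle entry allows for |u| <= 2; the last makes |Im w| <= 2 K0 |z| at most half of phi0 -
     phi1. *)
  set (d := Rmin d0 (Rmin (r0 / 2) ((phi0 - phi1) / (2 * K0 * 2)))).
  exists d. split.
  { unfold d. repeat apply Rmin_pos; try lra. apply Rdiv_lt_0_compat; lra. }
  intros v Hv1 Hv2.
  assert (Hd : d <= d0 /\ d <= r0 / 2 /\ d <= (phi0 - phi1) / (2 * K0 * 2)).
  { unfold d. set (u := (phi0 - phi1) / (2 * K0 * 2)).
    pose proof (Rmin_l d0 (Rmin (r0 / 2) u)). pose proof (Rmin_r d0 (Rmin (r0 / 2) u)).
    pose proof (Rmin_l (r0 / 2) u). pose proof (Rmin_r (r0 / 2) u). lra. }
  set (z := Cexp v). assert (Hz : Cmod z = exp (Re v)) by apply Cmod_Cexp.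
  assert (Hz0 : z <> 0%C) by apply Cexp_neq_0. assert (Hzp : 0 < Cmod z) by (apply Cmod_gt_0; auto).
  specialize (HQ z ltac:(lra)).
  set (u := ((1 - PiFun P E z) / z)%C).
  assert (Hu : Cmod (u - 1) <= K0 * Cmod z).
  { unfold u. replace ((1 - PiFun P E z) / z - 1)%C with (- (PiFun P E z - 1 + z) / z)%C by (field; auto).
    rewrite Cmod_div, Cmod_opp by auto. apply Rle_div_l; auto. }
  assert (Hu2 : K0 * Cmod z <= 1 / 4).
  { apply Rle_trans with (K0 * d0); auto. apply Rmult_le_compat_l; lra. }
  destruct (Cexp_log u ltac:(lra)) as (w & Hw1 & Hw2).
  assert (EPi : PiFun P E z = (1 - RtoC (exp (Re (v + w))) * Cexp (Ci * RtoC (Im (v + w))))%C).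
  { replace (PiFun P E z) with (1 - z * u)%C by (unfold u; field; auto).
    rewrite <- Hw1. unfold z. rewrite <- Cexp_plus, <- Cexp_RtoC, <- Cexp_plus. f_equal. f_equal.
    apply injective_projections; unfold Re, Im; simpl; ring. }
  rewrite EPi.
  assert (HJ : julia0 D P (1 - RtoC (exp (Re (v + w))) * Cexp (Ci * RtoC (Im (v + w))))%C).
  { apply HS.
    - assert (Him : Rabs (Im (v + w)%C) < phi0).
      { replace (Im (v + w)%C) with (Im v + Im w) by reflexivity.
        eapply Rle_lt_trans; [apply Rabs_triang|].
        assert (2 * K0 * Cmod z <= (phi0 - phi1) / 2).
        { apply Rle_trans with (2 * K0 * ((phi0 - phi1) / (2 * K0 * 2))); [apply Rmult_le_compat_l; lra|].
          apply Req_le. field. lra. }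
        lra. }
      apply Rabs_lt_between in Him. exact Him.
    - split; [apply exp_pos|].
      rewrite <- Cmod_Cexp, Cexp_plus, Hw1, Cmod_mult. fold z.
      assert (Cmod u <= 2).
      { replace u with ((u - 1) + 1)%C by ring. eapply Rle_trans; [apply Cmod_triangle|]. rewrite Cmod_1. lra. }
      nra. }
  destruct HJ as (S & _ & HSB & _ & HSz). apply HSB; auto.
Qed.

(** * An admissible half-angle larger than a right angle *)

Lemma Pi_disc_closed : exists d, 0 < d /\ forall z, Cmod z <= d -> 0 <= Re z -> Cmod (PiFun P E z) <= 1.
Proof.
  destruct Pi_local as (d0 & Hd0 & Hlim & _ & Hlip & _ & _).
  assert (Hpos : forall z, Cmod z <= d0 -> 0 < Re z -> Cmod (PiFun P E z) <= 1).
  { intros z Hz Hre. pose proof (Hlim z Hz) as HL.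
    (* |1 - z / E^n| <= 1 is equivalent to |z|^2 <= 2 Re z * E^n, true for large n when Re z > 0. *)
    destruct (Pow_x_infinity E ltac:(rewrite Rabs_pos_eq; lra) (Cmod z ^ 2 / (2 * Re z))) as [N HN].
    replace (PiFun P E z) with (PiFun P E z - 0)%C by ring.
    apply (cseq_lim_bound _ _ _ _ N HL). intros n Hn. specialize (HN n Hn).
    assert (HEn : 0 < E ^ n) by (apply pow_lt; lra). rewrite Rabs_pos_eq in HN by lra.
    replace (iterate P n (1 - z / RtoC (E ^ n)) - 0)%C with (iterate P n (1 - z / RtoC (E ^ n))%C) by ring.
    assert (Hm : Cmod (1 - z / RtoC (E ^ n)) <= 1).
    { pose proof (Cmod_ge_0 (1 - z / RtoC (E ^ n))) as Hge.
      assert (H2 : Cmod (1 - z / RtoC (E ^ n)) ^ 2 <= 1).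
      { rewrite Cmod2_alt.
        replace (z / RtoC (E ^ n))%C with (RtoC (/ E ^ n) * z)%C
          by (rewrite RtoC_inv by lra; field; apply E_pow_neq).
        pose proof (Cmod2_alt z) as Hz2.
        replace (Re (1 - RtoC (/ E ^ n) * z)%C) with (1 - / E ^ n * Re z) by (unfold Re; simpl; ring).
        replace (Im (1 - RtoC (/ E ^ n) * z)%C) with (- (/ E ^ n * Im z)) by (unfold Im; simpl; ring).
        set (ee := / E ^ n). assert (Hee : 0 < ee) by (apply Rinv_0_lt_compat; auto).
        assert (H3 : ee * (Re z ^ 2 + Im z ^ 2) <= 2 * Re z).
        { rewrite <- Hz2. apply Rle_trans with (ee * (2 * Re z * E ^ n)).
          - apply Rmult_le_compat_l; [lra|]. apply Rge_le in HN. apply Rle_div_l in HN; lra.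
          - apply Req_le. unfold ee. field. lra. }
        nra. }
      nra. }
    pose proof (pgf_iter_disc a p D P ha hp hp01 hP n _ Hm). lra. }
  exists (d0 / 2). split; [lra|]. intros z Hz Hre.
  apply le_epsilon. intros e He.
  (* Points of the imaginary axis are reached by a shift h to the right and the Lipschitz bound. *)
  set (h := Rmin (d0 / 2) (e / 2)). assert (Hh : 0 < h) by (unfold h; apply Rmin_pos; lra).
  assert (Hh2 : h <= d0 / 2 /\ h <= e / 2) by (unfold h; split; [apply Rmin_l|apply Rmin_r]).
  assert (Hzh : Cmod (z + RtoC h) <= d0).
  { eapply Rle_trans; [apply Cmod_triangle|]. rewrite Cmod_RtoC_pos; lra. }
  pose proof (Hpos (z + RtoC h)%C Hzh ltac:(unfold Re in *; simpl; lra)) as H1.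
  pose proof (Hlip z (z + RtoC h)%C ltac:(lra) Hzh) as H2.
  replace (z - (z + RtoC h))%C with (- RtoC h)%C in H2 by ring. rewrite Cmod_opp, Cmod_RtoC_pos in H2 by lra.
  pose proof (Cmod_triangle_rev (PiFun P E z) (PiFun P E (z + RtoC h))). lra.
Qed.

(** If |Pi(z)| = 1, then u = Pi(z / E) satisfies |P(u)| = 1, hence u^k = 1 for the fixed k of
    [pgf_strict]. But u - 1 is close to - z / E, nonzero and smaller than the gap between 1 and the
    other k-th roots of unity. *)
Lemma Pi_disc_open : exists d, 0 < d /\ forall z, Cmod z <= d -> 0 <= Re z -> z <> 0%C -> Cmod (PiFun P E z) < 1.
Proof.
  destruct Pi_local as (d0 & Hd0 & Hlim & (K0 & HK0 & HK0d & HQ) & _ & _ & HD).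
  destruct Pi_disc_closed as (d1 & Hd1 & Hcl).
  destruct (pgf_strict a p D P ha hp hp01 hP) as (k & Hk & Hst).
  assert (HINR : 1 <= INR k) by (apply (le_INR 1 k) in Hk; simpl in Hk; lra).
  set (d := Rmin d0 (Rmin d1 (/ (4 * INR k)))).
  assert (Hd : 0 < d).
  { unfold d. repeat apply Rmin_pos; try lra. apply Rinv_0_lt_compat; lra. }
  assert (Hdb : d <= d0 /\ d <= d1 /\ d <= / (4 * INR k)).
  { unfold d. pose proof (Rmin_l d0 (Rmin d1 (/ (4 * INR k)))). pose proof (Rmin_r d0 (Rmin d1 (/ (4 * INR k)))).
    pose proof (Rmin_l d1 (/ (4 * INR k))). pose proof (Rmin_r d1 (/ (4 * INR k))). lra. }
  exists d. split; auto. intros z Hz Hre Hz0.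
  destruct (Rle_lt_or_eq_dec _ _ (Hcl z ltac:(lra) Hre)) as [h|h]; auto. exfalso.
  set (w := (z / RtoC E)%C).
  assert (HEC : RtoC E <> 0%C) by (apply RtoC_neq_0; lra).
  assert (Hw : Cmod w = Cmod z / E) by (unfold w; rewrite Cmod_div, Cmod_RtoC_pos; auto; lra).
  assert (Hwz : Cmod w <= Cmod z).
  { rewrite Hw. pose proof (Cmod_ge_0 z). apply Rle_div_l; nra. }
  assert (Hwre : 0 <= Re w).
  { unfold w. replace (z / RtoC E)%C with (RtoC (/ E) * z)%C by (rewrite RtoC_inv by lra; field; auto).
    rewrite Re_scal. apply Rmult_le_pos; auto. left; apply Rinv_0_lt_compat; lra. }
  assert (Hwp : 0 < Cmod w).
  { rewrite Hw. apply Rdiv_lt_0_compat; [apply Cmod_gt_0; auto|lra]. }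
  set (u := PiFun P E w). assert (Hu : Cmod u <= 1) by (apply Hcl; auto; lra).
  assert (HPu : P u = PiFun P E z).
  { destruct (Pi_pull 1 w u (Hlim w ltac:(lra))) as [_ HH].
    - intros j Hj. replace j with 0%nat by lia. apply HD. lra.
    - simpl in HH. rewrite <- HH. f_equal. unfold w. rewrite Rmult_1_r. field. auto. }
  pose proof (Hst u Hu ltac:(rewrite HPu; auto)) as Huk.
  pose proof (Cpow_linear u k Hu) as HL. rewrite Huk in HL.
  replace (1 - 1 - RtoC (INR k) * (u - 1))%C with (- (RtoC (INR k) * (u - 1)))%C in HL by ring.
  rewrite Cmod_opp, Cmod_mult, Cmod_RtoC_pos in HL by lra.
  specialize (HQ w ltac:(lra)). fold u in HQ.
  assert (HKw : K0 * Cmod w <= 1 / 4).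
  { apply Rle_trans with (K0 * d0); auto. apply Rmult_le_compat_l; lra. }
  assert (Hq : K0 * Cmod w * Cmod w <= Cmod w / 4) by nra.
  assert (H1 : Cmod (u - 1) <= 2 * Cmod w).
  { replace (u - 1)%C with ((u - 1 + w) - w)%C by ring. eapply Rle_trans; [apply Cmod_minus_triangle|]. lra. }
  assert (H2 : Cmod w / 2 <= Cmod (u - 1)).
  { pose proof (Cmod_triangle_rev w (u - 1 + w)) as T. replace (w - (u - 1 + w))%C with (- (u - 1))%C in T by ring.
    rewrite Cmod_opp in T. lra. }
  set (x := Cmod (u - 1)) in *.
  assert (H3 : INR k * x * 1 <= INR k * x * (INR k * x)) by (simpl in HL; lra).
  assert (H4 : 1 <= INR k * x) by (apply Rmult_le_reg_l with (INR k * x); auto; apply Rmult_lt_0_compat; lra).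
  assert (H5 : INR k * x <= INR k * (2 * / (4 * INR k))) by (apply Rmult_le_compat_l; lra).
  replace (INR k * (2 * / (4 * INR k))) with (1 / 2) in H5 by (field; lra). lra.
Qed.

Lemma Cexp_close (t x y : R) : Cmod (Cexp (t, x) - Cexp (t, y)) <= exp t * (5 * Rabs (x - y)).
Proof.
  replace (Cexp (t, x) - Cexp (t, y))%C with (Cexp (t, x) * (1 - Cexp (- (0%R, (x - y)%R))))%C.
  - rewrite Cmod_mult, Cmod_Cexp. apply Rmult_le_compat_l; [left; apply exp_pos|].
    destruct (one_minus_exp (0, x - y)) as [_ H]; [simpl; lra|].
    eapply Rle_trans; [exact H|]. apply Rmult_le_compat_l; [lra|].
    eapply Rle_trans; [apply Cmod_Re_Im|]. simpl. rewrite Rabs_R0. lra.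
  - rewrite <- (Cmult_1_r (Cexp (t, x))) at 2.
    replace (Cexp (t, y)) with (Cexp (t, x) * Cexp (- (0%R, (x - y)%R)))%C.
    + ring.
    + rewrite <- Cexp_plus. f_equal. apply injective_projections; simpl; ring.
Qed.

(** On one closed period of the strip |Im v| <= pi/2 the modulus of Pi is below 1 by a uniform
    amount, so by the Lipschitz bound it remains below 1 on a slightly wider strip. Any v further
    left reaches that period after a whole number of applications of P. *)
Lemma good_beyond_right_angle : exists b, PI / 2 < b /\ good_angle b.
Proof.
  pose proof PI_RGT_0. pose proof lnE_pos as HL.
  destruct Pi_local as (d0 & Hd0 & Hlim & _ & Hlip & Hdf & HD).
  destruct Pi_disc_open as (d1 & Hd1 & Hop).
  set (d := Rmin d0 d1). assert (Hd : 0 < d) by (apply Rmin_pos; auto).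
  assert (Hdb : d <= d0 /\ d <= d1) by (unfold d; split; [apply Rmin_l|apply Rmin_r]).
  set (T := ln d). assert (HT : exp T = d) by (apply exp_ln; auto).
  assert (HeT : forall t, t <= T -> exp t <= d) by (intros; rewrite <- HT; apply exp_monotone; auto).
  assert (Hlt1 : forall v, in_rect (T - L) T (- (PI / 2)) (PI / 2) v -> Cmod (PiFun P E (Cexp v)) < 1).
  { intros v [Hv1 Hv2]. apply Hop; [|rewrite Re_Cexp|apply Cexp_neq_0].
    - rewrite Cmod_Cexp. pose proof (HeT (Re v) ltac:(lra)). lra.
    - apply Rmult_le_pos; [left; apply exp_pos|]. apply cos_ge_0; lra. }
  (* The uniform gap is obtained by bounding 1 / (1 - |Pi|) on the closed rectangle. *)
  destruct (bounded_on_rect (fun v => / (1 - RtoC (Cmod (PiFun P E (Cexp v)))))%C (T - L) T (- (PI / 2)) (PI / 2))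
    as (B & HB & HBd); try lra.
  { intros v Hv. specialize (Hlt1 v Hv). apply Ccont_inv.
    - apply Ccont_plus; [apply Ccont_const|].
      apply (Ccont_comp (fun w => RtoC (Cmod (PiFun P E (Cexp w)))) Copp).
      + apply Ccont_Cmod. apply Cdiff_cont. apply (Cdiff_comp Cexp (PiFun P E)); [apply Cdiff_Cexp, Cdiff_id|].
        apply Hdf. rewrite Cmod_Cexp. destruct Hv as [Hv1 _]. pose proof (HeT (Re v) ltac:(lra)). lra.
      + apply Cdiff_cont, (Cdiff_opp (fun w => w)), Cdiff_id.
    - rewrite <- RtoC_minus. apply RtoC_neq_0. lra. }
  assert (HB1 : forall v, in_rect (T - L) T (- (PI / 2)) (PI / 2) v -> Cmod (PiFun P E (Cexp v)) <= 1 - / B).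
  { intros v Hv. specialize (Hlt1 v Hv). specialize (HBd v Hv). simpl in HBd.
    rewrite <- RtoC_minus, Cmod_inv, Cmod_RtoC_pos in HBd by (try apply RtoC_neq_0; lra).
    set (m := Cmod (PiFun P E (Cexp v))) in *.
    apply Rinv_le_contravar in HBd; [|apply Rinv_0_lt_compat; lra]. rewrite Rinv_inv in HBd. lra. }
  assert (HBi : 0 < / B) by (apply Rinv_0_lt_compat; auto).
  (* Lipschitz factor 2, times 5 exp t <= 5 d for the exponential, times eta, is 1 / (2 B): half of
     the gap. *)
  set (eta := / B / (20 * d)). assert (Heta : 0 < eta) by (apply Rdiv_lt_0_compat; lra).
  assert (Hlt2 : forall t y, T - L <= t <= T -> Rabs y <= PI / 2 + eta -> Cmod (PiFun P E (Cexp (t, y))) < 1).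
  { intros t y Ht Hy. apply Rabs_le_between in Hy.
    assert (Hy' : exists y', - (PI / 2) <= y' <= PI / 2 /\ Rabs (y - y') <= eta).
    { destruct (Rle_dec y (PI / 2)).
      - destruct (Rle_dec (- (PI / 2)) y).
        + exists y. split; [lra|]. rewrite Rminus_diag, Rabs_R0. lra.
        + exists (- (PI / 2)). split; [lra|]. apply Rabs_le_between; lra.
      - exists (PI / 2). split; [lra|]. apply Rabs_le_between; lra. }
    destruct Hy' as (y' & Hy1 & Hy2).
    pose proof (HB1 (t, y') ltac:(split; simpl; lra)) as H1.
    pose proof (HeT t ltac:(lra)) as Het.
    pose proof (Hlip (Cexp (t, y)) (Cexp (t, y')) ltac:(rewrite Cmod_Cexp; simpl; lra) ltac:(rewrite Cmod_Cexp; simpl; lra)) as H2.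
    pose proof (Cexp_close t y y') as H3.
    pose proof (Cmod_triangle_rev (PiFun P E (Cexp (t, y))) (PiFun P E (Cexp (t, y')))) as H4.
    pose proof (Rabs_pos (y - y')). pose proof (exp_pos t).
    assert (H15 : exp t * (5 * Rabs (y - y')) <= d * (5 * eta)) by (apply Rmult_le_compat; lra).
    assert (H16 : d * (5 * eta) = / B / 4) by (unfold eta; field; split; lra). lra. }
  exists (PI / 2 + eta). split; [lra|]. exists d. split; auto.
  intros v Hv1 Hv2.
  assert (HvT : Re v < T) by (apply exp_lt_inv; lra).
  (* The number of whole periods separating v from the period that ends at Re v = T. *)
  set (n := Z.to_nat (Int_part ((T - Re v) / L))).
  assert (Hq0 : 0 < (T - Re v) / L) by (apply Rdiv_lt_0_compat; lra).
  assert (Hn : INR n <= (T - Re v) / L < INR n + 1).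
  { unfold n. pose proof (base_Int_part ((T - Re v) / L)) as [H1 H2].
    assert (0 <= Int_part ((T - Re v) / L))%Z.
    { apply Znot_gt_le. intros h. assert (h2 : (Int_part ((T - Re v) / L) <= -1)%Z) by lia. apply IZR_le in h2. lra. }
    rewrite INR_IZR_INZ, Z2Nat.id by auto. lra. }
  assert (Hn2 : T - L <= Re v + INR n * L <= T).
  { destruct Hn as [Hn1 Hn2]. apply Rle_div_r in Hn1; auto. apply Rlt_div_l in Hn2; auto. lra. }
  assert (Hpow : forall j, (RtoC (E ^ j) * Cexp v)%C = Cexp (Re v + INR j * L, Im v)).
  { intros j. replace (E ^ j) with (exp (INR j * L)).
    - rewrite <- Cexp_RtoC, <- Cexp_plus. f_equal. apply injective_projections; unfold Re, Im; simpl; ring.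
    - rewrite <- exp_L, <- Rpower_pow by apply exp_pos. unfold Rpower. rewrite ln_exp. auto. }
  assert (Hiter : forall j, (j <= n)%nat -> PiFun P E (Cexp (Re v + INR j * L, Im v)) = iterate P j (PiFun P E (Cexp v))
     /\ D (iterate P j (PiFun P E (Cexp v)))).
  { assert (Hsm : forall j, (j <= n)%nat -> Cmod (Cexp (Re v + INR j * L, Im v)) <= d).
    { intros j Hj. rewrite Cmod_Cexp. simpl. apply HeT. apply le_INR in Hj.
      assert (INR j * L <= INR n * L) by (apply Rmult_le_compat_r; lra). lra. }
    assert (Hind : forall m j, (j <= m)%nat -> (m <= n)%nat -> PiFun P E (Cexp (Re v + INR j * L, Im v)) = iterate P j (PiFun P E (Cexp v))
     /\ D (iterate P j (PiFun P E (Cexp v)))).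
    { induction m; intros j Hj Hm.
      - replace j with 0%nat by lia. simpl INR. rewrite Rmult_0_l, Rplus_0_r.
        assert (Ev : (Re v, Im v) = v) by (symmetry; apply surjective_pairing). rewrite Ev.
        split; [reflexivity|]. apply HD. rewrite Cmod_Cexp. lra.
      - destruct (Nat.eq_dec j (S m)) as [->|]; [|apply IHm; lia].
        destruct (Pi_pull (S m) (Cexp v) (PiFun P E (Cexp v))) as [_ HH].
        + apply Hlim. rewrite Cmod_Cexp. lra.
        + intros i Hi. apply IHm; lia.
        + rewrite Hpow in HH. split; auto. rewrite <- HH. apply HD.
          pose proof (Hsm (S m) ltac:(lia)). lra. }
    intros j Hj. apply (Hind n j); auto. }
  apply (basin_pullback D P n).
  - intros j Hj. apply Hiter. lia.
  - destruct (Hiter n (Nat.le_refl n)) as [HH _]. rewrite <- HH.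
    apply (disc_basin a p D P ha hp hp01 hP). apply Hlt2; auto. lra.
Qed.

(** * Pi and the composite of Phi with Pi on a good strip *)

Section Good.
Variable b0 : R.
Hypothesis Hgood : good_angle b0.
Let Pv (v : C) : C := PiFun P E (Cexp v).

Lemma Cexp_shift (n : nat) (v : C) : (Cexp v = RtoC (E ^ n) * Cexp (v - RtoC (INR n * L)))%C.
Proof.
  replace (E ^ n) with (exp (INR n * L)).
  - rewrite <- Cexp_RtoC, <- Cexp_plus. f_equal. ring.
  - rewrite <- exp_L, <- Rpower_pow by apply exp_pos. unfold Rpower. rewrite ln_exp. auto.
Qed.

(** Convergence of the limit defining Pi is known directly only near 0. Going back n periods reaches
    that region, and one n serves a whole neighbourhood of v, so the identity also gives
    holomorphy. *)
Lemma Pv_pull (v : C) : Rabs (Im v) < b0 -> exists n e, 0 < e /\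
  forall w, Cmod (w - v) < e -> Rabs (Im w) < b0 /\
    basin0 D P (Pv (w - RtoC (INR n * L))) /\ Cdiff Pv (w - RtoC (INR n * L)) /\
    cseq_lim (fun t => iterate P t (1 - Cexp (w - RtoC (INR n * L)) / RtoC (E ^ t)))%C (Pv (w - RtoC (INR n * L))) /\
    Pv w = iterate P n (Pv (w - RtoC (INR n * L))).
Proof.
  intros Hv. destruct Hgood as (d & Hd & Hb).
  destruct Pi_local as (d0 & Hd0 & Hlim & _ & Hlip & Hdf & HD).
  pose proof lnE_pos as HL.
  set (m := Rmin d d0 / 2). assert (Hm : 0 < m < d /\ m < d0).
  { unfold m. pose proof (Rmin_pos d d0 Hd Hd0). pose proof (Rmin_l d d0). pose proof (Rmin_r d d0). lra. }
  destruct (nfloor_ex (Rmax 0 ((Re v + 1 - ln m) / L)) (Rmax_l _ _)) as [n0 Hn0].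
  set (n := S n0).
  (* The 1 covers the neighbourhood of v, whose radius is at most 1. *)
  assert (Hn : Re v + 1 - INR n * L <= ln m).
  { unfold n. rewrite S_INR. pose proof (Rmax_r 0 ((Re v + 1 - ln m) / L)).
    assert (H1 : (Re v + 1 - ln m) / L <= INR n0 + 1) by lra. apply Rle_div_l in H1; auto. lra. }
  exists n, (Rmin 1 (b0 - Rabs (Im v))). split; [apply Rmin_pos; lra|].
  intros w Hw. pose proof (Rmin_l 1 (b0 - Rabs (Im v))). pose proof (Rmin_r 1 (b0 - Rabs (Im v))).
  assert (Him : Rabs (Im w) < b0).
  { pose proof (Rabs_Im_le (w - v)). replace (Im w) with (Im v + Im (w - v)%C) by (unfold Im; simpl; ring).
    eapply Rle_lt_trans; [apply Rabs_triang|]. lra. }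
  assert (Hre : exp (Re (w - RtoC (INR n * L))%C) <= m).
  { rewrite <- (exp_ln m) by lra. apply exp_monotone.
    pose proof (Rabs_Re_le (w - v)). pose proof (Rle_abs (Re (w - v)%C)).
    unfold Re in *; simpl in *. lra. }
  assert (Hbas : basin0 D P (Pv (w - RtoC (INR n * L)))).
  { apply Hb; [|lra]. replace (Im (w - RtoC (INR n * L))%C) with (Im w) by (unfold Im; simpl; ring). auto. }
  assert (Hl : cseq_lim (fun t => iterate P t (1 - Cexp (w - RtoC (INR n * L)) / RtoC (E ^ t)))%C (Pv (w - RtoC (INR n * L)))).
  { apply Hlim. rewrite Cmod_Cexp. lra. }
  split; [auto|]. split; [auto|]. split; [|split; [auto|]].
  - apply (Cdiff_comp Cexp (PiFun P E)); [apply Cdiff_Cexp, Cdiff_id|]. apply Hdf. rewrite Cmod_Cexp. lra.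
  - unfold Pv at 1. rewrite (Cexp_shift n w). apply Pi_pull; auto. intros j _. apply Hbas.
Qed.

Lemma Pv_basin (v : C) : Rabs (Im v) < b0 -> basin0 D P (Pv v).
Proof.
  intros Hv. destruct (Pv_pull v Hv) as (n & e & He & H).
  destruct (H v) as (_ & H1 & _ & _ & H2); [rewrite Cminus_diag_mod; auto|].
  rewrite H2. apply basin_iter; auto.
Qed.

Lemma Pv_Cdiff (v : C) : Rabs (Im v) < b0 -> Cdiff Pv v.
Proof.
  intros Hv. destruct (Pv_pull v Hv) as (n & e & He & H).
  apply Cdiff_ext_loc with (f := fun w => iterate P n (Pv (w - RtoC (INR n * L)))).
  - exists e. split; auto. intros w Hw. symmetry. apply H; auto.
  - destruct (H v) as (_ & H1 & H3 & _ & H2); [rewrite Cminus_diag_mod; auto|].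
    apply (Cdiff_comp (fun w => Pv (w - RtoC (INR n * L)))%C (iterate P n)).
    + apply (Cdiff_comp (fun w => w - RtoC (INR n * L))%C Pv); auto.
      apply Cdiff_minus; [apply Cdiff_id|apply Cdiff_const].
    + apply (iter_Cdiff a D P hP). intros j _. apply H1.
Qed.

Lemma Pv_iter (n : nat) (v : C) : Rabs (Im v) < b0 -> Pv (v + RtoC (INR n * L)) = iterate P n (Pv v).
Proof.
  intros Hv. destruct (Pv_pull v Hv) as (m & e & He & H).
  destruct (H v) as (_ & H1 & _ & H3 & H2); [rewrite Cminus_diag_mod; auto|].
  rewrite H2, <- iterate_add. unfold Pv at 1. rewrite (Cexp_shift (n + m)).
  replace (v + RtoC (INR n * L) - RtoC (INR (n + m) * L))%C with (v - RtoC (INR m * L))%C.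
  - apply Pi_pull; auto. intros j _. apply H1.
  - rewrite plus_INR, Rmult_plus_distr_r, RtoC_plus. ring.
Qed.

(** Each point of one period falls into the small disc after some number of steps, and the disc is
    forward invariant, so bisection gives one number T for the whole period. Moving right by n >= T
    periods then means applying at least T steps. *)
Lemma Pv_small (b eps : R) : 0 < b < b0 -> 0 < eps -> exists R0, forall v,
  Rabs (Im v) <= b -> R0 <= Re v -> Cmod (Pv v) <= eps.
Proof.
  intros Hb Heps. pose proof lnE_pos as HL.
  set (ep := Rmin eps 1). assert (Hep : 0 < ep <= 1 /\ ep <= eps).
  { unfold ep. pose proof (Rmin_pos eps 1 Heps ltac:(lra)). pose proof (Rmin_l eps 1). pose proof (Rmin_r eps 1). lra. }
  assert (Hstay : forall n m z, (n <= m)%nat -> Cmod (iterate P n z) <= ep -> Cmod (iterate P m z) <= ep).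
  { intros n m z Hnm Hz. replace m with ((m - n) + n)%nat by lia. rewrite iterate_add.
    pose proof (pgf_iter_disc a p D P ha hp hp01 hP (m - n) (iterate P n z) ltac:(lra)). lra. }
  assert (HQ : exists T, forall v, in_rect 0 L (- b) b v -> Cmod (iterate P T (Pv v)) <= ep).
  { apply (rect_bisection (fun a b c d => exists T, forall v, in_rect a b c d v -> Cmod (iterate P T (Pv v)) <= ep)); try lra.
    - intros a' b' c' d' _ _ _ _ _ _ (T1 & H1) (T2 & H2) (T3 & H3) (T4 & H4).
      (* By forward invariance any common upper bound works. *)
      exists (T1 + T2 + T3 + T4)%nat. intros z [Hz1 Hz2].
      destruct (Rle_dec (Re z) ((a' + b') / 2)), (Rle_dec (Im z) ((c' + d') / 2)).
      + apply (Hstay T1); [lia|]. apply H1. split; lra.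
      + apply (Hstay T3); [lia|]. apply H3. split; lra.
      + apply (Hstay T2); [lia|]. apply H2. split; lra.
      + apply (Hstay T4); [lia|]. apply H4. split; lra.
    - intros z [_ Hz2]. assert (Hz : Rabs (Im z) < b0) by (apply Rabs_lt_between; lra).
      pose proof (Pv_basin z Hz) as [HB1 HB2]. apply cseq_lim_filterlim in HB2.
      destruct (HB2 (ep / 2) ltac:(lra)) as [T HT]. specialize (HT T (Nat.le_refl T)).
      assert (Hc : Ccont (fun v => iterate P T (Pv v)) z).
      { apply Ccont_comp with (g := iterate P T); apply Cdiff_cont; [apply Pv_Cdiff; auto|].
        apply (iter_Cdiff a D P hP). intros; apply HB1. }
      destruct (Hc (ep / 2) ltac:(lra)) as (e & He & H1).
      exists (e / 2). split; [lra|]. intros a' b' c' d' _ _ _ _ [Hz3 Hz4] h1 h2.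
      exists T. intros w [Hw1 Hw2].
      assert (Hwz : Cmod (w - z) < e).
      { eapply Rle_lt_trans; [apply Cmod_Re_Im|].
        assert (Rabs (Re (w - z)) <= b' - a') by (apply Rabs_le_between; unfold Re in *; simpl; lra).
        assert (Rabs (Im (w - z)) <= d' - c') by (apply Rabs_le_between; unfold Im in *; simpl; lra).
        lra. }
      specialize (H1 w Hwz). pose proof (Cmod_triangle_rev (iterate P T (Pv w)) (iterate P T (Pv z))).
      replace (iterate P T (Pv z) - 0)%C with (iterate P T (Pv z)) in HT by ring. lra. }
  destruct HQ as [T HT]. exists (INR T * L). intros v Hv1 Hv2.
  assert (Hv0 : 0 <= Re v) by (pose proof (pos_INR T); assert (0 <= INR T * L) by (apply Rmult_le_pos; lra); lra).
  destruct (nfloor_ex (Re v / L)) as [n Hn].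
  { apply Rmult_le_pos; auto. left; apply Rinv_0_lt_compat; auto. }
  destruct Hn as [Hn1 Hn2]. apply Rle_div_r in Hn1; auto. apply Rlt_div_l in Hn2; auto.
  assert (HTn : (T <= n)%nat).
  { apply INR_le. assert (H : INR T * L < (INR n + 1) * L) by lra. apply Rmult_lt_reg_r in H; auto.
    rewrite <- S_INR in H. apply INR_lt in H. apply le_INR. lia. }
  set (w := (v - RtoC (INR n * L))%C).
  assert (Hw : in_rect 0 L (- b) b w).
  { apply Rabs_le_between in Hv1. unfold w. split; unfold Re, Im in *; simpl; lra. }
  replace v with (w + RtoC (INR n * L))%C by (unfold w; ring).
  rewrite Pv_iter.
  - apply Rle_trans with ep; [|lra]. apply (Hstay T); auto.
  - destruct Hw as [_ Hw]. apply Rabs_lt_between. lra.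
Qed.

Let Psi (v : C) : C := PhiFun P p (Pv v).

Lemma Psi_Cdiff (v : C) : Rabs (Im v) < b0 -> Cdiff Psi v.
Proof.
  intros Hv. apply (Cdiff_comp Pv (PhiFun P p)); [apply Pv_Cdiff; auto|].
  apply (Phi_Cdiff a p D P ha hp hp01 hP), Pv_basin; auto.
Qed.

Lemma Psi_shift (v : C) : Rabs (Im v) < b0 -> (Psi (v + RtoC L) = RtoC p * Psi v)%C.
Proof.
  intros Hv. unfold Psi. replace (RtoC L) with (RtoC (INR 1 * L)) by (simpl; f_equal; ring).
  rewrite (Pv_iter 1 v Hv).
  apply (Phi_functional a p D P ha hp hp01 hP), Pv_basin; auto.
Qed.

Lemma Psi_small (b eps : R) : 0 < b < b0 -> 0 < eps -> exists R0, forall v,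
  Rabs (Im v) <= b -> R0 <= Re v -> Cmod (Psi v) <= eps.
Proof.
  intros Hb Heps.
  assert (Hc : Ccont (PhiFun P p) 0).
  { apply Cdiff_cont, (Phi_Cdiff a p D P ha hp hp01 hP), (disc_basin a p D P ha hp hp01 hP). rewrite Cmod_0; lra. }
  destruct (Hc eps Heps) as (d & Hd & H1).
  destruct (Pv_small b (d / 2) Hb ltac:(lra)) as (R0 & HR). exists R0. intros v Hv1 Hv2.
  specialize (HR v Hv1 Hv2). specialize (H1 (Pv v)).
  replace (Pv v - 0)%C with (Pv v) in H1 by ring.
  rewrite (Phi_0 a p D P ha hp hp01 hP) in H1.
  left. unfold Psi. replace (PhiFun P p (Pv v)) with (PhiFun P p (Pv v) - 0)%C by ring. apply H1. lra.
Qed.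
End Good.
End Angle.

(** * The Karlin-McGregor function, its Fourier coefficients, and the inverse of Phi *)

Section Expansion.
Variables (a : nat -> R) (p E : R) (D : C -> Prop) (P : C -> C) (phi : nat -> C).
Hypothesis ha : is_pgf a.
Hypothesis hp : a 1%nat = p.
Hypothesis hp01 : 0 < p < 1.
Hypothesis hP : extends_pgf a D P.
Hypothesis hE : is_derive (K := C_AbsRing) (V := C_NormedModule) P (RtoC 1) (RtoC E).
Hypothesis hphi : is_inverse_coeffs P p phi.
Let HE1 : 1 < E := mean_gt_1 a p E D P ha hp hp01 hP hE.
Let L := ln E.
Let HL : 0 < L := lnE_pos a p E D P ha hp hp01 hP hE.
Let al := - ln p / L.
Let Pv (v : C) : C := PiFun P E (Cexp v).
Let Psi (v : C) : C := PhiFun P p (Pv v).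
(** The Karlin-McGregor function at v / ln E. As p = exp (- al * L), the factor exp (al v)
    compensates the multiplier p that [Psi] acquires under translation by L. *)
Let Kc (v : C) : C := (Psi v * Cexp (RtoC al * v))%C.

Lemma al_pos : 0 < al.
Proof. unfold al. apply Rdiv_lt_0_compat; auto. pose proof (ln_increasing p 1 ltac:(lra) ltac:(lra)) as H. rewrite ln_1 in H. lra. Qed.

Lemma exponent_Re_Im (n : nat) (m : Z) :
  (- exponent p E n m)%C = (INR n * al, - (2 * PI * IZR m / L)).
Proof.
  unfold exponent, al. fold L. apply injective_projections; simpl; field; lra.
Qed.

Lemma Cexp_exponent (n : nat) (m : Z) (v : C) :
  Cexp (- (- exponent p E n m * v)) = (Cexp (- (RtoC (INR n * al) * v)) * emode L m v)%C.
Proof.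
  unfold emode. rewrite <- Cexp_plus, exponent_Re_Im. f_equal.
  replace ((INR n * al, - (2 * PI * IZR m / L)) : C) with (RtoC (INR n * al) - RtoC (2 * PI * IZR m / L) * Ci)%C
    by (apply injective_projections; simpl; ring).
  ring.
Qed.

Lemma Cexp_nat_mult (n : nat) (u : C) : (Cexp u ^ n)%C = Cexp (RtoC (INR n) * u).
Proof.
  induction n.
  - simpl. rewrite Cmult_0_l, Cexp_0. reflexivity.
  - rewrite S_INR, RtoC_plus. change (Cexp u ^ S n)%C with (Cexp u * Cexp u ^ n)%C.
    rewrite IHn, <- Cexp_plus. f_equal. ring.
Qed.

Lemma Psi_Kc (v : C) (n : nat) : (Psi v ^ n = Cexp (- (RtoC (INR n * al) * v)) * Kc v ^ n)%C.
Proof.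
  unfold Kc. rewrite Cpow_mult_l, Cexp_nat_mult.
  replace (RtoC (INR n) * (RtoC al * v))%C with (RtoC (INR n * al) * v)%C by (rewrite RtoC_mult; ring).
  rewrite Cexp_opp. field. apply Cexp_neq_0.
Qed.

Section GoodAngle.
Variable b0 : R.
Hypothesis Hb0 : 0 < b0.
Hypothesis Hgood : good_angle E D P b0.

Lemma Kc_Cdiff (v : C) : Rabs (Im v) < b0 -> Cdiff Kc v.
Proof.
  intros Hv. apply Cdiff_mult; [apply (Psi_Cdiff a p E D P ha hp hp01 hP hE b0 Hgood v Hv)|].
  apply Cdiff_Cexp, Cdiff_mult; [apply Cdiff_const|apply Cdiff_id].
Qed.

Lemma Kc_shift (v : C) : Rabs (Im v) < b0 -> Kc (v + RtoC L) = Kc v.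
Proof.
  intros Hv. unfold Kc.
  replace (Psi (v + RtoC L)) with (RtoC p * Psi v)%C
    by (symmetry; exact (Psi_shift a p E D P ha hp hp01 hP hE b0 Hgood v Hv)).
  rewrite Cmult_plus_distr_l, Cexp_plus, <- RtoC_mult, Cexp_RtoC.
  replace (al * L) with (- ln p) by (unfold al; field; lra).
  rewrite exp_Ropp, exp_ln, RtoC_inv by lra. unfold Psi, Pv. field. apply RtoC_neq_0. lra.
Qed.

(* Kc is known to be L-periodic only inside the strip; after the cut-off periodicity holds
   everywhere. *)
Let Kp (v : C) : C := if Rlt_dec (Rabs (Im v)) b0 then Kc v else 0%C.

Lemma Kp_eq (v : C) : Rabs (Im v) < b0 -> Kp v = Kc v.
Proof. intros H. unfold Kp. destruct (Rlt_dec (Rabs (Im v)) b0); [auto|tauto]. Qed.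

Lemma Kp_Cdiff (v : C) : Rabs (Im v) < b0 -> Cdiff Kp v.
Proof.
  intros Hv. apply Cdiff_ext_loc with (f := Kc); [|apply Kc_Cdiff; auto].
  exists (b0 - Rabs (Im v)). split; [lra|]. intros w Hw. symmetry. apply Kp_eq.
  pose proof (Rabs_Im_le (w - v)). replace (Im w) with (Im v + Im (w - v)%C) by (unfold Im; simpl; ring).
  eapply Rle_lt_trans; [apply Rabs_triang|]. lra.
Qed.

Lemma Kp_shift (v : C) : Kp (v + RtoC L) = Kp v.
Proof.
  unfold Kp. replace (Im (v + RtoC L)%C) with (Im v) by (unfold Im; simpl; ring).
  destruct (Rlt_dec (Rabs (Im v)) b0); [apply Kc_shift; auto|auto].
Qed.

(** The substitution v = L * x maps the unit period of the Karlin-McGregor function to the period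
    L. *)
Lemma kappa_fourier (n : nat) (m : Z) :
  kappa P p E n m = fourier_coeff (fun v => Kp v ^ n)%C L m.
Proof.
  unfold fourier_coeff, hint.
  set (f := fun t : R => (Kp (t, 0) ^ n * emode L (- m) (t, 0))%C).
  assert (Hf : Rcont_on f 0 L).
  { apply (Rcont_on_h (fun v => Kp v ^ n * emode L (- m) v)%C). intros t _.
    apply Cdiff_cont, Cdiff_mult; [apply Cdiff_pow, Kp_Cdiff; simpl; rewrite Rabs_R0; auto|].
    apply Cdiff_emode, Cdiff_id. }
  pose proof (RInt_comp_lin (V := C_R_CompleteNormedModule) f L 0 0 1) as H.
  rewrite Rmult_0_r, Rmult_1_r, !Rplus_0_r in H. specialize (H (ex_CI f 0 L Hf)).
  change (CI f 0 L) with (RInt (V := C_R_CompleteNormedModule) f 0 L). rewrite <- H.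
  set (g := fun x : R => f (L * x + 0)).
  assert (Hg : Rcont_on g 0 1).
  { intros t Ht. rewrite Rmin_left, Rmax_right in Ht by lra.
    intros e He. destruct (Hf (L * t)) with (eps := e) as (d & Hd & H1); auto.
    { rewrite Rmin_left, Rmax_right by lra. nra. }
    exists (d / L). split; [apply Rdiv_lt_0_compat; auto|]. intros s Hs. unfold g. rewrite !Rplus_0_r.
    apply H1. rewrite <- Rmult_minus_distr_l, Rabs_mult, (Rabs_pos_eq L) by lra.
    apply Rlt_div_r in Hs; auto. lra. }
  transitivity (CI g 0 1).
  - unfold kappa. apply (RInt_ext (V := C_R_CompleteNormedModule)). intros x _.
    unfold g, f. rewrite Rplus_0_r, Kp_eq by (simpl; rewrite Rabs_R0; auto).
    f_equal.
    + f_equal. unfold KarlinMcGregor, Kc, Psi, Pv. unfold Rpower. fold L.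
      f_equal.
      * f_equal. f_equal. rewrite <- Cexp_RtoC. f_equal. apply injective_projections; simpl; ring.
      * rewrite <- Cexp_RtoC. f_equal. unfold al. apply injective_projections; simpl; field; lra.
    + unfold emode. f_equal. rewrite opp_IZR. apply injective_projections; simpl; field; lra.
  - symmetry. transitivity (RtoC (/ L) * CI (fun x => RtoC L * g x) 0 1)%C.
    + f_equal. apply (RInt_ext (V := C_R_CompleteNormedModule)). intros x _. apply scal_C_R.
    + rewrite CI_scal by auto. rewrite Cmult_assoc, <- RtoC_mult.
      replace (/ L * L) with 1 by (field; lra). ring.
Qed.

Lemma Kp_bounded (b : R) : 0 < b < b0 -> exists M, 0 < M /\ forall v, Rabs (Im v) <= b -> Cmod (Kp v) <= M.
Proof.
  intros Hb. apply (periodic_bounded Kp L b0); auto; [apply Kp_Cdiff|apply Kp_shift].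
Qed.

Lemma Kp_pow_bounded (b M : R) (n : nat) : (forall v, Rabs (Im v) <= b -> Cmod (Kp v) <= M) ->
  forall v, Rabs (Im v) <= b -> Cmod (Kp v ^ n) <= M ^ n.
Proof. intros H v Hv. rewrite Cmod_pow. apply pow_incr. split; [apply Cmod_ge_0|auto]. Qed.

Lemma kappa_bound (b M : R) (n : nat) (m : Z) : 0 < b < b0 -> 0 < M ->
  (forall v, Rabs (Im v) <= b -> Cmod (Kp v) <= M) ->
  Cmod (kappa P p E n m) <= M ^ n * exp (- (2 * PI * Rabs (IZR m) / L * b)).
Proof.
  intros Hb HM H. rewrite kappa_fourier.
  apply (fourier_coeff_bound (fun v => Kp v ^ n)%C L b0 b (M ^ n)); auto.
  - intros; apply Cdiff_pow, Kp_Cdiff; auto.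
  - intros z. rewrite Kp_shift. auto.
  - apply Kp_pow_bounded; auto.
Qed.

Lemma kappa_expansion (b M : R) (n N : nat) (v : C) : 0 < b < b0 -> 0 < M ->
  (forall v, Rabs (Im v) <= b -> Cmod (Kp v) <= M) -> Rabs (Im v) < b ->
  Cmod (Kc v ^ n - (csum (fun k => kappa P p E n (Z.of_nat k) * emode L (Z.of_nat k) v) N
             + csum (fun k => kappa P p E n (- Z.of_nat (S k)) * emode L (- Z.of_nat (S k)) v) N))%C
  <= 2 * M ^ n * exp (- (2 * PI / L * (b - Rabs (Im v)))) ^ N / (1 - exp (- (2 * PI / L * (b - Rabs (Im v))))).
Proof.
  intros Hb HM H Hv.
  pose proof (fourier_expansion (fun v => Kp v ^ n)%C L b0 b (M ^ n) HL Hb ltac:(apply pow_le; lra)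
    ltac:(intros; apply Cdiff_pow, Kp_Cdiff; auto) ltac:(intros z; cbv beta; rewrite Kp_shift; auto)
    (Kp_pow_bounded b M n H) v N Hv) as HF.
  assert (X : forall u w, (forall k, u k = w k) -> forall n, csum u n = csum w n).
  { intros u w Huw n0. induction n0; simpl; [auto|rewrite IHn0, Huw; auto]. }
  rewrite (X _ (fun k => kappa P p E n (Z.of_nat k) * emode L (Z.of_nat k) v)%C) in HF
    by (intros; rewrite kappa_fourier; auto).
  rewrite (X (fun k => fourier_coeff (fun v => Kp v ^ n)%C L (- Z.of_nat (S k)) * emode L (- Z.of_nat (S k)) v)%C
    (fun k => kappa P p E n (- Z.of_nat (S k)) * emode L (- Z.of_nat (S k)) v)%C) in HF
    by (intros; rewrite kappa_fourier; auto).
  rewrite Kp_eq in HF by lra. exact HF.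
Qed.
(** One constant M, a bound for the periodic function itself, serves all powers n. The statement no
    longer mentions the cut-off function. *)
Lemma kappa_data (b : R) : 0 < b < b0 -> exists M, 0 < M /\
  (forall n m, Cmod (kappa P p E n m) <= M ^ n * exp (- (2 * PI * Rabs (IZR m) / ln E * b))) /\
  (forall n N v, Rabs (Im v) < b ->
    Cmod (PhiFun P p (PiFun P E (Cexp v)) ^ n - Cexp (- (RtoC (INR n * (- ln p / ln E)) * v)) *
       (csum (fun k => kappa P p E n (Z.of_nat k) * emode (ln E) (Z.of_nat k) v) N
        + csum (fun k => kappa P p E n (- Z.of_nat (S k)) * emode (ln E) (- Z.of_nat (S k)) v) N))%C
    <= exp (- (INR n * (- ln p / ln E) * Re v)) * (2 * M ^ n) *
       (exp (- (2 * PI / ln E * (b - Rabs (Im v)))) ^ N / (1 - exp (- (2 * PI / ln E * (b - Rabs (Im v))))))).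
Proof.
  intros Hb. destruct (Kp_bounded b Hb) as (M & HM & HMb). exists M. split; [auto|split].
  - intros n m. apply kappa_bound; auto.
  - intros n N v Hv. pose proof (kappa_expansion b M n N v Hb HM HMb Hv) as H.
    change (PhiFun P p (PiFun P E (Cexp v))) with (Psi v). rewrite Psi_Kc. fold L al.
    set (X := (csum (fun k => kappa P p E n (Z.of_nat k) * emode L (Z.of_nat k) v)%C N
        + csum (fun k => kappa P p E n (- Z.of_nat (S k)) * emode L (- Z.of_nat (S k)) v)%C N)%C) in *.
    replace (Cexp (- (RtoC (INR n * al) * v)) * Kc v ^ n - Cexp (- (RtoC (INR n * al) * v)) * X)%C
      with (Cexp (- (RtoC (INR n * al) * v)) * (Kc v ^ n - X))%C by ring.
    rewrite Cmod_mult, Cmod_Cexp.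
    replace (Re (- (RtoC (INR n * al) * v))%C) with (- (INR n * al * Re v)) by (unfold Re; simpl; ring).
    rewrite (Rmult_assoc (exp _)). apply Rmult_le_compat_l; [left; apply exp_pos|].
    eapply Rle_trans; [exact H|]. apply Req_le. unfold Rdiv. ring.
Qed.
End GoodAngle.

(** The terms of a series convergent at r1 are bounded, which gives the coefficient bound. Where
    |Phi(z)| <= r1 / 2 the n-th term is then at most Cf 2^(-n), and the local inverse identifies the
    sum as z. Phi(0) = 0 forces [phi 0] to vanish. *)
Lemma inverse_series : exists r1 r2 Cf, 0 < r1 /\ 0 < r2 /\ 0 < Cf /\ phi 0%nat = 0%C /\
  (forall n, Cmod (phi n) * r1 ^ n <= Cf) /\
  (forall z, Cmod z <= r2 -> Cmod (PhiFun P p z) <= r1 / 2 -> forall N,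
     Cmod (z - csum (fun k => phi k * PhiFun P p z ^ k) N)%C <= 2 * Cf * (1 / 2) ^ N).
Proof.
  destruct hphi as (g & [Hinv _] & Htay).
  apply locally_C_Cmod in Hinv. destruct Hinv as (d1 & Hd1 & Hinv).
  apply locally_C_Cmod in Htay. destruct Htay as (d2 & Hd2 & Htay).
  set (r1 := d2 / 2). assert (Hr1 : 0 < r1) by (unfold r1; lra).
  assert (Hser : forall w, Cmod w < d2 -> cseq_lim (csum (fun k => phi k * w ^ k)%C) (g w)).
  { intros w Hw. apply is_Cpseries_csum, Htay. replace (w - 0)%C with w by ring. auto. }
  assert (Hphi0 : phi 0%nat = 0%C).
  { assert (G0 : g 0%C = 0%C).
    { rewrite <- (Phi_0 a p D P ha hp hp01 hP) at 1. apply Hinv. rewrite Cminus_diag_mod; auto. }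
    rewrite <- G0. eapply cseq_lim_unique; [|apply (Hser 0%C); rewrite Cmod_0; auto].
    apply (cseq_lim_shift _ _ 1). apply cseq_lim_ext with (m := 0%nat) (u := fun _ => phi 0%nat).
    - intros n _. induction n; [simpl; ring|].
      change (csum (fun k => phi k * 0 ^ k)%C (1 + S n)) with
        (csum (fun k => phi k * 0 ^ k)%C (1 + n) + phi (S n) * 0 ^ S n)%C.
      rewrite <- IHn. simpl. ring.
    - intros e He. exists 0%nat. intros. rewrite Cminus_diag_mod; lra. }
  assert (Hbd : exists Cf, 0 < Cf /\ forall n, Cmod (phi n) * r1 ^ n <= Cf).
  { pose proof (Hser (RtoC r1) ltac:(rewrite Cmod_RtoC_pos; unfold r1 in *; lra)) as HS.
    destruct (HS (1 / 2) ltac:(lra)) as [N HN].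
    assert (Hlate : forall n, (N <= n)%nat -> Cmod (phi n) * r1 ^ n <= 1).
    { intros n Hn. pose proof (HN n Hn) as H1. pose proof (HN (S n) ltac:(lia)) as H2. simpl csum in H2.
      set (S0 := csum (fun k => phi k * RtoC r1 ^ k)%C n) in *.
      pose proof (Cmod_minus_triangle (S0 + phi n * RtoC r1 ^ n - g (RtoC r1)) (S0 - g (RtoC r1))) as T.
      replace (S0 + phi n * RtoC r1 ^ n - g (RtoC r1) - (S0 - g (RtoC r1)))%C with (phi n * RtoC r1 ^ n)%C in T by ring.
      rewrite Cmod_mult, Cmod_pow, Cmod_RtoC_pos in T by lra. lra. }
    assert (Hearly : forall m, exists B, 0 < B /\ forall n, (n < m)%nat -> Cmod (phi n) * r1 ^ n <= B).
    { induction m; [exists 1; split; [lra|]; intros; lia|]. destruct IHm as (B & HB & H).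
      exists (B + Cmod (phi m) * r1 ^ m).
      assert (0 <= Cmod (phi m) * r1 ^ m) by (apply Rmult_le_pos; [apply Cmod_ge_0|apply pow_le; lra]).
      split; [lra|]. intros n Hn. destruct (Nat.eq_dec n m) as [->|]; [lra|]. specialize (H n ltac:(lia)). lra. }
    destruct (Hearly N) as (B & HB & H). exists (B + 1). split; [lra|]. intros n.
    destruct (lt_dec n N); [specialize (H n l); lra|]. specialize (Hlate n ltac:(lia)). lra. }
  destruct Hbd as (Cf & HCf & Hbd).
  exists r1, (d1 / 2), Cf. split; [auto|split; [lra|split; [auto|split; [auto|split; [auto|]]]]].
  intros z Hz HPhi N.
  set (w := PhiFun P p z) in *.
  assert (Hgw : g w = z).
  { apply Hinv. replace (z - 0)%C with z by ring. lra. }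
  destruct (geometric_cauchy (csum (fun k => phi k * w ^ k)%C) Cf (1 / 2)) as (l & Hl & Hl2); try lra.
  - intros n. simpl csum.
    replace (csum (fun k => phi k * w ^ k)%C n + phi n * w ^ n - csum (fun k => phi k * w ^ k)%C n)%C
      with (phi n * w ^ n)%C by ring.
    rewrite Cmod_mult, Cmod_pow.
    apply Rle_trans with (Cmod (phi n) * (r1 ^ n * (1 / 2) ^ n)).
    + apply Rmult_le_compat_l; [apply Cmod_ge_0|]. rewrite <- Rpow_mult_distr.
      apply pow_incr. split; [apply Cmod_ge_0|lra].
    + rewrite <- Rmult_assoc. apply Rmult_le_compat_r; [apply pow_le; lra|auto].
  - assert (El : l = z).
    { rewrite <- Hgw. eapply cseq_lim_unique; [exact Hl|apply Hser]. unfold r1 in *. lra. }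
    subst l. rewrite Cmod_minus_sym. eapply Rle_trans; [apply Hl2|]. apply Req_le. field.
Qed.

(** Hankel's formula carries x^(s-1), whereas the term carries x^s = x * x^(s-1); the extra x later
    cancels the prefactor 1 / x of the expansion. *)
Lemma expansion_term_hankel (x : R) (n : nat) (m : Z) (b : R) : (1 <= n)%nat -> 0 < x -> PI / 2 < b < PI ->
  exists l, climit (fun M => vint (hankel_kernel (- exponent p E n m) x) M (- b) b) l /\
    expansion_term P p E phi x n m = (RtoC x / (RtoC (2 * PI) * Ci) * (phi n * kappa P p E n m * l))%C.
Proof.
  intros Hn Hx Hb. pose proof al_pos as Hal.
  assert (Hs : 0 < Re (- exponent p E n m)).
  { rewrite exponent_Re_Im. simpl. apply Rmult_lt_0_compat; auto. apply lt_0_INR. lia. }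
  destruct (hankel_gamma (- exponent p E n m) b Hs Hb x Hx) as [HG Hl].
  eexists. split; [exact Hl|]. unfold expansion_term.
  set (s := (- exponent p E n m)%C) in *.
  assert (Ex : Rcpow x s = (RtoC x * Rcpow x (s - 1))%C).
  { unfold Rcpow. rewrite <- (RtoC_exp_ln x Hx) at 1. rewrite <- Cexp_plus. f_equal. ring. }
  rewrite Ex. pose proof twoPiI_neq_0 as HT. field. split; [auto|].
  split; [apply Ci_neq_0|]. intros E2. apply HT. rewrite E2. ring.
Qed.
End Expansion.

(** * Contour form of the density *)

Lemma Rcont_ext_loc (f g : R -> C) (t : R) :
  (exists d, 0 < d /\ forall s, Rabs (s - t) < d -> f s = g s) -> Rcont f t -> Rcont g t.
Proof.
  intros (d & Hd & E) H e He. destruct (H e He) as (d' & Hd' & H1).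
  exists (Rmin d d'). split; [apply Rmin_pos; auto|]. intros s Hs.
  pose proof (Rmin_l d d'). pose proof (Rmin_r d d').
  rewrite <- (E s), <- (E t); [apply H1; lra| |lra]. rewrite Rminus_diag, Rabs_R0. auto.
Qed.

Lemma Rcont_RtoC (h : R -> R) (t : R) : continuous h t -> Rcont (fun u => RtoC (h u)) t.
Proof.
  intros H e He. assert (He' : 0 < e) by auto.
  destruct (proj1 (filterlim_locally h (h t)) H (mkposreal e He')) as [d Hd].
  exists d. split; [apply cond_pos|]. intros s Hs.
  rewrite <- RtoC_minus, Cmod_R. apply Hd. exact Hs.
Qed.

Lemma Rcont_mult (f g : R -> C) (t : R) :
  Rcont f t -> Rcont g t -> Rcont (fun s => f s * g s)%C t.
Proof.
  assert (Hlift : forall h, Rcont h t -> Ccont (fun w => h (Re w)) (RtoC t)).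
  { intros h H e He. destruct (H e He) as (d & Hd & H1). exists d. split; auto. intros w Hw.
    apply H1. pose proof (Rabs_Re_le (w - RtoC t)) as HR. unfold Re in *. simpl in *. unfold Rminus. lra. }
  intros Hf Hg.
  apply (Rcont_path (fun w => f (Re w) * g (Re w))%C RtoC).
  - intros e He. exists e. split; auto. intros s Hs. rewrite <- RtoC_minus, Cmod_R. auto.
  - apply Ccont_mult; apply Hlift; auto.
Qed.

Lemma vint_Chasles (f : C -> C) (x c d e : R) :
  (forall t, Ccont f (x, t) \/ ~ (Rmin c (Rmin d e) <= t <= Rmax c (Rmax d e))) ->
  (vint f x c d + vint f x d e)%C = vint f x c e.
Proof.
  intros H. unfold vint. rewrite <- (CI_Chasles (fun t => f (x, t)) c d e); [ring| |].
  - apply Rcont_on_v. intros t Ht. destruct (H t) as [h|h]; auto. exfalso. apply h.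
    revert Ht. unfold Rmin, Rmax. repeat destruct (Rle_dec _ _); lra.
  - apply Rcont_on_v. intros t Ht. destruct (H t) as [h|h]; auto. exfalso. apply h.
    revert Ht. unfold Rmin, Rmax. repeat destruct (Rle_dec _ _); lra.
Qed.

Lemma is_RInt_exp_cos (Y c d : R) :
  is_RInt (fun t => exp (Y * cos t) * (Y * sin t)) c d (exp (Y * cos c) - exp (Y * cos d)).
Proof.
  replace (exp (Y * cos c) - exp (Y * cos d)) with (minus (- exp (Y * cos d)) (- exp (Y * cos c)))
    by (unfold minus, plus, opp; simpl; ring).
  apply (is_RInt_derive (fun t => - exp (Y * cos t)) (fun t => exp (Y * cos t) * (Y * sin t))).
  - intros t _. auto_derive; auto. ring.
  - intros t _. apply (ex_derive_continuous (V := R_NormedModule)). auto_derive. auto.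
Qed.

(* On the arc sin t >= sin b > 0, so the substitution u = cos t integrates the exponential
   exactly, without Jordan's inequality. *)
Lemma jordan_arc (f : C -> C) (x c b e : R) (sg : R) : 0 < x -> PI / 2 < b < PI -> 0 <= e ->
  sg = 1 \/ sg = - (1) ->
  (forall t, PI / 2 <= t <= b -> Ccont f (c, (sg * t)%R) /\ Cmod (f (c, (sg * t)%R)) <= e * Cmod (weight x (c, (sg * t)%R))) ->
  Cmod (CI (fun t => f (c, (sg * t)%R)) (PI / 2) b) <= e / (x * sin b).
Proof.
  intros Hx Hb He Hsg Hf. pose proof PI_RGT_0.
  assert (Hsb : 0 < sin b) by (apply sin_gt_0; lra).
  set (Y := x * exp c). assert (HY : 0 < Y) by (apply Rmult_lt_0_compat; [auto|apply exp_pos]).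
  assert (HcI : Rcont_on (fun t => f (c, (sg * t)%R)) (PI / 2) b).
  { intros t Ht. rewrite Rmin_left, Rmax_right in Ht by lra.
    apply (Rcont_path f (fun s => (c, (sg * s)%R))); [|apply Hf; auto].
    intros ep Hep. exists ep. split; auto. intros s Hs.
    replace ((c, (sg * s)%R) - (c, (sg * t)%R))%C with (RtoC sg * Ci * RtoC (s - t))%C
      by (apply injective_projections; simpl; ring).
    rewrite !Cmod_mult, Cmod_Ci, !Cmod_R.
    replace (Rabs sg) with 1; [lra|]. destruct Hsg as [-> | ->]; [rewrite Rabs_R1; auto|].
    rewrite Rabs_Ropp, Rabs_R1; auto. }
  assert (HI : is_RInt (fun t => e / (x * sin b) * (exp (Y * cos t) * (Y * sin t))) (PI / 2) b
      (e / (x * sin b) * (exp (Y * cos (PI / 2)) - exp (Y * cos b)))).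
  { apply (is_RInt_scal (V := R_NormedModule) (fun t => exp (Y * cos t) * (Y * sin t)) _ _ (e / (x * sin b))).
    apply is_RInt_exp_cos. }
  eapply Rle_trans; [apply (CI_norm_le _ _ (PI / 2) b _ ltac:(lra) HcI) with (2 := HI)|].
  - intros t Ht. destruct (Hf t Ht) as [_ H1]. eapply Rle_trans; [exact H1|].
    rewrite weight_mod. simpl.
    assert (Ecos : cos (sg * t) = cos t).
    { destruct Hsg as [-> | ->]; [rewrite Rmult_1_l; auto|].
      replace (- (1) * t) with (- t) by ring. apply cos_neg. }
    rewrite Ecos. replace (x * (exp c * cos t)) with (Y * cos t) by (unfold Y; ring).
    assert (Hst : sin b <= sin t) by (apply sin_decr_1; lra).
    apply Rle_trans with (e * (exp (Y * cos t) * exp c) * (sin t / sin b)).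
    + rewrite <- (Rmult_1_r (e * (exp (Y * cos t) * exp c))) at 1.
      apply Rmult_le_compat_l.
      * apply Rmult_le_pos; auto. apply Rmult_le_pos; left; apply exp_pos.
      * apply Rle_div_r; lra.
    + apply Req_le. unfold Y. field. lra.
  - rewrite cos_PI2, Rmult_0_r, exp_0. pose proof (exp_pos (Y * cos b)).
    rewrite <- (Rmult_1_r (e / (x * sin b))) at 2. apply Rmult_le_compat_l; [|lra].
    apply Rmult_le_pos; auto. left; apply Rinv_0_lt_compat. apply Rmult_lt_0_compat; auto.
Qed.

Section Density.
Variables (a : nat -> R) (p E : R) (D : C -> Prop) (P : C -> C).
Hypothesis ha : is_pgf a.
Hypothesis hp : a 1%nat = p.
Hypothesis hp01 : 0 < p < 1.
Hypothesis hP : extends_pgf a D P.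
Hypothesis hE : is_derive (K := C_AbsRing) (V := C_NormedModule) P (RtoC 1) (RtoC E).
Let Pv (v : C) : C := PiFun P E (Cexp v).
Variables (x b b1 : R).
Hypothesis Hx : 0 < x.
Hypothesis Hb : PI / 2 < b < PI.
Hypothesis Hbb : b < b1.
Hypothesis Hgood : good_angle E D P b1.
Let F (v : C) : C := (Pv v * weight x v)%C.
Let di := density_integrand P E x.

Lemma F_Cdiff (v : C) : Rabs (Im v) <= b -> Cdiff F v.
Proof.
  intros Hv. apply Cdiff_mult; [|apply Cdiff_weight].
  apply (Pv_Cdiff a p E D P ha hp hp01 hP hE b1 Hgood). lra.
Qed.

Lemma F_Cdiff_rect (c d y1 y2 : R) : - b <= y1 -> y2 <= b -> forall z, in_rect c d y1 y2 z -> Cdiff F z.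
Proof. intros h1 h2 z [_ Hz]. apply F_Cdiff. apply Rabs_le_between. lra. Qed.

Lemma Pv_bounded (r : R) : exists S, 0 < S /\ forall v, Rabs (Im v) <= b -> r <= Re v -> Cmod (Pv v) <= S.
Proof.
  pose proof PI_RGT_0.
  destruct (Pv_small a p E D P ha hp hp01 hP hE b1 Hgood b 1 ltac:(lra) ltac:(lra)) as [R0 HR].
  destruct (bounded_on_rect Pv r (Rmax r R0) (- b) b) as (M & HM & HB); try lra.
  - apply Rmax_l.
  - intros z [_ Hz]. apply Cdiff_cont, (Pv_Cdiff a p E D P ha hp hp01 hP hE b1 Hgood).
    apply Rabs_lt_between. lra.
  - exists (M + 1). split; [lra|]. intros v Hv1 Hv2. apply Rabs_le_between in Hv1 as Hv1'.
    destruct (Rle_dec R0 (Re v)) as [h|h].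
    + specialize (HR v Hv1 h). unfold Pv. lra.
    + specialize (HB v). pose proof (Rmax_r r R0). assert (Cmod (Pv v) <= M); [|lra].
      apply HB. split; lra.
Qed.

Lemma Ci_Cexp_pos (t : R) : Cexp (t, PI / 2) = (Ci * RtoC (exp t))%C.
Proof. unfold Cexp; simpl. rewrite cos_PI2, sin_PI2. apply injective_projections; simpl; ring. Qed.

Lemma Ci_Cexp_neg (t : R) : Cexp (t, - (PI / 2)) = (Ci * RtoC (- exp t))%C.
Proof. unfold Cexp; simpl. rewrite cos_neg, sin_neg, cos_PI2, sin_PI2. apply injective_projections; simpl; ring. Qed.

(** Away from 0 the point i y is exp (ln |y| +- i pi/2), inside the good strip. At y = 0 there is no
    logarithm and the local holomorphy of Pi takes over. *)
Lemma di_cont (y : R) : Rcont di y.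
Proof.
  pose proof PI_RGT_0.
  assert (HPi : Rcont (fun y => PiFun P E (Ci * RtoC y)) y).
  { destruct (Rtotal_order y 0) as [h|[h|h]].
    - apply Rcont_ext_loc with (f := fun u => Pv (RtoC (ln (- u)) + (0%R, (- (PI / 2))%R))%C).
      + exists (- y). split; [lra|]. intros s Hs. apply Rabs_lt_between in Hs.
        unfold Pv. f_equal.
        replace (RtoC (ln (- s)) + (0%R, (- (PI / 2))%R))%C with ((ln (- s), - (PI / 2)) : C)
          by (apply injective_projections; simpl; ring).
        rewrite Ci_Cexp_neg, exp_ln by lra. f_equal. f_equal. ring.
      + apply (Rcont_path (fun w => Pv (w + (0%R, (- (PI / 2))%R))%C) (fun u => RtoC (ln (- u)))).
        * apply (Rcont_RtoC (fun u => ln (- u))). apply (ex_derive_continuous (V := R_NormedModule)). auto_derive. lra.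
        * apply Cdiff_cont. apply (Cdiff_comp (fun w => w + (0%R, (- (PI / 2))%R))%C Pv).
          -- apply Cdiff_plus; [apply Cdiff_id|apply Cdiff_const].
          -- apply (Pv_Cdiff a p E D P ha hp hp01 hP hE b1 Hgood). simpl. rewrite Rplus_0_l, Rabs_Ropp, Rabs_pos_eq; lra.
    - subst y. destruct (Pi_local a p E D P ha hp hp01 hP hE) as (d0 & Hd0 & _ & _ & _ & Hdf & _).
      apply (Rcont_path (fun w => PiFun P E (Ci * w)%C) RtoC).
      + apply (Rcont_RtoC (fun u => u)). apply continuous_id.
      + apply Cdiff_cont. apply (Cdiff_comp (fun w => Ci * w)%C (PiFun P E)).
        * apply Cdiff_mult; [apply Cdiff_const|apply Cdiff_id].
        * apply Hdf. rewrite Cmult_0_r, Cmod_0. lra.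
    - apply Rcont_ext_loc with (f := fun u => Pv (RtoC (ln u) + (0%R, (PI / 2)%R))%C).
      + exists y. split; [lra|]. intros s Hs. apply Rabs_lt_between in Hs.
        unfold Pv. f_equal.
        replace (RtoC (ln s) + (0%R, (PI / 2)%R))%C with ((ln s, PI / 2) : C)
          by (apply injective_projections; simpl; ring).
        rewrite Ci_Cexp_pos, exp_ln by lra. reflexivity.
      + apply (Rcont_path (fun w => Pv (w + (0%R, (PI / 2)%R))%C) (fun u => RtoC (ln u))).
        * apply (Rcont_RtoC (fun u => ln u)). apply (ex_derive_continuous (V := R_NormedModule)). auto_derive. lra.
        * apply Cdiff_cont. apply (Cdiff_comp (fun w => w + (0%R, (PI / 2)%R))%C Pv).
          -- apply Cdiff_plus; [apply Cdiff_id|apply Cdiff_const].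
          -- apply (Pv_Cdiff a p E D P ha hp hp01 hP hE b1 Hgood). simpl. rewrite Rplus_0_l, Rabs_pos_eq; lra. }
  assert (Hex : Rcont (fun y => Cexp (Ci * RtoC (y * x))) y).
  { apply (Rcont_path (fun w => Cexp (Ci * w))%C (fun y => RtoC (y * x))).
    - apply (Rcont_RtoC (fun y => y * x)). apply (ex_derive_continuous (V := R_NormedModule)). auto_derive. auto.
    - apply Cdiff_cont, Cdiff_Cexp, Cdiff_mult; [apply Cdiff_const|apply Cdiff_id]. }
  exact (Rcont_mult _ _ _ HPi Hex).
Qed.

Lemma di_cont_on (c d : R) : Rcont_on di c d.
Proof. intros t _. apply di_cont. Qed.

Lemma F_di_pos (t : R) : F (t, PI / 2) = (Ci * scal (V := C_R_NormedModule) (exp t) (di (exp t)))%C.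
Proof.
  rewrite scal_C_R. unfold F, Pv, weight, di, density_integrand. rewrite Ci_Cexp_pos.
  replace (RtoC x * (Ci * RtoC (exp t)))%C with (Ci * RtoC (exp t * x))%C by (rewrite RtoC_mult; ring). ring.
Qed.

Lemma F_di_neg (t : R) : F (t, - (PI / 2)) = (Ci * scal (V := C_R_NormedModule) (- exp t)%R (di (- exp t)%R))%C.
Proof.
  rewrite scal_C_R. unfold F, Pv, weight, di, density_integrand. rewrite Ci_Cexp_neg.
  replace (RtoC x * (Ci * RtoC (- exp t)))%C with (Ci * RtoC (- exp t * x))%C by (rewrite RtoC_mult; ring). ring.
Qed.

Lemma subst_pos (c d : R) : (Ci * CI di (exp c) (exp d))%C = hint F (PI / 2) c d.
Proof.
  unfold hint. symmetry. apply CI_unique.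
  apply (is_RInt_ext (V := C_R_NormedModule) (fun t => Ci * scal (V := C_R_NormedModule) (exp t) (di (exp t)))%C).
  - intros t _. symmetry. apply F_di_pos.
  - apply is_RInt_C_scal. apply (is_RInt_comp (V := C_R_CompleteNormedModule) di exp exp).
    + intros t _. apply Rcont_continuous, di_cont.
    + intros t _. split; [auto_derive; auto; ring|].
      apply (ex_derive_continuous (V := R_NormedModule)). auto_derive. auto.
Qed.

Lemma subst_neg (c d : R) : (Ci * CI di (- exp c) (- exp d))%C = hint F (- (PI / 2)) c d.
Proof.
  unfold hint. symmetry. apply CI_unique.
  apply (is_RInt_ext (V := C_R_NormedModule) (fun t => Ci * scal (V := C_R_NormedModule) (- exp t)%R (di (- exp t)%R))%C).
  - intros t _. symmetry. apply F_di_neg.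
  - apply is_RInt_C_scal. apply (is_RInt_comp (V := C_R_CompleteNormedModule) di (fun t => - exp t) (fun t => - exp t)).
    + intros t _. apply Rcont_continuous, di_cont.
    + intros t _. split; [auto_derive; auto; ring|].
      apply (ex_derive_continuous (V := R_NormedModule)). auto_derive. auto.
Qed.

Lemma CI_di_swap (c d : R) : CI di d c = (- CI di c d)%C.
Proof.
  apply Cminus_eq_0. pose proof (CI_Chasles di c d c (di_cont_on _ _) (di_cont_on _ _)) as H.
  rewrite CI_point in H. rewrite <- H. ring.
Qed.

(** The endpoints d1 and d2 stay independent, because the two-sided improper integral lets them tend
    to infinity separately. *)
Lemma di_symmetric (c d1 d2 : R) :
  (Ci * CI di (- exp d1) (exp d2) = Ci * CI di (- exp c) (exp c) + hint F (PI / 2) c d2 - hint F (- (PI / 2)) c d1)%C.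
Proof.
  rewrite <- subst_pos, <- subst_neg.
  rewrite <- (CI_Chasles di (- exp d1) (- exp c) (exp d2)) by apply di_cont_on.
  rewrite <- (CI_Chasles di (- exp c) (exp c) (exp d2)) by apply di_cont_on.
  rewrite (CI_di_swap (- exp c) (- exp d1)). ring.
Qed.

(** Cauchy's theorem for a half-disc in the z-plane, whose centre z = 0 is not covered by v = ln z.
    The difference of the two sides is independent of c by Goursat, and as c tends to minus infinity
    both sides tend to 0 because Pi is bounded near 0. *)
Lemma di_middle (c : R) : (Ci * CI di (- exp c) (exp c))%C = vint F c (- (PI / 2)) (PI / 2).
Proof.
  pose proof PI_RGT_0 as HPI.
  destruct (Pi_local a p E D P ha hp hp01 hP hE) as (d0 & Hd0 & _ & (K0 & HK0 & HK0d & HQ) & _ & _ & _).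
  assert (HPib : forall z, Cmod z <= d0 -> Cmod (PiFun P E z) <= 1 + 2 * d0).
  { intros z Hz. specialize (HQ z Hz). pose proof (Cmod_ge_0 z).
    replace (PiFun P E z) with ((PiFun P E z - 1 + z) + (1 - z))%C by ring.
    eapply Rle_trans; [apply Cmod_triangle|]. pose proof (Cmod_minus_triangle 1 z) as HT. rewrite Cmod_1 in HT.
    assert (K0 * Cmod z * Cmod z <= Cmod z).
    { assert (K0 * Cmod z <= 1 / 4) by (apply Rle_trans with (K0 * d0); auto; apply Rmult_le_compat_l; lra). nra. }
    lra. }
  set (B := (1 + 2 * d0) * (2 + PI * exp (x * d0))).
  assert (HB : 0 < B).
  { unfold B. apply Rmult_lt_0_compat; [lra|]. pose proof (exp_pos (x * d0)). nra. }
  apply Cmod_eq_minus0, Rle_antisym; [|apply Cmod_ge_0].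
  apply le_epsilon. intros e He. rewrite Rplus_0_l.
  set (m := Rmin (exp c) (Rmin d0 (e / B))).
  assert (Hm : 0 < m).
  { unfold m. repeat apply Rmin_pos; auto; [apply exp_pos|apply Rdiv_lt_0_compat; auto]. }
  assert (Hmb : m <= exp c /\ m <= d0 /\ m <= e / B).
  { unfold m. pose proof (Rmin_l (exp c) (Rmin d0 (e / B))). pose proof (Rmin_r (exp c) (Rmin d0 (e / B))).
    pose proof (Rmin_l d0 (e / B)). pose proof (Rmin_r d0 (e / B)). lra. }
  set (c' := ln m). assert (Hc' : exp c' = m) by (apply exp_ln; auto).
  assert (Hcc : c' <= c).
  { unfold c'. rewrite <- (ln_exp c). apply ln_le; lra. }
  assert (HR : rect_int F c' c (- (PI / 2)) (PI / 2) = 0%C).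
  { apply goursat; try lra. apply F_Cdiff_rect; lra. }
  unfold rect_int in HR.
  replace (Ci * CI di (- exp c) (exp c) - vint F c (- (PI / 2)) (PI / 2))%C
    with (Ci * CI di (- exp c') (exp c') - vint F c' (- (PI / 2)) (PI / 2))%C.
  2:{ rewrite (di_symmetric c' c c).
      apply Cminus_eq_0. transitivity (hint F (- (PI / 2)) c' c + vint F c (- (PI / 2)) (PI / 2) - hint F (PI / 2) c' c
        - vint F c' (- (PI / 2)) (PI / 2))%C; [ring|exact HR]. }
  eapply Rle_trans; [apply Cmod_minus_triangle|].
  rewrite Cmod_mult, Cmod_Ci, Rmult_1_l, Hc'. unfold vint. rewrite Cmod_mult, Cmod_Ci, Rmult_1_l.
  assert (I1 : Cmod (CI di (- m) m) <= (m - - m) * (1 + 2 * d0)).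
  { apply CI_norm; [lra|apply di_cont_on|]. intros y Hy. unfold di, density_integrand.
    rewrite Cmod_mult, Cmod_Cexp. replace (Re (Ci * RtoC (y * x))%C) with 0 by (unfold Re; simpl; ring).
    rewrite exp_0, Rmult_1_r. apply HPib. rewrite Cmod_mult, Cmod_Ci, Cmod_R, Rmult_1_l.
    apply Rle_trans with m; [|lra]. apply Rabs_le_between. lra. }
  assert (I2 : Cmod (CI (fun t => F (c', t)) (- (PI / 2)) (PI / 2)) <= (PI / 2 - - (PI / 2)) * ((1 + 2 * d0) * (exp (x * d0) * m))).
  { apply CI_norm; [lra| |].
    - apply Rcont_on_v. intros t Ht. rewrite Rmin_left, Rmax_right in Ht by lra.
      apply Cdiff_cont, F_Cdiff. simpl. apply Rabs_le_between; lra.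
    - intros t Ht. unfold F. rewrite Cmod_mult. apply Rmult_le_compat; try apply Cmod_ge_0.
      + apply HPib. rewrite Cmod_Cexp. simpl. lra.
      + eapply Rle_trans; [apply weight_le; auto|]. simpl. rewrite Hc'.
        apply Rmult_le_compat_r; [lra|]. apply exp_monotone. apply Rmult_le_compat_l; lra. }
  apply Rle_trans with (B * m).
  - unfold B. replace ((m - - m) * (1 + 2 * d0)) with ((1 + 2 * d0) * (2 * m)) in I1 by ring.
    replace ((PI / 2 - - (PI / 2)) * ((1 + 2 * d0) * (exp (x * d0) * m)))
      with ((1 + 2 * d0) * (PI * exp (x * d0) * m)) in I2 by field. lra.
  - apply Rle_trans with (B * (e / B)); [apply Rmult_le_compat_l; lra|]. apply Req_le. field. lra.
Qed.

Lemma arc_vanishes (sg : R) : sg = 1 \/ sg = - (1) ->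
  climit (fun c => CI (fun t => F (c, (sg * t)%R)) (PI / 2) b) 0%C.
Proof.
  intros Hsg e He. pose proof PI_RGT_0.
  assert (Hsb : 0 < sin b) by (apply sin_gt_0; lra).
  assert (Hxs : 0 < x * sin b) by (apply Rmult_lt_0_compat; auto).
  destruct (Pv_small a p E D P ha hp hp01 hP hE b1 Hgood b (e * (x * sin b)) ltac:(lra) ltac:(apply Rmult_lt_0_compat; auto)) as [R0 HR].
  exists R0. intros c Hc.
  replace (CI (fun t => F (c, (sg * t)%R)) (PI / 2) b - 0)%C with (CI (fun t => F (c, (sg * t)%R)) (PI / 2) b) by ring.
  replace e with (e * (x * sin b) / (x * sin b)) by (field; lra).
  assert (Hin : forall t, PI / 2 <= t <= b -> Rabs (sg * t) <= b).
  { intros t Ht. rewrite Rabs_mult, (Rabs_pos_eq t) by lra.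
    replace (Rabs sg) with 1; [lra|]. destruct Hsg as [-> | ->]; [rewrite Rabs_R1; auto|rewrite Rabs_Ropp, Rabs_R1; auto]. }
  apply (jordan_arc F x c b (e * (x * sin b)) sg); auto.
  - apply Rmult_le_pos; lra.
  - intros t Ht. split; [apply Cdiff_cont, F_Cdiff, Hin; auto|].
    unfold F. rewrite Cmod_mult. apply Rmult_le_compat_r; [apply Cmod_ge_0|].
    apply HR; simpl; [apply Hin; auto|lra].
Qed.

Lemma climit_RInt_gen (G1 G2 : R -> C) (l1 l2 : C) :
  climit G1 l1 -> climit G2 l2 ->
  (forall c1 c2, 0 <= c1 -> 0 <= c2 -> CI di (- exp c1) (exp c2) = (G1 c1 + G2 c2)%C) ->
  is_RInt_gen (V := C_R_NormedModule) di (Rbar_locally m_infty) (Rbar_locally p_infty) (l1 + l2)%C.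
Proof.
  intros H1 H2 HG Q HQ. apply locally_C_Cmod in HQ. destruct HQ as (e & He & HQ).
  destruct (H1 (e / 4) ltac:(lra)) as [M1 HM1]. destruct (H2 (e / 4) ltac:(lra)) as [M2 HM2].
  apply (Filter_prod _ _ _ (fun X => X < - exp (Rmax 0 M1)) (fun Y => exp (Rmax 0 M2) < Y)).
  - exists (- exp (Rmax 0 M1)). auto.
  - exists (exp (Rmax 0 M2)). auto.
  - intros X Y HX HY. exists (CI di X Y). split; [apply is_CI, di_cont_on|]. apply HQ.
    pose proof (exp_pos (Rmax 0 M1)). pose proof (exp_pos (Rmax 0 M2)).
    assert (EX : X = - exp (ln (- X))) by (rewrite exp_ln; lra).
    assert (EY : Y = exp (ln Y)) by (rewrite exp_ln; lra).
    assert (LX : Rmax 0 M1 <= ln (- X)) by (rewrite <- (ln_exp (Rmax 0 M1)); apply ln_le; lra).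
    assert (LY : Rmax 0 M2 <= ln Y) by (rewrite <- (ln_exp (Rmax 0 M2)); apply ln_le; lra).
    pose proof (Rmax_l 0 M1). pose proof (Rmax_r 0 M1). pose proof (Rmax_l 0 M2). pose proof (Rmax_r 0 M2).
    rewrite EX, EY, HG by lra. specialize (HM1 (ln (- X)) ltac:(lra)). specialize (HM2 (ln Y) ltac:(lra)).
    replace (G1 (ln (- X)) + G2 (ln Y) - (l1 + l2))%C with ((G1 (ln (- X)) - l1) + (G2 (ln Y) - l2))%C by ring.
    eapply Rle_lt_trans; [apply Cmod_triangle|]. lra.
Qed.

(** Each half-line tail, a horizontal line at height pi/2 or - pi/2, is pushed to height b or - b.
    The connecting arcs vanish and the new rays converge absolutely, which also proves that the
    improper integral exists. *)
Theorem density_contour : exists l,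
  climit (fun M => vint F M (- b) b) l /\
  is_RInt_gen (V := C_R_NormedModule) di (Rbar_locally m_infty) (Rbar_locally p_infty) (l / Ci)%C.
Proof.
  pose proof PI_RGT_0 as HPI. pose proof (cos_obtuse b Hb) as Hk.
  destruct (Pv_bounded 0) as (S & HS & HB).
  set (W := 4 / ((x * - cos b) * (x * - cos b))).
  assert (HW : 0 < W) by (apply Rdiv_lt_0_compat; [lra|repeat apply Rmult_lt_0_compat; auto]).
  assert (Hray : forall y, y = b \/ y = - b -> exists l, climit (fun M => hint F y 0 M) l).
  { intros y Hy. assert (Hyb : Rabs y <= b).
    { destruct Hy as [-> | ->]; [|rewrite Rabs_Ropp]; rewrite Rabs_pos_eq; lra. }
    destruct (ray_limit (fun t => F (t, y)) 0 (S * W) 1) as (l & Hl & _); try lra.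
    - apply Rmult_le_pos; lra.
    - intros t Ht. apply (Rcont_path F (fun s => (s, y))); [apply Rcont_h|apply Cdiff_cont, F_Cdiff; auto].
    - intros t Ht. unfold F. rewrite Cmod_mult, Rmult_assoc.
      apply Rmult_le_compat; try apply Cmod_ge_0; [apply HB; auto|apply weight_ray; auto].
    - exists l. exact Hl. }
  destruct (Hray b (or_introl eq_refl)) as [l1 Hl1]. destruct (Hray (- b) (or_intror eq_refl)) as [l2 Hl2].
  set (V0 := vint F 0 (- b) b).
  assert (HFc : forall c t, - b <= t <= b -> Ccont F (c, t)).
  { intros c t Ht. apply Cdiff_cont, F_Cdiff. simpl. apply Rabs_le_between; lra. }
  assert (Hch : forall c, (vint F c (- b) (- (PI / 2)) + (vint F c (- (PI / 2)) (PI / 2) + vint F c (PI / 2) b) = vint F c (- b) b)%C).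
  { intros c. rewrite (vint_Chasles F c (- (PI / 2)) (PI / 2) b), (vint_Chasles F c (- b) (- (PI / 2)) b); auto.
    all: intros t; destruct (Rle_dec (- b) t); [destruct (Rle_dec t b); [left; apply HFc; lra|]|];
      right; unfold Rmin, Rmax; repeat destruct (Rle_dec _ _); lra. }
  exists (l1 - l2 + V0)%C. split.
  - apply climit_ext with (m := 0) (F := hankel F b 0).
    + intros M HM. apply hankel_entire; try lra. apply F_Cdiff_rect; lra.
    + unfold hankel. apply (climit_plus (fun M => hint F b 0 M - hint F (- b) 0 M)%C (fun _ => V0)).
      * replace (l1 - l2)%C with (l1 + - (1) * l2)%C by ring.
        apply climit_ext with (m := 0) (F := fun M => (hint F b 0 M + - (1) * hint F (- b) 0 M)%C); [intros; ring|].
        apply climit_plus; auto. apply climit_scal; auto.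
      * intros e He. exists 0. intros. rewrite Cminus_diag_mod; lra.
  - set (A1 := fun c => CI (fun t => F (c, (1 * t)%R)) (PI / 2) b).
    set (A2 := fun c => CI (fun t => F (c, (- (1) * t)%R)) (PI / 2) b).
    assert (HA1 : forall c, vint F c (PI / 2) b = (Ci * A1 c)%C).
    { intros c. unfold vint, A1. f_equal. apply CI_ext. intros t _. rewrite Rmult_1_l. auto. }
    assert (HA2 : forall c, vint F c (- b) (- (PI / 2)) = (Ci * A2 c)%C).
    { intros c. unfold vint, A2. f_equal. apply CI_unique.
      assert (HJ : is_RInt (V := C_R_NormedModule) (fun t => F (c, (- (1) * t)%R)) (PI / 2) b (A2 c)).
      { apply is_CI. intros t Ht. rewrite Rmin_left, Rmax_right in Ht by lra.
        apply (Rcont_path F (fun s => (c, (- (1) * s)%R))); [|apply HFc; lra].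
        intros ep Hep. exists ep. split; auto. intros s Hs.
        replace ((c, (- (1) * s)%R) - (c, (- (1) * t)%R))%C with (- (Ci * RtoC (s - t)))%C
          by (apply injective_projections; simpl; ring).
        rewrite Cmod_opp, Cmod_mult, Cmod_Ci, Cmod_R. lra. }
      apply (is_RInt_swap (V := C_R_NormedModule)) in HJ.
      assert (HJ2 : is_RInt (V := C_R_NormedModule) (fun t => F (c, (- (1) * t)%R)) (- - b) (- - (PI / 2)) (opp (A2 c)))
        by (rewrite !Ropp_involutive; exact HJ).
      apply (is_RInt_comp_opp (V := C_R_NormedModule)) in HJ2.
      apply (is_RInt_opp (V := C_R_NormedModule)) in HJ2.
      change (CI (fun t => F (c, (- (1) * t)%R)) (PI / 2) b) with (A2 c).
      replace (A2 c) with (- - A2 c)%C by ring.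
      eapply (is_RInt_ext (V := C_R_NormedModule)); [|exact HJ2]. intros t _.
      cbv beta. replace (- (1) * - t) with t by ring.
      change (- - F (c, t) = F (c, t))%C. ring. }
    (* The integral splits into a function of c1 and a function of c2. The fixed segment V0, which
       absorbs the middle part and both inner arcs, is assigned to the first. *)
    assert (Hmain : forall c1 c2, 0 <= c1 -> 0 <= c2 -> CI di (- exp c1) (exp c2) =
       (((V0 - hint F (- b) 0 c1) / Ci - A2 c1) + (hint F b 0 c2 / Ci - A1 c2))%C).
    { intros c1 c2 h1 h2. pose proof (di_symmetric 0 c1 c2) as HD. rewrite di_middle in HD.
      assert (R1 : rect_int F 0 c2 (PI / 2) b = 0%C) by (apply goursat; try lra; apply F_Cdiff_rect; lra).
      assert (R2 : rect_int F 0 c1 (- b) (- (PI / 2)) = 0%C) by (apply goursat; try lra; apply F_Cdiff_rect; lra).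
      unfold rect_int in R1, R2. rewrite HA1 in R1. rewrite HA2 in R2.
      assert (E1 : hint F (PI / 2) 0 c2 = (hint F b 0 c2 + vint F 0 (PI / 2) b - Ci * A1 c2)%C).
      { apply Cminus_eq_0. rewrite <- R1. ring. }
      assert (E2 : hint F (- (PI / 2)) 0 c1 = (hint F (- b) 0 c1 + Ci * A2 c1 - vint F 0 (- b) (- (PI / 2)))%C).
      { symmetry. apply Cminus_eq_0. rewrite <- R2. ring. }
      rewrite E1, E2 in HD. unfold V0. rewrite <- (Hch 0).
      replace (CI di (- exp c1) (exp c2)) with (Ci * CI di (- exp c1) (exp c2) / Ci)%C by (field; apply Ci_neq_0).
      rewrite HD. field. apply Ci_neq_0. }
    replace ((l1 - l2 + V0) / Ci)%C with ((/ Ci * (V0 + - (1) * l2) + - (1) * 0) + (/ Ci * l1 + - (1) * 0))%C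
      by (field; apply Ci_neq_0).
    assert (C0 : climit (fun _ => V0) V0) by (intros e He; exists 0; intros; rewrite Cminus_diag_mod; lra).
    assert (Ha2 : climit (fun c => - (1) * A2 c)%C (- (1) * 0)%C)
      by (apply (climit_scal A2 (- (1)) 0); unfold A2; apply arc_vanishes; auto).
    assert (Ha1 : climit (fun c => - (1) * A1 c)%C (- (1) * 0)%C)
      by (apply (climit_scal A1 (- (1)) 0); unfold A1; apply arc_vanishes; auto).
    pose proof (climit_plus _ _ _ _ (climit_scal _ (/ Ci) _ (climit_plus _ _ _ _ C0 (climit_scal _ (- (1)) _ Hl2))) Ha2) as K2.
    pose proof (climit_plus _ _ _ _ (climit_scal _ (/ Ci) _ Hl1) Ha1) as K1. cbv beta in K1, K2.
    apply (climit_RInt_gen (fun c => (V0 - hint F (- b) 0 c) / Ci - A2 c)%C (fun c => hint F b 0 c / Ci - A1 c)%C); auto.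
    + refine (climit_ext _ _ _ 0 _ K2). intros M _. field. apply Ci_neq_0.
    + refine (climit_ext _ _ _ 0 _ K1). intros M _. field. apply Ci_neq_0.
Qed.
End Density.

(** * Termwise integration and the coefficient bound *)

Section ContourFunctional.
Variables (x b : R).
Hypothesis Hx : 0 < x.
Hypothesis Hb : PI / 2 < b < PI.

(* When f is holomorphic in the strip, Cauchy's theorem identifies the integral over the
   segment Re v = M with the one over the contour truncated at Re v = M. *)
Definition contour_value (f : C -> C) (l : C) : Prop :=
  climit (fun M => vint (fun v => f v * weight x v)%C M (- b) b) l.

Definition strip_Cdiff (f : C -> C) : Prop := forall v, Rabs (Im v) <= b -> Cdiff f v.

(** Bound for the contour integral of the weight alone: two rays starting at Re v = r and the
    vertical segment of length 2 b. It is the norm bound of the functional for functions bounded on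
    Re v >= r. *)
Definition contour_const (r : R) : R :=
  2 * (4 / ((x * - cos b) * (x * - cos b)) * exp (- r)) + 2 * b * (exp (x * exp r) * exp r).

Lemma contour_const_pos (r : R) : 0 < contour_const r.
Proof.
  pose proof (cos_obtuse b Hb). pose proof PI_RGT_0. unfold contour_const.
  assert (0 < 4 / ((x * - cos b) * (x * - cos b)) * exp (- r)).
  { apply Rmult_lt_0_compat; [|apply exp_pos]. apply Rdiv_lt_0_compat; [lra|]. repeat apply Rmult_lt_0_compat; auto. }
  assert (0 < 2 * b * (exp (x * exp r) * exp r)).
  { repeat apply Rmult_lt_0_compat; try apply exp_pos; lra. }
  lra.
Qed.

Lemma contour_value_unique (f : C -> C) (l m : C) : contour_value f l -> contour_value f m -> l = m.
Proof. apply climit_unique. Qed.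

Lemma contour_value_exists (f : C -> C) (r S : R) : strip_Cdiff f -> 0 <= S ->
  (forall v, Rabs (Im v) <= b -> r <= Re v -> Cmod (f v) <= S) ->
  exists l, contour_value f l /\ Cmod l <= S * contour_const r.
Proof.
  intros Hf HS Hbd. pose proof PI_RGT_0.
  destruct (hankel_weight_limit f b r x S Hb Hx HS) as (l & Hl & Hl2).
  - intros v Hv1 Hv2. split; auto.
  - exists l. split; [|exact Hl2].
    apply climit_ext with (m := r) (F := hankel (fun v => f v * weight x v)%C b r); auto.
    intros M HM. apply hankel_entire; try lra. intros z [_ Hz].
    apply Cdiff_mult; [apply Hf; apply Rabs_le_between; lra|apply Cdiff_weight].
Qed.

Lemma strip_vint_cont (f : C -> C) (M : R) : strip_Cdiff f ->
  Rcont_on (fun t => f (M, t) * weight x (M, t))%C (- b) b.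
Proof.
  intros Hf. pose proof PI_RGT_0.
  apply (Rcont_on_v (fun v => f v * weight x v)%C). intros t Ht. rewrite Rmin_left, Rmax_right in Ht by lra.
  apply Cdiff_cont, Cdiff_mult; [apply Hf; simpl; apply Rabs_le_between; lra|apply Cdiff_weight].
Qed.

Lemma contour_value_ext (f g : C -> C) (l : C) : (forall v, Rabs (Im v) <= b -> f v = g v) ->
  contour_value f l -> contour_value g l.
Proof.
  intros E. pose proof PI_RGT_0. apply climit_ext with (m := 0). intros M _. unfold vint. f_equal. apply CI_ext.
  intros t. rewrite Rmin_left, Rmax_right by lra. intros Ht. rewrite E; auto. simpl. apply Rabs_le_between; lra.
Qed.

Lemma contour_value_plus (f g : C -> C) (l m : C) : strip_Cdiff f -> strip_Cdiff g ->
  contour_value f l -> contour_value g m -> contour_value (fun v => f v + g v)%C (l + m)%C.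
Proof.
  intros Hf Hg Hl Hm. unfold contour_value in *.
  eapply climit_ext with (m := 0); [|apply (climit_plus _ _ _ _ Hl Hm)].
  intros M _. unfold vint. rewrite <- Cmult_plus_distr_l. f_equal.
  rewrite <- CI_plus by (apply strip_vint_cont; auto).
  apply CI_ext. intros t _. ring.
Qed.

Lemma contour_value_scal (k : C) (f : C -> C) (l : C) : strip_Cdiff f ->
  contour_value f l -> contour_value (fun v => k * f v)%C (k * l)%C.
Proof.
  intros Hf Hl. unfold contour_value in *.
  eapply climit_ext with (m := 0); [|apply (climit_scal _ k _ Hl)].
  intros M _. unfold vint.
  transitivity (Ci * (k * CI (fun t => f (M, t) * weight x (M, t)) (- b)%R b))%C; [ring|]. f_equal.
  rewrite <- CI_scal by (apply strip_vint_cont; auto).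
  apply CI_ext. intros t _. ring.
Qed.

Lemma strip_Cdiff_plus (f g : C -> C) : strip_Cdiff f -> strip_Cdiff g -> strip_Cdiff (fun v => f v + g v)%C.
Proof. intros Hf Hg v Hv. apply Cdiff_plus; auto. Qed.

Lemma strip_Cdiff_scal (k : C) (f : C -> C) : strip_Cdiff f -> strip_Cdiff (fun v => k * f v)%C.
Proof. intros Hf v Hv. apply Cdiff_mult; auto. apply Cdiff_const. Qed.

Lemma strip_Cdiff_csum (f : nat -> C -> C) (N : nat) :
  (forall k, strip_Cdiff (f k)) -> strip_Cdiff (fun v => csum (fun k => f k v) N).
Proof.
  intros Hf. induction N; intros v Hv; simpl; [apply Cdiff_const|].
  apply Cdiff_plus; [apply IHN; auto|apply Hf; auto].
Qed.

Lemma contour_value_csum (f : nat -> C -> C) (l : nat -> C) (N : nat) :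
  (forall k, strip_Cdiff (f k)) -> (forall k, contour_value (f k) (l k)) ->
  contour_value (fun v => csum (fun k => f k v) N) (csum l N).
Proof.
  intros Hf Hl. induction N.
  - simpl. intros e He. exists 0. intros M _.
    assert (E : vint (fun v => 0 * weight x v)%C M (- b) b = 0%C).
    { unfold vint. rewrite (CI_ext _ (fun _ => 0%C)) by (intros; ring). rewrite CI_const. ring. }
    rewrite E, Cminus_diag_mod. lra.
  - simpl. apply contour_value_plus; auto. apply strip_Cdiff_csum; auto.
Qed.

(** Closeness is asked only on Re v >= r, since the value does not depend on where the contour is
    cut. Both infinite sums are exchanged with the integral by this estimate, applied with r so
    large that the series in powers of Phi(Pi) converges. *)
Lemma contour_value_close (f g : C -> C) (l m : C) (r S : R) : strip_Cdiff f -> strip_Cdiff g -> 0 <= S ->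
  contour_value f l -> contour_value g m ->
  (forall v, Rabs (Im v) <= b -> r <= Re v -> Cmod (f v - g v) <= S) ->
  Cmod (l - m) <= S * contour_const r.
Proof.
  intros Hf Hg HS Hl Hm Hbd.
  assert (Hd : strip_Cdiff (fun v => f v + - (1) * g v)%C).
  { apply strip_Cdiff_plus; auto. apply strip_Cdiff_scal; auto. }
  destruct (contour_value_exists (fun v => f v + - (1) * g v)%C r S Hd HS) as (d & H1 & H2).
  - intros v Hv1 Hv2. replace (f v + - (1) * g v)%C with (f v - g v)%C by ring. auto.
  - replace (l - m)%C with d; auto.
    apply (contour_value_unique _ _ _ H1).
    replace (l - m)%C with (l + - (1) * m)%C by ring.
    apply (contour_value_plus f (fun v => - (1) * g v)%C); auto; [apply strip_Cdiff_scal; auto|].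
    apply contour_value_scal; auto.
Qed.
End ContourFunctional.

Lemma exp_pow (y : R) (k : nat) : exp y ^ k = exp (INR k * y).
Proof.
  induction k; [simpl; rewrite Rmult_0_l, exp_0; auto|].
  rewrite S_INR. simpl. rewrite IHk, <- exp_plus. f_equal. ring.
Qed.

Lemma csum_scal (k : C) (u : nat -> C) (N : nat) : csum (fun i => k * u i)%C N = (k * csum u N)%C.
Proof. induction N; simpl; [ring|rewrite IHN; ring]. Qed.

Lemma csum_ext (u w : nat -> C) (N : nat) : (forall i, u i = w i) -> csum u N = csum w N.
Proof. intros H. induction N; simpl; [auto|rewrite IHN, H; auto]. Qed.

Lemma csum_Sl (u : nat -> C) (N : nat) : csum u (S N) = (u 0%nat + csum (fun i => u (S i)) N)%C.
Proof. induction N; [simpl; ring|]. change (csum u (S (S N))) with (csum u (S N) + u (S N))%C. rewrite IHN. simpl. ring. Qed.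

Lemma geometric_vanishes (c q e : R) : 0 < q < 1 -> 0 < e -> exists N, forall n, (N <= n)%nat -> c * q ^ n <= e.
Proof.
  intros Hq He. destruct (pow_lt_1_zero q ltac:(rewrite Rabs_pos_eq; lra) (e / (Rabs c + 1))) as [N HN].
  { apply Rdiv_lt_0_compat; auto. pose proof (Rabs_pos c). lra. }
  exists N. intros n Hn. specialize (HN n Hn). rewrite Rabs_pos_eq in HN by (apply pow_le; lra).
  pose proof (Rabs_pos c). pose proof (Rle_abs c). pose proof (pow_le q n ltac:(lra)).
  apply Rle_trans with ((Rabs c + 1) * (e / (Rabs c + 1))); [|apply Req_le; field; lra].
  apply Rle_trans with ((Rabs c + 1) * q ^ n); [apply Rmult_le_compat_r; lra|apply Rmult_le_compat_l; lra].
Qed.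

(** * Assembly of the expansion and of the coefficient estimate *)

Section MainExpansion.
Variables (a : nat -> R) (p E : R) (D : C -> Prop) (P : C -> C) (phi : nat -> C).
Hypothesis ha : is_pgf a.
Hypothesis hp : a 1%nat = p.
Hypothesis hp01 : 0 < p < 1.
Hypothesis hP : extends_pgf a D P.
Hypothesis hE : is_derive (K := C_AbsRing) (V := C_NormedModule) P (RtoC 1) (RtoC E).
Hypothesis hphi : is_inverse_coeffs P p phi.
Let L := ln E.
Let HL : 0 < L := lnE_pos a p E D P ha hp hp01 hP hE.
Let al := - ln p / L.
Let Pv (v : C) : C := PiFun P E (Cexp v).
Let Psi (v : C) : C := PhiFun P p (Pv v).

(** On height at most b the m-th mode grows like exp (2 pi |m| b / L), while its coefficient decays
    with the larger height b'. The difference b' - b gives the geometric ratio. *)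
Lemma mode_bound (n : nat) (m : Z) (k : nat) (r b b' M : R) (v : C) : 0 < M ->
  (forall n m, Cmod (kappa P p E n m) <= M ^ n * exp (- (2 * PI * Rabs (IZR m) / L * b'))) ->
  Rabs (IZR m) = INR k -> Rabs (Im v) <= b -> r <= Re v ->
  Cmod (phi n * kappa P p E n m * Cexp (- (- exponent p E n m * v))) <=
    (Cmod (phi n) * M ^ n * exp (- (INR n * al * r))) * exp (- (2 * PI / L * (b' - b))) ^ k.
Proof.
  intros HM Hk Hm Hv1 Hv2. pose proof PI_RGT_0.
  assert (Hal : 0 < al) by (apply (al_pos a p E D P ha hp hp01 hP hE)).
  rewrite !Cmod_mult, Cmod_Cexp_lin.
  rewrite (exponent_Re_Im a p E D P ha hp hp01 hP hE).
  unfold Re at 1, Im at 1; simpl fst; simpl snd. fold L al.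
  specialize (Hk n m). rewrite Hm in Hk.
  assert (H2 : exp (- (INR n * al * Re v) + - (2 * PI * IZR m / L) * Im v) <=
     exp (- (INR n * al * r)) * exp (2 * PI * INR k / L * b)).
  { rewrite <- exp_plus. apply exp_monotone. apply Rplus_le_compat.
    - apply Ropp_le_contravar. apply Rmult_le_compat_l; auto. apply Rmult_le_pos; [apply pos_INR|lra].
    - eapply Rle_trans; [apply Rle_abs|]. rewrite Rabs_mult, Rabs_Ropp.
      assert (HI : Rabs (2 * PI * IZR m / L) = 2 * PI * INR k / L).
      { unfold Rdiv. rewrite !Rabs_mult, Hm, (Rabs_pos_eq 2), (Rabs_pos_eq PI), (Rabs_pos_eq (/ L)); try lra.
        left; apply Rinv_0_lt_compat; auto. }
      rewrite HI. apply Rmult_le_compat_l; auto.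
      apply Rmult_le_pos; [|left; apply Rinv_0_lt_compat; auto]. apply Rmult_le_pos; [lra|apply pos_INR]. }
  rewrite exp_pow.
  apply Rle_trans with (Cmod (phi n) * (M ^ n * exp (- (2 * PI * INR k / L * b'))) *
     (exp (- (INR n * al * r)) * exp (2 * PI * INR k / L * b))).
  - apply Rmult_le_compat; auto; [apply Rmult_le_pos; apply Cmod_ge_0|left; apply exp_pos|].
    apply Rmult_le_compat_l; [apply Cmod_ge_0|auto].
  - apply Req_le. replace (exp (INR k * - (2 * PI / L * (b' - b)))) with
      (exp (- (2 * PI * INR k / L * b')) * exp (2 * PI * INR k / L * b)).
    + ring.
    + rewrite <- exp_plus. f_equal. field. lra.
Qed.

Lemma strip_Cdiff_mode (b : R) (n : nat) (m : Z) :
  strip_Cdiff b (fun v => phi n * kappa P p E n m * Cexp (- (- exponent p E n m * v)))%C.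
Proof. intros v _. apply Cdiff_mult; [apply Cdiff_const|apply Cdiff_exp_lin]. Qed.

Lemma term_contour (x b : R) (n : nat) (m : Z) : (1 <= n)%nat -> 0 < x -> PI / 2 < b < PI ->
  exists l, contour_value x b (fun v => phi n * kappa P p E n m * Cexp (- (- exponent p E n m * v)))%C l /\
    expansion_term P p E phi x n m = (RtoC x / (RtoC (2 * PI) * Ci) * l)%C.
Proof.
  intros Hn Hx Hb.
  destruct (expansion_term_hankel a p E D P phi ha hp hp01 hP hE x n m b Hn Hx Hb) as (l & Hl & ->).
  exists (phi n * kappa P p E n m * l)%C. split; auto.
  apply (contour_value_scal x b Hb (phi n * kappa P p E n m)%C (fun v => Cexp (- (- exponent p E n m * v))%C)).
  - intros v _. apply Cdiff_exp_lin.
  - exact Hl.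
Qed.

Theorem expansion_for (x : R) : 0 < x ->
  ex_RInt_gen (V := C_R_NormedModule) (density_integrand P E x)
    (Rbar_locally m_infty) (Rbar_locally p_infty) /\
  exists (inner : nat -> C) (total : C),
    (forall n : nat, (1 <= n)%nat -> is_bilateral_series (expansion_term P p E phi x n) (inner n)) /\
    is_Cseries (fun k : nat => inner (S k)) total /\
    density P E x = (RtoC (/ x) * total)%C.
Proof.
  intros Hx. pose proof PI_RGT_0 as HPI.
  assert (Hal : 0 < al) by (apply (al_pos a p E D P ha hp hp01 hP hE)).
  destruct (good_beyond_right_angle a p E D P ha hp hp01 hP hE) as (b1 & Hb1 & Hgood).
  set (B := Rmin b1 PI).
  assert (HB : PI / 2 < B /\ B <= b1 /\ B <= PI).
  { unfold B. split; [apply Rmin_glb_lt; lra|split; [apply Rmin_l|apply Rmin_r]]. }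
  (* The points at one and two thirds of the way from pi/2 to B: b carries the contour, b' the
     Fourier coefficients. Capping B at pi keeps cos b negative and sin b positive. *)
  set (b := (2 * (PI / 2) + B) / 3). set (b' := (PI / 2 + 2 * B) / 3).
  assert (Hb : PI / 2 < b < PI) by (unfold b; lra).
  assert (Hbb : b < b' < b1) by (unfold b, b'; lra).
  destruct (density_contour a p E D P ha hp hp01 hP hE x b b1 Hx Hb ltac:(lra) Hgood) as (lP & HlP & Hdens).
  destruct (inverse_series a p D P phi ha hp hp01 hP hphi) as (r1 & r2 & Cf & Hr1 & Hr2 & HCf & Hphi0 & Hphib & Hinv).
  destruct (kappa_data a p E D P ha hp hp01 hP hE b1 ltac:(lra) Hgood b' ltac:(lra)) as (M & HM & Hkb & Hke).
  destruct (Psi_small a p E D P ha hp hp01 hP hE b1 Hgood b (r1 / 2) ltac:(lra) ltac:(lra)) as [R1 HR1].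
  destruct (Pv_small a p E D P ha hp hp01 hP hE b1 Hgood b r2 ltac:(lra) ltac:(lra)) as [R2 HR2].
  set (r := Rmax R1 R2).
  assert (HPsi : forall v, Rabs (Im v) <= b -> r <= Re v -> Cmod (Psi v) <= r1 / 2).
  { intros v h1 h2. apply HR1; auto. pose proof (Rmax_l R1 R2). unfold r in h2. lra. }
  assert (HPv : forall v, Rabs (Im v) <= b -> r <= Re v -> Cmod (Pv v) <= r2).
  { intros v h1 h2. apply HR2; auto. pose proof (Rmax_r R1 R2). unfold r in h2. lra. }
  set (C0 := contour_const x b r).
  assert (HC0 : 0 < C0) by (apply contour_const_pos; auto).
  (* The factor 1 / (2 pi) of the density and 1 / i from dz = i dy, multiplied by the x that the
     final formula divides out. *)
  set (T := (RtoC x / (RtoC (2 * PI) * Ci))%C).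
  set (Fn := fun n v => (phi n * Psi v ^ n)%C).
  assert (HFd : forall n, strip_Cdiff b (Fn n)).
  { intros n v Hv. apply Cdiff_mult; [apply Cdiff_const|]. apply Cdiff_pow.
    apply (Psi_Cdiff a p E D P ha hp hp01 hP hE b1 Hgood). lra. }
  assert (HPd : strip_Cdiff b Pv).
  { intros v Hv. apply (Pv_Cdiff a p E D P ha hp hp01 hP hE b1 Hgood). lra. }
  assert (Hlex : forall n, exists l, contour_value x b (Fn n) l).
  { intros n. destruct (contour_value_exists x b Hx Hb (Fn n) r Cf (HFd n)) as (l & Hl & _); eauto; [lra|].
    intros v h1 h2. unfold Fn. rewrite Cmod_mult, Cmod_pow. specialize (HPsi v h1 h2).
    eapply Rle_trans; [|apply (Hphib n)]. apply Rmult_le_compat_l; [apply Cmod_ge_0|].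
    apply pow_incr. split; [apply Cmod_ge_0|lra]. }
  set (lf := fun n => proj1_sig (constructive_indefinite_description _ (Hlex n))).
  assert (Hlf : forall n, contour_value x b (Fn n) (lf n)).
  { intros n. unfold lf. destruct (constructive_indefinite_description _ (Hlex n)); auto. }
  (* The power series in Phi(Pi) starts at n = 0 and the expansion at n = 1; the constant term
     vanishes. *)
  assert (Hlf0 : lf 0%nat = 0%C).
  { apply (contour_value_unique x b (Fn 0%nat)); auto.
    pose proof (contour_value_scal x b Hb 0%C (Fn 0%nat) _ (HFd _) (Hlf _)) as H0.
    rewrite (Cmult_0_l (lf 0%nat)) in H0.
    apply (contour_value_ext x b Hb (fun v => 0 * Fn 0%nat v)%C); [|exact H0].
    intros v _. unfold Fn. rewrite Hphi0. ring. }
  (* Exchange of the sum over n with the contour integral: the remainder of the inverse series is at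
     most 2 Cf 2^(-N) uniformly on the half strip. *)
  assert (HsumP : cseq_lim (csum lf) lP).
  { intros e He.
    destruct (geometric_vanishes (2 * Cf * C0) (1 / 2) e ltac:(lra) He) as [N HN].
    exists N. intros n Hn. rewrite Cmod_minus_sym.
    eapply Rle_trans; [apply (contour_value_close x b Hx Hb Pv (fun v => csum (fun k => Fn k v) n) lP (csum lf n) r (2 * Cf * (1 / 2) ^ n)); auto|].
    - apply strip_Cdiff_csum; auto.
    - apply Rmult_le_pos; [lra|apply pow_le; lra].
    - apply contour_value_csum; auto.
    - intros v h1 h2. unfold Fn. apply Hinv; [apply HPv; auto|apply HPsi; auto].
    - fold C0. specialize (HN n Hn). lra. }
  set (q := exp (- (2 * PI / L * (b' - b)))).
  assert (Hq : 0 < q < 1).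
  { split; [apply exp_pos|]. unfold q. rewrite <- exp_0. apply exp_increasing.
    assert (0 < 2 * PI / L * (b' - b)) by (apply Rmult_lt_0_compat; [apply Rdiv_lt_0_compat|]; lra). lra. }
  assert (Hbil : forall n, (1 <= n)%nat -> is_bilateral_series (expansion_term P p E phi x n) (T * lf n)%C).
  { intros n Hn.
    set (md := fun m v => (phi n * kappa P p E n m * Cexp (- (- exponent p E n m * v)))%C).
    assert (Hmex : forall m, exists l, contour_value x b (md m) l /\ expansion_term P p E phi x n m = (T * l)%C)
      by (intros m; apply term_contour; auto).
    set (lm := fun m => proj1_sig (constructive_indefinite_description _ (Hmex m))).
    assert (Hlm : forall m, contour_value x b (md m) (lm m) /\ expansion_term P p E phi x n m = (T * lm m)%C).
    { intros m. unfold lm. destruct (constructive_indefinite_description _ (Hmex m)); auto. }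
    set (An := Cmod (phi n) * M ^ n * exp (- (INR n * al * r))).
    assert (HAn : 0 <= An).
    { unfold An. apply Rmult_le_pos; [|left; apply exp_pos]. apply Rmult_le_pos; [apply Cmod_ge_0|apply pow_le; lra]. }
    assert (Hmd : forall m, strip_Cdiff b (md m)) by (intros m; apply strip_Cdiff_mode).
    assert (Hlmb : forall m k, Rabs (IZR m) = INR k -> Cmod (lm m) <= An * C0 * q ^ k).
    { intros m k Hmk.
      destruct (contour_value_exists x b Hx Hb (md m) r (An * q ^ k) (Hmd m)) as (l & Hl & Hl2).
      - apply Rmult_le_pos; auto. apply pow_le; lra.
      - intros v h1 h2. apply (mode_bound n m k r b b' M v HM Hkb Hmk h1 h2).
      - rewrite (contour_value_unique x b _ _ _ (proj1 (Hlm m)) Hl). fold C0 in Hl2. lra. }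
    set (K := An * C0). assert (HK : 0 <= K) by (apply Rmult_le_pos; lra).
    set (u1 := fun k => lm (Z.of_nat k)). set (u2 := fun k => lm (- Z.of_nat (S k))%Z).
    destruct (geometric_cauchy (csum u1) K q HK Hq) as (s1 & Hs1 & _).
    { intros k. simpl csum. replace (csum u1 k + u1 k - csum u1 k)%C with (u1 k) by ring.
      apply Hlmb. rewrite <- INR_IZR_INZ. apply Rabs_pos_eq, pos_INR. }
    destruct (geometric_cauchy (csum u2) K q HK Hq) as (s2 & Hs2 & _).
    { intros k. simpl csum. replace (csum u2 k + u2 k - csum u2 k)%C with (u2 k) by ring.
      apply Rle_trans with (K * q ^ S k).
      - apply Hlmb. rewrite opp_IZR, Rabs_Ropp, <- INR_IZR_INZ. apply Rabs_pos_eq, pos_INR.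
      - apply Rmult_le_compat_l; auto. simpl. pose proof (pow_le q k ltac:(lra)). nra. }
    (* Exchange of the sum over m with the integral: both sides are limits of the symmetrically
       truncated sums, whose Fourier remainder is O(q^N) uniformly on the half strip. *)
    assert (Hs12 : (s1 + s2)%C = lf n).
    { apply (cseq_lim_unique (fun N => csum u1 N + csum u2 N)%C).
      - intros e He. destruct (Hs1 (e / 2) ltac:(lra)) as [N1 H1]. destruct (Hs2 (e / 2) ltac:(lra)) as [N2 H2].
        exists (N1 + N2)%nat. intros N HN. specialize (H1 N ltac:(lia)). specialize (H2 N ltac:(lia)).
        replace (csum u1 N + csum u2 N - (s1 + s2))%C with ((csum u1 N - s1) + (csum u2 N - s2))%C by ring.
        eapply Rle_trans; [apply Cmod_triangle|]. lra.
      - intros e He.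
        set (Gn := Cmod (phi n) * (exp (- (INR n * al * r)) * (2 * M ^ n) / (1 - q))).
        assert (HGn : 0 <= Gn).
        { unfold Gn. apply Rmult_le_pos; [apply Cmod_ge_0|]. apply Rmult_le_pos; [|left; apply Rinv_0_lt_compat; lra].
          apply Rmult_le_pos; [left; apply exp_pos|]. apply Rmult_le_pos; [lra|apply pow_le; lra]. }
        destruct (geometric_vanishes (Gn * C0) q e Hq He) as [N0 HN0].
        exists N0. intros N HN. rewrite Cmod_minus_sym.
        set (S12 := fun v => (csum (fun k => md (Z.of_nat k) v) N + csum (fun k => md (- Z.of_nat (S k))%Z v) N)%C).
        eapply Rle_trans; [apply (contour_value_close x b Hx Hb (Fn n) S12 (lf n) (csum u1 N + csum u2 N)%C r (Gn * q ^ N)); auto|].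
        + apply strip_Cdiff_plus; apply strip_Cdiff_csum; intros; apply Hmd.
        + apply Rmult_le_pos; auto. apply pow_le; lra.
        + apply contour_value_plus; auto; try (apply strip_Cdiff_csum; intros; apply Hmd).
          * apply (contour_value_csum x b Hb (fun k => md (Z.of_nat k))); [intros; apply Hmd|intros; apply Hlm].
          * apply (contour_value_csum x b Hb (fun k => md (- Z.of_nat (S k))%Z)); [intros; apply Hmd|intros; apply Hlm].
        + intros v h1 h2. unfold Fn, S12.
          rewrite (csum_ext (fun k => md (Z.of_nat k) v) (fun k => phi n * Cexp (- (RtoC (INR n * al) * v)) *
             (kappa P p E n (Z.of_nat k) * emode L (Z.of_nat k) v))%C).
          2:{ intros i. unfold md. rewrite (Cexp_exponent a p E D P ha hp hp01 hP hE). fold L al. ring. }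
          rewrite (csum_ext (fun k => md (- Z.of_nat (S k))%Z v) (fun k => phi n * Cexp (- (RtoC (INR n * al) * v)) *
             (kappa P p E n (- Z.of_nat (S k)) * emode L (- Z.of_nat (S k)) v))%C).
          2:{ intros i. unfold md. rewrite (Cexp_exponent a p E D P ha hp hp01 hP hE). fold L al. ring. }
          rewrite !csum_scal, <- Cmult_plus_distr_l.
          specialize (Hke n N v ltac:(lra)). fold L al in Hke. fold (Pv v) in Hke. fold (Psi v) in Hke.
          set (Y := (csum (fun k => kappa P p E n (Z.of_nat k) * emode L (Z.of_nat k) v)%C N +
             csum (fun k => kappa P p E n (- Z.of_nat (S k)) * emode L (- Z.of_nat (S k)) v)%C N)%C) in *.
          replace (phi n * Psi v ^ n - phi n * Cexp (- (RtoC (INR n * al) * v)) * Y)%C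
            with (phi n * (Psi v ^ n - Cexp (- (RtoC (INR n * al) * v)) * Y))%C by ring.
          rewrite Cmod_mult. unfold Gn. rewrite Rmult_assoc. apply Rmult_le_compat_l; [apply Cmod_ge_0|].
          eapply Rle_trans; [exact Hke|].
          set (qv := exp (- (2 * PI / L * (b' - Rabs (Im v))))).
          assert (Hqv : 0 < qv <= q).
          { split; [apply exp_pos|]. apply exp_monotone. apply Ropp_le_contravar.
            apply Rmult_le_compat_l; [apply Rlt_le, Rdiv_lt_0_compat; lra|lra]. }
          assert (He1 : exp (- (INR n * al * Re v)) <= exp (- (INR n * al * r))).
          { apply exp_monotone, Ropp_le_contravar, Rmult_le_compat_l; auto. apply Rmult_le_pos; [apply pos_INR|lra]. }
          assert (HM0 : 0 <= 2 * M ^ n) by (apply Rmult_le_pos; [lra|apply pow_le; lra]).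
          pose proof (exp_pos (- (INR n * al * Re v))).
          apply Rle_trans with (exp (- (INR n * al * r)) * (2 * M ^ n) * (q ^ N / (1 - q))).
          * apply Rmult_le_compat; [apply Rmult_le_pos; lra| |apply Rmult_le_compat_r; auto|].
            -- apply Rmult_le_pos; [apply pow_le; lra|left; apply Rinv_0_lt_compat; lra].
            -- apply Rmult_le_compat; [apply pow_le; lra|left; apply Rinv_0_lt_compat; lra|apply pow_incr; lra|].
               apply Rinv_le_contravar; lra.
          * apply Req_le. field. lra.
        + fold C0. specialize (HN0 N HN). lra. }
    exists (T * s1)%C, (T * s2)%C. split; [|split].
    - apply is_Cseries_csum. apply cseq_lim_ext with (m := 0%nat) (u := fun N => (T * csum u1 N)%C).
      + intros N _. rewrite <- csum_scal. apply csum_ext. intros i. symmetry. apply Hlm.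
      + apply (cseq_lim_cont _ (fun w => T * w)%C); auto. apply Ccont_mult; [apply Ccont_const|apply Ccont_id].
    - apply is_Cseries_csum. apply cseq_lim_ext with (m := 0%nat) (u := fun N => (T * csum u2 N)%C).
      + intros N _. rewrite <- csum_scal. apply csum_ext. intros i. symmetry. apply Hlm.
      + apply (cseq_lim_cont _ (fun w => T * w)%C); auto. apply Ccont_mult; [apply Ccont_const|apply Ccont_id].
    - rewrite <- Hs12. ring. }
  split; [exists (lP / Ci)%C; exact Hdens|].
  exists (fun n => (T * lf n)%C), (T * lP)%C. split; [exact Hbil|split].
  - apply is_Cseries_csum.
    apply cseq_lim_ext with (m := 0%nat) (u := fun N => (T * csum lf (S N))%C).
    + intros N _. rewrite csum_Sl, Hlf0, Cplus_0_l, csum_scal. reflexivity.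
    + apply (cseq_lim_cont (fun N => csum lf (S N)) (fun w => T * w)%C); [|apply Ccont_mult; [apply Ccont_const|apply Ccont_id]].
      intros e He. destruct (HsumP e He) as [N HN]. exists N. intros k Hk. apply HN. lia.
  - unfold density. rewrite (is_RInt_gen_unique (V := C_R_CompleteNormedModule) _ _ Hdens).
    unfold T. rewrite !RtoC_inv by lra. pose proof twoPiI_neq_0 as HT.
    assert (H2 : RtoC (2 * PI) <> 0%C) by (apply RtoC_neq_0; lra).
    assert (H3 : RtoC x <> 0%C) by (apply RtoC_neq_0; lra).
    field. repeat split; auto; apply Ci_neq_0.
Qed.

(** With r = ln n, |exp (- s v)| contributes n^(- al n), that is exp (log_E p * n ln n), times exp
    (2 pi b |m| / ln E). The price is the weight at |z| = n, of size n exp n <= exp (2 n), which is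
    only geometric in n. *)
Lemma inv_gamma_bound (n : nat) (m : Z) (b : R) : (1 <= n)%nat -> PI / 2 < b < PI ->
  Cmod (/ CGamma (- exponent p E n m)) <=
    (2 * (4 / (cos b * cos b)) + 2 * b) * exp (2 * INR n) *
    (exp (ln p / ln E * (INR n * ln (INR n))) * exp (2 * PI / ln E * b * Rabs (IZR m))).
Proof.
  intros Hn Hb. pose proof PI_RGT_0.
  assert (Hal : 0 < al) by (apply (al_pos a p E D P ha hp hp01 hP hE)).
  assert (Hn1 : 1 <= INR n) by (apply (le_INR 1 n) in Hn; simpl in Hn; lra).
  set (s := (- exponent p E n m)%C).
  assert (Es : s = (INR n * al, - (2 * PI * IZR m / L))).
  { unfold s. apply (exponent_Re_Im a p E D P ha hp hp01 hP hE). }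
  assert (Hs : 0 < Re s) by (rewrite Es; simpl; apply Rmult_lt_0_compat; lra).
  destruct (hankel_gamma s b Hs Hb 1 ltac:(lra)) as [HG Hl].
  set (S := exp (ln p / ln E * (INR n * ln (INR n))) * exp (2 * PI / ln E * b * Rabs (IZR m))).
  assert (HS : 0 < S) by (apply Rmult_lt_0_compat; apply exp_pos).
  destruct (contour_value_exists 1 b ltac:(lra) Hb (fun v => Cexp (- (s * v)))%C (ln (INR n)) S) as (l & Hl' & Hl2).
  - intros v _. apply Cdiff_exp_lin.
  - lra.
  - intros v h1 h2. rewrite Cmod_Cexp_lin, Es. unfold Re at 1, Im at 1; simpl fst; simpl snd.
    unfold S. rewrite <- exp_plus. apply exp_monotone. apply Rplus_le_compat.
    + replace (ln p / ln E * (INR n * ln (INR n))) with (- (INR n * al * ln (INR n))) by (unfold al, L; field; fold L; lra).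
      apply Ropp_le_contravar, Rmult_le_compat_l; auto. apply Rmult_le_pos; lra.
    + eapply Rle_trans; [apply Rle_abs|]. rewrite Rabs_mult, Rabs_Ropp. fold L.
      replace (2 * PI / L * b * Rabs (IZR m)) with (Rabs (2 * PI * IZR m / L) * b).
      * apply Rmult_le_compat_l; auto. apply Rabs_pos.
      * unfold Rdiv. rewrite !Rabs_mult, (Rabs_pos_eq 2), (Rabs_pos_eq PI), (Rabs_pos_eq (/ L)); try lra.
        left; apply Rinv_0_lt_compat; auto.
  - assert (El : l = (RtoC (2 * PI) * Ci / CGamma s)%C).
    { apply (climit_unique _ _ _ Hl').
      replace (RtoC (2 * PI) * Ci / CGamma s)%C with (RtoC (2 * PI) * Ci * Rcpow 1 (s - 1) / CGamma s)%C; [exact Hl|].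
      unfold Rcpow. rewrite ln_1, Cmult_0_r, Cexp_0. field. auto. }
    rewrite El in Hl2. unfold Cdiv in Hl2. rewrite Cmod_mult, Cmod_twoPiI in Hl2.
    fold s. fold S. set (G := Cmod (/ CGamma s)) in *. assert (HG0 : 0 <= G) by apply Cmod_ge_0.
    assert (PI2 : 1 <= 2 * PI) by (pose proof PI2_1; lra).
    apply Rle_trans with (2 * PI * G); [nra|]. eapply Rle_trans; [exact Hl2|].
    rewrite Rmult_comm. apply Rmult_le_compat_r; [lra|].
    unfold contour_const. rewrite !Rmult_1_l, exp_Ropp, exp_ln by lra.
    replace (- cos b * - cos b) with (cos b * cos b) by ring.
    assert (Hc : 0 < cos b * cos b) by (pose proof (cos_obtuse b Hb); nra).
    assert (He : INR n * exp (INR n) <= exp (2 * INR n)).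
    { replace (2 * INR n) with (INR n + INR n) by ring. rewrite exp_plus.
      apply Rmult_le_compat_r; [left; apply exp_pos|]. pose proof (exp_ineq1_le (INR n)). lra. }
    assert (He1 : 1 <= exp (2 * INR n)) by (pose proof (exp_ineq1_le (2 * INR n)); lra).
    assert (Hi : / INR n <= 1) by (rewrite <- Rinv_1; apply Rinv_le_contravar; lra).
    assert (H4 : 0 < 4 / (cos b * cos b)) by (apply Rdiv_lt_0_compat; lra).
    assert (4 / (cos b * cos b) * / INR n <= 4 / (cos b * cos b) * exp (2 * INR n)) by (apply Rmult_le_compat_l; lra).
    assert (2 * b * (exp (INR n) * INR n) <= 2 * b * exp (2 * INR n)) by (apply Rmult_le_compat_l; lra).
    lra.
Qed.

(** From u <= exp u at u = y / eps - ln n, multiplied by eps n. It converts a factor exp (n y) into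
    exp (eps n ln n) times a constant that depends on y and eps but not on n. *)
Lemma superexponential_absorb (n : nat) (y eps : R) : (1 <= n)%nat -> 0 < eps ->
  INR n * y <= eps * (INR n * ln (INR n)) + eps * exp (y / eps).
Proof.
  intros Hn He.
  assert (Hn1 : 1 <= INR n) by (apply (le_INR 1 n) in Hn; simpl in Hn; lra).
  assert (H : y / eps - ln (INR n) <= exp (y / eps) / INR n).
  { pose proof (exp_ineq1_le (y / eps - ln (INR n))) as H. unfold Rminus at 2 in H.
    rewrite exp_plus, exp_Ropp, exp_ln in H by lra. unfold Rdiv at 2. lra. }
  apply Rle_div_r in H; [|lra].
  assert (H1 : eps * ((y / eps - ln (INR n)) * INR n) <= eps * exp (y / eps)) by (apply Rmult_le_compat_l; lra).
  replace (eps * ((y / eps - ln (INR n)) * INR n)) with (INR n * y - eps * (INR n * ln (INR n))) in H1 by (field; lra).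
  lra.
Qed.

Theorem term_estimate (theta eps : R) : is_critical_angle D P theta -> 0 < eps ->
  exists A : R -> R,
    (forall x : R, 0 < x ->
       0 < A x /\
       forall (n : nat) (m : Z), (1 <= n)%nat ->
         Cmod (expansion_term P p E phi x n m) <=
         A x * exp ((ln p / ln E + eps) * (INR n * ln (INR n))
                    + 2 * PI * (PI / 2 - theta + eps) / ln E * Rabs (IZR m))) /\
    (forall X : R -> Prop, compact X -> (forall x, X x -> 0 < x) ->
       exists M : R, forall x, X x -> A x <= M).
Proof.
  intros [Hub Hlub] Heps. pose proof PI_RGT_0 as HPI.
  assert (Hal : 0 < al) by (apply (al_pos a p E D P ha hp hp01 hP hE)).
  (* The angle is lost four times, from theta to phi0, to b1, to b', and from pi/2 up to b; each
     loss is at most eps / 4. The second entry keeps b below pi. *)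
  set (e1 := Rmin (eps / 4) (PI / 4)).
  assert (He1 : 0 < e1 /\ e1 <= eps / 4 /\ e1 <= PI / 4).
  { unfold e1. split; [apply Rmin_pos; lra|split; [apply Rmin_l|apply Rmin_r]]. }
  assert (Hs : exists phi0, sector_angle D P phi0 /\ theta - e1 < phi0).
  { apply NNPP. intros Hno. assert (theta <= theta - e1); [|lra].
    apply Hlub. intros y Hy. apply Rnot_lt_le. intros h. apply Hno. eauto. }
  destruct Hs as (phi0 & Hsec & Hphi0).
  pose proof Hsec as [[Hp0 _] _].
  (* The alternative phi0 / 2 keeps the angle positive when phi0 is smaller than e1; b' below is
     built the same way. *)
  set (b1 := Rmax (phi0 / 2) (phi0 - e1)).
  assert (Hb1 : 0 < b1 /\ b1 < phi0 /\ phi0 - e1 <= b1).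
  { unfold b1. pose proof (Rmax_l (phi0 / 2) (phi0 - e1)). pose proof (Rmax_r (phi0 / 2) (phi0 - e1)).
    split; [lra|split; [apply Rmax_lub_lt; lra|lra]]. }
  pose proof (sector_good a p E D P ha hp hp01 hP hE phi0 b1 Hsec ltac:(lra)) as Hgood.
  set (b' := Rmax (b1 / 2) (b1 - e1)).
  assert (Hb' : 0 < b' < b1 /\ b1 - e1 <= b').
  { unfold b'. pose proof (Rmax_l (b1 / 2) (b1 - e1)). pose proof (Rmax_r (b1 / 2) (b1 - e1)).
    split; [split; [lra|apply Rmax_lub_lt; lra]|lra]. }
  destruct (kappa_data a p E D P ha hp hp01 hP hE b1 ltac:(lra) Hgood b' ltac:(lra)) as (M & HM & Hkb & _).
  destruct (inverse_series a p D P phi ha hp hp01 hP hphi) as (r1 & r2 & Cf & Hr1 & Hr2 & HCf & Hphi0' & Hphib & _).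
  set (b := PI / 2 + e1). assert (Hb : PI / 2 < b < PI) by (unfold b; lra).
  set (CG := 2 * (4 / (cos b * cos b)) + 2 * b).
  assert (HCG : 0 < CG).
  { assert (0 < 4 / (cos b * cos b)).
    { apply Rdiv_lt_0_compat; [lra|]. pose proof (cos_obtuse b Hb). nra. }
    unfold CG. lra. }
  set (G := M / r1 * exp 2).
  assert (HG : 0 < G) by (apply Rmult_lt_0_compat; [apply Rdiv_lt_0_compat; lra|apply exp_pos]).
  (* All geometric factors are collected in exp (n (ln G + al ln x)): M from the Fourier
     coefficients, 1 / r1 from phi, exp 2 from Gamma, and the power of x. Their absorption into eps
     n ln n leaves this doubly exponential constant. *)
  set (A := fun x => Cf * CG * exp (eps * exp ((ln G + al * ln x) / eps))).
  exists A. split.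
  - intros x Hx. split.
    { unfold A. apply Rmult_lt_0_compat; [apply Rmult_lt_0_compat; auto|apply exp_pos]. }
    intros n m Hn.
    assert (Hn1 : 1 <= INR n) by (apply (le_INR 1 n) in Hn; simpl in Hn; lra).
    assert (Hs : 0 < Re (- exponent p E n m)).
    { rewrite (exponent_Re_Im a p E D P ha hp hp01 hP hE). simpl. apply Rmult_lt_0_compat; [lra|exact Hal]. }
    destruct (hankel_gamma (- exponent p E n m) b Hs Hb x Hx) as [HGam _].
    unfold expansion_term. unfold Cdiv. rewrite !Cmod_mult.
    pose proof (inv_gamma_bound n m b Hn Hb) as HIG. fold CG in HIG.
    specialize (Hkb n m). specialize (Hphib n).
    assert (HX : Cmod (Rcpow x (- exponent p E n m)) = exp (INR n * (al * ln x))).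
    { unfold Rcpow. rewrite Cmod_Cexp. f_equal. rewrite (exponent_Re_Im a p E D P ha hp hp01 hP hE).
      unfold Re; simpl. fold L al. ring. }
    rewrite HX.
    assert (Hphin : Cmod (phi n) <= Cf * (/ r1) ^ n).
    { rewrite pow_inv. apply Rle_div_r in Hphib; [exact Hphib|apply pow_lt; auto]. }
    set (q1 := exp (ln p / ln E * (INR n * ln (INR n)))) in *.
    set (q2 := exp (2 * PI / ln E * b * Rabs (IZR m))) in *.
    set (q3 := exp (- (2 * PI * Rabs (IZR m) / ln E * b'))) in *.
    set (q4 := exp (INR n * (al * ln x))) in *.
    assert (0 < q1) by apply exp_pos. assert (0 < q2) by apply exp_pos.
    assert (0 < q3) by apply exp_pos. assert (0 < q4) by apply exp_pos.
    pose proof (Cmod_ge_0 (phi n)). pose proof (Cmod_ge_0 (kappa P p E n m)). pose proof (Cmod_ge_0 (/ CGamma (- exponent p E n m))).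
    apply Rle_trans with (Cf * (/ r1) ^ n * (M ^ n * q3) * q4 * (CG * exp (2 * INR n) * (q1 * q2))).
    { apply Rmult_le_compat; auto.
      - apply Rmult_le_pos; [apply Rmult_le_pos; auto|lra].
      - apply Rmult_le_compat_r; [lra|]. apply Rmult_le_compat; auto. }
    assert (HGn : (/ r1) ^ n * M ^ n * exp (2 * INR n) * q4 = exp (INR n * (ln G + al * ln x))).
    { assert (EG : exp (ln G * INR n) = ((/ r1) * M * exp 2) ^ n).
      { rewrite Rmult_comm, <- exp_pow, exp_ln by auto. f_equal. unfold G. field. lra. }
      rewrite Rmult_plus_distr_l, exp_plus, (Rmult_comm (INR n) (ln G)), EG, !Rpow_mult_distr, exp_pow.
      fold q4. rewrite (Rmult_comm (INR n) 2). ring. }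
    apply Rle_trans with (Cf * CG * (exp (INR n * (ln G + al * ln x)) * (q1 * (q2 * q3)))).
    { rewrite <- HGn. apply Req_le. ring. }
    unfold A. rewrite (Rmult_assoc (Cf * CG)). apply Rmult_le_compat_l; [apply Rlt_le, Rmult_lt_0_compat; auto|].
    unfold q1, q2, q3. rewrite <- !exp_plus. apply exp_monotone.
    pose proof (superexponential_absorb n (ln G + al * ln x) eps Hn Heps) as Habs.
    assert (Hth : 2 * PI / ln E * b * Rabs (IZR m) + - (2 * PI * Rabs (IZR m) / ln E * b')
       <= 2 * PI * (PI / 2 - theta + eps) / ln E * Rabs (IZR m)).
    { fold L. replace (2 * PI / L * b * Rabs (IZR m) + - (2 * PI * Rabs (IZR m) / L * b'))
        with (2 * PI / L * Rabs (IZR m) * (b - b')) by (field; lra).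
      replace (2 * PI * (PI / 2 - theta + eps) / L * Rabs (IZR m))
        with (2 * PI / L * Rabs (IZR m) * (PI / 2 - theta + eps)) by (field; lra).
      apply Rmult_le_compat_l; [|unfold b; lra].
      apply Rmult_le_pos; [apply Rlt_le, Rdiv_lt_0_compat; lra|apply Rabs_pos]. }
    lra.
  (* As al > 0, A is increasing in x, so an upper bound of X bounds A on X. *)
  - intros X HX HXpos. destruct (compact_P1 X HX) as (m0 & M0 & HM0).
    set (x1 := Rmax 1 M0).
    exists (A x1). intros x Hx. specialize (HXpos x Hx). destruct (HM0 x Hx) as [_ h].
    assert (Hxx : x <= x1) by (unfold x1; pose proof (Rmax_r 1 M0); lra).
    unfold A. apply Rmult_le_compat_l; [apply Rlt_le, Rmult_lt_0_compat; auto|].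
    apply exp_monotone. apply Rmult_le_compat_l; [lra|]. apply exp_monotone.
    unfold Rdiv. apply Rmult_le_compat_r; [left; apply Rinv_0_lt_compat; auto|].
    apply Rplus_le_compat_l. apply Rmult_le_compat_l; [lra|]. apply ln_le; auto.
Qed.
End MainExpansion.

Theorem theorem1p2 (a : nat -> R) (p E theta : R) (D : C -> Prop) (P : C -> C)
    (phi : nat -> C)
    (ha : is_pgf a) (hp : a 1%nat = p) (hp01 : 0 < p < 1)
    (hP : extends_pgf a D P)
    (hE : is_derive (K := C_AbsRing) (V := C_NormedModule) P (RtoC 1) (RtoC E))
    (htheta : is_critical_angle D P theta)
    (hphi : is_inverse_coeffs P p phi) :
  (forall x : R, 0 < x ->
     ex_RInt_gen (V := C_R_NormedModule) (density_integrand P E x)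
       (Rbar_locally m_infty) (Rbar_locally p_infty) /\
     exists (inner : nat -> C) (total : C),
       (forall n : nat, (1 <= n)%nat ->
          is_bilateral_series (expansion_term P p E phi x n) (inner n)) /\
       is_Cseries (fun k : nat => inner (S k)) total /\
       density P E x = (RtoC (/ x) * total)%C) /\
  (forall eps : R, 0 < eps ->
     exists A : R -> R,
       (forall x : R, 0 < x ->
          0 < A x /\
          forall (n : nat) (m : Z), (1 <= n)%nat ->
            Cmod (expansion_term P p E phi x n m) <=
            A x * exp ((ln p / ln E + eps) * (INR n * ln (INR n))
                       + 2 * PI * (PI / 2 - theta + eps) / ln E
                         * Rabs (IZR m))) /\
       (forall X : R -> Prop, compact X -> (forall x, X x -> 0 < x) ->
          exists M : R, forall x, X x -> A x <= M)).
Proof.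
  split.
  - intros x Hx. exact (expansion_for a p E D P phi ha hp hp01 hP hE hphi x Hx).
  - intros eps Heps. exact (term_estimate a p E D P phi ha hp hp01 hP hE hphi theta eps htheta Heps).
Qed.
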